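(* Let $\Omega\subset\mathbb{R}^n$ be a special Lipschitz domain. For all $p,q\in[1,+\infty]$, $s\in(-1+\frac1p,\frac1p)$, $$\dot{\mathrm{B}}^{s}_{p,q,0}(\Omega)=\dot{\mathrm{B}}^{s}_{p,q}(\Omega)$$ (with equivalent norms, via the canonical restriction map). In particular, if $p,q<+\infty$, the space $\mathrm{C}_c^\infty(\Omega)$ is dense in $\dot{\mathrm{B}}^{s}_{p,q}(\Omega)$ and in $\dot{\mathcal{B}}^{s}_{p,\infty}(\Omega)$. The result still holds for $\dot{\mathrm{B}}^{s,0}_{\infty,q}$ (density for $q<+\infty$) and $\dot{\mathcal{B}}^{s,0}_{\infty,\infty}$, $s\in(-1,0)$.
   Context: $n\geqslant2$. A special Lipschitz domain is $\Omega=\{(x',x_n)\in\mathbb{R}^{n-1}\times\mathbb{R}: x_n>\phi(x')\}$ with $\phi:\mathbb{R}^{n-1}\to\mathbb{R}$ globally Lipschitz. Littlewood–Paley family: fix $\varphi\in\mathrm{C}_c^\infty(\mathbb{R}^n)$ radial, real, non-negative, $\operatorname{supp}\varphi\subset B(0,4/3)$, $\varphi=1$ on $B(0,3/4)$; $\varphi_j(\xi)=\varphi(2^{-j}\xi)$, $\psi_j(\xi)=\varphi_j(\xi/2)-\varphi_j(\xi)$, $\dot{\Delta}_j=\mathcal{F}^{-1}\psi_j\mathcal{F}$, $j\in\mathbb{Z}$. $\mathcal{S}'_h(\mathbb{R}^n)$ is the set of $u\in\mathcal{S}'(\mathbb{R}^n)$ such that for all $\Theta\in\mathrm{C}_c^\infty(\mathbb{R}^n)$,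 $\lVert\mathcal{F}^{-1}\Theta(\lambda\cdot)\mathcal{F}u\rVert_{\mathrm{L}^\infty}\to0$ as $\lambda\to+\infty$. $\dot{\mathrm{B}}^s_{p,q}(\mathbb{R}^n)$ is the normed space of $u\in\mathcal{S}'_h(\mathbb{R}^n)$ with $\lVert u\rVert_{\dot{\mathrm{B}}^s_{p,q}}=\lVert(2^{js}\lVert\dot{\Delta}_ju\rVert_{\mathrm{L}^p})_{j}\rVert_{\ell^q(\mathbb{Z})}<\infty$; $\dot{\mathcal{B}}^{s}_{p,\infty}=\{u\in\dot{\mathrm{B}}^s_{p,\infty}: 2^{js}\lVert\dot{\Delta}_ju\rVert_{\mathrm{L}^p}\to0 \text{ as }|j|\to\infty\}$; $\dot{\mathrm{B}}^{s,0}_{\infty,q}=\{u\in\dot{\mathrm{B}}^s_{\infty,q}:\dot{\Delta}_ju\in\mathrm{C}^0_0(\mathbb{R}^n)\ \forall j\}$ with $\mathrm{C}^0_0$ the continuous functions vanishing at infinity; $\dot{\mathcal{B}}^{s,0}_{\infty,\infty}=\dot{\mathcal{B}}^{s}_{\infty,\infty}\cap\dot{\mathrm{B}}^{s,0}_{\infty,\infty}$. For each such space $\mathrm{X}$, $\mathrm{X}(\Omega)$ is the space of restrictions to $\Omega$ (as distributions) of elements of $\mathrm{X}(\mathbb{R}^n)$ with the quotient norm; the space on $\Omega$ with an additional last lower index $0$ is $\{u\in\mathrm{X}(\mathbb{R}^n):\operatorname{supp}u\subset\overline{\Omega}\}$ with the norm of $\mathrm{X}(\mathbb{R}^n)$;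 the canonical map from the latter to the former is restriction to $\Omega$. *)

(* Defs.v *)
From HB Require Import structures.
From mathcomp Require Import all_boot all_order all_algebra.
From mathcomp Require Import complex.
From mathcomp Require Import all_classical all_reals all_analysis.

Set Implicit Arguments.
Unset Strict Implicit.
Unset Printing Implicit Defensive.
Import Order.TTheory GRing.Theory Num.Theory.
Import numFieldNormedType.Exports.

Local Open Scope classical_set_scope.
Local Open Scope ring_scope.

(* R^n is 'rV[R]_n.  Its sigma-algebra is the product one, i.e. the one
   generated by the coordinate functions, which is the Borel sigma-algebra. *)
Section MeasurableRow.
Context {R : realType} (n : nat).

Definition row_coord (i : 'I_n) (x : 'rV[R]_n) : measurableTypeR R := x ord0 i.

Let row_set0 : g_sigma_preimage row_coord set0.
Proof. exact: sigma_algebra0. Qed.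

Let row_setC A : g_sigma_preimage row_coord A ->
  g_sigma_preimage row_coord (~` A).
Proof. exact: sigma_algebraC. Qed.

Let row_bigcup (F : _^nat) : (forall i, g_sigma_preimage row_coord (F i)) ->
  g_sigma_preimage row_coord (\bigcup_i (F i)).
Proof. exact: sigma_algebra_bigcup. Qed.

HB.instance Definition _ := @isMeasurable.Build
  (measure_tuple_display default_measure_display)
  'rV[R]_n (g_sigma_preimage row_coord) row_set0 row_setC row_bigcup.

End MeasurableRow.

Section LebesgueRow.
Context {R : realType}.

Definition snoc_row n (tx : 'rV[R]_n * measurableTypeR R) : 'rV[R]_n.+1 :=
  \row_(i < n.+1) if unlift ord_max i is Some j then tx.1 ord0 j else tx.2.

Lemma measurable_row_coord n (i : 'I_n) :
  measurable_fun [set: 'rV[R]_n] (row_coord i).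
Proof.
move=> _ Y mY; rewrite setTI; apply: sub_sigma_algebra => /=.
rewrite -bigcup_seq/=; exists i => /=; first by rewrite mem_index_enum.
by exists Y => //; rewrite setTI.
Qed.

Lemma measurable_snoc_row n : measurable_fun setT (@snoc_row n).
Proof.
move=> _ A mA; rewrite setTI.
suff : g_sigma_preimage (fun i => row_coord i \o @snoc_row n) `<=` measurable.
  by apply; rewrite g_sigma_preimage_comp; exists A => //; rewrite setTI.
apply: smallest_sub; first exact: sigma_algebra_measurable.
rewrite -bigcup_mkord_ord; apply: bigcup_sub => i Ii B [C mC <-].
suff mf : measurable_fun setT (row_coord (inord i) \o @snoc_row n).
  exact: (mf measurableT C mC).
case: (unliftP ord_max (inord i : 'I_n.+1)) => [j|] ->.
- rewrite (_ : _ \o _ = row_coord j \o fst).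
    by apply: measurableT_comp; [exact: measurable_row_coord|exact: measurable_fst].
  by apply/funext => tx; rewrite /= /row_coord mxE liftK.
- rewrite (_ : _ \o _ = snd); first exact: measurable_snd.
  by apply/funext => tx; rewrite /= /row_coord mxE unlift_none.
Qed.

Definition leb_snoc n (mu : {measure set 'rV[R]_n -> \bar R}) :
    set 'rV[R]_n.+1 -> \bar R :=
  pushforward (mu \x @lebesgue_measure R)%E (@snoc_row n).

HB.instance Definition _ n (mu : {measure set 'rV[R]_n -> \bar R}) :=
  Measure.copy (leb_snoc mu)
    (measure_function_pushforward__canonical__measure_function_Measure
       (mu \x @lebesgue_measure R)%E (@measurable_snoc_row n)).

(* n-dimensional Lebesgue measure, as an iterated product; see `lebn_box` *)
Fixpoint lebn (n : nat) : {measure set 'rV[R]_n -> \bar R} :=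
  if n is m.+1 then leb_snoc (lebn m) else dirac (0 : 'rV[R]_0).

Lemma lebn_box n (a b : 'I_n -> R) : (forall i, a i <= b i) ->
  lebn n [set x | forall i, x ord0 i \in `[a i, b i]] =
  (\prod_(i < n) (b i - a i))%:E.
Proof.
elim: n a b => [|n IH] a b ab.
  by rewrite big_ord0 /= diracE mem_set//= => -[].
pose w i := widen_ord (leqnSn n) i.
have -> : lebn n.+1 [set x | forall i, x ord0 i \in `[a i, b i]] =
  (lebn n \x @lebesgue_measure R)%E
    ([set x : 'rV_n | forall i, x ord0 i \in `[a (w i), b (w i)]] `*`
     `[a ord_max, b ord_max]%classic).
  rewrite /= /leb_snoc /pushforward; congr (product_measure1 _ _ _).
  have wE i : w i = lift ord_max i by apply/val_inj; rewrite /= /bump leqNgt ltn_ord.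
  apply/seteqP; split=> -[t x] /= H.
    split=> [i|]; last by have := H ord_max; rewrite mxE unlift_none.
    by have := H (w i); rewrite wE mxE liftK.
  by move=> i; rewrite mxE; case: unliftP => [j|] ->; [rewrite -wE; apply H.1|apply H.2].
rewrite product_measure1E.
- rewrite [X in (X * _)%E](IH (a \o w) (b \o w)) => [|i]; last exact: ab.
  rewrite big_ord_recr /= lebesgue_measure_itv /= lte_fin EFinM.
  have [//|ba] := ltP (a ord_max) (b ord_max).
  by rewrite (le_anti (introT andP (conj ba (ab ord_max)))) subrr.
- rewrite (_ : mkset _ = \bigcap_(i in [set: 'I_n])
    (row_coord i @^-1` `[a (w i), b (w i)]%classic)).
    apply: fin_bigcap_measurable => // i _.
    rewrite -[X in measurable X]setTI.
    by apply: measurable_row_coord => //; exact: measurable_itv.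
  by apply/seteqP; split=> x /= H i; [move=> _|]; exact: H.
- exact: measurable_itv.
Qed.

End LebesgueRow.

Section Functions.
Context {R : realType} {n : nat}.
Local Notation pt := 'rV[R]_n.
Local Notation C := R[i].
Implicit Types (f g theta : pt -> C) (E : set pt).

Definition dotp (x y : pt) : R := \sum_(i < n) x ord0 i * y ord0 i.

(* The library norm `|x| of a row vector is the sup norm. *)
Definition enorm (x : pt) : R := Num.sqrt (dotp x x).

Definition pderiv (i : 'I_n) (f : pt -> R) : pt -> R := 'D_(delta_mx 0 i) f.

Definition pderivs (l : seq 'I_n) (f : pt -> R) : pt -> R := foldr pderiv f l.

Definition smoothR (f : pt -> R) : Prop :=
  forall (l : seq 'I_n) (x : pt), differentiable (pderivs l f) x.

Definition reF f : pt -> R := fun x => complex.Re (f x).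
Definition imF f : pt -> R := fun x => complex.Im (f x).

Definition smooth f : Prop := smoothR (reF f) /\ smoothR (imF f).

Definition cpderivs (l : seq 'I_n) f : pt -> C :=
  fun x => Complex (pderivs l (reF f) x) (pderivs l (imF f) x).

Definition cmod (z : C) : R := Normc.normc z.

Definition supp f : set pt := closure [set x | f x != 0].

(* C_c^oo(E), for E open, as functions on R^n *)
Definition test E : set (pt -> C) :=
  [set theta | [/\ smooth theta, compact (supp theta) & supp theta `<=` E]].

Definition schwartz_norm (N : nat) f : \bar R :=
  ereal_sup [set r | exists (k : nat) (l : seq 'I_n) (x : pt),
    [/\ (k <= N)%N, (size l <= N)%N &
        r = (enorm x ^+ k * cmod (cpderivs l f x))%:E]].

Definition schwartz : set (pt -> C) :=
  [set f | smooth f /\ forall N, (schwartz_norm N f < +oo)%E].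

Definition cintegral f : C :=
  Complex (Rintegral (lebn n) setT (reF f)) (Rintegral (lebn n) setT (imF f)).

Definition cmeasurable f : Prop :=
  measurable_fun setT (reF f) /\ measurable_fun setT (imF f).

Definition cintegrable f : Prop :=
  (lebn n).-integrable setT (EFin \o reF f) /\
  (lebn n).-integrable setT (EFin \o imF f).

Definition Lp_norm (p : \bar R) f : \bar R :=
  Lnorm (lebn n) p (fun x => (cmod (f x))%:E).

Definition expi (t : R) : C := Complex (cos t) (sin t).

Definition fourier f : pt -> C :=
  fun xi => cintegral (fun x => expi (- dotp x xi) * f x).

Definition ifourier f : pt -> C :=
  fun x => real_complex R ((2 * pi) ^- n) *
    cintegral (fun xi => expi (dotp x xi) * f xi).

(* C^0_0(R^n) *)
Definition C0_vanishing : set (pt -> C) :=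
  [set f | [/\ continuous (reF f), continuous (imF f) &
    forall e : R, 0 < e ->
      exists M : R, forall x, M < enorm x -> cmod (f x) < e]].

End Functions.

(* Tempered distributions act on Schwartz functions and distributions on an
   open set E on test E.  Both are encoded as functionals on all functions; by
   convention (in `tempered` and `restr_to`) these vanish outside the space on
   which they act, so that equality of distributions is Leibniz equality.  The
   auxiliary operations dist_mult, dist_fourier, dist_ifourier and dist_of are
   only meaningful on Schwartz functions. *)
Definition dist (R : realType) (n : nat) := ('rV[R]_n -> R[i]) -> R[i].

Section Distributions.
Context {R : realType} {n : nat}.
Local Notation pt := 'rV[R]_n.
Local Notation C := R[i].
Implicit Types (f theta eta m : pt -> C) (u v : dist R n) (E : set pt).

Definition tempered : set (dist R n) :=
  [set u | [/\ forall (a : C) theta eta, schwartz theta -> schwartz eta ->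
                 u (fun x => a * theta x + eta x) = a * u theta + u eta,
               exists (N : nat) (K : R), forall theta, schwartz theta ->
                 ((cmod (u theta))%:E <= K%:E * schwartz_norm N theta)%E &
               forall theta, ~ schwartz theta -> u theta = 0]].

Definition dist_of f : dist R n :=
  fun theta => cintegral (fun x => f x * theta x).

Definition represents f u : Prop :=
  cmeasurable f /\ forall theta, schwartz theta ->
    cintegrable (fun x => f x * theta x) /\ u theta = dist_of f theta.

(* +oo when u is not a function of L^p *)
Definition dist_Lp_norm (p : \bar R) u : \bar R :=
  ereal_inf [set Lp_norm p f | f in [set f | represents f u]].

Definition dist_supp u : set pt :=
  [set x | forall V, open V -> V x -> exists2 theta, test V theta & u theta != 0].

Definition dist_mult m u : dist R n := fun theta => u (fun x => m x * theta x).
Definition dist_fourier u : dist R n := fun theta => u (fourier theta).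
Definition dist_ifourier u : dist R n := fun theta => u (ifourier theta).

Definition fourier_mult m u : dist R n :=
  dist_ifourier (dist_mult m (dist_fourier u)).

Definition restr_to E u : dist R n :=
  fun theta => if `[< test E theta >] then u theta else 0.

Definition Sh : set (dist R n) :=
  [set u | tempered u /\ forall Theta, test setT Theta ->
    dist_Lp_norm +oo%E (fourier_mult (fun xi => Theta (lam *: xi)) u)
      @[lam --> (+oo)%R] --> 0%E].

End Distributions.

Section Besov.
Context {R : realType} {n : nat}.
Local Notation pt := 'rV[R]_n.

Definition cutoff (phi : pt -> R) : Prop :=
  [/\ smoothR phi,
      forall x y, enorm x = enorm y -> phi x = phi y,
      forall x, 0 <= phi x,
      closure [set x | phi x != 0] `<=` [set x | enorm x < 4 / 3] &
      forall x, enorm x < 3 / 4 -> phi x = 1].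

Variable phi : pt -> R.

Definition phij (j : int) (xi : pt) : R := phi ((2 : R) ^ (- j) *: xi).
Definition psij (j : int) (xi : pt) : R := phij j (2^-1 *: xi) - phij j xi.

Definition Delta (j : int) (u : dist R n) : dist R n :=
  fourier_mult (fun xi => real_complex R (psij j xi)) u.

Definition lq_norm (q : \bar R) (a : int -> \bar R) : \bar R :=
  if q is r%:E then (poweR (\esum_(j in [set: int]) poweR (a j) r) r^-1)%E
  else ereal_sup (range a).

Definition besov_term (s : R) (p : \bar R) (u : dist R n) (j : int) : \bar R :=
  ((2 `^ (j%:~R * s))%:E * dist_Lp_norm p (Delta j u))%E.

Definition besov_norm (s : R) (p q : \bar R) (u : dist R n) : \bar R :=
  lq_norm q (besov_term s p u).

Definition besov (s : R) (p q : \bar R) : set (dist R n) :=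
  [set u | Sh u /\ (besov_norm s p q u < +oo)%E].

(* calligraphic B^s_{p,oo} *)
Definition besov_van (s : R) (p : \bar R) : set (dist R n) :=
  [set u | [/\ besov s p +oo%E u,
    besov_term s p u (k%:Z) @[k --> \oo] --> 0%E &
    besov_term s p u (- k%:Z) @[k --> \oo] --> 0%E]].

(* B^{s,0}_{oo,q} *)
Definition besov0 (s : R) (q : \bar R) : set (dist R n) :=
  [set u | besov s +oo%E q u /\ forall j : int,
    exists2 f, C0_vanishing f & represents f (Delta j u)].

(* calligraphic B^{s,0}_{oo,oo} *)
Definition besov0_van (s : R) : set (dist R n) :=
  besov_van s +oo%E `&` besov0 s +oo%E.

End Besov.

Section Domains.
Context {R : realType}.

Definition special_lipschitz n (Om : set 'rV[R]_n.+1) : Prop :=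
  exists g : 'rV[R]_n -> R, (exists k : R, k.-lipschitz g) /\
    Om = [set x | g (col' ord_max x) < x ord0 ord_max].

Context {n : nat}.
Implicit Types (X : set (dist R n)) (N : dist R n -> \bar R) (Om : set 'rV[R]_n).

(* X(Omega) and its quotient norm *)
Definition on_domain X Om : set (dist R n) := restr_to Om @` X.

Definition on_domain_norm X N Om (f : dist R n) : \bar R :=
  ereal_inf [set N u | u in [set u | X u /\ restr_to Om u = f]].

(* X_0(Omega), normed by N *)
Definition supported X Om : set (dist R n) :=
  [set u | X u /\ dist_supp u `<=` closure Om].

Definition supported_eq_on_domain X N Om : Prop :=
  set_bij (supported X Om) (on_domain X Om) (restr_to Om) /\
  exists c1 c2 : R, [/\ 0 < c1, 0 < c2 &
    forall u, supported X Om u ->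
      (c1%:E * N u <= on_domain_norm X N Om (restr_to Om u) <= c2%:E * N u)%E].

Definition test_dists Om : set (dist R n) :=
  [set restr_to Om (dist_of theta) | theta in test Om].

Definition test_dense X N Om : Prop :=
  test_dists Om `<=` on_domain X Om /\
  forall f, on_domain X Om f -> forall e : R, 0 < e ->
    exists2 g, test_dists Om g & (on_domain_norm X N Om (f \- g)%R < e%:E)%E.

End Domains.

(* Main.v *)
(* Let [m] be the indicator of the domain.  For [v] in the space, with
   Littlewood-Paley pieces [f_k] and fattened kernels [H_k], put
     Q(F) = \sum_k \int f_k (H_k * F),
   which is [v(F)] when [F] is Schwartz.  If [F] is [m] times a bump at scale
   1/b, then [F] has bounded variation, because [m] only jumps across a Lipschitz
   graph.  Hence [H_k * F] is of size min(1, b 2^-k) in L^1 and min(2^k, b)^n in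
   the sup norm, and the interpolated bound makes the series converge exactly for
   -1 + 1/p < s < 1/p.  Taking for [F] the product of [m] with the kernels of
   [Delta_j], Schur's test yields
     2^(js) |Delta_j (m v)|_p <= C \sum_k 2^(-ka |j-k|) 2^(ks) |Delta_k v|_p,
   so that [v |-> Q(m .)] is bounded on the Besov space; it is a bounded right
   inverse of the restriction with values in the distributions supported in the
   closed domain.

   Pushing [m theta] vertically into the domain and mollifying gives test
   functions [w_e] supported inside such that [w_e - m theta] is bounded in BV and
   O(e) in L^1, whence [Q(m theta) = lim v(w_e)].  The same on the other side of
   the graph shows that a distribution supported in the closed domain and
   vanishing on it is zero, which is injectivity.

   For the density, truncating finitely many [f_k] replaces [v] by a Schwartz
   function [G], and [m G] is approximated by the test functions above, which
   converge to it in the Besov norm by interpolating the L^1 and BV bounds.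

   A complex functional is handled as a pair of real ones: the kernels of the
   radial multipliers are real and even. *)
From HB Require Import structures.
Require Import Defs.
From mathcomp Require Import all_boot all_order all_algebra.
From mathcomp Require Import complex ring lra.
From mathcomp Require Import all_classical all_reals all_analysis.
From mathcomp Require Import measurable_realfun ess_sup_inf.
Set Implicit Arguments.
Unset Strict Implicit.
Unset Printing Implicit Defensive.
Import Order.TTheory GRing.Theory Num.Theory.
Import numFieldNormedType.Exports.
Local Open Scope classical_set_scope.
Local Open Scope ring_scope.

(** * Lebesgue measure and integrable functions on R^n *)

Section RowMeasure.
Context {R : realType}.

(** The product of a tempered distribution with an indicator has no meaning a priori. It is defined
    by [Q], and its Littlewood-Paley pieces are read off [Q] at rough bumps: Q(m (A * th)) is the
    integral of Q(m A(. - x)) against th(x), so that x |-> Q(m A(. - x)) is the function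
    representing A * (m v), for an even kernel A. The margin [ka] is half the distance from s to the
    ends of the interval because it is spent twice: once on the geometric decay in frequency, once
    on the rate e^tau with which [Q] and the Besov norm follow an approximation that is O(e) in L^1.
    Membership in S'_h enters on both sides. Given for v, it removes the low-frequency remainder of
    the decomposition, which a polynomial would leave; for m v it is proved from the smallness of
    [Q] at bumps of width 1/a as a tends to 0. Norms are replaced by real bounds on functions and by
    sequences of such bounds on the pieces, so that one estimate serves all q. An L^p norm of a
    distribution is an infimum over representatives; replacing a representative f_k by its
    convolution with H_k fixes one choice, good for the L^p and C^0_0 conditions alike. *)

Lemma measurable_rowP d (T : measurableType d) n (f : T -> 'rV[R]_n) :
  (forall i, measurable_fun setT (fun t => f t ord0 i)) ->
  measurable_fun setT f.
Proof.
move=> mf _ A mA; rewrite setTI.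
suff : g_sigma_preimage (fun i => @row_coord R n i \o f) `<=` measurable.
  by apply; rewrite g_sigma_preimage_comp; exists A => //; rewrite setTI.
apply: smallest_sub; first exact: sigma_algebra_measurable.
rewrite -bigcup_seq; apply: bigcup_sub => i _ B [C mC <-]; exact: mf.
Qed.

Lemma measurable_coord n (i : 'I_n) :
  measurable_fun [set: 'rV[R]_n] (fun x => x ord0 i).
Proof. exact: measurable_row_coord. Qed.

Lemma measurable_fun_coord d (T : measurableType d) n (f : T -> 'rV[R]_n) i :
  measurable_fun setT f -> measurable_fun setT (fun t => f t ord0 i).
Proof. by move=> mf; exact: (measurableT_comp (measurable_coord i) mf). Qed.

Lemma measurable_rowD d (T : measurableType d) n (f g : T -> 'rV[R]_n) :
  measurable_fun setT f -> measurable_fun setT g ->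
  measurable_fun setT (fun t => f t + g t).
Proof.
move=> mf mg; apply: measurable_rowP => i.
under eq_fun do rewrite mxE.
by apply: measurable_funD; exact: measurable_fun_coord.
Qed.

Lemma measurable_rowZ d (T : measurableType d) n (f : T -> 'rV[R]_n) (c : R) :
  measurable_fun setT f -> measurable_fun setT (fun t => c *: f t).
Proof.
move=> mf; apply: measurable_rowP => i.
under eq_fun do rewrite mxE.
by apply: measurable_funM => //; exact: measurable_fun_coord.
Qed.

Lemma measurable_rowB d (T : measurableType d) n (f g : T -> 'rV[R]_n) :
  measurable_fun setT f -> measurable_fun setT g ->
  measurable_fun setT (fun t => f t - g t).
Proof.
move=> mf mg; under eq_fun do rewrite -scaleN1r.
by apply: measurable_rowD => //; exact: measurable_rowZ.
Qed.

Lemma normr_coord n (x : 'rV[R]_n) i : `|x ord0 i| <= `|x|.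
Proof.
have -> : `|x| = mx_norm x by [].
rewrite mx_normrE.
exact: (le_bigmax _ (fun p : 'I_1 * 'I_n => `|x p.1 p.2|) (ord0, i)).
Qed.

Lemma row_normP n (x : 'rV[R]_n) (e : R) :
  0 <= e -> (forall i, `|x ord0 i| <= e) -> `|x| <= e.
Proof.
move=> e0 H; have -> : `|x| = mx_norm x by [].
rewrite mx_normrE.
by apply: bigmax_le => //= -[i j] _; rewrite ord1.
Qed.

(** The sigma-algebra is generated by the coordinates, so an open set has to be exhausted by
    countably many boxes: those with rational centre and half-width 1/(k+1), enumerated through
    [pickle]. *)
Lemma open_measurable_row n (U : set 'rV[R]_n) : open U -> measurable U.
Proof.
move=> oU.
pose B (p : 'rV[rat]_n * nat) : set 'rV[R]_n :=
  \bigcap_(i in [set: 'I_n]) [set x | `|x ord0 i - ratr (p.1 ord0 i)| < p.2.+1%:R^-1].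
have mB p : measurable (B p).
  apply: fin_bigcap_measurable => // i _.
  have mg : measurable_fun setT (fun x : 'rV[R]_n => `|x ord0 i - ratr (p.1 ord0 i)|).
    apply: measurableT_comp => //; apply: measurable_funB => //.
    exact: measurable_coord.
  rewrite -[X in measurable X]setTI.
  have := mg measurableT `]-oo, (p.2.+1%:R^-1)[%classic (measurable_itv _).
  by congr measurable; apply/seteqP; split=> x [_ /= ]; rewrite in_itv /=.
have -> : U = \bigcup_k (if unpickle k is Some p then
    if `[< B p `<=` U >] then B p else set0 else set0).
  apply/seteqP; split=> [x Ux|x [k _]]; last first.
    by case: unpickle => // p; case: asboolP => // + Bp; apply.
  have /nbhs_ballP[e /= e0 eU] := open_nbhs_nbhs (conj oU Ux).
  have [k ke] : exists k, 2 * k.+1%:R^-1 < e.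
    have [k _ /(_ _ (leqnn k))] := near_infty_natSinv_lt (PosNum (divr_gt0 e0 (ltr0Sn R 1))).
    by rewrite /= ltr_pdivlMr // mulrC => ?; exists k.
  have Q i : exists q : rat, `|x ord0 i - ratr q| < k.+1%:R^-1.
    have := @rat_in_itvoo R (x ord0 i - k.+1%:R^-1) (x ord0 i + k.+1%:R^-1).
    case.
      by rewrite ltrBlDr -addrA ltrDl addr_gt0 // invr_gt0.
    move=> q; rewrite in_itv /= => /andP[q1 q2]; exists q.
    by rewrite ltr_distlC q1.
  pose q := \row_i projT1 (cid (Q i)).
  exists (pickle (q, k)) => //; rewrite pickleK.
  have Bx : B (q, k) x.
    by move=> i _ /=; rewrite mxE; exact: projT2 (cid (Q i)).
  rewrite asboolT // => y By; apply: eU.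
  rewrite -ball_normE /=; apply: le_lt_trans ke.
  apply: row_normP => [|i]; first by rewrite mulr_ge0 // invr_ge0.
  rewrite !mxE -(subrK (ratr (q ord0 i)) (x ord0 i)) -addrA.
  apply: (le_trans (ler_normD _ _)); rewrite mulrDl mul1r lerD //.
    by apply/ltW; exact: Bx.
  by rewrite distrC; apply/ltW; exact: By.
apply: bigcupT_measurable => k; case: unpickle => [p|]; last exact: measurable0.
by case: asboolP.
Qed.

Lemma continuous_measurable_row n (f : 'rV[R]_n -> R) :
  continuous f -> measurable_fun setT f.
Proof.
move=> cf; apply: (measurability _ (RGenOInfty.measurableE R)).
move=> _ [_ [a ->] <-]; rewrite setTI; apply: open_measurable_row.
by apply: open_comp => // x _; exact: cf.
Qed.

Lemma sigma_finite_lebn n : sigma_finite setT (@lebn R n).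
Proof.
pose B k : set 'rV[R]_n := [set x | forall i, x ord0 i \in `[- k%:R, k%:R]].
exists (fun k => B k) => [|k].
  apply/esym; rewrite -subTset => x _; exists (Num.bound `|x|) => // i.
  rewrite in_itv /= -ler_norml (le_trans (normr_coord _ _)) //.
  by apply/ltW/archi_boundP; rewrite normr_ge0.
split.
  rewrite (_ : B k = \bigcap_(i in [set: 'I_n])
    (row_coord i @^-1` `[(- k%:R), k%:R]%classic)).
    apply: fin_bigcap_measurable => // i _; rewrite -[X in measurable X]setTI.
    by apply: measurable_row_coord => //; exact: measurable_itv.
  by apply/seteqP; split=> x /= H i; [move=> _|]; exact: H.
rewrite /B (@lebn_box R n (fun=> - k%:R) (fun=> k%:R)) ?ltry // => i.
by rewrite ge0_cp.
Qed.

End RowMeasure.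

(** A name for the set function underlying [lebn], on which the sigma-finite structure required by
    Tonelli and Fubini is declared. *)
Definition leb_fun (R : realType) n : set 'rV[R]_n -> \bar R := lebn n.
HB.instance Definition _ (R : realType) n := Measure.copy (@leb_fun R n) (@lebn R n).
HB.instance Definition _ (R : realType) n :=
  Measure_isSigmaFinite.Build _ _ _ (@leb_fun R n) (@sigma_finite_lebn R n).
Definition leb (R : realType) n : {sigma_finite_measure set 'rV[R]_n -> \bar R} :=
  @leb_fun R n.

Section RowIntegral.
Context {R : realType}.
Local Notation lebesgue := (@lebesgue_measure R).

Lemma ge0_integral_lebS n (f : 'rV[R]_n.+1 -> \bar R) :
  measurable_fun setT f -> (forall x, 0 <= f x)%E ->
  (\int[leb R n.+1]_x f x =
   \int[leb R n]_t \int[lebesgue]_x f (snoc_row (t, x)))%E.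
Proof.
move=> mf f0.
rewrite -(fubini_tonelli1 (m1 := leb R n) (m2 := lebesgue) (f \o @snoc_row R n)) //.
- pose nu := measure_function_pushforward__canonical__measure_function_Measure
    (leb R n \x lebesgue)%E (@measurable_snoc_row R n).
  rewrite (@eq_measure_integral _ _ _ _ nu); last by [].
  by rewrite (@ge0_integral_pushforward _ _ _ _ _ _ (@measurable_snoc_row R n) _ setT f).
- by apply: measurableT_comp => //; exact: measurable_snoc_row.
- by move=> x; exact: f0.
Qed.

Lemma ge0_integral_affine1 (a b : R) (f : R -> \bar R) : a != 0 ->
  measurable_fun setT f -> (forall x, 0 <= f x)%E ->
  (\int[lebesgue]_x f (a * x + b)%R = `|a|^-1%:E * \int[lebesgue]_x f x)%E.
Proof.
move=> a0 mf f0.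
pose T : measurableTypeR R -> measurableTypeR R := fun x : R => (a * x + b)%R.
have mT : measurable_fun setT T.
  by apply: measurable_funD => //; apply: measurable_funM.
have a1 : 0 < `|a| by rewrite normr_gt0.
pose k : {nonneg R} := NngNum (ltW a1).
pose nu := measure_function_pushforward__canonical__measure_function_Measure lebesgue mT.
(* By uniqueness of Lebesgue measure it suffices to compare on intervals ]u, v]; for a < 0 the
   preimage is closed on the other side, which does not change its length. *)
have E A : measurable A -> lebesgue A = mscale k nu A.
  apply: lebesgue_measure_unique => _ [[u v] _ <-] /=.
  rewrite /mscale /= /pushforward lebesgue_measure_itv /= lte_fin.
  have [a_gt0|] := ltP 0 a.
    have -> : T @^-1` `]u, v] = `](u - b) / a, (v - b) / a]%classic.
      apply/seteqP; split => x /=; rewrite !in_itv /= /T ltr_pdivrMr // ler_pdivlMr //;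
        rewrite ltrBlDr lerBrDr (mulrC a x) //.
    rewrite lebesgue_measure_itv /= lte_fin ltr_pM2r ?invr_gt0 // ltrBlDr subrK.
    case: ifP => _; last by rewrite mule0.
    rewrite -!EFinD -EFinM; congr EFin; rewrite gtr0_norm //; field.
    by rewrite gt_eqF.
  rewrite le_eqVlt (negbTE a0) /= => a_lt0.
  have -> : T @^-1` `]u, v] = `[(v - b) / a, (u - b) / a[%classic.
    apply/seteqP; split => x /=; rewrite !in_itv /= /T ltr_ndivlMr // ler_ndivrMr //;
      rewrite ltrBlDr lerBrDr (mulrC a x) andbC //.
  rewrite lebesgue_measure_itv /= lte_fin ltr_nM2r ?invr_lt0 // ltrBlDr subrK.
  case: ifP => _; last by rewrite mule0.
  rewrite -!EFinD -EFinM; congr EFin; rewrite ltr0_norm //; field.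
  by rewrite lt_eqF.
rewrite [X in (_ * X)%E](@eq_measure_integral _ _ _ _ (mscale k nu)); last first.
  by move=> A mA _; exact: E.
rewrite ge0_integral_mscale // (ge0_integral_pushforward mT) //=.
by rewrite muleA -EFinM mulVf ?gt_eqF // mul1e.
Qed.

Lemma snoc_row_lift n (t : 'rV[R]_n) (x : R) i :
  snoc_row (t, x) ord0 (lift ord_max i) = t ord0 i.
Proof. by rewrite mxE liftK. Qed.

Lemma snoc_row_max n (t : 'rV[R]_n) (x : R) : snoc_row (t, x) ord0 ord_max = x.
Proof. by rewrite mxE unlift_none. Qed.

Lemma snoc_rowP n (x y : 'rV[R]_n.+1) :
  (forall i, x ord0 (lift ord_max i) = y ord0 (lift ord_max i)) ->
  x ord0 ord_max = y ord0 ord_max -> x = y.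
Proof.
by move=> H1 H2; apply/rowP => i; case: (unliftP ord_max i) => [j|] ->.
Qed.

Lemma col'_snoc_row n (t : 'rV[R]_n) (x : R) : col' ord_max (snoc_row (t, x)) = t.
Proof. by apply/rowP => i; rewrite mxE snoc_row_lift. Qed.

Lemma measurable_snoc_row_r n (t : 'rV[R]_n) :
  measurable_fun setT (fun x : measurableTypeR R => snoc_row (t, x)).
Proof.
apply: measurable_rowP => i; case: (unliftP ord_max i) => [j|] ->.
  apply: (eq_measurable_fun (cst (t ord0 j))) => // x _.
  by rewrite snoc_row_lift.
rewrite (_ : (fun x => _) = (fun x : measurableTypeR R => x : R)) //.
by apply/funext => x; rewrite snoc_row_max.
Qed.

Lemma ge0_integral_affine n (c : R) (z : 'rV[R]_n) (f : 'rV[R]_n -> \bar R) :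
  c != 0 -> measurable_fun setT f -> (forall x, 0 <= f x)%E ->
  (\int[leb R n]_x f (c *: x + z)%R = (`|c| ^- n)%:E * \int[leb R n]_x f x)%E.
Proof.
move=> c0; elim: n z f => [|n IH] z f mf f0.
  rewrite expr0 invr1 mul1e; apply: eq_integral => x _.
  by congr f; apply/rowP => -[].
have maff : measurable_fun setT (fun x : 'rV[R]_n.+1 => c *: x + z).
  by apply: measurable_rowD => //; apply: measurable_rowZ.
rewrite ge0_integral_lebS; [|exact: measurableT_comp|by []].
have E t x : c *: snoc_row (t, x) + z =
    snoc_row (c *: t + col' ord_max z, c * x + z ord0 ord_max).
  by apply: snoc_rowP => [i|]; rewrite ?snoc_row_lift ?snoc_row_max !mxE
    ?liftK ?unlift_none.
pose g t := (\int[lebesgue]_x f (snoc_row (t, x)))%E.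
have mg : measurable_fun setT g.
  apply: (measurable_fun_fubini_tonelli_F (m2 := lebesgue) (f \o @snoc_row R n)) => //.
    by apply: measurableT_comp => //; exact: measurable_snoc_row.
  by move=> x; exact: f0.
have g0 t : (0 <= g t)%E by apply: integral_ge0.
transitivity (\int[leb R n]_t (`|c|^-1%:E * g (c *: t + col' ord_max z)%R))%E.
  apply: eq_integral => t _.
  under eq_integral do rewrite E.
  rewrite (@ge0_integral_affine1 c _ (fun x => f (snoc_row (_, x)))) //.
  by apply: measurableT_comp => //; exact: measurable_snoc_row_r.
rewrite ge0_integralZl //; last first.
  apply: (measurableT_comp mg).
  by apply: measurable_rowD => //; apply: measurable_rowZ.
by rewrite IH // muleA -EFinM -invfM -exprS ge0_integral_lebS.
Qed.

End RowIntegral.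

(** * Integrable functions with explicit bounds, and Fubini's theorem *)

Section L1Bounds.
Context d (T : measurableType d) {R : realType}.
Variable mu : {measure set T -> \bar R}.
Implicit Types (f g : T -> R) (A B c : R).

Definition intg f := mu.-integrable setT (EFin \o f).

(** A bound by a real number rather than an equality with a norm: integrability comes with it, and
    constants are combined by real arithmetic. *)
Definition L1le f A :=
  measurable_fun setT f /\ (\int[mu]_x `|f x|%:E <= A%:E)%E.

Lemma measurable_abse f : measurable_fun setT f ->
  measurable_fun setT (fun x => `|f x|%:E).
Proof. by move=> mf; apply/measurable_EFinP; exact: measurableT_comp. Qed.

Lemma L1le_intg f A : L1le f A -> intg f.
Proof.
move=> [mf fA]; apply/integrableP; split; first exact/measurable_EFinP.
by apply: le_lt_trans fA _; rewrite ltry.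
Qed.

Lemma L1le_ge0 f A : L1le f A -> 0 <= A.
Proof.
by move=> [_ fA]; rewrite -lee_fin; apply: le_trans fA; exact: integral_ge0.
Qed.

Lemma L1leW f A B : A <= B -> L1le f A -> L1le f B.
Proof. by move=> AB [mf fA]; split=> //; rewrite (le_trans fA) ?lee_fin. Qed.

Lemma abs_Rintegral f : measurable_fun setT f ->
  (`|Rintegral mu setT f|%:E <= \int[mu]_x `|f x|%:E)%E.
Proof.
move=> mf; apply: (@le_trans _ _ `|\int[mu]_x (f x)%:E|%E); last first.
  by apply: le_abse_integral => //; exact/measurable_EFinP.
by rewrite /Rintegral; case: (integral _ _ _) => [r| |] //=; rewrite normr0 leey.
Qed.

Lemma L1le_Rintegral f A : L1le f A -> `|Rintegral mu setT f| <= A.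
Proof. by move=> [mf fA]; rewrite -lee_fin (le_trans (abs_Rintegral mf)). Qed.

Lemma intg_meas f : intg f -> measurable_fun setT f.
Proof. by move=> /measurable_int /measurable_EFinP. Qed.

Lemma intg_L1le f : intg f -> L1le f (Rintegral mu setT (fun x => `|f x|)).
Proof.
move=> If; split; first exact: intg_meas.
rewrite /Rintegral fineK //; apply: integrable_fin_num => //.
exact: (integrable_abse If).
Qed.

Lemma le_L1le f g A : measurable_fun setT f -> (forall x, `|f x| <= g x) ->
  L1le g A -> L1le f A.
Proof.
move=> mf fg [mg gA]; split=> //; apply: le_trans gA.
apply: ge0_le_integral => //; [exact: measurable_abse|exact: measurable_abse|].
by move=> x _; rewrite lee_fin (le_trans (fg x)) // ler_norm.
Qed.

Lemma L1le_eq f g A : f =1 g -> L1le f A -> L1le g A.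
Proof. by move=> /funext ->. Qed.

Lemma L1leN f A : L1le f A -> L1le (fun x => - f x) A.
Proof.
move=> [mf fA]; split; first exact: measurableT_comp.
by under eq_integral do rewrite normrN.
Qed.

Lemma L1le_abs f A : L1le f A -> L1le (fun x => `|f x|) A.
Proof.
move=> [mf fA]; split; first exact: measurableT_comp.
by under eq_integral do rewrite normr_id.
Qed.

Lemma L1leD f g A B : L1le f A -> L1le g B -> L1le (fun x => f x + g x) (A + B).
Proof.
move=> [mf fA] [mg gB]; split; first exact: measurable_funD.
rewrite EFinD; apply: le_trans (leeD fA gB).
rewrite -ge0_integralD //; [|exact: measurable_abse..].
apply: ge0_le_integral => //; [| |by move=> x _; rewrite -EFinD lee_fin ler_normD].
- by apply: measurable_abse; exact: measurable_funD.
- by apply: emeasurable_funD; exact: measurable_abse.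
Qed.

Lemma L1leB f g A B : L1le f A -> L1le g B -> L1le (fun x => f x - g x) (A + B).
Proof. by move=> fA /L1leN; exact: L1leD. Qed.

Lemma L1leM (h : T -> R) f c A : 0 <= c -> measurable_fun setT h ->
  (forall x, `|h x| <= c) -> L1le f A -> L1le (fun x => h x * f x) (c * A).
Proof.
move=> c0 mh hc [mf fA]; split; first exact: measurable_funM.
rewrite EFinM; apply: (@le_trans _ _ (\int[mu]_x (c%:E * `|f x|%:E))%E).
  apply: ge0_le_integral => //.
  - by apply: measurable_abse; exact: measurable_funM.
  - by apply: (@emeasurable_funM _ _ _ _ (cst c%:E)) => //; exact: measurable_abse.
  - by move=> x _; rewrite -EFinM lee_fin normrM ler_wpM2r.
rewrite ge0_integralZl //; last exact: measurable_abse.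
by apply: lee_wpmul2l; rewrite ?lee_fin.
Qed.

Lemma L1leZ f c A : L1le f A -> L1le (fun x => c * f x) (`|c| * A).
Proof. by move=> fA; apply: L1leM. Qed.

Lemma L1le0 : L1le (fun=> 0) 0.
Proof.
split; first exact: measurable_cst.
by under eq_integral do rewrite normr0; rewrite integral0.
Qed.

Lemma L1le_sum (I : Type) (s : seq I) (P : pred I) (F : I -> T -> R) (A : I -> R) :
  (forall i, P i -> L1le (F i) (A i)) ->
  L1le (fun x => \sum_(i <- s | P i) F i x) (\sum_(i <- s | P i) A i).
Proof.
move=> H; elim: s => [|i s IH].
  by rewrite big_nil; apply: L1le_eq L1le0 => x; rewrite big_nil.
rewrite big_cons; case: ifPn => Pi.
  apply: L1le_eq (L1leD (H _ Pi) IH) => x.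
  by rewrite big_cons Pi.
by apply: L1le_eq IH => x; rewrite big_cons (negbTE Pi).
Qed.

Lemma intg_le f g : measurable_fun setT f -> (forall x, `|f x| <= g x) ->
  intg g -> intg f.
Proof.
by move=> mf fg /intg_L1le /(le_L1le mf fg); exact: L1le_intg.
Qed.

Lemma intgD f g : intg f -> intg g -> intg (fun x => f x + g x).
Proof. by move=> /intg_L1le If /intg_L1le Ig; apply: L1le_intg (L1leD If Ig). Qed.

Lemma intgB f g : intg f -> intg g -> intg (fun x => f x - g x).
Proof. by move=> /intg_L1le If /intg_L1le Ig; apply: L1le_intg (L1leB If Ig). Qed.

Lemma intgZ c f : intg f -> intg (fun x => c * f x).
Proof. by move=> /intg_L1le If; apply: L1le_intg (L1leZ c If). Qed.

Lemma intgZr c f : intg f -> intg (fun x => f x * c).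
Proof. by move=> If; under eq_fun do rewrite mulrC; exact: intgZ. Qed.

Lemma intg_abs f : intg f -> intg (fun x => `|f x|).
Proof. by move=> If; exact: integrable_abse If. Qed.

Lemma intgM (h : T -> R) f c : measurable_fun setT h ->
  (forall x, `|h x| <= c) -> intg f -> intg (fun x => h x * f x).
Proof.
move=> mh hc /intg_L1le If; apply: (L1le_intg (A := Num.max 0 c * _)); apply: L1leM If => //.
  by rewrite le_max lexx.
by move=> x; rewrite le_max hc orbT.
Qed.

Lemma RintD f g : intg f -> intg g ->
  Rintegral mu setT (fun x => f x + g x) =
  Rintegral mu setT f + Rintegral mu setT g.
Proof. exact: RintegralD. Qed.

Lemma RintB f g : intg f -> intg g ->
  Rintegral mu setT (fun x => f x - g x) =
  Rintegral mu setT f - Rintegral mu setT g.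
Proof. exact: RintegralB. Qed.

Lemma Rint_sum (I : Type) (s : seq I) (F : I -> T -> R) :
  (forall i, intg (F i)) ->
  Rintegral mu setT (fun x => \sum_(i <- s) F i x) =
  \sum_(i <- s) Rintegral mu setT (F i).
Proof.
move=> H; elim: s => [|i s IH].
  rewrite big_nil /Rintegral; under eq_integral do rewrite big_nil.
  by rewrite integral0.
rewrite big_cons -IH -RintD //; first by apply: eq_Rintegral => x _; rewrite big_cons.
apply: L1le_intg; apply: L1le_sum => j _; exact: intg_L1le.
Qed.

Lemma RintZl c f : intg f ->
  Rintegral mu setT (fun x => c * f x) = c * Rintegral mu setT f.
Proof. by move=> If; rewrite RintegralZl. Qed.

Lemma RintZr c f : intg f ->
  Rintegral mu setT (fun x => f x * c) = Rintegral mu setT f * c.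
Proof. by move=> If; rewrite RintegralZr. Qed.

Lemma Rint_ge0 f : (forall x, 0 <= f x) -> 0 <= Rintegral mu setT f.
Proof. by move=> f0; apply: Rintegral_ge0. Qed.

Lemma eq_Rint f g : f =1 g -> Rintegral mu setT f = Rintegral mu setT g.
Proof. by move=> /funext ->. Qed.

Lemma EFin_Rint f : intg f -> (Rintegral mu setT f)%:E = (\int[mu]_x (f x)%:E)%E.
Proof. by move=> If; rewrite /Rintegral fineK // integrable_fin_num. Qed.

End L1Bounds.
Arguments intg_le {d T R mu f} g.

Section Kernels.
Context d1 d2 (T1 : measurableType d1) (T2 : measurableType d2) {R : realType}.
Variable m1 : {sigma_finite_measure set T1 -> \bar R}.
Variable m2 : {sigma_finite_measure set T2 -> \bar R}.
Implicit Types (K : T1 -> T2 -> R).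

Definition kermeas K := measurable_fun setT (fun p : T1 * T2 => K p.1 p.2).

Lemma kermeas1 K x : kermeas K -> measurable_fun setT (K x).
Proof.
move=> mK; change (measurable_fun setT ((fun p : T1 * T2 => K p.1 p.2) \o pair x)).
by apply: measurableT_comp => //; exact: pair2_measurable.
Qed.

Lemma kermeas2 K y : kermeas K -> measurable_fun setT (K ^~ y).
Proof.
move=> mK; change (measurable_fun setT ((fun p : T1 * T2 => K p.1 p.2) \o pair^~ y)).
by apply: measurableT_comp => //; exact: pair1_measurable.
Qed.

Lemma measurable_Rint K : kermeas K ->
  measurable_fun setT (fun x => Rintegral m2 setT (K x)).
Proof.
move=> mK; apply: (measurableT_comp (f := fine)) => //.
under eq_fun do rewrite integralE.
pose k (p : T1 * T2) := (K p.1 p.2)%:E.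
have mk : measurable_fun setT k by exact/measurable_EFinP.
apply: emeasurable_funB.
- rewrite (_ : (fun x => _) = fubini_F m2 (k^\+)%E).
    exact: (measurable_fun_fubini_tonelli_F (m2 := m2) (k^\+)%E
      (measurable_funepos mk) (funepos_ge0 k)).
  by apply/funext => x; apply: eq_integral => y _; rewrite !funeposE.
- rewrite (_ : (fun x => _) = fubini_F m2 (k^\-)%E).
    exact: (measurable_fun_fubini_tonelli_F (m2 := m2) (k^\-)%E
      (measurable_funeneg mk) (funeneg_ge0 k)).
  by apply/funext => x; apply: eq_integral => y _; rewrite !funenegE.
Qed.

Lemma measurable_int_abs K : kermeas K ->
  measurable_fun setT (fun x => \int[m2]_y `|K x y|%:E)%E.
Proof.
move=> mK.
apply: (measurable_fun_fubini_tonelli_F (m2 := m2) (fun p => `|K p.1 p.2|%:E)) => //.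
exact: measurable_abse.
Qed.

Lemma tonelli_abs K : kermeas K ->
  (\int[m1]_x \int[m2]_y `|K x y|%:E = \int[m2]_y \int[m1]_x `|K x y|%:E)%E.
Proof.
move=> mK; apply: (fubini_tonelli (m1 := m1) (m2 := m2) (fun p => `|K p.1 p.2|%:E)) => //.
exact: measurable_abse.
Qed.

Lemma fubini_lty K g A : kermeas K ->
  (forall x, \int[m2]_y `|K x y|%:E <= (g x)%:E)%E -> L1le m1 g A ->
  (\int[m1]_x \int[m2]_y `|K x y|%:E <= A%:E)%E.
Proof.
move=> mK Kg [mg gA]; apply: le_trans gA; apply: ge0_le_integral => //.
- by move=> x _; exact: integral_ge0.
- exact: measurable_int_abs.
- exact: measurable_abse.
- by move=> x _; rewrite (le_trans (Kg x)) // lee_fin ler_norm.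
Qed.

Lemma swap_Rint K : kermeas K -> (forall x, intg m2 (K x)) ->
  (forall y, intg m1 (K ^~ y)) ->
  (\int[m1]_x \int[m2]_y `|K x y|%:E < +oo)%E ->
  Rintegral m1 setT (fun x => Rintegral m2 setT (K x)) =
  Rintegral m2 setT (fun y => Rintegral m1 setT (K ^~ y)).
Proof.
move=> mK I2 I1 foo; rewrite /Rintegral.
under eq_integral do rewrite -/(Rintegral _ _ _) (EFin_Rint (I2 _)).
under [in RHS]eq_integral do rewrite -/(Rintegral _ _ _) (EFin_Rint (I1 _)).
congr fine; apply: (Fubini (m1 := m1) (m2 := m2) (f := fun p => (K p.1 p.2)%:E)).
by apply/integrable12ltyP => //; exact/measurable_EFinP.
Qed.

(** Minkowski's inequality for integrals in L^1, by Tonelli. *)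
Lemma L1le_Rint_ker K g A : kermeas K ->
  (forall y, L1le m1 (K ^~ y) (g y)) -> L1le m2 g A ->
  L1le m1 (fun x => Rintegral m2 setT (K x)) A.
Proof.
move=> mK Kg [mg gA]; split; first exact: measurable_Rint.
apply: (@le_trans _ _ (\int[m1]_x \int[m2]_y `|K x y|%:E)%E).
  apply: ge0_le_integral => //.
  - by apply: measurable_abse; exact: measurable_Rint.
  - exact: measurable_int_abs.
  - by move=> x _; apply: abs_Rintegral; exact: kermeas1.
rewrite tonelli_abs //; apply: le_trans gA; apply: ge0_le_integral => //.
- by move=> y _; exact: integral_ge0.
- apply: (measurable_fun_fubini_tonelli_G (m1 := m1) (fun p => `|K p.1 p.2|%:E)) => //.
  exact: measurable_abse.
- exact: measurable_abse.
- by move=> y _; rewrite (le_trans (Kg y).2) // lee_fin ler_norm.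
Qed.

End Kernels.

(** * Weights and functions of bounded variation *)

Section Weights.
Context {R : realType}.
Local Notation lebesgue := (@lebesgue_measure R).
Local Notation I n f := (Rintegral (leb R n) setT f).

Lemma integral_cauchy : (\int[lebesgue]_x ((1 + x ^+ 2)^-1)%:E = (pi : R)%:E)%E.
Proof.
have d0 (x : R) : 1 + x ^+ 2 != 0 by rewrite gt_eqF // ltr_pwDl // sqr_ge0.
have ct : continuous (fun x : R => (1 + x ^+ 2)^-1).
  move=> x; apply: cvgV => //.
  by apply: cvgD; [exact: cvg_cst|exact: exprn_continuous].
rewrite (@ge0_symfun_integralT R) //=.
- rewrite (_ : [set x | _] = `[0, +oo[%classic); last first.
    by apply/seteqP; split => x/=; rewrite in_itv/= andbT.
  rewrite (@ge0_continuous_FTC2y R _ atan 0 (pi / 2)) //.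
  + by rewrite atan0 sube0 -EFinM mulrC divfK.
  + by move=> x _; rewrite invr_ge0 addr_ge0 // sqr_ge0.
  + exact: continuous_subspaceT.
  + exact: cvgy_atan.
  + by apply: cvg_at_right_filter; exact: continuous_atan.
  + by move=> x _; rewrite derive1_atan.
- by move=> x; rewrite invr_ge0 addr_ge0 // sqr_ge0.
- by move=> x /=; rewrite sqrrN.
Qed.

Lemma measurable_prod_coord d (T : measurableType d) n (q : 'I_n -> R -> R)
    (f : T -> 'rV[R]_n) :
  measurable_fun setT f -> (forall i, measurable_fun setT (q i)) ->
  measurable_fun setT (fun x => \prod_i q i (f x ord0 i)).
Proof.
move=> mf mq.
rewrite (_ : (fun x => _) = \prod_i (fun x => q i (f x ord0 i))); last first.
  by apply/funext => x; rewrite fct_prodE.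
apply: (big_ind (fun h : T -> R => measurable_fun setT h)) => [|h k mh mk|i _].
- exact: measurable_cst.
- exact: measurable_funM.
- by apply: (measurableT_comp (mq i)); exact: measurable_fun_coord.
Qed.

Lemma integral_prod_coord n (q : 'I_n -> R -> R) (c : 'I_n -> R) :
  (forall i, measurable_fun setT (q i)) -> (forall i t, 0 <= q i t) ->
  (forall i, \int[lebesgue]_t (q i t)%:E = (c i)%:E)%E ->
  (\int[leb R n]_x (\prod_i q i (x ord0 i))%:E = (\prod_i c i)%:E)%E.
Proof.
elim: n q c => [|n IH] q c mq q0 qc.
  under eq_integral do rewrite big_ord0.
  by rewrite big_ord0 integral_cst // [X in (_ * X)%E]diracE mem_set //= mule1.
have mP m (h : 'I_m -> R -> R) : (forall i, measurable_fun setT (h i)) ->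
    measurable_fun setT (fun x : 'rV[R]_m => (\prod_i h i (x ord0 i))%:E).
  move=> mh; apply/measurable_EFinP.
  by apply: (@measurable_prod_coord _ _ _ h idfun) => //; exact: measurable_id.
rewrite ge0_integral_lebS; [|exact: mP|by move=> x; rewrite lee_fin prodr_ge0].
have wE i : widen_ord (leqnSn n) i = lift ord_max i.
  by apply/val_inj; rewrite /= /bump leqNgt ltn_ord.
transitivity (\int[leb R n]_t ((c ord_max)%:E *
    (\prod_i q (lift ord_max i) (t ord0 i))%:E))%E.
  apply: eq_integral => t _; rewrite -qc -ge0_integralZr //.
  - apply: eq_integral => x _; rewrite big_ord_recr /= EFinM muleC snoc_row_max.
    congr (_ * _%:E)%E; apply: eq_bigr => i _.
    by rewrite wE snoc_row_lift.
  - by apply/measurable_EFinP; exact: mq.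
  - by move=> x _; rewrite lee_fin.
  - by rewrite lee_fin; apply: prodr_ge0.
rewrite ge0_integralZl //.
- rewrite (IH (fun i => q (lift ord_max i)) (fun i => c (lift ord_max i))) // -EFinM big_ord_recr /= mulrC.
  by congr (_ * _)%:E; apply: eq_bigr => i _; rewrite wE.
- exact: (mP n (fun i => q (lift ord_max i))).
- by move=> t _; rewrite lee_fin; apply: prodr_ge0.
- by rewrite -qc; apply: integral_ge0 => x _; rewrite lee_fin.
Qed.

(** Products over the coordinates, so that integrals factor: [wt b] is pi^n times the product Cauchy
    density at scale 1/b. Up to constants, [Wt b] majorises the dilated Schwartz kernels, and [wt b]
    what remains after a first moment has been taken. *)
Definition wt n (b : R) (x : 'rV[R]_n) : R :=
  \prod_i (b / (1 + (b * x ord0 i) ^+ 2)).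
Definition Wt n (b : R) (x : 'rV[R]_n) : R :=
  \prod_i (b / (1 + (b * x ord0 i) ^+ 2) ^+ 2).

Lemma cauchy_gt0 (t : R) : 0 < 1 + t ^+ 2.
Proof. by rewrite ltr_pwDl // sqr_ge0. Qed.

Lemma wt_ge0 n (b : R) (x : 'rV[R]_n) : 0 <= b -> 0 <= wt b x.
Proof.
by move=> b0; apply: prodr_ge0 => i _; rewrite divr_ge0 // ltW // cauchy_gt0.
Qed.

Lemma Wt_ge0 n (b : R) (x : 'rV[R]_n) : 0 <= b -> 0 <= Wt b x.
Proof.
move=> b0; apply: prodr_ge0 => i _; rewrite divr_ge0 // exprn_ge0 //.
by rewrite ltW // cauchy_gt0.
Qed.

Lemma le_Wt_wt n (b : R) (x : 'rV[R]_n) : 0 <= b -> Wt b x <= wt b x.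
Proof.
move=> b0; apply: ler_prod => i _; have := cauchy_gt0 (b * x ord0 i).
set q := 1 + _ => q0; rewrite divr_ge0 ?exprn_ge0 ?(ltW q0) //=.
rewrite ler_wpM2l // lef_pV2 ?posrE ?exprn_gt0 // expr2 ler_peMl ?(ltW q0) //.
by rewrite lerDl sqr_ge0.
Qed.

Lemma wt_le n (b : R) (x : 'rV[R]_n) : 0 <= b -> wt b x <= b ^+ n.
Proof.
move=> b0; rewrite -[n in leRHS]card_ord -prodr_const; apply: ler_prod => i _.
rewrite divr_ge0 ?(ltW (cauchy_gt0 _)) //= ler_pdivrMr ?cauchy_gt0 //.
by rewrite ler_peMr // lerDl sqr_ge0.
Qed.

(* One factor of the weight absorbs the first moment. *)
Lemma norm_Wt_le n (b : R) (x : 'rV[R]_n) : 0 < b -> b * `|x| * Wt b x <= wt b x.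
Proof.
move=> b0.
have P1 (y : 'rV[R]_n) : 1 <= \prod_i (1 + (b * y ord0 i) ^+ 2).
  by apply: (big_ind (fun y => 1 <= y)) => // [u v|i _]; [exact: mulr_ege1|rewrite lerDl sqr_ge0].
have -> : Wt b x = wt b x / \prod_i (1 + (b * x ord0 i) ^+ 2).
  rewrite /Wt /wt -prodf_div; apply: eq_bigr => i _.
  by rewrite expr2 invfM mulrA.
rewrite mulrA ler_pdivrMr ?(lt_le_trans _ (P1 x)) // mulrC.
apply: ler_wpM2l; first exact: wt_ge0 (ltW b0).
rewrite -[X in X * _]ger0_norm ?(ltW b0) // -normrZ.
apply: row_normP => [|i]; first by rewrite (le_trans _ (P1 x)).
rewrite mxE (bigD1 i) //=.
have Q1 : 1 <= \prod_(j < n | j != i) (1 + (b * x ord0 j) ^+ 2).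
  by apply: (big_ind (fun y => 1 <= y)) => // [u v|j _]; [exact: mulr_ege1|rewrite lerDl sqr_ge0].
apply: le_trans (ler_peMr (ltW (cauchy_gt0 _)) Q1).
set t := b * _; rewrite -(real_normK (num_real t)).
have := sqr_ge0 (`|t| - 2^-1); rewrite sqrrB; nra.
Qed.

Lemma measurable_wt1 (b : R) : measurable_fun setT (fun t : R => b / (1 + (b * t) ^+ 2)).
Proof.
apply: continuous_measurable_fun => x; apply: cvgM; first exact: cvg_cst.
apply: cvgV; first by rewrite gt_eqF // cauchy_gt0.
apply: cvgD; first exact: cvg_cst.
apply: (@continuous_comp _ _ _ (fun t => b * t) (fun t => t ^+ 2)).
  by apply: cvgM; [exact: cvg_cst|exact: cvg_id].
exact: exprn_continuous.
Qed.

Lemma integral_wt1 (b c : R) : 0 < b ->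
  (\int[lebesgue]_t (b / (1 + (b * (t - c)) ^+ 2))%:E = (pi : R)%:E)%E.
Proof.
move=> b0; rewrite -integral_cauchy.
have mq : measurable_fun setT (fun x : R => ((1 + x ^+ 2)^-1)%:E).
  apply/measurable_EFinP; have := measurable_wt1 1.
  by under eq_fun do rewrite !mul1r.
have q0 (x : R) : (0 <= ((1 + x ^+ 2)^-1)%:E)%E.
  by rewrite lee_fin invr_ge0 ltW // cauchy_gt0.
have mh : measurable_fun setT (fun t : R => b * t + - (b * c)).
  by apply: measurable_funD => //; apply: measurable_funM.
have E (t : R) : b * (t - c) = b * t + - (b * c) by rewrite mulrBr.
transitivity (\int[lebesgue]_t (b%:E * ((1 + (b * t + - (b * c))%R ^+ 2)^-1)%:E))%E.
  by apply: eq_integral => t _; rewrite E EFinM.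
rewrite ge0_integralZl //; last 2 first.
- exact: (measurableT_comp mq mh).
- by rewrite lee_fin ltW.
rewrite (@ge0_integral_affine1 R b (- (b * c)) (fun t => ((1 + t ^+ 2)^-1)%:E)) ?gt_eqF //.
by rewrite muleA gtr0_norm // -EFinM mulfV ?gt_eqF // mul1e.
Qed.

Lemma measurable_wt n (b : R) : measurable_fun setT (@wt n b).
Proof.
apply: (@measurable_prod_coord _ _ _ (fun=> fun t => b / (1 + (b * t) ^+ 2)) idfun) => [|i].
  exact: measurable_id.
exact: measurable_wt1.
Qed.

Lemma measurable_Wt n (b : R) : measurable_fun setT (@Wt n b).
Proof.
apply: (@measurable_prod_coord _ _ _ (fun=> fun t => b / (1 + (b * t) ^+ 2) ^+ 2) idfun) => [|i].
  exact: measurable_id.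
apply: continuous_measurable_fun => x; apply: cvgM; first exact: cvg_cst.
apply: cvgV; first by rewrite expf_neq0 // gt_eqF // cauchy_gt0.
apply: (@continuous_comp _ _ _ (fun t => 1 + (b * t) ^+ 2) (fun t => t ^+ 2)).
  apply: cvgD; first exact: cvg_cst.
  apply: (@continuous_comp _ _ _ (fun t => b * t) (fun t => t ^+ 2)).
    by apply: cvgM; [exact: cvg_cst|exact: cvg_id].
  exact: exprn_continuous.
exact: exprn_continuous.
Qed.

Lemma integral_wt n (b : R) (z : 'rV[R]_n) : 0 < b ->
  (\int[leb R n]_x (wt b (x - z))%:E = (pi ^+ n)%:E)%E.
Proof.
move=> b0; rewrite -[n in RHS]card_ord -prodr_const.
rewrite -(@integral_prod_coord n (fun i t => b / (1 + (b * (t - z ord0 i)) ^+ 2))).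
- by apply: eq_integral => x _; congr EFin; apply: eq_bigr => i _; rewrite !mxE.
- move=> i; apply: (measurableT_comp (measurable_wt1 b)).
  exact: measurable_funB.
- by move=> i t; rewrite divr_ge0 ?(ltW b0) // ltW // cauchy_gt0.
- by move=> i; exact: integral_wt1.
Qed.

Lemma L1le_wt n (b : R) (z : 'rV[R]_n) : 0 < b ->
  L1le (leb R n) (fun x => wt b (x - z)) (pi ^+ n).
Proof.
move=> b0; split.
  by apply: (measurableT_comp (measurable_wt b)); exact: measurable_rowB.
under eq_integral do rewrite ger0_norm ?wt_ge0 ?(ltW b0) //.
by rewrite integral_wt.
Qed.

(* Indicator of the points at height at most [r] from the graph of [g]. *)
Definition strip n (g : 'rV[R]_n -> R) (r : R) (x : 'rV[R]_n.+1) : R :=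
  (`|x ord0 ord_max - g (col' ord_max x)| <= r)%R%:R.

Lemma measurable_col' n : measurable_fun setT (fun x : 'rV[R]_n.+1 => col' ord_max x).
Proof.
by apply: measurable_rowP => i; under eq_fun do rewrite mxE; exact: measurable_coord.
Qed.

Lemma measurable_leR d (T : measurableType d) (f : T -> R) (r : R) :
  measurable_fun setT f -> measurable_fun setT (fun x => (f x <= r)%R%:R : R).
Proof.
move=> mf; have mA : measurable (f @^-1` `]-oo, r]%classic).
  by rewrite -[X in measurable X]setTI; apply: mf => //; exact: measurable_itv.
have := @measurable_indic _ T R setT _ mA; congr measurable_fun.
apply/funext => x; rewrite indicE; congr (nat_of_bool _)%:R.
by apply/idP/idP => [/set_mem|H]; [|apply/mem_set]; rewrite /= in_itv.
Qed.

Lemma measurable_strip n (g : 'rV[R]_n -> R) r :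
  measurable_fun setT g -> measurable_fun setT (strip g r).
Proof.
move=> mg; apply: measurable_leR; apply: measurableT_comp => //.
apply: measurable_funB; first exact: measurable_coord.
by apply: (measurableT_comp mg); exact: measurable_col'.
Qed.

(** Each vertical line meets the strip in a segment of length 2r, on which the last factor of the
    weight is at most b; the remaining factors integrate to pi^n. *)
Lemma L1le_strip n (g : 'rV[R]_n -> R) (r b : R) (z : 'rV[R]_n.+1) :
  measurable_fun setT g -> 0 <= r -> 0 < b ->
  L1le (leb R n.+1) (fun x => strip g r x * wt b (x - z)) (pi ^+ n * (b * (r *+ 2))).
Proof.
move=> mg r0 b0.
have mw : measurable_fun setT (fun x : 'rV[R]_n.+1 => wt b (x - z)).
  by apply: (measurableT_comp (measurable_wt b)); exact: measurable_rowB.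
have ms := measurable_strip r mg.
have s0 (x : 'rV[R]_n.+1) : 0 <= strip g r x by exact: ler0n.
split; first exact: measurable_funM.
have sw0 x : (0 <= `|strip g r x * wt b (x - z)|%:E)%E by rewrite lee_fin.
have mf : measurable_fun setT (fun x => `|strip g r x * wt b (x - z)|%:E).
  by apply: measurable_abse; exact: measurable_funM.
rewrite ge0_integral_lebS; [|exact: mf|exact: sw0].
pose z' := col' ord_max z.
apply: (@le_trans _ _ (\int[leb R n]_t ((b * (r *+ 2))%:E * (wt b (t - z'))%:E))%E).
  apply: ge0_le_integral => //.
  - by move=> t _; exact: integral_ge0.
  - apply: (measurable_fun_fubini_tonelli_F (m2 := lebesgue)
      ((fun x => `|strip g r x * wt b (x - z)|%:E) \o @snoc_row R n)) => [|u].
      by apply: measurableT_comp => //; exact: measurable_snoc_row.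
    exact: sw0.
  - under eq_fun do rewrite -EFinM.
    apply/measurable_EFinP; apply: measurable_funM => //.
    by apply: (measurableT_comp (measurable_wt b)); exact: measurable_rowB.
  move=> t _.
  have wE x : wt b (snoc_row (t, x) - z) <= wt b (t - z') * b.
    rewrite /wt big_ord_recr /=; apply: ler_pM.
    - by apply: prodr_ge0 => i _; rewrite divr_ge0 ?(ltW b0) // ltW // cauchy_gt0.
    - by rewrite divr_ge0 ?(ltW b0) // ltW // cauchy_gt0.
    - rewrite le_eqVlt; apply/orP; left; apply/eqP; apply: eq_bigr => i _.
      have -> : widen_ord (leqnSn n) i = lift ord_max i.
        by apply/val_inj; rewrite /= /bump leqNgt ltn_ord.
      by rewrite !mxE liftK.
    - rewrite ler_pdivrMr ?cauchy_gt0 // ler_peMr ?(ltW b0) //.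
      by rewrite lerDl sqr_ge0.
  apply: (@le_trans _ _ (\int[lebesgue]_x ((wt b (t - z') * b)%:E *
     (\1_(`[g t - r, g t + r]%classic) x)%:E))%E).
    apply: ge0_le_integral => //.
    - exact: (measurableT_comp mf (measurable_snoc_row_r t)).
    - under eq_fun do rewrite -EFinM.
      apply/measurable_EFinP; apply: measurable_funM => //.
    - move=> x _; rewrite -EFinM lee_fin normrM (ger0_norm (s0 _)).
      rewrite ger0_norm ?wt_ge0 ?(ltW b0) // mulrC.
      rewrite ler_pM ?wt_ge0 ?(ltW b0) //.
      rewrite /strip snoc_row_max col'_snoc_row indicE; case: (boolP (_ <= r)) => //= H.
      by rewrite mem_set //= in_itv /= -ler_distlC distrC.
  rewrite ge0_integralZl //; last 2 first.
  - apply/measurable_EFinP.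
    exact: (@measurable_indic _ (measurableTypeR R) R setT _ (measurable_itv `[g t - r, g t + r])).
  - by rewrite lee_fin mulr_ge0 ?wt_ge0 ?(ltW b0).
  rewrite integral_indic // setIT [X in (_ * X)%E](_ : _ = lebesgue_measure (`[g t - r, g t + r]%classic : set R)) // lebesgue_measure_itv /= lte_fin.
  case: ifP => _; last first.
    by rewrite mule0 -EFinM lee_fin mulr_ge0 ?wt_ge0 ?mulr_ge0 ?mulrn_wge0 ?(ltW b0).
  rewrite -EFinD -!EFinM lee_fin (_ : g t + r - (g t - r) = r *+ 2); last by ring.
  by rewrite -mulrA mulrC.
rewrite ge0_integralZl //; last 3 first.
- apply/measurable_EFinP.
  by apply: (measurableT_comp (measurable_wt b)); exact: measurable_rowB.
- by move=> x _; rewrite lee_fin wt_ge0 ?(ltW b0).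
- by rewrite lee_fin mulr_ge0 ?mulrn_wge0 ?(ltW b0).
by rewrite integral_wt // -EFinM mulrC.
Qed.

End Weights.

Section Affine.
Context {R : realType} (n : nat).
Implicit Types (f : 'rV[R]_n -> R) (z : 'rV[R]_n).
Local Notation mu := (leb R n).
Local Notation I f := (Rintegral mu setT f).

Lemma measurable_affine (c : R) z :
  measurable_fun setT (fun x : 'rV[R]_n => c *: x + z).
Proof. by apply: measurable_rowD => //; apply: measurable_rowZ. Qed.

Lemma L1le_affine (c : R) z f A : c != 0 -> L1le mu f A ->
  L1le mu (fun x => f (c *: x + z)) (`|c| ^- n * A).
Proof.
move=> c0 [mf fA]; split; first exact: measurableT_comp mf (measurable_affine c z).
rewrite (@ge0_integral_affine R n c z (fun x => `|f x|%:E)) //; last exact: measurable_abse.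
by rewrite EFinM lee_wpmul2l // lee_fin invr_ge0 exprn_ge0.
Qed.

Lemma intg_affine (c : R) z f : c != 0 -> intg mu f ->
  intg mu (fun x => f (c *: x + z)).
Proof. by move=> c0 /intg_L1le /(L1le_affine z c0); exact: L1le_intg. Qed.

Lemma integral_affine (c : R) z f : c != 0 -> measurable_fun setT f ->
  (\int[mu]_x (f (c *: x + z))%:E =
   (`|c| ^- n)%:E * \int[mu]_x ((EFin \o f)^\+ x) -
   (`|c| ^- n)%:E * \int[mu]_x ((EFin \o f)^\- x))%E.
Proof.
move=> c0 mf; have mF : measurable_fun setT (EFin \o f) by exact/measurable_EFinP.
rewrite integralE.
rewrite -(@ge0_integral_affine R n c z (EFin \o f)^\+%E) //; last exact: measurable_funepos.
rewrite -(@ge0_integral_affine R n c z (EFin \o f)^\-%E) //; last exact: measurable_funeneg.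
by congr (_ - _)%E; apply: eq_integral => x _; rewrite ?funeposE ?funenegE.
Qed.

Lemma Rint_affine (c : R) z f : c != 0 -> intg mu f ->
  I (fun x => f (c *: x + z)) = `|c| ^- n * I f.
Proof.
move=> c0 If; apply: EFin_inj; rewrite EFinM EFin_Rint; last exact: intg_affine.
rewrite integral_affine //; last exact: intg_meas If.
have Ip := integrable_funepos measurableT If.
have In := integrable_funeneg measurableT If.
rewrite EFin_Rint // (integralE _ _ (fun x => (f x)%:E)).
rewrite -(fineK (integrable_fin_num measurableT Ip)) -(fineK (integrable_fin_num measurableT In)).
exact: (congr1 EFin (esym (mulrBr _ _ _))).
Qed.

Lemma Rint_reflect z f : measurable_fun setT f -> I (fun x => f (z - x)) = I f.
Proof.
move=> mf; rewrite /Rintegral; congr fine.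
have -> : (\int[mu]_x (f (z - x))%:E = \int[mu]_x (f (-1 *: x + z))%:E)%E.
  by apply: eq_integral => x _; rewrite scaleN1r addrC.
by rewrite integral_affine // normrN1 expr1n invr1 !mul1e -integralE.
Qed.

Lemma Rint_shift z f : measurable_fun setT f -> I (fun x => f (x + z)) = I f.
Proof.
move=> mf; rewrite /Rintegral; congr fine.
have -> : (\int[mu]_x (f (x + z))%:E = \int[mu]_x (f (1 *: x + z))%:E)%E.
  by apply: eq_integral => x _; rewrite scale1r.
by rewrite integral_affine // normr1 expr1n invr1 !mul1e -integralE.
Qed.

Lemma L1le_shift z f A : L1le mu f A -> L1le mu (fun x => f (x + z)) A.
Proof.
move=> /(@L1le_affine 1 z); rewrite normr1 expr1n invr1 mul1r => /(_ (oner_neq0 _)).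
by apply: L1le_eq => x; rewrite scale1r.
Qed.

Lemma L1le_shiftN z f A : L1le mu f A -> L1le mu (fun x => f (x - z)) A.
Proof. exact: L1le_shift. Qed.

Lemma L1le_reflect z f A : L1le mu f A -> L1le mu (fun x => f (z - x)) A.
Proof.
move=> /(@L1le_affine (-1) z); rewrite normrN1 expr1n invr1 mul1r oppr_eq0.
move=> /(_ (oner_neq0 _)); apply: L1le_eq => x; by rewrite scaleN1r addrC.
Qed.

Lemma kermeas_sub f : measurable_fun setT f -> kermeas (fun x y : 'rV[R]_n => f (x - y)).
Proof.
move=> mf; apply: (measurableT_comp mf).
by apply: measurable_rowB; [exact: measurable_fst|exact: measurable_snd].
Qed.

End Affine.

Section KermeasGen.
Context d1 d2 (T1 : measurableType d1) (T2 : measurableType d2) {R : realType}.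
Implicit Types (K : T1 -> T2 -> R).

Lemma kermeasM K K' : kermeas K -> kermeas K' -> kermeas (fun x y => K x y * K' x y).
Proof. by move=> mK mK'; exact: measurable_funM. Qed.

Lemma kermeasB K K' : kermeas K -> kermeas K' -> kermeas (fun x y => K x y - K' x y).
Proof. by move=> mK mK'; exact: measurable_funB. Qed.

Lemma kermeas_fst (f : T1 -> R) : measurable_fun setT f -> kermeas (fun x (_ : T2) => f x).
Proof. by move=> mf; apply: (measurableT_comp mf); exact: measurable_fst. Qed.

Lemma kermeas_snd (f : T2 -> R) : measurable_fun setT f -> kermeas (fun (_ : T1) y => f y).
Proof. by move=> mf; apply: (measurableT_comp mf); exact: measurable_snd. Qed.

Lemma kermeas_swap K : kermeas K -> kermeas (fun y x => K x y).
Proof.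
move=> mK; apply: (measurableT_comp mK (g := fun p : T2 * T1 => (p.2, p.1))).
by apply/measurable_fun_pairP; split; [exact: measurable_snd|exact: measurable_fst].
Qed.

End KermeasGen.

(** * Convolution with functions of bounded variation *)

Section BV.
Context {R : realType} (n : nat).
Implicit Types (A F G : 'rV[R]_n -> R) (a b M C : R).
Local Notation mu := (leb R n).
Local Notation I f := (Rintegral mu setT f).

Definition cv A F (x : 'rV[R]_n) : R := I (fun y => A (x - y) * F y).

(** For the dilations of a Schwartz function the constant [C] does not depend on the scale, see
    [ker_dil]. *)
Definition ker a C A := measurable_fun setT A /\ forall x, `|A x| <= C * Wt a x.

(* Functions at scale 1/b: the class is invariant under [dil], and it contains the
   products of a multiplier with a bump at scale 1/b, see [BV_multiplier]. *)
Definition BV b M F :=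
  [/\ measurable_fun setT F, forall x, `|F x| <= M * b ^+ n, L1le mu F M &
      forall v, L1le mu (fun x => F (x + v) - F x) (M * (b * `|v|))].

Lemma ker_ge0 a C A : 0 < a -> ker a C A -> 0 <= C.
Proof.
move=> a0 [_ /(_ 0)]; have [//|C0] := leP 0 C.
rewrite leNgt (lt_le_trans _ (normr_ge0 _)) // pmulr_llt0 //.
apply: prodr_gt0 => i _; rewrite divr_gt0 // exprn_gt0 //; exact: cauchy_gt0.
Qed.

Lemma L1le_Wt a z C : 0 < a -> 0 <= C ->
  L1le mu (fun x => C * Wt a (x - z)) (C * pi ^+ n).
Proof.
move=> a0 C0; have := L1leZ C (L1le_wt z a0); rewrite (ger0_norm C0).
apply: le_L1le.
  by apply: measurable_funM => //; apply: (measurableT_comp (measurable_Wt a));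
    exact: measurable_rowB.
move=> x; rewrite ger0_norm ?mulr_ge0 ?Wt_ge0 ?(ltW a0) //.
by rewrite ler_wpM2l // le_Wt_wt ?(ltW a0).
Qed.

Lemma ker_L1 a C A : 0 < a -> ker a C A -> L1le mu A (C * pi ^+ n).
Proof.
move=> a0 kA; have C0 := ker_ge0 a0 kA; case: kA => mA AC.
apply: (le_L1le mA _ (L1le_Wt 0 a0 C0)) => x; by rewrite subr0.
Qed.

Lemma ker_sup a C A x : 0 < a -> ker a C A -> `|A x| <= C * a ^+ n.
Proof.
move=> a0 kA; have C0 := ker_ge0 a0 kA; case: kA => mA AC.
rewrite (le_trans (AC x)) // ler_wpM2l //.
by rewrite (le_trans (le_Wt_wt _ (ltW a0))) // wt_le ?(ltW a0).
Qed.

Lemma BV_ge0 b M F : BV b M F -> 0 <= M.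
Proof. by case=> _ _ /L1le_ge0. Qed.

Lemma cvE A F x : measurable_fun setT A -> measurable_fun setT F ->
  cv A F x = I (fun y => A y * F (x - y)).
Proof.
move=> mA mF; rewrite /cv -(Rint_reflect x (f := fun y => A (x - y) * F y)).
  by apply: eq_Rint => y; rewrite subKr.
apply: measurable_funM => //.
by apply: (measurableT_comp mA); apply: measurable_rowB.
Qed.

Lemma cvC A F x : measurable_fun setT A -> measurable_fun setT F ->
  cv A F x = cv F A x.
Proof. by move=> mA mF; rewrite cvE //; apply: eq_Rint => y; rewrite mulrC. Qed.

Lemma kermeas_cv A F : measurable_fun setT A -> measurable_fun setT F ->
  kermeas (fun x y : 'rV[R]_n => A (x - y) * F y).
Proof.
by move=> mA mF; apply: kermeasM; [exact: kermeas_sub|exact: kermeas_snd].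
Qed.

Lemma measurable_cv A F : measurable_fun setT A -> measurable_fun setT F ->
  measurable_fun setT (cv A F).
Proof. by move=> mA mF; apply: measurable_Rint; exact: kermeas_cv. Qed.

Lemma L1le_cv A F C M : L1le mu A C -> L1le mu F M -> L1le mu (cv A F) (C * M).
Proof.
move=> LA LF; have [mA _] := LA; have [mF _] := LF.
apply: (@L1le_Rint_ker _ _ _ _ _ _ _ _ (fun y => C * `|F y|)).
- exact: kermeas_cv.
- move=> y; rewrite mulrC; have := L1leZ (F y) (L1le_shiftN y LA).
  by apply: L1le_eq => x; rewrite mulrC.
- have := L1leZ C (L1le_abs LF); rewrite ger0_norm //; exact: L1le_ge0 LA.
Qed.

Lemma intg_cv A F C s x : L1le mu A C -> measurable_fun setT F ->
  (forall y, `|F y| <= s) -> L1le mu (fun y => A (x - y) * F y) (s * C).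
Proof.
move=> LA mF Fs; have s0 : 0 <= s by rewrite (le_trans (normr_ge0 _) (Fs 0)).
have := L1leM s0 mF Fs (L1le_reflect x LA).
by apply: L1le_eq => y; rewrite mulrC.
Qed.

Lemma intg_cvr A F M s x : measurable_fun setT A ->
  (forall y, `|A y| <= s) -> L1le mu F M -> L1le mu (fun y => A (x - y) * F y) (s * M).
Proof.
move=> mA As LF; have s0 : 0 <= s by rewrite (le_trans (normr_ge0 _) (As 0)).
by apply: L1leM => //; apply: (measurableT_comp mA); apply: measurable_rowB.
Qed.

Lemma cv_sup A F C s x : L1le mu A C -> measurable_fun setT F ->
  (forall y, `|F y| <= s) -> `|cv A F x| <= s * C.
Proof. by move=> LA mF Fs; exact/L1le_Rintegral/intg_cv. Qed.

Lemma cv_supr A F M s x : measurable_fun setT A ->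
  (forall y, `|A y| <= s) -> L1le mu F M -> `|cv A F x| <= s * M.
Proof. by move=> mA As LF; exact/L1le_Rintegral/intg_cvr. Qed.

(* The source of the off-diagonal decay of the multiplication by the indicator
   of the domain. *)
Lemma L1le_cv_cancel a b C M A F : 0 < a -> 0 < b -> ker a C A -> I A = 0 ->
  BV b M F -> L1le mu (cv A F) (C * pi ^+ n * M * (b / a)).
Proof.
move=> a0 b0 kA A0 bF; have C0 := ker_ge0 a0 kA; have M0 := BV_ge0 bF.
have [mA AC] := kA; have [mF Fs LF dF] := bF; have LA := ker_L1 a0 kA.
have mFx (x : 'rV[R]_n) : measurable_fun setT (fun y : 'rV[R]_n => F (x - y)).
  by apply: (measurableT_comp mF); apply: measurable_rowB.
(* The vanishing mean of [A] allows [F x] to be subtracted; the L^1 modulus of continuity of [F]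
   then meets the first moment of [A], which [norm_Wt_le] controls. *)
have E x : I (fun y => A y * (F (x - y) - F x)) = cv A F x.
  rewrite cvE //.
  rewrite (@eq_Rint _ _ _ _ _ (fun y => A y * F (x - y) - A y * F x)); last first.
    by move=> y; rewrite mulrBr.
  rewrite RintB.
  - by rewrite RintZr ?A0 ?mul0r ?subr0 //; exact: L1le_intg LA.
  - apply: (@L1le_intg _ _ _ _ _ (M * b ^+ n * (C * pi ^+ n))).
    have := L1leM (mulr_ge0 M0 (exprn_ge0 n (ltW b0)))
      (mFx x) (fun y => Fs _) LA.
    by apply: L1le_eq => y; rewrite mulrC.
  - by apply: intgZr; exact: L1le_intg LA.
apply: (L1le_eq E).
apply: (@L1le_Rint_ker _ _ _ _ _ _ _ _ (fun y => `|A y| * (M * (b * `|y|)))).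
- apply: kermeasM; first exact: kermeas_snd.
  by apply: kermeasB; [exact: kermeas_sub|exact: kermeas_fst].
- by move=> y; apply: L1leZ; rewrite -normrN; exact: dF.
have := L1leZ (C * M * (b / a)) (L1le_wt 0 a0).
rewrite ger0_norm ?mulr_ge0 ?invr_ge0 ?(ltW a0) ?(ltW b0) // => H.
have -> : C * pi ^+ n * M * (b / a) = C * M * (b / a) * pi ^+ n by ring.
apply: (le_L1le _ _ (H n)).
  apply: measurable_funM; first exact: measurableT_comp.
  apply: measurable_funM => //; apply: measurable_funM => //.
  by apply: continuous_measurable_row; exact: norm_continuous.
move=> y; rewrite subr0 ger0_norm ?mulr_ge0 ?(ltW b0) //.
apply: (@le_trans _ _ (C * Wt a y * (M * (b * `|y|)))).
  by rewrite ler_wpM2r ?mulr_ge0 ?(ltW b0).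
rewrite (_ : _ * _ = C * M * (b / a) * (a * `|y| * Wt a y)); last first.
  by field; rewrite gt_eqF.
by rewrite ler_wpM2l ?norm_Wt_le // ?mulr_ge0 ?invr_ge0 ?(ltW a0) ?(ltW b0).
Qed.

(** The cancellation gains when the kernel oscillates faster than [F] varies, that is b < a;
    otherwise Young's inequality is better. *)
Lemma BV_cv_L1 a b C M A F : 0 < a -> 0 < b -> ker a C A -> I A = 0 ->
  BV b M F -> L1le mu (cv A F) (C * pi ^+ n * M * Num.min 1 (b / a)).
Proof.
move=> a0 b0 kA A0 bF; have [mF Fs LF dF] := bF.
have C0 := ker_ge0 a0 kA; have M0 := BV_ge0 bF.
rewrite /Num.min; case: ifP => _; last exact: L1le_cv_cancel.
by rewrite mulr1; apply: L1le_cv => //; exact: ker_L1 a0 kA.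
Qed.

Lemma BV_cv_sup a b C M A F x : 0 < a -> 0 < b -> ker a C A ->
  BV b M F -> `|cv A F x| <= C * pi ^+ n * M * Num.min a b ^+ n.
Proof.
move=> a0 b0 kA bF; have [mF Fs LF dF] := bF.
have C0 := ker_ge0 a0 kA; have M0 := BV_ge0 bF.
(* Since pi >= 1, the constant of the L^1 bounds also serves in the sup bound, so that both can be
   interpolated. *)
have pi1 : 1 <= (pi : R) ^+ n.
  by rewrite exprn_ege1 // (le_trans _ (pi_ge2 R)) // ler1n.
rewrite /Num.min; case: ifP => _.
  apply: (le_trans (cv_supr x kA.1 (fun y => ker_sup y a0 kA) LF)).
  rewrite mulrAC -!mulrA ler_wpM2l // !mulrA ler_wpM2r ?exprn_ge0 ?(ltW a0) //.
  by rewrite ler_peMl.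
rewrite (le_trans (cv_sup x (ker_L1 a0 kA) mF Fs)) //.
by rewrite [leLHS]mulrC mulrA.
Qed.

Lemma BV_comp_shift b M F v : BV b M F -> BV b M (fun x => F (x + v)).
Proof.
case=> mF Fs LF dF; split.
- by apply: (measurableT_comp mF); apply: measurable_rowD.
- by move=> x.
- exact: L1le_shift.
- by move=> w; have := L1le_shift v (dF w); apply: L1le_eq => x; rewrite addrAC.
Qed.

Lemma BV_cv A C b M F : L1le mu A C -> BV b M F -> BV b (C * M) (cv A F).
Proof.
move=> LA [mF Fs LF dF]; have [mA _] := LA; split.
- exact: measurable_cv.
- by move=> x; rewrite (le_trans (cv_sup x LA mF Fs)) // [leLHS]mulrC mulrA.
- exact: L1le_cv.
- move=> v; rewrite -mulrA; have := L1le_cv LA (dF v); apply: L1le_eq => x.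
  have If z : intg mu (fun y => A y * F (z - y)).
    have := L1le_reflect z (intg_cv z LA mF Fs).
    by move=> /L1le_intg; under eq_fun do rewrite subKr.
  rewrite !(cvE _ mA) //; last first.
    apply: measurable_funB => //.
    by apply: (measurableT_comp mF); apply: measurable_rowD.
  rewrite -RintB //; apply: eq_Rint => y.
  by rewrite mulrBr addrAC.
Qed.

Lemma BVD b M N F G : BV b M F -> BV b N G -> BV b (M + N) (fun x => F x + G x).
Proof.
case=> mF Fs LF dF [mG Gs LG dG]; split.
- exact: measurable_funD.
- by move=> x; rewrite (le_trans (ler_normD _ _)) // mulrDl lerD.
- exact: L1leD.
- move=> v; rewrite mulrDl; have := L1leD (dF v) (dG v); apply: L1le_eq => x.
  by rewrite opprD addrACA.
Qed.

Lemma BVN b M F : BV b M F -> BV b M (fun x => - F x).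
Proof.
case=> mF Fs LF dF; split.
- exact: measurableT_comp.
- by move=> x; rewrite normrN.
- exact: L1leN.
- by move=> v; have := L1leN (dF v); apply: L1le_eq => x; rewrite opprD.
Qed.

Lemma BVW b M N F : 0 <= b -> M <= N -> BV b M F -> BV b N F.
Proof.
move=> b0 MN [mF Fs LF dF]; split => //.
- by move=> x; rewrite (le_trans (Fs x)) // ler_wpM2r // exprn_ge0.
- exact: L1leW LF.
- by move=> v; apply: L1leW (dF v); rewrite ler_wpM2r // mulr_ge0.
Qed.

End BV.

Section Multiplier.
Context {R : realType} (n : nat).
Implicit Types (m G : 'rV[R]_n.+1 -> R) (b S L : R).
Local Notation mu := (leb R n.+1).

(** The increments are restricted to [b * |v| <= 1], where the weight at [y] still controls the
    value at [y + v]; longer increments are handled by the L^1 norm. *)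
Definition bump (z : 'rV[R]_n.+1) b S G :=
  [/\ measurable_fun setT G, forall y, `|G y| <= S * Wt b (y - z) &
      forall y v, b * `|v| <= 1 ->
        `|G (y + v) - G y| <= S * (b * `|v|) * Wt b (y - z)].

(** What is retained of the indicator of a special Lipschitz domain: its increments live in a strip
    along a graph, of height proportional to the increment. The class is stable under m |-> 1 - m
    and contains the constant 1, which makes the bounds for m th contain those for th. *)
Definition multiplier m := exists (g : 'rV[R]_n -> R) (L : R),
  [/\ measurable_fun setT g, 0 <= L, measurable_fun setT m, forall x, `|m x| <= 1 &
      forall x v, `|m (x + v) - m x| <= strip g (L * `|v|) x].

Lemma bump_ge0 z b S G : 0 < b -> bump z b S G -> 0 <= S.
Proof.
move=> b0 [_ /(_ z) + _]; rewrite subrr; have [//|S0] := leP 0 S.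
rewrite leNgt (lt_le_trans _ (normr_ge0 _)) // pmulr_llt0 //.
apply: prodr_gt0 => i _; rewrite divr_gt0 // exprn_gt0 //; exact: cauchy_gt0.
Qed.

Lemma BV_multiplier m : multiplier m -> exists2 C, 0 <= C &
  forall z b S G, 0 < b -> bump z b S G -> BV b (C * S) (fun x => m x * G x).
Proof.
move=> [g [L [mg L0 mm m1 dm]]].
have p0 k : 0 <= (pi : R) ^+ k by rewrite exprn_ge0 // pi_ge0.
(* The 1 serves the sup bound, the second term the L^1 norm and the increments of the bump, the
   third the strip where [m] jumps. *)
exists (1 + 2 * pi ^+ n.+1 + pi ^+ n * (L *+ 2)).
  by rewrite !addr_ge0 ?mulr_ge0 ?mulrn_wge0.
set C := _ + _ => z b S G b0 bG; have S0 := bump_ge0 b0 bG; case: bG => mG Gs dG.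
have wS (x : 'rV[R]_n.+1) : `|G x| <= S * wt b (x - z).
  by rewrite (le_trans (Gs x)) // ler_wpM2l // le_Wt_wt ?(ltW b0).
have mGs x : `|m x * G x| <= S * wt b (x - z).
  by rewrite normrM (le_trans _ (wS x)) // ler_piMl.
have mmG : measurable_fun setT (fun x => m x * G x) by exact: measurable_funM.
have LS := L1leZ S (L1le_wt z b0); rewrite (ger0_norm S0) in LS.
have LmG : L1le mu (fun x => m x * G x) (S * pi ^+ n.+1) by exact: le_L1le LS.
have CS : 2 * pi ^+ n.+1 * S + pi ^+ n * (L *+ 2) * S <= C * S.
  by rewrite -mulrDl ler_wpM2r // /C -addrA lerDr.
have C1 : 1 <= C by rewrite /C -addrA lerDl addr_ge0 // ?mulr_ge0 ?mulrn_wge0.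
have Cp : S * pi ^+ n.+1 <= C * S.
  rewrite (le_trans _ CS) // (le_trans (y := 2 * pi ^+ n.+1 * S)) //; last first.
    by rewrite lerDl !mulr_ge0 // mulrn_wge0.
  by rewrite mulrC ler_wpM2r // ler_peMl // ler1n.
split=> //.
- move=> x; rewrite (le_trans (mGs x)) // ler_pM ?wt_ge0 ?(ltW b0) ?wt_le ?(ltW b0) //.
  by rewrite ler_peMl.
- exact: L1leW LmG.
move=> v; have [bv|bv] := leP (b * `|v|) 1; last first.
  have := L1leB (L1le_shift v LmG) LmG; apply: L1leW.
  rewrite (le_trans (y := C * S * 1)) // ?ler_wpM2l // ?(ltW bv) ?mulr_ge0 ?(le_trans ler01 C1) //.
  rewrite mulr1 (le_trans _ CS) //.
  rewrite (_ : S * pi ^+ n.+1 + _ = 2 * pi ^+ n.+1 * S); last by ring.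
  by rewrite lerDl !mulr_ge0 // mulrn_wge0.
have H1 := L1leZ (S * (b * `|v|)) (L1le_wt z b0).
have H2 := L1leZ S (L1le_strip z mg (mulr_ge0 L0 (normr_ge0 v)) b0).
have := L1leD H1 H2.
rewrite (ger0_norm S0) ger0_norm ?mulr_ge0 ?(ltW b0) // => H.
apply: L1leW (le_L1le _ _ H).
- apply: (@le_trans _ _ ((2 * pi ^+ n.+1 * S + pi ^+ n * (L *+ 2) * S) * (b * `|v|))); last first.
    by rewrite ler_wpM2r // mulr_ge0 // ltW.
  rewrite -subr_ge0.
  have -> : (2 * pi ^+ n.+1 * S + pi ^+ n * (L *+ 2) * S) * (b * `|v|) -
    (S * (b * `|v|) * pi ^+ n.+1 + S * (pi ^+ n * (b * (L * `|v| *+ 2)))) =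
    S * (b * `|v|) * pi ^+ n.+1 by ring.
  by rewrite !mulr_ge0 // ltW.
- by apply: measurable_funB => //; apply: (measurableT_comp mmG); apply: measurable_rowD.
(* Product rule for differences: the first term uses the regularity of the bump, the second lives in
   the strip where [m] may jump. *)
- move=> x; have -> : m (x + v) * G (x + v) - m x * G x =
      m (x + v) * (G (x + v) - G x) + (m (x + v) - m x) * G x by ring.
  rewrite (le_trans (ler_normD _ _)) // lerD // normrM.
    rewrite (le_trans (y := `|G (x + v) - G x|)) // ?ler_piMl // (le_trans (dG x v bv)) //.
    by rewrite ler_wpM2l ?le_Wt_wt ?(ltW b0) // !mulr_ge0 ?(ltW b0).
  by rewrite mulrCA ler_pM.
Qed.

End Multiplier.

(** * L^p bounds and Schur's test *)

Section LpBounds.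
Context d (T : measurableType d) {R : realType}.
Variable mu : {sigma_finite_measure set T -> \bar R}.
Hypothesis mu_gt0 : (0 < mu setT)%E.
Implicit Types (f g k : T -> R) (p : \bar R) (r A B S N : R).

Lemma measurableT_comp_powR f r : measurable_fun setT f ->
  measurable_fun setT (fun x => f x `^ r).
Proof. exact: (@measurableT_comp _ _ _ _ _ _ (@powR R ^~ r)). Qed.

Lemma measurable_powR_abs f r : measurable_fun setT f ->
  measurable_fun setT (fun x => `|f x| `^ r).
Proof. by move=> mf; apply: measurableT_comp_powR; exact: measurableT_comp. Qed.

Lemma le_poweR (x y : \bar R) r : 0 <= r -> (0 <= x)%E -> (x <= y)%E ->
  (x `^ r <= y `^ r)%E.
Proof.
move=> r0 x0 xy; apply: gt0_ler_poweR => //; rewrite in_itv /= leey andbT //.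
exact: le_trans xy.
Qed.

Lemma poweR_le (x : \bar R) r N : 0 < r -> (0 <= x)%E -> 0 <= N ->
  (x `^ r <= (N `^ r)%:E)%E -> (x <= N%:E)%E.
Proof.
move=> r0 x0 N0 H; rewrite -(poweRe1 x0) -[leRHS]poweRe1 ?lee_fin //.
rewrite -(mulfV (negbT (gt_eqF r0))) !poweRrM.
by apply: le_poweR; rewrite ?invr_ge0 ?(ltW r0) ?poweR_ge0.
Qed.

Lemma cvg_powR (u : nat -> R) (a r : R) : 0 < r -> (forall i, 0 <= u i) -> 0 <= a ->
  u i @[i --> \oo] --> a -> u i `^ r @[i --> \oo] --> a `^ r.
Proof.
move=> r0 u0; rewrite le_eqVlt => /predU1P[<-|a0] ua.
  rewrite powR0 ?gt_eqF //; apply/cvgrPdist_lt => e e0.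
  have /cvgrPdist_lt/(_ (e `^ r^-1) (powR_gt0 _ e0)) := ua.
  apply: filterS => i; rewrite !sub0r !normrN !ger0_norm ?powR_ge0 // => H.
  have := @gt0_ltr_powR R r r0 _ _ _ _ H; rewrite !nnegrE u0 powR_ge0 => /(_ isT isT).
  by rewrite -powRrM mulVf ?gt_eqF // powRr1 // ltW.
apply: (@cvg_comp _ _ _ u (fun x => x `^ r) _ (nbhs a)) => //.
have /derivable1_diffP/differentiable_continuous : derivable (fun x : R => x `^ r) a 1.
  by apply: derivable_powR; rewrite in_itv /= a0.
exact.
Qed.

Lemma inhabited_of_measure : exists x : T, True.
Proof.
apply: contrapT => Tn; move: mu_gt0; rewrite (_ : setT = set0) ?measure0 ?ltxx //.
by rewrite -subset0 => x _; apply: Tn; exists x.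
Qed.

(** Jensen's inequality for the measure of density [k], of mass at most [A]: Hoelder's inequality
    with k split as k^(1/r) k^(1/q). *)
Lemma jensen_powR k f r A : 1 <= r -> 0 < A -> measurable_fun setT f ->
  (forall x, 0 <= k x) -> L1le mu k A ->
  ((\int[mu]_x (k x * `|f x|)%:E) `^ r <=
   (A `^ (r - 1))%:E * \int[mu]_x (k x * `|f x| `^ r)%:E)%E.
Proof.
move=> r1 A0 mf k0 [mk kA]; have r0 : 0 < r by exact: lt_le_trans r1.
have mkf : measurable_fun setT (fun x => (k x * `|f x| `^ r)%:E).
  by apply/measurable_EFinP; apply: measurable_funM => //; exact: measurable_powR_abs.
have J0 : (0 <= \int[mu]_x (k x * `|f x| `^ r)%:E)%E.
  by apply: integral_ge0 => x _; rewrite lee_fin mulr_ge0 // powR_ge0.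
have [->|rN1] := eqVneq r 1.
  rewrite subrr powRr0 mul1e poweRe1; last first.
    by apply: integral_ge0 => x _; rewrite lee_fin mulr_ge0.
  by under [leRHS]eq_integral do rewrite powRr1 //.
have r1' : 1 < r by rewrite lt_neqAle eq_sym rN1.
pose q := r / (r - 1).
have q0 : 0 < q by rewrite divr_gt0 // subr_gt0.
have rq : r^-1 + q^-1 = 1 by rewrite /q invf_div; field; rewrite gt_eqF.
pose u x := k x `^ r^-1 * `|f x|.
pose v x := k x `^ q^-1.
have mu_ : measurable_fun setT u.
  by apply: measurable_funM; [exact: measurableT_comp_powR|exact: measurableT_comp].
have mv : measurable_fun setT v by exact: measurableT_comp_powR.
have := hoelder mu mu_ mv r0 q0 rq; rewrite Lnorm1 => H.
have E x : `|((u \* v) x)%:E|%E = (k x * `|f x|)%:E.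
  rewrite /= /u /v ger0_norm ?mulr_ge0 ?powR_ge0 //; congr EFin.
  rewrite mulrAC -powRD; first by rewrite rq powRr1.
  by rewrite rq oner_eq0.
rewrite (eq_integral _ _ (fun x _ => E x)) in H.
have I0 : (0 <= \int[mu]_x (k x * `|f x|)%:E)%E.
  by apply: integral_ge0 => x _; rewrite lee_fin mulr_ge0.
have {}H := le_poweR (ltW r0) I0 H.
apply: le_trans H _; rewrite poweRM ?Lnorm_ge0 // muleC; apply: lee_pmul.
- exact: poweR_ge0.
- exact: poweR_ge0.
- have -> : r = q * (r - 1) by rewrite /q divfK // subr_eq0.
  rewrite poweRrM powR_Lnorm ?gt_eqF // (_ : q * (r - 1) - 1 = r - 1); last first.
    by rewrite /q divfK // subr_eq0.
  rewrite -poweR_EFin; apply: le_poweR.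
  + by rewrite subr_ge0.
  + by apply: integral_ge0 => x _; exact: poweR_ge0.
  + apply: le_trans kA; rewrite le_eqVlt; apply/orP; left; apply/eqP.
    apply: eq_integral => x _; rewrite /= /v !ger0_norm ?powR_ge0 // -powRrM.
    by rewrite mulVf ?gt_eqF // powRr1.
- rewrite powR_Lnorm ?gt_eqF // le_eqVlt; apply/orP; left; apply/eqP.
  apply: eq_integral => x _; rewrite /= /u ger0_norm ?mulr_ge0 ?powR_ge0 //.
  by rewrite powRM ?powR_ge0 // -powRrM mulVf ?gt_eqF // powRr1.
Qed.

Definition LpB p f N := measurable_fun setT f /\ (Lnorm mu p (EFin \o f) <= N%:E)%E.

(** With the value 0 at p = +oo, the exponents of all the estimates read the same for finite and
    infinite p. *)
Definition alp p : R := fine (p^-1)%E.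

Lemma LpB_ge0 p f N : LpB p f N -> 0 <= N.
Proof. by move=> [_ H]; rewrite -lee_fin (le_trans _ H) // Lnorm_ge0. Qed.

Lemma alp_fin r : r != 0 -> alp r%:E = r^-1.
Proof. by move=> r0; rewrite /alp inver (negbTE r0). Qed.

Lemma alp_oo : alp +oo%E = 0.
Proof. by rewrite /alp invey. Qed.

Lemma LpB_ooP f N : measurable_fun setT f ->
  LpB +oo%E f N <-> \forall x \ae mu, `|f x| <= N.
Proof.
move=> mf; rewrite /LpB unlock /Lnorm mu_gt0; split=> [[_ /ess_supP]|H].
  by apply: filterS => x /=; rewrite lee_fin.
by split=> //; apply/ess_supP; apply: filterS H => x /=; rewrite lee_fin.
Qed.

Lemma LpB_finP f r N : 1 <= r -> measurable_fun setT f -> 0 <= N ->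
  LpB r%:E f N <-> (\int[mu]_x (`|f x| `^ r)%:E <= (N `^ r)%:E)%E.
Proof.
move=> r1 mf N0; have r0 : 0 < r by exact: lt_le_trans r1.
have E : (\int[mu]_x (`|f x| `^ r)%:E = Lnorm mu r%:E (EFin \o f) `^ r)%E.
  by rewrite powR_Lnorm ?gt_eqF.
rewrite E -poweR_EFin; split=> [[_ H]|H].
  by apply: le_poweR; rewrite ?(ltW r0) ?Lnorm_ge0.
by split=> //; apply: (poweR_le r0) => //; exact: Lnorm_ge0.
Qed.

Lemma L1le_holder_oo f g N A : LpB +oo%E f N -> L1le mu g A ->
  L1le mu (fun x => f x * g x) (N * A).
Proof.
move=> fN gA; have N0 := LpB_ge0 fN; have mf := fN.1; have mg := gA.1.
split; first exact: measurable_funM.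
have fae := (LpB_ooP N mf).1 fN.
apply: (@le_trans _ _ (\int[mu]_x (N%:E * `|g x|%:E))%E).
  apply: ae_ge0_le_integral => //.
  - by apply: measurable_abse; exact: measurable_funM.
  - by move=> x _; rewrite mule_ge0 // lee_fin.
  - by under eq_fun do rewrite -EFinM; apply/measurable_EFinP; apply: measurable_funM => //; exact: measurableT_comp.
  - by apply: filterS fae => x fx _; rewrite -EFinM lee_fin normrM ler_wpM2r.
rewrite ge0_integralZl //; last exact: measurable_abse.
by rewrite EFinM lee_wpmul2l // ?lee_fin //; exact: gA.2.
Qed.

(** The factor S^(1/p) A^(1-1/p) bounds the norm of [g] in the dual exponent by interpolation
    between sup and L^1. It is reached through Jensen's inequality with density |g|, followed by |g|
    <= S. *)
Lemma L1le_holder p f g N S A : (1 <= p)%E -> LpB p f N -> (forall x, `|g x| <= S) ->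
  0 < A -> L1le mu g A ->
  L1le mu (fun x => f x * g x) (N * S `^ alp p * A `^ (1 - alp p)).
Proof.
move=> p1 fN gS A0 gA; have N0 := LpB_ge0 fN; have mf := fN.1; have mg := gA.1.
have S0 : 0 <= S by have [x _] := inhabited_of_measure; exact: le_trans (gS x).
case: p p1 fN => [r| |] // p1 fN; last first.
  rewrite alp_oo powRr0 mulr1 subr0 powRr1 ?(ltW A0) //.
  exact: L1le_holder_oo.
split; first exact: measurable_funM.
rewrite lee_fin in p1; have r0 : 0 < r by exact: lt_le_trans p1.
rewrite alp_fin ?gt_eqF //.
have fN' := (LpB_finP p1 mf N0).1 fN.
have gp x : 0 <= `|g x| by [].
have H := jensen_powR p1 A0 mf gp (L1le_abs gA).
have J : (\int[mu]_x (`|g x| * `|f x| `^ r)%:E <= (S * N `^ r)%:E)%E.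
  apply: (@le_trans _ _ (\int[mu]_x (S%:E * (`|f x| `^ r)%:E))%E).
    apply: ge0_le_integral => //.
    - by apply/measurable_EFinP; apply: measurable_funM; [exact: measurableT_comp|exact: measurable_powR_abs].
    - by under eq_fun do rewrite -EFinM; apply/measurable_EFinP; apply: measurable_funM => //; exact: measurable_powR_abs.
    - by move=> x _; rewrite -EFinM lee_fin ler_wpM2r // powR_ge0.
  rewrite ge0_integralZl //.
  - by rewrite EFinM lee_wpmul2l // lee_fin.
  - by apply/measurable_EFinP; exact: measurable_powR_abs.
have {}H : ((\int[mu]_x (`|g x| * `|f x|)%:E) `^ r <=
    ((N * S `^ r^-1 * A `^ (1 - r^-1)) `^ r)%:E)%E.
  apply: le_trans H _; rewrite !powRM ?mulr_ge0 ?powR_ge0 // -!powRrM mulVf ?gt_eqF // powRr1 //.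
  rewrite mulrBl mul1r mulVf ?gt_eqF // mulrC EFinM lee_wpmul2l ?lee_fin ?powR_ge0 //.
  by rewrite [X in (_ <= X%:E)%E]mulrC.
under eq_integral do rewrite normrM mulrC.
have I0 : (0 <= \int[mu]_x (`|g x| * `|f x|)%:E)%E.
  by apply: integral_ge0 => x _; rewrite lee_fin mulr_ge0.
have B0 : 0 <= N * S `^ r^-1 * A `^ (1 - r^-1) by rewrite !mulr_ge0 // powR_ge0.
exact: (poweR_le r0).
Qed.

Lemma LpB0 p : (1 <= p)%E -> LpB p (fun=> 0) 0.
Proof.
move=> p1; split; first exact: measurable_cst.
rewrite (_ : _ \o _ = cst 0%E) // Lnorm0 //.
by case: p p1 => [r| |] //; rewrite lee_fin eqe => /(lt_le_trans ltr01) /gt_eqF ->.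
Qed.

Lemma LpBW p f N N' : N <= N' -> LpB p f N -> LpB p f N'.
Proof. by move=> NN' [mf fN]; split=> //; rewrite (le_trans fN) // lee_fin. Qed.

Lemma LpBD p f g N N' : (1 <= p)%E -> LpB p f N -> LpB p g N' ->
  LpB p (fun x => f x + g x) (N + N').
Proof.
move=> p1 [mf fN] [mg gN]; split; first exact: measurable_funD.
apply: le_trans (eminkowski mu mf mg p1) _.
by rewrite EFinD leeD.
Qed.

Lemma LpBN p f N : LpB p f N -> LpB p (fun x => - f x) N.
Proof.
move=> [mf fN]; split; first exact: measurableT_comp.
by rewrite -oppe_Lnorm in fN.
Qed.

Lemma LpBB p f g N N' : (1 <= p)%E -> LpB p f N -> LpB p g N' ->
  LpB p (fun x => f x - g x) (N + N').
Proof. by move=> p1 fN /LpBN; exact: LpBD. Qed.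

Lemma LpB_sum p (I : Type) (s : seq I) (F : I -> T -> R) (N : I -> R) :
  (1 <= p)%E -> (forall i, LpB p (F i) (N i)) ->
  LpB p (fun x => \sum_(i <- s) F i x) (\sum_(i <- s) N i).
Proof.
move=> p1 H; elim: s => [|i s IH].
  by rewrite big_nil; under eq_fun do rewrite big_nil; exact: LpB0.
by rewrite big_cons; under eq_fun do rewrite big_cons; exact: LpBD.
Qed.

Lemma le_LpB p f g N : (1 <= p)%E -> measurable_fun setT f ->
  (forall x, `|f x| <= `|g x|) -> LpB p g N -> LpB p f N.
Proof.
move=> p1 mf fg gN; have N0 := LpB_ge0 gN; have mg := gN.1.
case: p p1 gN => [r| |] // p1 gN; last first.
  apply/(LpB_ooP _ mf); have := (LpB_ooP _ mg).1 gN.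
  by apply: filterS => x; exact: le_trans.
rewrite lee_fin in p1; have r0 : 0 < r by exact: lt_le_trans p1.
apply/(LpB_finP p1 mf N0); apply: le_trans ((LpB_finP p1 mg N0).1 gN).
apply: ge0_le_integral => //.
- by apply/measurable_EFinP; exact: measurable_powR_abs.
- by apply/measurable_EFinP; exact: measurable_powR_abs.
- by move=> x _; rewrite lee_fin ge0_ler_powR ?(ltW r0) ?nnegrE.
Qed.

(** Fatou's lemma for finite [p]; it carries the bounds on the partial sums of [Q] to the limit. *)
Lemma LpB_lim p (F : nat -> T -> R) f N : (1 <= p)%E ->
  (forall i, LpB p (F i) N) -> (forall x, F i x @[i --> \oo] --> f x) -> LpB p f N.
Proof.
move=> p1 FN Ff; have N0 := LpB_ge0 (FN 0).
have mf : measurable_fun setT f.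
  by apply: (measurable_fun_cvg (h := F)) => [i|x _]; [exact: (FN i).1|exact: Ff].
have aF x : `|F i x| @[i --> \oo] --> `|f x| by exact: cvg_norm (Ff x).
case: p p1 FN => [r| |] // p1 FN; last first.
  apply/(LpB_ooP _ mf).
  have : \forall x \ae mu, forall i, `|F i x| <= N.
    by apply: ae_foralln => i; exact: (LpB_ooP _ (FN i).1).1 (FN i).
  apply: filterS => x Fx.
  rewrite -(cvg_lim _ (aF x)) //; apply: limr_le; first by apply/cvg_ex; exists `|f x|.
  exact: nearW.
rewrite lee_fin in p1; have r0 : 0 < r by exact: lt_le_trans p1.
apply/(LpB_finP p1 mf N0).
have cF x : (`|F i x| `^ r)%:E @[i --> \oo] --> (`|f x| `^ r)%:E.
  by apply: cvg_EFin; [exact: nearW|exact: cvg_powR].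
apply: (@le_trans _ _ (\int[mu]_x limn_einf (fun i => (`|F i x| `^ r)%:E))%E).
  rewrite le_eqVlt; apply/orP; left; apply/eqP; apply: eq_integral => x _.
  by rewrite (cvg_limn_einf_sup (cF x)).1.
apply: le_trans (fatou _ _ _ _) _ => //.
- by move=> i; apply/measurable_EFinP; apply: measurable_powR_abs; exact: (FN i).1.
rewrite limn_einf_lim; apply: lime_le; first exact: is_cvg_einfs.
apply: nearW => i; apply: (@le_trans _ _ (\int[mu]_x (`|F i x| `^ r)%:E)%E).
  by apply: ereal_inf_lbound; exists i => /=.
by apply/(LpB_finP p1 (FN i).1 N0).
Qed.

(** For p = r finite, |g|^r <= S^(r-1) |g|. *)
Lemma LpB_interp p g S A : (1 <= p)%E -> (forall x, `|g x| <= S) -> L1le mu g A ->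
  LpB p g (S `^ (1 - alp p) * A `^ alp p).
Proof.
move=> p1 gS gA; have mg := gA.1; have A0 := L1le_ge0 gA.
have S0 : 0 <= S by have [x _] := inhabited_of_measure; exact: le_trans (gS x).
case: p p1 => [r| |] // p1; last first.
  rewrite alp_oo powRr0 mulr1 subr0 powRr1 //.
  by apply/(LpB_ooP _ mg); apply: nearW.
rewrite lee_fin in p1; have r0 : 0 < r by exact: lt_le_trans p1.
rewrite alp_fin ?gt_eqF //.
apply/LpB_finP => //; first by rewrite mulr_ge0 // powR_ge0.
rewrite powRM ?powR_ge0 // -!powRrM mulVf ?gt_eqF // powRr1 //.
rewrite mulrBl mul1r mulVf ?gt_eqF // EFinM.
apply: (@le_trans _ _ (\int[mu]_x ((S `^ (r - 1))%:E * `|g x|%:E))%E).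
  apply: ge0_le_integral => //.
  - by apply/measurable_EFinP; exact: measurable_powR_abs.
  - by under eq_fun do rewrite -EFinM; apply/measurable_EFinP; apply: measurable_funM => //; exact: measurableT_comp.
  - move=> x _; rewrite -EFinM lee_fin -(mulr_powRB1 (normr_ge0 _) r0) mulrC ler_wpM2r //.
    by rewrite ge0_ler_powR ?subr_ge0 ?nnegrE.
rewrite ge0_integralZl ?lee_fin ?powR_ge0 //; last exact: measurable_abse.
by rewrite lee_wpmul2l ?lee_fin ?powR_ge0 //; exact: gA.2.
Qed.

End LpBounds.

Section Schur.
Context d1 d2 (T1 : measurableType d1) (T2 : measurableType d2) {R : realType}.
Variable m1 : {sigma_finite_measure set T1 -> \bar R}.
Variable m2 : {sigma_finite_measure set T2 -> \bar R}.
Hypothesis m1_gt0 : (0 < m1 setT)%E.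
Hypothesis m2_gt0 : (0 < m2 setT)%E.
Implicit Types (K : T1 -> T2 -> R) (A B N : R).

(** Jensen's inequality for the density |K(x, .)| of mass at most [A], then Tonelli and the column
    bound [B]. *)
Lemma LpB_schur p K f A B N : (1 <= p)%E -> kermeas K -> 0 < A ->
  (forall x, L1le m2 (K x) A) -> (forall z, L1le m1 (K ^~ z) B) ->
  LpB m2 p f N ->
  LpB m1 p (fun x => Rintegral m2 setT (fun z => K x z * f z))
    (N * (A `^ (1 - alp p) * B `^ alp p)).
Proof.
move=> p1 mK A0 KA KB fN; have N0 := LpB_ge0 fN; have mf := fN.1.
have [z0 _] := inhabited_of_measure m2_gt0.
have B0 : 0 <= B := L1le_ge0 (KB z0).
have mKf : kermeas (fun x z => K x z * f z).
  by apply: kermeasM => //; exact: kermeas_snd.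
have mT : measurable_fun setT (fun x => Rintegral m2 setT (fun z => K x z * f z)).
  exact: measurable_Rint mKf.
case: p p1 fN => [r| |] // p1 fN; last first.
  rewrite alp_oo powRr0 mulr1 subr0 powRr1 ?(ltW A0) //.
  apply/(LpB_ooP m1_gt0) => //; apply: nearW => x.
  apply: L1le_Rintegral; apply: L1le_eq (L1le_holder_oo m2_gt0 fN (KA x)) => z.
  by rewrite mulrC.
rewrite lee_fin in p1; have r0 : 0 < r by exact: lt_le_trans p1.
rewrite alp_fin ?gt_eqF //.
apply/(LpB_finP m1 p1 mT); first by rewrite !mulr_ge0 // powR_ge0.
have fN' := (LpB_finP m2 p1 mf N0).1 fN.
pose J x := (\int[m2]_z (`|K x z| * `|f z| `^ r)%:E)%E.
have mKr : kermeas (fun x z => `|K x z| * `|f z| `^ r).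
  apply: kermeasM; first exact: measurableT_comp mK.
  by apply: kermeas_snd; exact: measurable_powR_abs.
have Kr0 x z : 0 <= `|K x z| * `|f z| `^ r by rewrite mulr_ge0 // powR_ge0.
have JE x : J x = (\int[m2]_z `| `|K x z| * `|f z| `^ r |%:E)%E.
  by apply: eq_integral => z _; rewrite (ger0_norm (Kr0 x z)).
have mJ : measurable_fun setT J.
  by have := measurable_int_abs m2 mKr; congr measurable_fun; apply/funext => x; exact/esym/JE.
have J0 x : (0 <= J x)%E by apply: integral_ge0 => z _; rewrite lee_fin.
apply: (@le_trans _ _ (\int[m1]_x ((A `^ (r - 1))%:E * J x))%E).
  apply: ge0_le_integral => //.
  - by apply/measurable_EFinP; exact: measurable_powR_abs.
  - by apply: emeasurable_funM.
  - move=> x _; rewrite -poweR_EFin.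
    have KAx := KA x; have H := jensen_powR p1 A0 mf (fun z => normr_ge0 (K x z)) (L1le_abs KAx).
    apply: le_trans H; apply: le_poweR; rewrite ?(ltW r0) ?lee_fin //.
    apply: le_trans (abs_Rintegral _ (kermeas1 x mKf)) _.
    by rewrite le_eqVlt; apply/orP; left; apply/eqP; apply: eq_integral => z _; rewrite normrM.
rewrite ge0_integralZl ?lee_fin ?powR_ge0 //.
have -> : (N * (A `^ (1 - r^-1) * B `^ r^-1)) `^ r = A `^ (r - 1) * (B * N `^ r).
  rewrite !powRM ?mulr_ge0 ?powR_ge0 // -!powRrM mulVf ?gt_eqF // powRr1 //.
  by rewrite mulrBl mul1r mulVf ?gt_eqF // mulrCA; congr (_ * _); rewrite mulrC.
rewrite EFinM lee_wpmul2l ?lee_fin ?powR_ge0 //.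
under eq_integral do rewrite JE.
rewrite (tonelli_abs m1 m2 mKr) EFinM.
apply: (@le_trans _ _ (\int[m2]_z (B%:E * (`|f z| `^ r)%:E))%E).
  apply: ge0_le_integral => //.
  - by move=> z _; exact: integral_ge0.
  - exact: (measurable_int_abs m1 (kermeas_swap mKr)).
  - by under eq_fun do rewrite -EFinM; apply/measurable_EFinP; apply: measurable_funM => //; exact: measurable_powR_abs.
  - move=> z _; under eq_integral do rewrite (ger0_norm (Kr0 _ _)) EFinM muleC.
    rewrite ge0_integralZl ?lee_fin ?powR_ge0 //; last by apply: measurable_abse; exact: kermeas2.
    by rewrite muleC lee_wpmul2r ?lee_fin ?powR_ge0 //; exact: (KB z).2.
rewrite ge0_integralZl ?lee_fin //.
  by rewrite lee_wpmul2l // lee_fin.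
by apply/measurable_EFinP; exact: measurable_powR_abs.
Qed.

End Schur.

(** * Smooth and Schwartz functions *)

Section Calculus.
Context {R : realType} (n : nat).
Local Notation pt := 'rV[R]_n.
Implicit Types (f g : pt -> R) (x v z : pt) (i : 'I_n) (l : seq 'I_n).

Definition lform (L : 'I_n -> R) (v : pt) : R := \sum_i v ord0 i * L i.

Lemma lform_is_linear (L : 'I_n -> R) : linear (lform L).
Proof.
move=> a u v; rewrite /lform scaler_sumr -big_split /=; apply: eq_bigr => i _.
by rewrite !mxE mulrDl -scalerAl.
Qed.
HB.instance Definition _ (L : 'I_n -> R) :=
  GRing.isLinear.Build R pt R _ (lform L) (lform_is_linear L).

Lemma lform_continuous (L : 'I_n -> R) : continuous (lform L).
Proof.
move=> v; rewrite /lform.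
rewrite (_ : (fun v => _) = \sum_i (fun v : pt => v ord0 i * L i)); last first.
  by apply/funext => w; rewrite fct_sumE.
apply: (big_ind (fun h : pt -> R => {for v, continuous h})) => [|h k ch ck|i _].
- exact: cst_continuous.
- exact: continuousD.
- by apply: continuousM; [exact: coord_continuous|exact: cst_continuous].
Qed.

(** A quadratic remainder survives integration with respect to a parameter, so convolutions and
    Fourier integrals are differentiated by this criterion. *)
Lemma diff_quadratic f x (L : 'I_n -> R) (C : R) :
  (forall v, `|v| <= 1 -> `|f (x + v) - f x - \sum_i v ord0 i * L i| <= C * `|v| ^+ 2) ->
  differentiable f x /\ forall i, pderiv i f x = L i.
Proof.
move=> H.
have key (e : {posnum R}) : \forall v \near (0 : pt),
    `|(f \o shift x - (cst (f x) + lform L)) v| <= e%:num * `|v|.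
  have C1 : 0 < `|C| + 1 by rewrite ltr_wpDl.
  pose d := Num.min 1 (e%:num / (`|C| + 1)).
  have d0 : 0 < d by rewrite lt_min ltr01 divr_gt0.
  have : \forall v \near nbhs (0 : pt), `|v| < d.
    apply/nbhs_ballP; exists d => //= v; rewrite -ball_normE /= sub0r normrN.
    exact.
  apply: filterS => v; rewrite lt_min => /andP[/ltW v1 /ltW v2].
  have -> : (f \o shift x - (cst (f x) + lform L)) v =
      f (x + v) - f x - \sum_i v ord0 i * L i.
    by rewrite !fctE /= opprD addrA [v + x]addrC.
  apply: le_trans (H v v1) _; rewrite /= expr2 mulrA ler_wpM2r //.
  apply: (@le_trans _ _ ((`|C| + 1) * `|v|)).
    by rewrite ler_wpM2r // (le_trans (ler_norm _)) // lerDl.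
  by rewrite mulrC -ler_pdivlMr.
have D : 'd f x = lform L :> (pt -> R).
  apply: diff_unique; first exact: lform_continuous.
  by apply/eqaddoP => _/posnumP[e]; exact: key.
have df : differentiable f x.
  apply/diff_locallyP; rewrite D; split; first exact: lform_continuous.
  by apply/eqaddoP => _/posnumP[e]; exact: key.
split=> // i; rewrite /pderiv deriveE // D /lform (bigD1 i) //= big1 ?addr0.
  by rewrite mxE !eqxx mul1r.
by move=> j ji; rewrite mxE (negbTE ji) andbF mul0r.
Qed.

Lemma derive_coord f x v : differentiable f x ->
  'D_v f x = \sum_i v ord0 i * pderiv i f x.
Proof.
move=> df; rewrite deriveE // {1}(row_sum_delta v) linear_sum; apply: eq_bigr => i _.
by rewrite linearZ /pderiv deriveE.
Qed.

Lemma derive_line f x v (t : R) : differentiable f (x + t *: v) ->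
  is_derive t 1 (fun t => f (x + t *: v)) ('D_v f (x + t *: v)).
Proof.
move=> df; have dv : derivable f (x + t *: v) v := diff_derivable df.
have E : (fun h : R => h^-1 *: (((fun t => f (x + t *: v)) \o shift t) (h *: 1) - f (x + t *: v))) =
  (fun h => h^-1 *: ((f \o shift (x + t *: v)) (h *: v) - f (x + t *: v))).
  apply/funext => h; congr (_ *: (f _ - _)); rewrite /= scalerDl [h *: 1]mulr1.
  by rewrite addrCA.
by split; [rewrite /derivable E|rewrite /derive E].
Qed.

Lemma mean_value f x v : (forall y, differentiable f y) ->
  exists2 t, 0 < t < 1 &
    f (x + v) - f x = \sum_i v ord0 i * pderiv i f (x + t *: v).
Proof.
move=> df; have H t := derive_line (df (x + t *: v)).
have [|t] := @MVT R (fun t => f (x + t *: v)) (fun t => 'D_v f (x + t *: v)) 0 1 ltr01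
  (fun t _ => H t).
  apply: continuous_subspaceT => t.
  by have [+ _] := H t; move=> /derivable1_diffP/differentiable_continuous.
rewrite in_itv /= scale1r scale0r addr0 subr0 mulr1 => t01 E; exists t => //.
by rewrite E derive_coord.
Qed.

Lemma norm_lform_le (L : 'I_n -> R) v (B : R) : (forall i, `|L i| <= B) ->
  `|\sum_i v ord0 i * L i| <= n%:R * B * `|v|.
Proof.
move=> LB; apply: le_trans (ler_norm_sum _ _ _) _.
apply: (@le_trans _ _ (\sum_(i < n) (B * `|v|))).
  by apply: ler_sum => i _; rewrite normrM mulrC ler_pM // normr_coord.
by rewrite sumr_const card_ord -[leLHS]mulr_natl mulrA.
Qed.

Lemma lipschitz_of_pderiv f x v (B : R) : (forall y, differentiable f y) ->
  (forall i t, 0 < t < 1 -> `|pderiv i f (x + t *: v)| <= B) ->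
  `|f (x + v) - f x| <= n%:R * B * `|v|.
Proof.
move=> df fB; have [t t01 ->] := mean_value x v df.
by apply: norm_lform_le => i; exact: fB.
Qed.

Lemma taylor2 f x v (B : R) : 0 <= B -> (forall y, differentiable f y) ->
  (forall i y, differentiable (pderiv i f) y) ->
  (forall i j y, `|pderiv i (pderiv j f) y| <= B) ->
  `|f (x + v) - f x - \sum_i v ord0 i * pderiv i f x| <=
    n%:R * (n%:R * B) * `|v| ^+ 2.
Proof.
move=> B0 df ddf fB; have [t /andP[t0 t1] ->] := mean_value x v df.
rewrite -sumrB; under eq_bigr do rewrite -mulrBr.
rewrite expr2 mulrA; apply: le_trans (norm_lform_le v (B := n%:R * B * `|v|) _) _.
  move=> i; apply: le_trans (lipschitz_of_pderiv (B := B) (ddf i) _) _ => //.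
  rewrite ler_wpM2l ?mulr_ge0 // normrZ gtr0_norm // ler_piMl // ltW //.
by rewrite !mulrA.
Qed.

Lemma smoothR_differentiable f x : smoothR f -> differentiable f x.
Proof. by move=> /(_ [::]). Qed.

Lemma pderivs_rcons l i f : pderivs (rcons l i) f = pderivs l (pderiv i f).
Proof. by rewrite /pderivs foldr_rcons. Qed.

Lemma smoothR_pderiv f i : smoothR f -> smoothR (pderiv i f).
Proof. by move=> sf l x; rewrite -pderivs_rcons; exact: sf. Qed.

(** Smoothness by coinduction: it is enough to enclose the function in a family of differentiable
    functions stable under partial derivatives. *)
Lemma smoothR_class (P : (pt -> R) -> Prop) :
  (forall f, P f -> forall x, differentiable f x) ->
  (forall f i, P f -> P (pderiv i f)) ->
  forall f, P f -> smoothR f /\ forall l, P (pderivs l f).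
Proof.
move=> Pd Pp f Pf; have H l : P (pderivs l f) by elim: l => //= i l; exact: Pp.
by split=> // l x; exact: Pd (H l) x.
Qed.

Lemma smoothR_continuous f : smoothR f -> continuous f.
Proof. by move=> sf x; apply: differentiable_continuous; exact: smoothR_differentiable. Qed.

Lemma smoothR_measurable f : smoothR f -> measurable_fun setT f.
Proof. by move=> /smoothR_continuous; exact: continuous_measurable_row. Qed.

Lemma pderivD f g i : (forall x, differentiable f x) -> (forall x, differentiable g x) ->
  pderiv i (fun x => f x + g x) = fun x => pderiv i f x + pderiv i g x.
Proof.
move=> df dg; apply/funext => x; rewrite /pderiv.
by rewrite -(deriveD (diff_derivable (df x)) (diff_derivable (dg x))).
Qed.

Lemma pderivZ f (c : R) i : (forall x, differentiable f x) ->
  pderiv i (fun x => c * f x) = fun x => c * pderiv i f x.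
Proof.
move=> df; apply/funext => x; rewrite /pderiv.
exact: (deriveZ c (diff_derivable (df x))).
Qed.

Lemma pderivM f g i : (forall x, differentiable f x) -> (forall x, differentiable g x) ->
  pderiv i (fun x => f x * g x) = fun x => f x * pderiv i g x + g x * pderiv i f x.
Proof.
move=> df dg; apply/funext => x; rewrite /pderiv.
by rewrite -[RHS](deriveM (diff_derivable (df x)) (diff_derivable (dg x))).
Qed.

(** Single products are not stable under differentiation; by Leibniz' rule, finite sums of products
    are. *)
Inductive smooth_alg : (pt -> R) -> Prop :=
| Salg_mul f g : smoothR f -> smoothR g -> smooth_alg (fun x => f x * g x)
| Salg_add f g : smooth_alg f -> smooth_alg g -> smooth_alg (fun x => f x + g x).

Lemma smooth_alg_smoothR f : smooth_alg f -> smoothR f.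
Proof.
have dif g : smooth_alg g -> forall x, differentiable g x.
  elim=> {g} [g h sg sh|g h _ dg _ dh] x.
    by apply: differentiableM; exact: smoothR_differentiable.
  exact: differentiableD.
move=> sf; apply: (proj1 (@smoothR_class smooth_alg _ _ f sf)) => // {f sf}.
move=> g i; elim=> {g} [g h sg sh|g h ag Ag ah Ah].
  rewrite pderivM; [|by move=> x; exact: smoothR_differentiable..].
  apply: Salg_add; apply: Salg_mul => //; exact: smoothR_pderiv.
by rewrite pderivD; [exact: Salg_add|exact: dif..].
Qed.

Lemma smoothRM f g : smoothR f -> smoothR g -> smoothR (fun x => f x * g x).
Proof. by move=> sf sg; apply: smooth_alg_smoothR; exact: Salg_mul. Qed.

Lemma pderivs_cst (c : R) i : pderiv i (fun=> c) = (fun=> 0) :> (pt -> R).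
Proof. by apply/funext => x; rewrite /pderiv derive_cst. Qed.

Lemma smoothR_cst (c : R) : smoothR ((fun=> c) : pt -> R).
Proof.
apply: (proj1 (@smoothR_class (fun f => exists c : R, f = fun=> c) _ _ _ _)).
- by move=> f [a ->] x; exact: differentiable_cst.
- by move=> f i [a ->]; exists 0; exact: pderivs_cst.
- by exists c.
Qed.

Lemma smoothRD f g : smoothR f -> smoothR g -> smoothR (fun x => f x + g x).
Proof.
move=> sf sg; have := smooth_alg_smoothR (Salg_add (Salg_mul sf (smoothR_cst 1))
  (Salg_mul sg (smoothR_cst 1))).
by under eq_fun do rewrite !mulr1.
Qed.

Lemma smoothRZ f (c : R) : smoothR f -> smoothR (fun x => c * f x).
Proof. by move=> sf; apply: smoothRM => //; exact: smoothR_cst. Qed.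

Lemma smoothRN f : smoothR f -> smoothR (fun x => - f x).
Proof. by move=> /(smoothRZ (-1)); under eq_fun do rewrite mulN1r. Qed.

Lemma pderivs_add f g l : smoothR f -> smoothR g ->
  pderivs l (fun x => f x + g x) = fun x => pderivs l f x + pderivs l g x.
Proof.
move=> sf sg; elim: l => //= i l ->; by rewrite pderivD.
Qed.

Lemma pderivs_scale f (c : R) l : smoothR f ->
  pderivs l (fun x => c * f x) = fun x => c * pderivs l f x.
Proof. by move=> sf; elim: l => //= i l ->; rewrite pderivZ // => x; exact: (sf l). Qed.

Lemma differentiable_affine f (c : R) z x : differentiable f (c *: x + z) ->
  differentiable (fun y => f (c *: y + z)) x.
Proof.
move=> df; apply: (@differentiable_comp _ _ _ _ (fun y : pt => c *: y + z) f) => //.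
Qed.

Lemma pderiv_affine f (c : R) z i : (forall x, differentiable f x) ->
  pderiv i (fun x => f (c *: x + z)) = fun x => c * pderiv i f (c *: x + z).
Proof.
move=> df; apply/funext => x; rewrite /pderiv.
have -> : 'D_(delta_mx 0 i) (fun x => f (c *: x + z)) x =
    'D_(c *: delta_mx 0 i) f (c *: x + z).
  have E : (fun h : R => h^-1 *: (((fun y => f (c *: y + z)) \o shift x)
        (h *: delta_mx 0 i) - f (c *: x + z))) =
      (fun h => h^-1 *: ((f \o shift (c *: x + z)) (h *: (c *: delta_mx 0 i)) -
        f (c *: x + z))).
    apply/funext => h; congr (_ *: (f _ - _)).
    by rewrite /= scalerDr !scalerA mulrC addrA.
  by rewrite /derive E.
by rewrite !deriveE // linearZ.
Qed.

Lemma smoothR_affine f (c : R) z : smoothR f -> smoothR (fun x => f (c *: x + z)).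
Proof.
move=> sf; apply: (proj1 (@smoothR_class (fun g => exists a h, smoothR h /\
   g = fun x => a * h (c *: x + z)) _ _ _ _)).
- move=> g [a [h [sh ->]]] x; apply: differentiableM => //.
  by apply: differentiable_affine; exact: smoothR_differentiable.
- move=> g i [a [h [sh ->]]]; exists (a * c), (pderiv i h); split; first exact: smoothR_pderiv.
  rewrite pderivZ; last by move=> x; apply: differentiable_affine; exact: smoothR_differentiable.
  rewrite pderiv_affine; last by move=> x; exact: smoothR_differentiable.
  by apply/funext => x; rewrite mulrA.
- by exists 1, f; split => //; apply/funext => x; rewrite mul1r.
Qed.

Lemma pderivs_affine f (c : R) z l : smoothR f ->
  pderivs l (fun x => f (c *: x + z)) =
  fun x => c ^+ size l * pderivs l f (c *: x + z).
Proof.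
move=> sf; elim: l => [|i l IH] /=.
  by apply/funext => x; rewrite expr0 mul1r.
rewrite IH pderivZ.
  rewrite pderiv_affine; last by move=> x; exact: (sf l).
  by apply/funext => x; rewrite exprSr mulrA.
by move=> x; apply: differentiable_affine; exact: (sf l).
Qed.

Lemma dotpDr y x v : dotp y (x + v) = dotp y x + dotp y v :> R.
Proof. by rewrite /dotp -big_split; apply: eq_bigr => i _; rewrite mxE mulrDr. Qed.

Lemma dotpC y x : dotp y x = dotp x y :> R.
Proof. by apply: eq_bigr => i _; rewrite mulrC. Qed.

Lemma dotpZr y x (c : R) : dotp y (c *: x) = c * dotp y x.
Proof. by rewrite /dotp mulr_sumr; apply: eq_bigr => i _; rewrite mxE mulrCA. Qed.

Lemma dotpNr y x : dotp y (- x) = - dotp y x :> R.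
Proof. by rewrite -scaleN1r dotpZr mulN1r. Qed.

Lemma dotpNl y x : dotp (- y) x = - dotp y x :> R.
Proof. by rewrite dotpC dotpNr dotpC. Qed.

Lemma norm_dotp y x : `|dotp y x| <= n%:R * `|y| * `|x|.
Proof.
have := @norm_lform_le (fun i => y ord0 i) x `|y| (normr_coord y).
by rewrite dotpC.
Qed.

Lemma smoothR_coord i : smoothR (fun x : pt => x ord0 i).
Proof.
have D : (forall x, differentiable (fun x : pt => x ord0 i) x) /\
   forall j, pderiv j (fun x : pt => x ord0 i) = fun=> (j == i)%:R.
  have H x : differentiable (fun x : pt => x ord0 i) x /\
      forall j, pderiv j (fun x : pt => x ord0 i) x = (j == i)%:R.
    apply: (@diff_quadratic _ x (fun j => (j == i)%:R) 0) => v _.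
    rewrite mul0r mxE [x ord0 i + _]addrC addrK (bigD1 i) //= eqxx mulr1 big1.
      by rewrite addr0 subrr normr0.
    by move=> j /negbTE ->; rewrite mulr0.
  by split=> [x|j]; [exact: (H x).1|apply/funext => x; exact: (H x).2].
apply: (proj1 (@smoothR_class (fun f => f = (fun x => x ord0 i) \/ exists c : R, f = fun=> c) _ _ _ _)).
- by move=> f [->|[c ->]] x; [exact: D.1|exact: differentiable_cst].
- by move=> f j [->|[c ->]]; right; [exists (j == i)%:R; exact: D.2|exists 0; exact: pderivs_cst].
- by left.
Qed.

End Calculus.

Section Trigonometric.
Context {R : realType} (n : nat).
Local Notation pt := 'rV[R]_n.

Lemma is_derive_line (y c u : R) : is_derive u 1 (fun u : R => y + u * c) c.
Proof.
have -> : (fun u : R => y + u * c) = cst y + c *: id.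
  by apply/funext => t; rewrite /= mulrC.
have d1 : derivable (cst y : R -> R) u 1 by exact: derivable_cst.
have d2 : derivable (c *: (id : R -> R)) u 1 by apply: derivableZ; exact: derivable_id.
split; first exact: derivableD.
rewrite (deriveD d1 d2) derive_cst add0r deriveZ; last exact: derivable_id.
by rewrite derive_id [_ *: _]mulr1.
Qed.

Lemma sin_lipschitz (x y : R) : `|sin x - sin y| <= `|x - y|.
Proof.
have H (u : R) : is_derive u 1 (fun u : R => sin (y + u * (x - y))) (cos (y + u * (x - y)) * (x - y)).
  apply: (@is_derive1_comp _ sin (fun u : R => y + u * (x - y))).
  exact: is_derive_line.
have [|t _] := @MVT R _ _ 0 1 ltr01 (fun u _ => H u).
  apply: continuous_subspaceT => u.
  by have [+ _] := H u; move=> /derivable1_diffP/differentiable_continuous.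
rewrite mul1r mul0r addr0 subrKC subr0 mulr1 => ->.
by rewrite normrM ler_piMl // cos_max.
Qed.

Lemma cos_taylor (a t : R) : `|cos (a + t) - cos a + t * sin a| <= t ^+ 2.
Proof.
have H (u : R) : is_derive u 1 (fun u : R => cos (a + u * t)) (- sin (a + u * t) * t).
  apply: (@is_derive1_comp _ cos (fun u : R => a + u * t)).
  exact: is_derive_line.
have [|u] := @MVT R _ _ 0 1 ltr01 (fun u _ => H u).
  apply: continuous_subspaceT => u.
  by have [+ _] := H u; move=> /derivable1_diffP/differentiable_continuous.
rewrite in_itv /= => /andP[u0 u1].
rewrite mul1r mul0r addr0 subr0 mulr1 => ->.
rewrite (_ : _ + _ = - (t * (sin (a + u * t) - sin a))); last by ring.
rewrite normrN normrM -(real_normK (num_real t)) expr2 ler_wpM2l //.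
apply: le_trans (sin_lipschitz _ _) _; rewrite addrAC subrr add0r normrM.
by rewrite ler_piMl // gtr0_norm // ltW.
Qed.

Lemma sin_taylor (a t : R) : `|sin (a + t) - sin a - t * cos a| <= t ^+ 2.
Proof.
have := cos_taylor (a - pi / 2) t.
have E (x : R) : cos (x - pi / 2) = sin x by rewrite -[in RHS](subrK (pi / 2) x) sinDpihalf.
have F (x : R) : sin (x - pi / 2) = - cos x.
  by rewrite -[in RHS](subrK (pi / 2) x) cosDpihalf opprK.
by rewrite [a - pi / 2 + t]addrAC !E F mulrN.
Qed.

(** The span of the cosine and the sine of y.x is stable under differentiation in x, which the
    cosine alone is not. *)
Definition trigf (y : pt) (a b : R) (x : pt) : R := a * cos (dotp y x) + b * sin (dotp y x).

Lemma trigf_taylor (y : pt) (a b : R) (x v : pt) :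
  `|trigf y a b (x + v) - trigf y a b x -
    \sum_i v ord0 i * trigf y (b * y ord0 i) (- (a * y ord0 i)) x| <=
  (`|a| + `|b|) * (n%:R * `|y|) ^+ 2 * `|v| ^+ 2.
Proof.
rewrite /trigf dotpDr; set s := dotp y x; set t := dotp y v.
have -> : \sum_i v ord0 i * (b * y ord0 i * cos s + - (a * y ord0 i) * sin s) =
    t * (b * cos s - a * sin s).
  by rewrite /t /dotp mulr_suml; apply: eq_bigr => i _; ring.
rewrite (_ : _ - _ = a * (cos (s + t) - cos s + t * sin s) +
  b * (sin (s + t) - sin s - t * cos s)); last by ring.
apply: le_trans (ler_normD _ _) _; rewrite -mulrA mulrDl !normrM -exprMn.
have t2 : t ^+ 2 <= (n%:R * `|y| * `|v|) ^+ 2.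
  by rewrite -(real_normK (num_real t)) ler_pXn2r ?nnegrE ?mulr_ge0 // norm_dotp.
by rewrite lerD // ler_wpM2l // (le_trans _ t2) // ?cos_taylor ?sin_taylor.
Qed.

Lemma trigf_diff (y : pt) (a b : R) :
  (forall x, differentiable (trigf y a b) x) /\
  forall i, pderiv i (trigf y a b) = trigf y (b * y ord0 i) (- (a * y ord0 i)).
Proof.
have H (x : pt) : differentiable (trigf y a b) x /\
    forall i, pderiv i (trigf y a b) x = trigf y (b * y ord0 i) (- (a * y ord0 i)) x.
  apply: diff_quadratic => v _; exact: trigf_taylor.
by split=> [x|i]; [exact: (H x).1|apply/funext => x; exact: (H x).2].
Qed.

Lemma smoothR_trigf (y : pt) (a b : R) : smoothR (trigf y a b).
Proof.
apply: (proj1 (@smoothR_class R n (fun f => exists a b, f = trigf y a b) _ _ _ _)).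
- by move=> f [c [e ->]] x; exact: (trigf_diff y c e).1.
- move=> f i [c [e ->]]; exists (e * y ord0 i), (- (c * y ord0 i)).
  exact: (trigf_diff y c e).2.
- by exists a, b.
Qed.

Lemma measurable_dotp : kermeas (fun x y : pt => dotp x y).
Proof.
rewrite /kermeas /dotp.
rewrite (_ : (fun p => _) = \sum_i (fun p : pt * pt => p.1 ord0 i * p.2 ord0 i)); last first.
  by apply/funext => w; rewrite fct_sumE.
apply: (big_ind (fun h : pt * pt -> R => measurable_fun setT h)) => [|h k ch ck|i _].
- exact: measurable_cst.
- exact: measurable_funD.
- by apply: measurable_funM; apply: measurable_fun_coord;
    [exact: measurable_fst|exact: measurable_snd].
Qed.

Lemma kermeas_cos : kermeas (fun x y : pt => cos (dotp x y)).
Proof.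
apply: (measurableT_comp _ measurable_dotp).
by apply: continuous_measurable_fun; exact: continuous_cos.
Qed.

Lemma kermeas_sin : kermeas (fun x y : pt => sin (dotp x y)).
Proof.
apply: (measurableT_comp _ measurable_dotp).
by apply: continuous_measurable_fun; exact: continuous_sin.
Qed.

End Trigonometric.

(** * Schwartz functions, their convolutions and dilations *)

Section Schwartz.
Context {R : realType} (n : nat).
Local Notation pt := 'rV[R]_n.
Local Notation mu := (leb R n).
Local Notation I f := (Rintegral mu setT f).
Implicit Types (f g A b : pt -> R) (x v z : pt) (i : 'I_n) (l : seq 'I_n).

Definition schR f := smoothR f /\
  forall k l, exists B, forall x, `|x| ^+ k * `|pderivs l f x| <= B.

Definition testR f := smoothR f /\ exists M, forall x, M < `|x| -> f x = 0.

Lemma schR_smooth f : schR f -> smoothR f. Proof. by case. Qed.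

Lemma schR_class (P : (pt -> R) -> Prop) :
  (forall f, P f -> forall x, differentiable f x) ->
  (forall f i, P f -> P (pderiv i f)) ->
  (forall f, P f -> forall k, exists B, forall x, `|x| ^+ k * `|f x| <= B) ->
  forall f, P f -> schR f.
Proof.
move=> Pd Pp Pb f Pf; have [sf H] := smoothR_class Pd Pp Pf.
by split=> // k l; exact: Pb.
Qed.

Lemma schR_pderiv f i : schR f -> schR (pderiv i f).
Proof.
move=> [sf Hf]; split; first exact: smoothR_pderiv.
by move=> k l; rewrite -pderivs_rcons.
Qed.

Lemma schR_pderivs f l : schR f -> schR (pderivs l f).
Proof. by move=> sf; elim: l => //= i l; exact: schR_pderiv. Qed.

Lemma schRD f g : schR f -> schR g -> schR (fun x => f x + g x).
Proof.
move=> [sf Hf] [sg Hg]; split; first exact: smoothRD.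
move=> k l; have [B HB] := Hf k l; have [C HC] := Hg k l; exists (B + C) => x.
rewrite pderivs_add //; apply: le_trans (lerD (HB x) (HC x)).
by rewrite -mulrDr ler_wpM2l ?exprn_ge0 // ler_normD.
Qed.

Lemma schRZ f (c : R) : schR f -> schR (fun x => c * f x).
Proof.
move=> [sf Hf]; split; first exact: smoothRZ.
move=> k l; have [B HB] := Hf k l; exists (`|c| * B) => x.
by rewrite pderivs_scale // normrM mulrCA ler_wpM2l.
Qed.

Lemma schRB f g : schR f -> schR g -> schR (fun x => f x - g x).
Proof.
move=> sf /(schRZ (-1)) sg; have := schRD sf sg.
by under eq_fun do rewrite mulN1r.
Qed.

Lemma schR0 : schR (fun=> 0).
Proof.
split; first exact: smoothR_cst.
move=> k l; exists 0 => x.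
have -> : pderivs l ((fun=> 0) : pt -> R) = (fun=> 0).
    by elim: l => //= i l ->; exact: pderivs_cst.
by rewrite normr0 mulr0.
Qed.

Lemma schR_affine f (c : R) z : c != 0 -> schR f -> schR (fun x => f (c *: x + z)).
Proof.
move=> c0 [sf Hf]; split; first exact: smoothR_affine.
move=> k l; have [B HB] := Hf k l; have [C HC] := Hf 0 l.
exists (`|c ^+ size l| * (2 ^+ k * `|c| ^- k * (B + `|z| ^+ k * C))) => x.
rewrite pderivs_affine // normrM mulrCA ler_wpM2l //.
set y := c *: x + z; have := HB y; have := HC y; set p := `|pderivs l f y|.
rewrite expr0 mul1r => pC pB.
have xy : `|x| ^+ k <= 2 ^+ k * `|c| ^- k * (`|y| ^+ k + `|z| ^+ k).
  have -> : `|x| ^+ k = `|c| ^- k * `|y - z| ^+ k.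
    by rewrite /y addrK normrZ exprMn mulKf // expf_neq0 // normr_eq0.
  rewrite [X in _ <= X]mulrAC [X in _ <= X]mulrC ler_wpM2l ?invr_ge0 ?exprn_ge0 //.
  have h := le_trans (ler_normB y z); have [yz|zy] := leP `|y| `|z|.
    apply: (@le_trans _ _ ((2 * `|z|) ^+ k)).
      rewrite lerXn2r ?nnegrE ?mulr_ge0 // h // mulr_natl mulr2n lerD2r //.
    by rewrite exprMn ler_wpM2l ?exprn_ge0 // lerDr exprn_ge0.
  apply: (@le_trans _ _ ((2 * `|y|) ^+ k)).
    by rewrite lerXn2r ?nnegrE ?mulr_ge0 // h // mulr_natl mulr2n lerD2l ltW.
  by rewrite exprMn ler_wpM2l ?exprn_ge0 // lerDl exprn_ge0.
have : 0 <= p by exact: normr_ge0.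
have k0 : 0 <= 2 ^+ k * `|c| ^- k by rewrite mulr_ge0 ?invr_ge0 ?exprn_ge0.
have z0 : 0 <= `|z| ^+ k by rewrite exprn_ge0.
move: xy pB pC k0 z0; move: (`|x| ^+ k) (`|y| ^+ k) (`|z| ^+ k) (2 ^+ k * _) p.
move=> X Y Z K p xy pB pC k0 z0 p0; apply: le_trans (ler_wpM2r p0 xy) _.
by rewrite -mulrA ler_wpM2l // mulrDl lerD // ler_wpM2l.
Qed.

Lemma schR_measurable f : schR f -> measurable_fun setT f.
Proof. by move=> [/smoothR_measurable]. Qed.

Lemma expr_prod_ord (c : R) : c ^+ n = \prod_(i < n) c.
Proof. by rewrite prodr_const card_ord. Qed.

Lemma prod_weight_le x : \prod_(i < n) (1 + x ord0 i ^+ 2) ^+ 2 <= (1 + `|x| ^+ 2) ^+ (2 * n).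
Proof.
rewrite exprM expr_prod_ord; apply: ler_prod => i _.
rewrite exprn_ge0 ?(ltW (cauchy_gt0 _)) //= lerXn2r ?nnegrE ?addr_ge0 ?sqr_ge0 //.
by rewrite lerD2l -(real_normK (num_real (x ord0 i))) lerXn2r ?nnegrE // normr_coord.
Qed.

Lemma Wt1E x : Wt 1 x = (\prod_(i < n) (1 + x ord0 i ^+ 2) ^+ 2)^-1.
Proof.
by rewrite /Wt -prodfV; apply: eq_bigr => i _; rewrite div1r mul1r.
Qed.

Lemma weight_gt0 x : 0 < \prod_(i < n) (1 + x ord0 i ^+ 2) ^+ 2.
Proof. by apply: prodr_gt0 => i _; rewrite exprn_gt0 // cauchy_gt0. Qed.

(** The denominator of [Wt 1] has degree 4n: the sup bound is used for |x| <= 1 and the weighted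
    bound of order 4n beyond. *)
Lemma le_Wt1 f x (B C : R) : `|f x| <= B -> `|x| ^+ (4 * n) * `|f x| <= C ->
  `|f x| <= 2 ^+ (2 * n) * (B + C) * Wt 1 x.
Proof.
move=> fB fC; rewrite Wt1E ler_pdivlMr ?weight_gt0 //.
apply: le_trans (ler_wpM2l (normr_ge0 _) (prod_weight_le x)) _.
have B0 : 0 <= B by exact: le_trans fB.
have C0 : 0 <= C by apply: le_trans fC; rewrite mulr_ge0 ?exprn_ge0.
have [x1|x1] := leP `|x| 1.
  have H1 : (1 + `|x| ^+ 2) ^+ (2 * n) <= 2 ^+ (2 * n).
    rewrite lerXn2r ?nnegrE ?addr_ge0 ?sqr_ge0 //.
    by rewrite -[2]/(1 + 1) lerD2l expr_le1.
  rewrite mulrC; apply: le_trans (ler_wpM2r (normr_ge0 _) H1) _.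
  by rewrite ler_wpM2l ?exprn_ge0 // (le_trans fB) // lerDl.
apply: (@le_trans _ _ ((2 * `|x| ^+ 2) ^+ (2 * n) * `|f x|)).
  rewrite mulrC ler_wpM2r // lerXn2r ?nnegrE ?addr_ge0 ?mulr_ge0 ?sqr_ge0 //.
  by rewrite mulr_natl mulr2n lerD2r exprn_ege1 // ltW.
rewrite exprMn -mulrA ler_wpM2l ?exprn_ge0 // -exprM mulnA.
by rewrite (le_trans fC) // lerDr.
Qed.

Lemma Wt1_shift x v : `|v| <= 1 -> Wt 1 (x + v) <= 3 ^+ (2 * n) * Wt 1 x.
Proof.
move=> v1; rewrite !Wt1E ler_pdivlMr ?weight_gt0 // mulrC ler_pdivrMr ?weight_gt0 //.
rewrite exprM expr_prod_ord -big_split /=.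
apply: ler_prod => i _; rewrite exprn_ge0 ?(ltW (cauchy_gt0 _)) //= -exprMn.
rewrite lerXn2r ?nnegrE ?mulr_ge0 ?(ltW (cauchy_gt0 _)) // mxE.
have := normr_coord v i => /le_trans/(_ v1); rewrite ler_norml => /andP[a b].
have c : v ord0 i ^+ 2 <= 1 by rewrite -(real_normK (num_real _)) expr_le1 // ler_norml a b.
have := sqr_ge0 (x ord0 i + v ord0 i + v ord0 i); have := sqr_ge0 (x ord0 i + v ord0 i); nra.
Qed.

(** One constant for all seminorms of order at most [N]: the real counterpart of a bound on
    [schwartz_norm], in which the continuity of functionals is expressed. *)
Definition sbound (N : nat) (B : R) f := smoothR f /\
  forall k l x, (k <= N)%N -> (size l <= N)%N -> `|x| ^+ k * `|pderivs l f x| <= B.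

Lemma schR_sbound f N : schR f -> exists B, sbound N B f.
Proof.
move=> [sf Hf].
have H k : exists B, forall l x, (size l <= N)%N -> `|x| ^+ k * `|pderivs l f x| <= B.
  elim: N => [|N [B HB]].
    by have [B HB] := Hf k [::]; exists B => -[|//] x _.
  have [C HC] : exists C, forall l x, size l = N.+1 -> `|x| ^+ k * `|pderivs l f x| <= C.
    pose F (t : N.+1.-tuple 'I_n) := projT1 (cid (Hf k t)).
    exists (\sum_t `|F t|) => l x sl.
    pose t : N.+1.-tuple 'I_n := Tuple (introT eqP sl).
    have H := projT2 (cid (Hf k t)) x.
    apply: le_trans H _; rewrite -/(F t).
    rewrite (le_trans (ler_norm _)) // (bigD1 t) //= lerDl; exact: sumr_ge0.
  exists (Num.max B C) => l x; rewrite leq_eqVlt => /orP[/eqP sl|sl].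
    by rewrite le_max HC // orbT.
  by rewrite le_max HB.
have [B HB] : exists B, forall k l x, (k <= N)%N -> (size l <= N)%N ->
    `|x| ^+ k * `|pderivs l f x| <= B; last by exists B.
suff : forall M, exists B, forall k l x, (k <= M)%N -> (size l <= N)%N ->
  `|x| ^+ k * `|pderivs l f x| <= B by exact.
elim=> [|M [B HB]].
  by have [B HB] := H 0; exists B => -[|//] l x _; exact: HB.
have [C HC] := H M.+1; exists (Num.max B C) => k l x.
rewrite leq_eqVlt => /orP[/eqP -> sl|kM sl]; first by rewrite le_max HC // orbT.
by rewrite le_max HB.
Qed.

Lemma sbound_ge0 N B f : sbound N B f -> 0 <= B.
Proof. by move=> [_ /(_ 0 [::] 0 isT isT)]; apply: le_trans; rewrite mulr_ge0. Qed.

End Schwartz.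

Section SchwartzConvolution.
Context {R : realType} (n : nat).
Local Notation pt := 'rV[R]_n.
Local Notation mu := (leb R n).
Local Notation I f := (Rintegral mu setT f).
Implicit Types (f g A b : pt -> R) (x v z : pt) (i : 'I_n) (l : seq 'I_n).

Lemma normX_split x y k : `|x| ^+ k <= 2 ^+ k * (`|x - y| ^+ k + `|y| ^+ k).
Proof.
have h : `|x| <= `|x - y| + `|y| by rewrite -{1}(subrK y x) ler_normD.
have [a|/ltW a] := leP `|x - y| `|y|.
  apply: (@le_trans _ _ ((2 * `|y|) ^+ k)).
    by rewrite lerXn2r ?nnegrE ?mulr_ge0 // (le_trans h) // mulr_natl mulr2n lerD2r.
  by rewrite exprMn ler_wpM2l ?exprn_ge0 // lerDr exprn_ge0.
apply: (@le_trans _ _ ((2 * `|x - y|) ^+ k)).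
  by rewrite lerXn2r ?nnegrE ?mulr_ge0 // (le_trans h) // mulr_natl mulr2n lerD2l.
by rewrite exprMn ler_wpM2l ?exprn_ge0 // lerDl exprn_ge0.
Qed.

Lemma measurable_normX k : measurable_fun setT (fun x : pt => `|x| ^+ k).
Proof.
apply: continuous_measurable_row => x.
apply: (@continuous_comp _ _ _ (fun x : pt => `|x|) (fun t => t ^+ k)).
  exact: norm_continuous.
exact: exprn_continuous.
Qed.

(** The decay that makes the convolution with a Schwartz function again Schwartz. It asks for no
    smoothness, so that truncated L^p functions qualify. *)
Definition moments b := forall k, intg mu (fun y => `|y| ^+ k * b y).

Lemma moments_intg b : moments b -> intg mu b.
Proof. by move=> /(_ 0); under eq_fun do rewrite expr0 mul1r. Qed.

Lemma intg_le_Wt1 b (C : R) : measurable_fun setT b ->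
  (forall x, `|b x| <= C * Wt 1 x) -> L1le mu b (C * pi ^+ n).
Proof. by move=> mb bC; apply: (@ker_L1 _ _ 1). Qed.

Lemma schR_ker f : schR f -> exists C, ker 1 C f.
Proof.
move=> sf; have [B [_ HB]] := schR_sbound (4 * n) sf.
exists (2 ^+ (2 * n) * (B + B)); split; first exact: schR_measurable.
move=> x; apply: le_Wt1; last exact: (HB (4 * n)%N [::]).
by have := HB 0 [::] x; rewrite expr0 mul1r; exact.
Qed.

Lemma schR_moments f : schR f -> moments f.
Proof.
move=> sf k; have [_ H] := sf; have [B HB] := H k [::]; have [C HC] := H (4 * n + k)%N [::].
apply: (@L1le_intg _ _ _ _ _ (2 ^+ (2 * n) * (B + C) * pi ^+ n)); apply: intg_le_Wt1.
  by apply: measurable_funM; [exact: measurable_normX|exact: schR_measurable].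
move=> x; apply: (@le_Wt1 _ _ (fun x => `|x| ^+ k * f x)).
  by rewrite normrM ger0_norm ?exprn_ge0 //; exact: HB.
by rewrite normrM [`|_ ^+ k|]ger0_norm ?exprn_ge0 // mulrA -exprD; exact: HC.
Qed.

Lemma schR_intg f : schR f -> intg mu f.
Proof. by move=> /schR_moments/moments_intg. Qed.

Lemma schR_bounded f : schR f -> exists B, forall x, `|f x| <= B.
Proof.
by move=> [_ /(_ 0 [::])[B HB]]; exists B => x; have := HB x; rewrite expr0 mul1r.
Qed.

Lemma schR_pderiv2_bounded f : schR f -> exists2 B, 0 <= B &
  forall i j y, `|pderiv i (pderiv j f) y| <= B.
Proof.
move=> /(schR_sbound 2)[B HB]; exists B; first exact: sbound_ge0 HB.
by move=> i j y; have := HB.2 0 [:: i; j] y; rewrite expr0 mul1r; exact.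
Qed.

Lemma intg_cv_schR A b x : schR A -> intg mu b -> intg mu (fun y => A (x - y) * b y).
Proof.
move=> sA Ib; have [B HB] := schR_bounded sA.
apply: (L1le_intg (intg_cvr x (schR_measurable sA) HB (intg_L1le Ib))).
Qed.

Lemma cv_differentiable A b : schR A -> intg mu b ->
  (forall x, differentiable (cv A b) x) /\
  forall i, pderiv i (cv A b) = cv (pderiv i A) b.
Proof.
move=> sA Ib; have [B B0 HB] := schR_pderiv2_bounded sA.
have dA y : differentiable A y by exact: smoothR_differentiable sA.1.
have ddA i y : differentiable (pderiv i A) y.
  by apply: smoothR_differentiable; apply: smoothR_pderiv; exact: sA.1.
have H x : differentiable (cv A b) x /\ forall i, pderiv i (cv A b) x = cv (pderiv i A) b x.
  apply: (@diff_quadratic _ _ _ x (fun i => cv (pderiv i A) b x)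
    (n%:R * (n%:R * B) * I (fun y => `|b y|))) => v _.
  have E : cv A b (x + v) - cv A b x - \sum_i v ord0 i * cv (pderiv i A) b x =
      I (fun y => (A (x - y + v) - A (x - y) -
        \sum_i v ord0 i * pderiv i A (x - y)) * b y).
    have I1 z := intg_cv_schR z sA Ib.
    have I2 i := intgZ (v ord0 i) (intg_cv_schR x (schR_pderiv i sA) Ib).
    rewrite /cv -RintB //.
    under eq_bigr => i _ do rewrite -(RintZl _ (intg_cv_schR x (schR_pderiv i sA) Ib)).
    rewrite -(Rint_sum _ I2) -RintB; last first.
    - apply: L1le_intg; apply: L1le_sum => i _; exact: intg_L1le (I2 i).
    - exact: intgB.
    apply: eq_Rint => y; rewrite !mulrBl mulr_suml (addrAC x v); congr (_ - _ - _).
    by apply: eq_bigr => i _; rewrite mulrA.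
  rewrite E; apply: L1le_Rintegral.
  rewrite [X in L1le _ _ X](_ : _ = `|n%:R * (n%:R * B) * `|v| ^+ 2| * I (fun y => `|b y|)); last first.
    by rewrite ger0_norm ?mulr_ge0 ?exprn_ge0 //; ring.
  apply: (le_L1le _ _ (L1leZ (n%:R * (n%:R * B) * `|v| ^+ 2) (L1le_abs (intg_L1le Ib)))).
    apply: measurable_funM; last exact: intg_meas Ib.
    have mAx (h : pt -> R) : smoothR h -> measurable_fun setT (fun y : pt => h (x - y)).
      move=> sh; apply: (measurableT_comp (smoothR_measurable sh)).
      by apply: measurable_rowB.
    apply: measurable_funB.
      apply: measurable_funB; last exact: mAx sA.1.
      apply: (measurableT_comp (smoothR_measurable sA.1)).
      by apply: measurable_rowD => //; apply: measurable_rowB.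
    rewrite (_ : (fun y => _) = \sum_i (fun y => v ord0 i * pderiv i A (x - y))); last first.
      by apply/funext => w; rewrite fct_sumE.
    apply: (big_ind (fun h : pt -> R => measurable_fun setT h)) => [|h k ch ck|i _].
    - exact: measurable_cst.
    - exact: measurable_funD.
    - by apply: measurable_funM => //; apply: mAx; apply: smoothR_pderiv; exact: sA.1.
  move=> y; rewrite normrM ler_wpM2r //; exact: taylor2.
by split=> [x|i]; [exact: (H x).1|apply/funext => x; exact: (H x).2].
Qed.

Lemma pderivs_cv A b l : schR A -> intg mu b -> pderivs l (cv A b) = cv (pderivs l A) b.
Proof.
move=> sA Ib; elim: l => //= i l ->.
by rewrite (cv_differentiable (schR_pderivs l sA) Ib).2.
Qed.

Lemma schR_cv A b : schR A -> moments b -> schR (cv A b).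
Proof.
move=> sA mb; apply: (@schR_class R n (fun f => exists2 A, schR A & f = cv A b)).
- by move=> f [A' sA' ->]; exact: (cv_differentiable sA' (moments_intg mb)).1.
- move=> f i [A' sA' ->]; exists (pderiv i A'); first exact: schR_pderiv.
  exact: (cv_differentiable sA' (moments_intg mb)).2.
- move=> f [A' sA' ->] k; have [B HB] := sA'.2 k [::]; have [C HC] := schR_bounded sA'.
  have Ib := moments_intg mb; have mA := schR_measurable sA'; have mb' := intg_meas Ib.
  have B0 : 0 <= B by apply: le_trans (HB 0); rewrite mulr_ge0 ?exprn_ge0.
  have C0 : 0 <= C by exact: le_trans (HC 0).
  exists (2 ^+ k * (B * I (fun y => `|b y|) + C * I (fun y => `| (`|y| ^+ k * b y)|))) => x.
  have H := L1leD (L1leZ B (L1le_abs (intg_L1le Ib))) (L1leZ C (L1le_abs (intg_L1le (mb k)))).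
  have {}H := L1leZ (2 ^+ k) H; rewrite !ger0_norm ?exprn_ge0 // in H.
  have mAx : measurable_fun setT (fun y : pt => A' (x - y)).
    by apply: (measurableT_comp mA); apply: measurable_rowB.
  rewrite -[X in X * _](ger0_norm (exprn_ge0 k (normr_ge0 x))) -normrM.
  rewrite -RintZl; last exact: intg_cv_schR.
  apply: L1le_Rintegral; apply: le_L1le H.
    by apply: measurable_funM => //; exact: measurable_funM.
  move=> y; rewrite 3!normrM ger0_norm ?exprn_ge0 // (ger0_norm (exprn_ge0 k (normr_ge0 y))).
  apply: le_trans (ler_wpM2r _ (normX_split x y k)) _; first by rewrite mulr_ge0.
  rewrite -mulrA ler_wpM2l ?exprn_ge0 // mulrDl lerD //.
    by rewrite mulrA ler_wpM2r //; exact: HB.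
  by rewrite mulrCA ler_wpM2r ?mulr_ge0 ?exprn_ge0.
- by exists A.
Qed.

Lemma moments_bounded_support b M : intg mu b -> (forall x, M < `|x| -> b x = 0) -> moments b.
Proof.
move=> Ib bM k; have := L1leZ (`|M| ^+ k) (L1le_abs (intg_L1le Ib)).
move=> H; apply: L1le_intg (le_L1le _ _ H).
  by apply: measurable_funM; [exact: measurable_normX|exact: intg_meas Ib].
move=> x; rewrite normrM ger0_norm ?exprn_ge0 //; have [xM|xM] := leP `|x| M.
  by rewrite ler_wpM2r // lerXn2r ?nnegrE // (le_trans xM) // ler_norm.
by rewrite bM // normr0 !mulr0.
Qed.

Lemma cv_support A b M1 M2 : (forall x, M1 < `|x| -> A x = 0) ->
  (forall x, M2 < `|x| -> b x = 0) -> forall x, M1 + M2 < `|x| -> cv A b x = 0.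
Proof.
move=> HA Hb x xM; rewrite /cv.
rewrite (@eq_Rint _ _ _ _ _ (fun=> 0)) ?/Rintegral ?integral0 // => y.
have [yM|/Hb ->] := leP `|y| M2; last by rewrite mulr0.
rewrite HA ?mul0r //; rewrite -(ltrD2r M2) (lt_le_trans xM) // -{1}(subrK y x).
by rewrite (le_trans (ler_normD _ _)) // lerD2l.
Qed.

(** The L^1 normalisation preserves integrals and the constant in [ker]. *)
Definition dil (a : R) f x : R := a ^+ n * f (a *: x).

Lemma dil_measurable a f : measurable_fun setT f -> measurable_fun setT (dil a f).
Proof.
move=> mf; apply: measurable_funM => //; apply: (measurableT_comp mf).
exact: measurable_rowZ.
Qed.

Lemma WtE (a : R) x : Wt a x = a ^+ n * Wt 1 (a *: x).
Proof.
rewrite /Wt [X in X * _](_ : _ = \prod_(i < n) a); last by rewrite prodr_const card_ord.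
by rewrite -big_split; apply: eq_bigr => i _ /=; rewrite mxE mul1r mul1r.
Qed.

Lemma ker_dil a C f : 0 < a -> ker 1 C f -> ker a C (dil a f).
Proof.
move=> a0 [mf fC]; split; first exact: dil_measurable.
move=> x; rewrite /dil normrM ger0_norm ?exprn_ge0 ?(ltW a0) // WtE mulrCA.
by rewrite ler_wpM2l ?exprn_ge0 ?(ltW a0).
Qed.

Lemma L1le_dil a f (A : R) : 0 < a -> L1le mu f A -> L1le mu (dil a f) A.
Proof.
move=> a0 /(L1le_affine 0 (negbT (gt_eqF a0)))/(L1leZ (a ^+ n)).
rewrite mulrA !ger0_norm ?exprn_ge0 ?(ltW a0) // mulfV ?mul1r ?expf_neq0 ?gt_eqF //.
by apply: L1le_eq => x; rewrite addr0.
Qed.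

Lemma Rint_dil a f : 0 < a -> intg mu f -> I (dil a f) = I f.
Proof.
move=> a0 If; have Ia := intg_affine 0 (negbT (gt_eqF a0)) If.
transitivity (I (fun x => a ^+ n * f (a *: x + 0))).
  by apply: eq_Rint => x; rewrite addr0.
rewrite RintZl // Rint_affine ?gt_eqF // gtr0_norm // mulrA mulfV ?mul1r //.
by rewrite expf_neq0 // gt_eqF.
Qed.

Lemma schR_dil a f : 0 < a -> schR f -> schR (dil a f).
Proof.
move=> a0 sf; apply: schRZ; have := schR_affine 0 (negbT (gt_eqF a0)) sf.
by under eq_fun do rewrite addr0.
Qed.

(** The increment of a derivative of [f] along y is O(|y|), and y has size 1/a under the dilated
    kernel. The polynomial weight in x is shared between x - y and y, and the moments of [Phi]
    absorb the second share. *)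
Lemma approx_identity f Phi N : schR f -> schR Phi -> I Phi = 1 ->
  exists C, forall a, 1 <= a -> sbound N (C / a) (fun x => cv f (dil a Phi) x - f x).
Proof.
move=> sf sP P1.
have [B HB] := schR_sbound N.+1 sf; have B0 := sbound_ge0 HB.
pose G k u : R := (`|u| * (1 + `|u| ^+ k)) * Phi u.
have mG k : measurable_fun setT (G k).
  apply: measurable_funM; last exact: schR_measurable.
  apply: measurable_funM; first exact: (measurable_normX 1).
  by apply: measurable_funD => //; exact: measurable_normX.
have IG k : intg mu (G k).
  have := intgD (schR_moments sP 1) (schR_moments sP k.+1).
  by under eq_fun do rewrite -mulrDl expr1 exprS -[X in X + _]mulr1 -mulrDr.
pose c := n%:R * 2 ^+ N * B * \sum_(k < N.+1) I (fun u => `|G k u|).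
exists c => a a1; have a0 : 0 < a by exact: lt_le_trans a1.
have sPa := schR_dil a0 sP; have IPa := schR_intg sPa.
have sC := schR_cv sf (schR_moments sPa).
split; first exact: (schRB sC sf).1.
move=> k l x kN lN.
have -> : pderivs l (fun x => cv f (dil a Phi) x - f x) x =
    cv (pderivs l f) (dil a Phi) x - pderivs l f x.
  have /= := congr1 (fun h => h x) (pderivs_add l sC.1 (smoothRZ (-1) sf.1)).
  rewrite pderivs_scale; last exact: sf.1.
  rewrite pderivs_cv // mulN1r => <-.
  by congr (pderivs l _ x); apply/funext => y; rewrite mulN1r.
set h := pderivs l f; have sh : schR h by exact: schR_pderivs.
have E : cv h (dil a Phi) x - h x = I (fun y => (h (x - y) - h x) * dil a Phi y).
  rewrite (@eq_Rint _ _ _ _ _ (fun y : pt => h (x - y) * dil a Phi y - h x * dil a Phi y)); last first.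
    by move=> y; rewrite mulrBl.
  rewrite RintB; [|exact: intg_cv_schR|exact: intgZ].
  by rewrite RintZl // Rint_dil ?P1 ?mulr1 //; exact: schR_intg.
rewrite E -[X in X * _](ger0_norm (exprn_ge0 k (normr_ge0 x))) -normrM -RintZl; last first.
  have := intgB (intg_cv_schR x sh IPa) (intgZ (h x) IPa).
  by under eq_fun do rewrite -mulrBl.
apply: L1le_Rintegral.
have H : L1le mu (fun y => n%:R * 2 ^+ N * B * a^-1 * dil a (G k) y) (c / a).
  have := L1leZ (n%:R * 2 ^+ N * B * a^-1) (L1le_dil a0 (intg_L1le (IG k))).
  rewrite ger0_norm ?mulr_ge0 ?exprn_ge0 ?invr_ge0 ?(ltW a0) //; apply: L1leW.
  rewrite /c mulrAC ler_wpM2r ?invr_ge0 ?(ltW a0) // ler_wpM2l ?mulr_ge0 ?exprn_ge0 //.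
  have kN1 : (k < N.+1)%N by [].
  rewrite (bigD1 (Ordinal kN1)) //= lerDl; apply: sumr_ge0 => j _; exact: Rint_ge0.
apply: le_L1le (L1le_abs H).
  apply: measurable_funM => //; apply: measurable_funM; last exact: schR_measurable.
  apply: measurable_funB => //; apply: (measurableT_comp (schR_measurable sh)).
  exact: measurable_rowB.
move=> y.
have dh w : differentiable h w by exact: smoothR_differentiable sh.1.
have Dh : `|x| ^+ k * `|h (x - y) - h x| <= n%:R * 2 ^+ N * B * (`|y| * (1 + `|y| ^+ k)).
  have K : forall i t, 0 < t < 1 -> `|x| ^+ k * `|pderiv i h (x + t *: - y)| <= 2 ^+ N * (B + `|y| ^+ k * B).
    move=> i t /andP[t0 t1]; set w := x + _.
    apply: (@le_trans _ _ (2 ^+ k * (`|w| ^+ k + `|y| ^+ k) * `|pderiv i h w|)).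
      rewrite ler_wpM2r // (le_trans (normX_split x (x - w) k)) // subKr.
      rewrite ler_wpM2l ?exprn_ge0 // lerD2l lerXn2r ?nnegrE //.
      rewrite /w opprD addrA subrr sub0r normrN normrZ normrN gtr0_norm //.
      by rewrite ler_piMl // ltW.
    rewrite -mulrA ler_pM ?exprn_ge0 ?mulr_ge0 ?addr_ge0 ?exprn_ge0 //.
      by rewrite ler_weXn2l // ler1n.
    rewrite mulrDl lerD //.
      by apply: (HB.2 k (i :: l) w) => //; exact: leqW.
    rewrite ler_wpM2l ?exprn_ge0 //.
    by have := HB.2 0 (i :: l) w; rewrite expr0 mul1r; exact.
  have [t t01 ->] := mean_value x (- y) dh.
  rewrite -[X in X * _](ger0_norm (exprn_ge0 k (normr_ge0 x))) -normrM mulr_sumr.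
  under eq_bigr do rewrite mulrCA.
  apply: le_trans (norm_lform_le (L := fun i => `|x| ^+ k * pderiv i h (x + t *: - y)) (- y)
    (B := 2 ^+ N * (B + `|y| ^+ k * B)) _) _.
    by move=> i; rewrite normrM ger0_norm ?exprn_ge0 //; exact: K.
  by rewrite normrN le_eqVlt; apply/orP; left; apply/eqP; ring.
rewrite normrM ger0_norm ?exprn_ge0 // normrM mulrA.
apply: le_trans (ler_wpM2r (normr_ge0 _) Dh) _.
have ay : `|a *: y| = a * `|y| by rewrite normrZ gtr0_norm.
rewrite /dil /G ay !normrM.
move: (normr_ge0 (Phi (a *: y))); move: `|Phi (a *: y)| => p p0.
have an : `|a| = a by rewrite gtr0_norm.
move: (normr_ge0 y) ay; move: `|y| => Y Y0 _.
rewrite !an !ger0_norm ?exprn_ge0 ?invr_ge0 ?addr_ge0 ?exprn_ge0 ?mulr_ge0 ?(ltW a0) //.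
rewrite (_ : n%:R * 2 ^+ N * B / a * (a ^+ n * (a * Y * (1 + (a * Y) ^+ k) * p)) =
  n%:R * 2 ^+ N * B * (Y * (1 + (a * Y) ^+ k)) * (a ^+ n * p)); last first.
  by field; rewrite gt_eqF.
rewrite ler_wpM2r ?mulr_ge0 ?exprn_ge0 ?(ltW a0) ?normr_ge0 //.
rewrite ler_wpM2l ?mulr_ge0 ?exprn_ge0 // ler_wpM2l // lerD2l.
by rewrite lerXn2r ?nnegrE ?mulr_ge0 ?(ltW a0) // ler_peMl.
Qed.

End SchwartzConvolution.

Section SchwartzBump.
Context {R : realType} (n : nat).
Local Notation pt := 'rV[R]_n.+1.

(** The bump constant is linear in the seminorm, which is what makes th |-> Q(m th) a tempered
    functional. *)
Lemma sbound_bump : exists N C, 0 <= C /\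
  forall B (f : pt -> R), sbound N B f -> bump 0 1 (C * B) f.
Proof.
exists (4 * n.+1)%N, (2 ^+ (2 * n.+1) * 2 * (1 + n.+1%:R * 3 ^+ (2 * n.+1))).
split; first by rewrite !mulr_ge0 ?addr_ge0 ?mulr_ge0 ?exprn_ge0.
move=> B f HB; have B0 := sbound_ge0 HB.
have K l x : (size l <= 1)%N -> `|pderivs l f x| <= 2 ^+ (2 * n.+1) * 2 * B * Wt 1 x.
  move=> sl; rewrite -!mulrA [2 * (B * _)]mulrA mulr_natl mulr2n mulrA.
  have ll : (size l <= 4 * n.+1)%N by exact: leq_trans sl _.
  apply: le_Wt1; last exact: HB.2.
  by have := HB.2 0 l x (leq0n _) ll; rewrite expr0 mul1r.
have C1 : 1 <= 1 + n.+1%:R * 3 ^+ (2 * n.+1) :> R by rewrite lerDl mulr_ge0 ?exprn_ge0.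
have W0 (y : pt) : 0 <= Wt 1 y by exact: Wt_ge0.
split.
- exact: smoothR_measurable HB.1.
- move=> y; rewrite subr0; apply: le_trans (K [::] y isT) _.
  rewrite ler_wpM2r // -!mulrA ler_wpM2l ?exprn_ge0 // ler_wpM2l //.
  by rewrite ler_peMl.
- move=> y v; rewrite mul1r subr0 => v1.
  have df w : differentiable f w by exact: smoothR_differentiable HB.1.
  apply: le_trans (lipschitz_of_pderiv (B := 2 ^+ (2 * n.+1) * 2 * B * (3 ^+ (2 * n.+1) * Wt 1 y)) df _) _.
    move=> i t /andP[t0 t1]; apply: le_trans (K [:: i] _ isT) _.
    rewrite ler_wpM2l ?mulr_ge0 ?exprn_ge0 //; apply: Wt1_shift.
    by rewrite normrZ gtr0_norm // mulr_ile1 // ltW.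
  rewrite (_ : _ * `|v| = 2 ^+ (2 * n.+1) * 2 * (n.+1%:R * 3 ^+ (2 * n.+1)) * B * `|v| * Wt 1 y); last by ring.
  rewrite !ler_wpM2r // ler_wpM2l ?mulr_ge0 ?exprn_ge0 //.
  by rewrite lerDr.
Qed.

Lemma bump_dil z (a S : R) (f : pt -> R) : 0 < a -> bump 0 1 S f ->
  bump z a S (fun x => dil a f (x - z)).
Proof.
move=> a0 [mf fS df]; split.
- apply: (measurableT_comp (dil_measurable a mf)); exact: measurable_rowB.
- move=> y; rewrite /dil normrM ger0_norm ?exprn_ge0 ?(ltW a0) // WtE mulrCA.
  rewrite ler_wpM2l ?exprn_ge0 ?(ltW a0) //.
  by have := fS (a *: (y - z)); rewrite subr0.
- move=> y v av; rewrite /dil -mulrBr normrM ger0_norm ?exprn_ge0 ?(ltW a0) // WtE.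
  rewrite mulrCA ler_wpM2l ?exprn_ge0 ?(ltW a0) //.
  have := df (a *: (y - z)) (a *: v); rewrite mul1r subr0 normrZ gtr0_norm //.
  by rewrite -scalerDr addrAC; apply.
Qed.

Lemma schR_bump (f : pt -> R) : schR f -> exists S, bump 0 1 S f.
Proof.
move=> sf; have [N [C [_ H]]] := sbound_bump.
by have [B /H ?] := schR_sbound N sf; exists (C * B).
Qed.

End SchwartzBump.

(** * Fourier inversion *)

Section TestFunctions.
Context {R : realType} (n : nat).
Local Notation pt := 'rV[R]_n.
Local Notation mu := (leb R n).
Local Notation I f := (Rintegral mu setT f).
Implicit Types (f g A b c : pt -> R) (x v z : pt) (i : 'I_n) (l : seq 'I_n).

Lemma testR_smooth f : testR f -> smoothR f. Proof. by case. Qed.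

Lemma testR_pderiv f i : testR f -> testR (pderiv i f).
Proof.
move=> [sf [M HM]]; split; first exact: smoothR_pderiv.
exists M => x xM; rewrite /pderiv (@near_eq_derive _ _ _ f (cst 0)).
  exact: derive_cst.
have h : nbhs `|x| [set y : R | M < y] by exact: lt_nbhsr.
have {}h : nbhs x [set y : pt | M < `|y|] by exact: (@norm_continuous R pt x _ h).
by apply: filterS h => y; exact: HM.
Qed.

Lemma continuous_bounded_ball f (M : R) : continuous f ->
  exists B, forall x, `|x| <= M -> `|f x| <= B.
Proof.
move=> cf; have cM : compact [set x : pt | `|x| <= M].
  apply: bounded_closed_compact.
    by exists M; split; rewrite ?num_real // => y My x /= /le_trans -> //; exact: ltW.
  apply: (@closed_comp _ _ (fun x : pt => `|x|) [set y : R | y <= M]).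
    by move=> x _; exact: norm_continuous.
  exact: closed_le.
have := @continuous_compact _ _ f _ (continuous_subspaceT cf) cM.
move=> /compact_bounded[B [_ HB]]; exists (B + 1) => x xM.
by apply: (HB (B + 1)); [rewrite ltrDl|exists x].
Qed.

Lemma testR_bounded f : testR f -> exists B, forall x, `|f x| <= B.
Proof.
move=> [sf [M HM]].
have [B HB] := continuous_bounded_ball M (smoothR_continuous sf).
exists (Num.max 0 B) => x; have [xM|xM] := leP `|x| M.
  by rewrite le_max HB // orbT.
by rewrite HM // normr0 le_max lexx.
Qed.

Lemma testR_schR f : testR f -> schR f.
Proof.
apply: schR_class => {}f.
- by move=> [sf _] x; exact: smoothR_differentiable.
- by move=> i; exact: testR_pderiv.
- move=> tf k; have [B HB] := testR_bounded tf; have [_ [M HM]] := tf.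
  exists (`|M| ^+ k * B) => x; have B0 : 0 <= B by exact: le_trans (HB 0).
  have [xM|xM] := leP `|x| M; last by rewrite HM // normr0 mulr0 mulr_ge0 ?exprn_ge0.
  by rewrite ler_pM ?exprn_ge0 // lerXn2r ?nnegrE // (le_trans xM) // ler_norm.
Qed.

Lemma testR_intg f : testR f -> intg mu f.
Proof. by move=> /testR_schR/schR_intg. Qed.

Lemma testRM f g : smoothR f -> testR g -> testR (fun x => f x * g x).
Proof.
move=> sf [sg [M HM]]; split; first exact: smoothRM.
by exists M => x /HM ->; rewrite mulr0.
Qed.

Lemma testRZ f (k : R) : testR f -> testR (fun x => k * f x).
Proof. by move=> tf; apply: testRM => //; exact: smoothR_cst. Qed.

Lemma testRN f : testR f -> testR (fun x => - f x).
Proof.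
by move=> /(testRZ (-1)); under eq_fun do rewrite mulN1r.
Qed.

Lemma testRD f g : testR f -> testR g -> testR (fun x => f x + g x).
Proof.
move=> [sf [M HM]] [sg [N HN]]; split; first exact: smoothRD.
exists (Num.max M N) => x; rewrite gt_max => /andP[/HM -> /HN ->].
by rewrite addr0.
Qed.

Lemma testR0 : testR ((fun=> 0) : pt -> R).
Proof. by split; [exact: smoothR_cst|exists 0]. Qed.

Lemma testR_affine f (k : R) z : k != 0 -> testR f -> testR (fun x => f (k *: x + z)).
Proof.
move=> k0 [sf [M HM]]; split; first exact: smoothR_affine.
exists ((M + `|z|) / `|k|) => x; rewrite ltr_pdivrMr ?normr_gt0 // mulrC -normrZ => H.
apply: HM; rewrite -(ltrD2r `|z|) (lt_le_trans H) // -{1}(addrK z (k *: x)).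
exact: ler_normB.
Qed.

Lemma intg_ball (M : R) : intg mu (fun x => (`|x| <= M)%R%:R).
Proof.
apply: (L1le_intg (A := 2 ^+ (2 * n) * (1 + `|M| ^+ (4 * n)) * pi ^+ n)).
apply: intg_le_Wt1.
  by apply: measurable_leR; have := @measurable_normX R n 1; under eq_fun do rewrite expr1.
move=> x; apply: (@le_Wt1 _ _ (fun x : pt => (`|x| <= M)%R%:R)); case: (leP `|x| M) => xM /=; rewrite ?normr0 ?normr1 ?mulr0 ?mulr1 ?exprn_ge0 //.
by rewrite lerXn2r ?nnegrE // (le_trans xM) // ler_norm.
Qed.

(* Convolving with the indicator of a large ball gives a function which is
   constant near [0] and whose derivative there is the integral. *)
Lemma Rint_pderiv f i : testR f -> I (pderiv i f) = 0.
Proof.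
move=> tf; have [sf [M HM]] := tf; have [_ [N HN]] := testR_pderiv i tf.
(* The radius exceeds the support of [f] by 1, so that the convolution is constant for |x| < 1, and
   it contains the support of the derivative. *)
pose g x : R := (`|x| <= Num.max (M + 1) N)%R%:R.
have E (h : pt -> R) (L : R) x : (forall x, L < `|x| -> h x = 0) ->
    L + `|x| <= Num.max (M + 1) N -> measurable_fun setT h -> cv h g x = I h.
  move=> HL LN mh; rewrite -(Rint_reflect x mh); apply: eq_Rint => y.
  rewrite /g; case: leP => yN; first by rewrite mulr1.
  rewrite mulr0 HL // -(ltrD2r `|x|) (le_lt_trans LN) // (lt_le_trans yN) //.
  by have := ler_normB x (x - y); rewrite subKr addrC.
have sg := testR_schR tf.
have [_ /(_ i)] := cv_differentiable sg (intg_ball (Num.max (M + 1) N)).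
move=> /(congr1 (fun h => h 0)); rewrite (E _ N 0 HN) ?normr0 ?addr0 ?le_max ?lexx ?orbT //; last first.
  by apply: smoothR_measurable; exact: smoothR_pderiv.
move=> <-; rewrite /pderiv (@near_eq_derive _ _ _ _ (cst (I f))).
  exact: derive_cst.
have h : nbhs `|0 : pt| [set y : R | y < 1] by apply: lt_nbhsl; rewrite normr0.
have {}h : nbhs (0 : pt) [set y : pt | `|y| < 1] by exact: (@norm_continuous R pt 0 _ h).
apply: filterS h => x /= x1.
apply: (E f M) => //; last exact: smoothR_measurable.
by rewrite le_max lerD2l ltW.
Qed.

(* Real and imaginary parts of Fourier integrals are of this form. *)
Definition tr b c x : R := I (fun y => trigf y (b y) (c y) x).

Lemma measurable_trig x : measurable_fun setT (fun y : pt => cos (dotp x y)) /\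
  measurable_fun setT (fun y : pt => sin (dotp x y)).
Proof. by split; [exact: (kermeas1 x (@kermeas_cos R n))|exact: (kermeas1 x (@kermeas_sin R n))]. Qed.

Lemma cos_le1 (t : R) : `|cos t| <= 1.
Proof. by rewrite ler_norml cos_geN1 cos_le1. Qed.

Lemma sin_le1 (t : R) : `|sin t| <= 1.
Proof. by rewrite ler_norml sin_geN1 sin_le1. Qed.

Lemma L1le_tr b c x (B C : R) : L1le mu b B -> L1le mu c C ->
  L1le mu (fun y => trigf y (b y) (c y) x) (B + C).
Proof.
move=> Hb Hc; have [mc ms] := measurable_trig x.
have := L1leD (L1leM ler01 mc (fun y => cos_le1 (dotp x y)) Hb)
  (L1leM ler01 ms (fun y => sin_le1 (dotp x y)) Hc).
rewrite !mul1r; apply: L1le_eq => y.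
by rewrite /trigf (dotpC y) mulrC [sin _ * _]mulrC.
Qed.

Lemma intg_tr b c x : intg mu b -> intg mu c -> intg mu (fun y => trigf y (b y) (c y) x).
Proof. by move=> /intg_L1le Hb /intg_L1le Hc; exact: L1le_intg (L1le_tr x Hb Hc). Qed.

Lemma trE b c x : intg mu b -> intg mu c ->
  tr b c x = I (fun y => cos (dotp x y) * b y) + I (fun y => sin (dotp x y) * c y).
Proof.
move=> Ib Ic; have [mc ms] := measurable_trig x.
rewrite -RintD.
- by apply: eq_Rint => y; rewrite /trigf (dotpC y) mulrC [c y * _]mulrC.
- exact: (intgM mc (fun y => cos_le1 (dotp x y)) Ib).
- exact: (intgM ms (fun y => sin_le1 (dotp x y)) Ic).
Qed.

Lemma tr_diff b c : testR b -> testR c ->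
  (forall x, differentiable (tr b c) x) /\
  forall i, pderiv i (tr b c) =
    tr (fun y : pt => y ord0 i * c y) (fun y : pt => - (y ord0 i * b y)).
Proof.
move=> tb tc.
have Im (h : pt -> R) (C : R) k : testR h -> L1le mu (fun y => C * (`|y| ^+ k * `|h y|))
    (`|C| * I (fun y => `| `|y| ^+ k * h y|)).
  move=> th; have := L1leZ C (L1le_abs (intg_L1le (schR_moments (testR_schR th) k))).
  by apply: L1le_eq => y; rewrite normrM ger0_norm ?exprn_ge0.
have Ic i (h : pt -> R) : testR h -> testR (fun y : pt => y ord0 i * h y).
  by move=> th; apply: testRM => //; exact: smoothR_coord.
have H x : differentiable (tr b c) x /\ forall i, pderiv i (tr b c) x =
    tr (fun y : pt => y ord0 i * c y) (fun y : pt => - (y ord0 i * b y)) x.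
  have L := L1leD (Im b (n%:R ^+ 2) 2 tb) (Im c (n%:R ^+ 2) 2 tc).
  apply: (@diff_quadratic _ _ _ x (fun i => tr (fun y : pt => y ord0 i * c y) (fun y : pt => - (y ord0 i * b y)) x)
    (`|n%:R ^+ 2| * I (fun y => `| `|y| ^+ 2 * b y|) + `|n%:R ^+ 2| * I (fun y => `| `|y| ^+ 2 * c y|))) => v _.
  have It z := intg_tr z (testR_intg tb) (testR_intg tc).
  have Ii i := intg_tr x (testR_intg (Ic i _ tc)) (testR_intg (testRN (Ic i _ tb))).
  have Iv i := intgZ (v ord0 i) (Ii i).
  under eq_bigr => i _ do rewrite -(RintZl _ (Ii i)).
  rewrite -(Rint_sum _ Iv) -RintB // -RintB; last 2 first.
  - exact: intgB.
  - by apply: L1le_intg; apply: L1le_sum => i _; exact: intg_L1le (Iv i).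
  apply: L1le_Rintegral; rewrite mulrC -[`|v| ^+ 2](@ger0_norm _ (`|v| ^+ 2)) ?exprn_ge0 //.
  apply: le_L1le (L1leZ (`|v| ^+ 2) L).
    apply: measurable_funB; first by apply: measurable_funB; exact: intg_meas (It _).
    apply: intg_meas; apply: L1le_intg.
    by apply: L1le_sum => i _; exact: intg_L1le (Iv i).
  move=> y; under eq_bigr do rewrite [y ord0 _ * c y]mulrC [y ord0 _ * b y]mulrC.
  apply: le_trans (trigf_taylor _ _ _ _ _) _.
  by rewrite le_eqVlt; apply/orP; left; apply/eqP; ring.
by split=> [x|i]; [exact: (H x).1|apply/funext => x; exact: (H x).2].
Qed.

(** Integration by parts, from [Rint_pderiv]. Powers of the frequency are traded for derivatives,
    whence the decay of the transform. *)
Lemma tr_coord b c i x : testR b -> testR c ->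
  x ord0 i * tr b c x = tr (pderiv i c) (fun y => - pderiv i b y) x.
Proof.
(* [F y] is sin(x.y) b(y) - cos(x.y) c(y); its derivative along [i] is x_i times the integrand of
   [tr b c], minus the integrand of the right-hand side. *)
move=> tb tc; pose F y := trigf x 0 1 y * b y + trigf x (-1) 0 y * c y.
have sx k1 k2 : smoothR (trigf x k1 k2) by exact: smoothR_trigf.
have tF : testR F by apply: testRD; apply: testRM.
have d f : smoothR f -> forall y, differentiable f y.
  by move=> sf y; exact: smoothR_differentiable.
have := Rint_pderiv i tF; rewrite /F pderivD; last 2 first.
- by apply: d; apply: smoothRM => //; exact: tb.1.
- by apply: d; apply: smoothRM => //; exact: tc.1.
rewrite !pderivM; try exact: d; try exact: (d _ tb.1); try exact: (d _ tc.1).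
rewrite !(trigf_diff x _ _).2 => E.
have Ib := testR_intg tb; have Ic := testR_intg tc.
have Ib' := testR_intg (testR_pderiv i tb); have Ic' := testR_intg (testR_pderiv i tc).
have Ibn := testR_intg (testRN (testR_pderiv i tb)).
have It := intg_tr x Ib Ic; have It' := intg_tr x Ic' Ibn.
rewrite -RintZl //; apply/eqP; rewrite -subr_eq0 -RintB //; last exact: intgZ.
rewrite -[X in _ == X]E; apply/eqP; apply: eq_Rint => y.
by rewrite /trigf (dotpC y); ring.
Qed.

Lemma schR_tr b c : testR b -> testR c -> schR (tr b c).
Proof.
move=> tb tc; apply: (@schR_class R n (fun f => exists b c, [/\ testR b, testR c & f = tr b c])).
- by move=> f [b' [c' [tb' tc' ->]]]; exact: (tr_diff tb' tc').1.
- move=> f i [b' [c' [tb' tc' ->]]]; rewrite (tr_diff tb' tc').2.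
  exists (fun y : pt => y ord0 i * c' y), (fun y : pt => - (y ord0 i * b' y)); split=> //.
    by apply: testRM => //; exact: smoothR_coord.
  by apply: testRN; apply: testRM => //; exact: smoothR_coord.
- move=> f [b' [c' [tb' tc' ->]]] k {f b c tb tc}.
  elim: k b' c' tb' tc' => [|k IH] b c tb tc.
    exists (I (fun y => `|b y|) + I (fun y => `|c y|)) => x; rewrite expr0 mul1r.
    by apply: L1le_Rintegral; apply: L1le_tr; apply: intg_L1le; exact: testR_intg.
  pose T i := tr (pderiv i c) (fun y => - pderiv i b y).
  have HT i : exists B, forall x, `|x| ^+ k * `|T i x| <= B.
    by apply: IH; [exact: testR_pderiv|apply: testRN; exact: testR_pderiv].
  exists (\sum_i `|projT1 (cid (HT i))|) => x.
  have nx : `|x| <= \sum_i `|x ord0 i|.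
    apply: row_normP => [|i]; first exact: sumr_ge0.
    by rewrite (bigD1 i) //= lerDl sumr_ge0.
  rewrite exprSr -mulrA; apply: (@le_trans _ _ (`|x| ^+ k * ((\sum_i `|x ord0 i|) * `|tr b c x|))).
    by rewrite ler_wpM2l ?exprn_ge0 // ler_wpM2r.
  rewrite mulr_suml mulr_sumr ler_sum // => i _; rewrite -normrM tr_coord //.
  by apply: le_trans (projT2 (cid (HT i)) x) _; exact: ler_norm.
- by exists b, c.
Qed.

End TestFunctions.

(** * The Fourier transform of the product Laplace function *)

Section Poisson.
Context {R : realType}.
Local Notation lebesgue := (@lebesgue_measure R).
Local Notation I n f := (Rintegral (leb R n) setT f).

Lemma continuous_normr1 : continuous (fun t : R => `|t|).
Proof. by move=> t; exact: norm_continuous. Qed.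

Lemma continuous_exp_cos (k a : R) :
  continuous (fun t : R => expR (- `|t|) * (1 + k * cos (a * t))).
Proof.
move=> t; apply: cvgM.
  apply: (continuous_comp (f := fun t : R => - `|t|)); last exact: continuous_expR.
  by apply: cvgN; exact: continuous_normr1.
apply: cvgD; first exact: cvg_cst.
apply: cvgM; first exact: cvg_cst.
apply: (continuous_comp (f := fun t : R => a * t)); last exact: continuous_cos.
by apply: cvgM; [exact: cvg_cst|exact: cvg_id].
Qed.

Lemma abs_mul_cos (k t : R) : `|k| <= 1 -> `|k * cos t| <= 1.
Proof. by move=> k1; rewrite normrM mulr_ile1 ?cos_le1. Qed.

Lemma exp_cos_ge0 (s k t : R) : `|k| <= 1 -> 0 <= expR s * (1 + k * cos t).
Proof.
move=> k1; rewrite mulr_ge0 ?expR_ge0 //.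
by have := abs_mul_cos t k1; rewrite ler_norml => /andP[]; lra.
Qed.

(** The summand 1 keeps the integrand nonnegative, as the fundamental theorem on a half-line
    requires here; the parameter [k] will hold the cosine of a phase. *)
Lemma integral_exp_cos (k a : R) : `|k| <= 1 ->
  (\int[lebesgue]_t (expR (- `|t|) * (1 + k * cos (a * t)))%:E =
   (2 + 2 * k / (1 + a ^+ 2))%:E)%E.
Proof.
move=> k1; have d0 := cauchy_gt0 a.
rewrite (@ge0_symfun_integralT R (fun t => expR (- `|t|) * (1 + k * cos (a * t)))); last 3 first.
- by move=> t; exact: exp_cos_ge0.
- exact: continuous_exp_cos.
- by move=> t /=; rewrite normrN mulrN cosN.
rewrite (_ : [set x | _] = `[0, +oo[%classic); last first.
  by apply/seteqP; split => x/=; rewrite in_itv/= andbT.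
pose F (t : R) := expR (- t) * (k * (a * sin (a * t) - cos (a * t)) / (1 + a ^+ 2) - 1).
have dF (t : R) : is_derive t 1 F (expR (- t) * (1 + k * cos (a * t))).
  apply: trigger_derive; rewrite /GRing.scale /=; field.
  by rewrite gt_eqF.
rewrite (@ge0_continuous_FTC2y R _ F 0 0) //.
- rewrite /F oppr0 expR0 mulr0 sin0 cos0 mulr0 sub0r mul1r sub0e -EFinN -EFinM; congr _%:E.
  by field; rewrite gt_eqF.
- by move=> t _; exact: exp_cos_ge0.
- by apply: continuous_subspaceT; exact: continuous_exp_cos.
- pose c := `|k| * (`|a| + 1) / (1 + a ^+ 2) + 1.
  have H (t : R) : `|F t| <= expR (- t) * c.
    rewrite /F normrM ger0_norm ?expR_ge0 // ler_wpM2l ?expR_ge0 //.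
    rewrite (le_trans (ler_normB _ _)) // normr1 lerD2r !normrM normfV (gtr0_norm d0).
    rewrite ler_wpM2r ?invr_ge0 ?(ltW d0) // ler_wpM2l // (le_trans (ler_normB _ _)) //.
    by rewrite lerD ?cos_le1 // normrM ler_piMr // sin_le1.
  have L : expR (- t) * c @[t --> +oo] --> (0 : R).
    by rewrite -[X in _ --> X](mul0r c); apply: cvgMl; exact: cvgr_expR.
  apply: (@squeeze_cvgr _ _ _ _ (fun t : R => - (expR (- t) * c)) (fun t : R => expR (- t) * c) F) => //.
    by near=> t; have := H t; rewrite ler_norml.
  by rewrite -oppr0; exact: cvgN.
- apply: cvg_at_right_filter; apply: differentiable_continuous.
  by apply/derivable1_diffP; exact: (@ex_derive _ _ _ _ _ _ _ (dF 0)).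
- move=> t; rewrite in_itv /= andbT => t0.
  by rewrite derive1E (@derive_val _ _ _ _ _ _ _ (dF t)) gtr0_norm.
Unshelve. all: by end_near.
Qed.

Lemma integral_exp_cosD (a b : R) :
  (\int[lebesgue]_t (expR (- `|t|) * (1 + cos (a * t + b)))%:E =
   (2 + cos b * (2 / (1 + a ^+ 2)))%:E)%E.
Proof.
pose f (t : R) := expR (- `|t|) * (1 + cos (a * t + b)).
have f0 t : 0 <= f t by rewrite /f -[cos _]mul1r exp_cos_ge0 // normr1.
have cf : continuous f.
  move=> t; apply: cvgM.
    apply: (continuous_comp (f := fun t : R => - `|t|)); last exact: continuous_expR.
    by apply: cvgN; exact: continuous_normr1.
  apply: cvgD; first exact: cvg_cst.
  apply: (continuous_comp (f := fun t : R => a * t + b)); last exact: continuous_cos.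
  apply: cvgD; last exact: cvg_cst.
  by apply: cvgM; [exact: cvg_cst|exact: cvg_id].
have mf : measurable_fun setT (fun t => (f t)%:E).
  by apply/measurable_EFinP; exact: continuous_measurable_fun.
(* Adding the reflected integral removes the odd part: cos(a t + b) becomes cos(b) cos(a t), and
   [integral_exp_cos] applies with k = cos b. *)
have fN : (\int[lebesgue]_t (f (- t))%:E = \int[lebesgue]_t (f t)%:E)%E.
  have := @ge0_integral_affine1 R (-1) 0 (fun t => (f t)%:E) _ mf (fun t => f0 t).
  rewrite normrN1 invr1 mul1e => <-; last by rewrite oppr_eq0 oner_eq0.
  by apply: eq_integral => t _; rewrite mulN1r addr0.
have mfN : measurable_fun setT (fun t : R => (f (- t))%:E).
  by apply: (measurableT_comp mf); exact: oppr_measurable.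
have k1 : `|cos b| <= 1 by exact: cos_le1.
have E : (\int[lebesgue]_t (f t)%:E + \int[lebesgue]_t (f (- t))%:E =
    2%:E * (2 + cos b * (2 / (1 + a ^+ 2)))%:E)%E.
  rewrite -ge0_integralD //; last 2 first.
  - by move=> t _; rewrite lee_fin.
  - by move=> t _; rewrite lee_fin.
  rewrite (_ : 2 + _ = 2 + 2 * cos b / (1 + a ^+ 2)); last by ring.
  rewrite -(integral_exp_cos a k1) -ge0_integralZl //; last first.
  - have /measurable_EFinP : measurable_fun setT (fun t : R => expR (- `|t|) * (1 + cos b * cos (a * t))).
      by apply: continuous_measurable_fun; exact: continuous_exp_cos.
    by [].
  apply: eq_integral => t _; rewrite -EFinD -EFinM /f normrN mulrN !cosD cosN sinN.
  by congr _%:E; ring.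
move: E; rewrite fN.
have : (0 <= \int[lebesgue]_t (f t)%:E)%E by apply: integral_ge0 => t _; rewrite lee_fin.
case: (\int[lebesgue]_t (f t)%:E)%E => [r| |] // _ [] E.
by congr _%:E; apply: (mulfI (x := 2)); rewrite // -E; ring.
Qed.

(** The function exp(-|x|_1). Up to the factor 2^n its Fourier transform is the weight [wt 1]; both
    are explicit, nonnegative and integrable, which makes it the summability factor of the inversion
    formula. *)
Definition laplace n (x : 'rV[R]_n) : R := \prod_i expR (- `|x ord0 i|).

Lemma laplace_ge0 n (x : 'rV[R]_n) : 0 <= laplace x.
Proof. by apply: prodr_ge0 => i _; exact: expR_ge0. Qed.

Lemma continuous_expN : continuous (fun t : R => expR (- `|t|)).
Proof.
move=> t; apply: (continuous_comp (f := fun t : R => - `|t|)); last exact: continuous_expR.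
by apply: cvgN; exact: continuous_normr1.
Qed.

Lemma measurable_laplace n : measurable_fun setT (@laplace n).
Proof.
apply: (@measurable_prod_coord R _ _ n (fun _ t => expR (- `|t|)) idfun) => [|i].
  exact: measurable_id.
by apply: continuous_measurable_fun; exact: continuous_expN.
Qed.

Lemma L1le_laplace n : L1le (leb R n) (@laplace n) (2 ^+ n).
Proof.
split; first exact: measurable_laplace.
under eq_integral => x _ do rewrite (ger0_norm (laplace_ge0 x)).
rewrite (@integral_prod_coord R n (fun _ t => expR (- `|t|)) (fun=> 2)).
- by rewrite prodr_const card_ord.
- by move=> i; apply: continuous_measurable_fun; exact: continuous_expN.
- by move=> i t; exact: expR_ge0.
- move=> _; have := @integral_exp_cos 0 0; rewrite normr0 mulr0 mul0r addr0 => <- //.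
  by apply: eq_integral => t _; rewrite mul0r addr0 mulr1.
Qed.

Lemma widen_ord_lift n (i : 'I_n) : widen_ord (leqnSn n) i = lift ord_max i.
Proof. by apply: ord_inj; rewrite lift_max. Qed.

Lemma dotp_snoc n (t : 'rV[R]_n) (u : R) (y : 'rV[R]_n.+1) :
  dotp (snoc_row (t, u)) y = dotp t (col' ord_max y) + u * y ord0 ord_max.
Proof.
rewrite /dotp big_ord_recr /= snoc_row_max; congr (_ + _); apply: eq_bigr => i _.
by rewrite widen_ord_lift snoc_row_lift mxE.
Qed.

Lemma laplace_snoc n (t : 'rV[R]_n) (u : R) : laplace (snoc_row (t, u)) = laplace t * expR (- `|u|).
Proof.
rewrite /laplace big_ord_recr /= snoc_row_max; congr (_ * _); apply: eq_bigr => i _.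
by rewrite widen_ord_lift snoc_row_lift.
Qed.

(* The phase [b] makes the induction on the dimension go through with
   nonnegative integrands. *)
Lemma integral_laplace_cosD n (y : 'rV[R]_n) (b : R) :
  (\int[leb R n]_x (laplace x * (1 + cos (dotp x y + b)))%:E =
   (2 ^+ n + cos b * \prod_i (2 / (1 + y ord0 i ^+ 2)))%:E)%E.
Proof.
have mE m (z : 'rV[R]_m) c : measurable_fun setT (fun x : 'rV[R]_m => (laplace x * (1 + cos (dotp x z + c)))%:E).
  apply/measurable_EFinP; apply: measurable_funM; first exact: measurable_laplace.
  apply: measurable_funD => //; apply: (measurableT_comp (f := cos)).
    by apply: continuous_measurable_fun; exact: continuous_cos.
  by apply: measurable_funD => //; exact: (kermeas2 z (@measurable_dotp R m)).
have E0 m (x z : 'rV[R]_m) (c : R) : 0 <= laplace x * (1 + cos (dotp x z + c)).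
  by rewrite mulr_ge0 ?laplace_ge0 //; have := @cos_le1 R (dotp x z + c); rewrite ler_norml => /andP[]; lra.
elim: n y b => [|n IH] y b.
  rewrite big_ord0 expr0 mulr1 [LHS](@integral_dirac _ _ (0 : 'rV[R]_0) R setT) //; last exact: mE.
  by rewrite diracE mem_set // mul1e /laplace big_ord0 mul1r /dotp big_ord0 add0r.
rewrite ge0_integral_lebS; [|exact: mE|by move=> x; rewrite lee_fin; exact: E0].
pose c : R := 2 / (1 + y ord0 ord_max ^+ 2).
have c0 : 0 <= c by rewrite divr_ge0 // (ltW (cauchy_gt0 _)).
have c2 : 0 <= 2 - c.
  rewrite subr_ge0 ler_pdivrMr ?cauchy_gt0 // mulrDr mulr1 lerDl.
  by rewrite mulr_ge0 ?sqr_ge0.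
transitivity (\int[leb R n]_t ((2 - c)%:E * (laplace t)%:E +
    c%:E * (laplace t * (1 + cos (dotp t (col' ord_max y) + b)))%:E))%E.
  apply: eq_integral => t _.
  have := integral_exp_cosD (y ord0 ord_max) (dotp t (col' ord_max y) + b).
  move=> /(congr1 (fun z => (laplace t)%:E * z)%E); rewrite -ge0_integralZl //; last 2 first.
  - suff /measurable_EFinP : measurable_fun setT (fun u : R => expR (- `|u|) *
      (1 + cos (y ord0 ord_max * u + (dotp t (col' ord_max y) + b)))) by [].
    apply: continuous_measurable_fun => u; apply: cvgM.
      exact: continuous_expN.
    apply: cvgD; first exact: cvg_cst.
    apply: (continuous_comp (f := fun u : R => y ord0 ord_max * u + (dotp t (col' ord_max y) + b))); last exact: continuous_cos.
    apply: cvgD; last exact: cvg_cst.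
    by apply: cvgM; [exact: cvg_cst|exact: cvg_id].
  - by rewrite lee_fin laplace_ge0.
  move=> E; rewrite -!EFinM -EFinD -/c in E *.
  transitivity (laplace t * (2 + cos (dotp t (col' ord_max y) + b) * c))%:E; last by congr _%:E; ring.
  rewrite -E; apply: eq_integral => u _; rewrite laplace_snoc dotp_snoc -EFinM mulrA.
  by congr (_ * (1 + cos _))%:E; ring.
have mexp : measurable_fun setT (fun t : 'rV[R]_n => (laplace t)%:E).
  by apply/measurable_EFinP; exact: measurable_laplace.
rewrite ge0_integralD //; last 4 first.
- by move=> t _; rewrite mule_ge0 ?lee_fin ?laplace_ge0.
- exact: measurable_funeM.
- by move=> t _; rewrite mule_ge0 ?lee_fin.
- by apply: measurable_funeM; exact: mE.
rewrite ge0_integralZl //; last by move=> t _; rewrite lee_fin laplace_ge0.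
rewrite ge0_integralZl //; last 2 first.
- exact: mE.
- by move=> t _; rewrite lee_fin.
rewrite IH.
have -> : (\int[leb R n]_t (laplace t)%:E = (2 ^+ n)%:E)%E.
  have := IH (0 : 'rV[R]_n) (pi / 2); rewrite cos_pihalf mul0r addr0 => <-.
  apply: eq_integral => t _; rewrite (_ : dotp t 0 = 0) ?add0r ?cos_pihalf ?addr0 ?mulr1 //.
  by rewrite /dotp big1 // => i _; rewrite mxE mulr0.
rewrite -!EFinM -EFinD big_ord_recr /= -/c exprS; congr _%:E.
have -> : \prod_(i < n) (2 / (1 + y ord0 (widen_ord (leqnSn n) i) ^+ 2)) =
    \prod_(i < n) (2 / (1 + (col' ord_max y) ord0 i ^+ 2)).
  by apply: eq_bigr => i _; rewrite mxE widen_ord_lift.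
by ring.
Qed.

Lemma intg_laplace_cos n (y : 'rV[R]_n) : intg (leb R n) (fun x => laplace x * cos (dotp x y)).
Proof.
have := intgM (measurable_trig y).1 (fun x => cos_le1 (dotp y x)) (L1le_intg (@L1le_laplace n)).
by under eq_fun do rewrite mulrC dotpC.
Qed.

Lemma Rint_laplace_cos n (y : 'rV[R]_n) :
  I n (fun x => laplace x * cos (dotp x y)) = \prod_i (2 / (1 + y ord0 i ^+ 2)).
Proof.
have IE := L1le_intg (@L1le_laplace n).
have H := integral_laplace_cosD y 0; have H0 := integral_laplace_cosD y (pi / 2).
have IE2 : I n (@laplace n) = 2 ^+ n.
  apply: EFin_inj; rewrite EFin_Rint //.
  have := integral_laplace_cosD (0 : 'rV[R]_n) (pi / 2); rewrite cos_pihalf mul0r addr0 => <-.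
  apply: eq_integral => t _; rewrite (_ : dotp t 0 = 0) ?add0r ?cos_pihalf ?addr0 ?mulr1 //.
  by rewrite /dotp big1 // => i _; rewrite mxE mulr0.
apply: (addrI (2 ^+ n)); rewrite -{1}IE2 -RintD //; last exact: intg_laplace_cos.
apply: EFin_inj; rewrite EFin_Rint; last by apply: intgD => //; exact: intg_laplace_cos.
rewrite cos0 mul1r in H; rewrite -H; apply: eq_integral => x _.
by rewrite addr0 mulrDr mulr1.
Qed.

End Poisson.

(** * Fourier inversion for even test functions *)

Section Inversion.
Context {R : realType} (n : nat).
Local Notation pt := 'rV[R]_n.
Local Notation mu := (leb R n).
Local Notation I f := (Rintegral mu setT f).
Implicit Types (f g b c psi : pt -> R) (x y z : pt).

Lemma Rint_dct (F : nat -> pt -> R) f g : (forall k, measurable_fun setT (F k)) ->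
  intg mu g -> (forall k x, `|F k x| <= g x) ->
  (forall x, F k x @[k --> \oo] --> f x) -> I (F k) @[k --> \oo] --> I f.
Proof.
move=> mF Ig Fg Ff; rewrite /Rintegral.
have mf : measurable_fun setT f.
  by apply: (measurable_fun_cvg mF) => x _; exact: Ff.
have fg x : `|f x| <= g x.
  have aF : `|F k x| @[k --> \oo] --> `|f x| by exact: cvg_norm (Ff x).
  rewrite -(cvg_lim _ aF) //; apply: limr_le; first by apply/cvg_ex; exists `|f x|.
  by apply: nearW => k; exact: Fg.
have If : intg mu f by exact: intg_le Ig.
apply: (@fine_cvg _ _ _ _ (fun k => \int[mu]_x (F k x)%:E)%E).
rewrite -/(Rintegral mu setT f) EFin_Rint //.
apply: (@dominated_cvg _ _ _ _ _ _ _ _ (EFin \o g)) => //.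
- by move=> k; apply/measurable_EFinP; exact: mF.
- by move=> x _; apply: cvg_EFin; [exact: nearW|exact: Ff].
- by move=> k x _ /=; rewrite lee_fin.
Qed.

Definition ct g x : R := I (fun y => cos (dotp x y) * g y).
Definition st g x : R := I (fun y => sin (dotp x y) * g y).

Lemma intg_cos g x : intg mu g -> intg mu (fun y => cos (dotp x y) * g y).
Proof. exact: (intgM (measurable_trig x).1 (fun y => cos_le1 (dotp x y))). Qed.

Lemma intg_sin g x : intg mu g -> intg mu (fun y => sin (dotp x y) * g y).
Proof. exact: (intgM (measurable_trig x).2 (fun y => sin_le1 (dotp x y))). Qed.

Lemma tr_ct b c x : intg mu b -> intg mu c -> tr b c x = ct b x + st c x.
Proof. exact: trE. Qed.

Lemma ctE b : intg mu b -> ct b = tr b (fun=> 0).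
Proof.
move=> Ib; apply/funext => x; rewrite tr_ct //; last exact: L1le_intg (L1le0 _).
by rewrite /st (@eq_Rint _ _ _ _ _ (fun=> 0)) ?/Rintegral ?integral0 ?addr0 // => y; rewrite mulr0.
Qed.

(** Fubini for a bounded kernel that is symmetric in its two arguments; [h] stands for the cosine
    and the sine. *)
Lemma parseval g b (h : R -> R) (H : measurable_fun setT h) (h1 : forall t, `|h t| <= 1) :
  intg mu g -> intg mu b ->
  I (fun x => g x * I (fun y => h (dotp x y) * b y)) =
  I (fun y => I (fun x => h (dotp y x) * g x) * b y).
Proof.
move=> Ig Ib; have mh := measurableT_comp H (@measurable_dotp R n).
have {}mh : kermeas (fun x y : pt => h (dotp x y)) := mh.
have mh1 x := kermeas1 x mh; have mh2 y := kermeas2 y mh.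
pose K x y := g x * (h (dotp x y) * b y).
have mK : kermeas K.
  apply: kermeasM; first by apply: kermeas_fst; exact: intg_meas Ig.
  by apply: kermeasM => //; apply: kermeas_snd; exact: intg_meas Ib.
have I1 x : intg mu (fun y => h (dotp x y) * b y) by exact: (intgM (mh1 x) (fun y => h1 _) Ib).
have I2 y : intg mu (fun x => h (dotp x y) * g x) by exact: (intgM (mh2 y) (fun x => h1 _) Ig).
transitivity (I (fun x => I (K x))).
  by apply: eq_Rint => x; rewrite RintZl.
rewrite swap_Rint //.
- apply: eq_Rint => y; rewrite -RintZr //.
    by apply: eq_Rint => x; rewrite /K (dotpC y); ring.
  by under eq_fun do rewrite (dotpC y).
- by move=> x; exact: intgZ.
- by move=> y; have := intgZr (b y) (I2 y); congr intg; apply/funext => x; rewrite /K; ring.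
- have [mb Hb] := intg_L1le Ib; have Lg := intg_L1le Ig.
  have L := L1leZ (I (fun y => `|b y|)) (L1le_abs Lg).
  apply: le_lt_trans (fubini_lty mK _ L) _; last exact: ltry.
  move=> x; have [_] := L1leZ (g x) (L1leM ler01 (mh1 x) (fun y => h1 _) (intg_L1le Ib)).
  by rewrite mul1r mulrC.
Qed.

Lemma parseval_tr g b c : intg mu g -> intg mu b -> intg mu c ->
  I (fun x => g x * tr b c x) = I (fun y => ct g y * b y) + I (fun y => st g y * c y).
Proof.
move=> Ig Ib Ic.
have mcos : measurable_fun setT (@cos R) by apply: continuous_measurable_fun; exact: continuous_cos.
have msin : measurable_fun setT (@sin R) by apply: continuous_measurable_fun; exact: continuous_sin.
rewrite /ct /st -(parseval mcos (@cos_le1 R) Ig Ib) -(parseval msin (@sin_le1 R) Ig Ic) -RintD.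
- by apply: eq_Rint => x; rewrite -mulrDr tr_ct.
- under eq_fun do rewrite mulrC.
  apply: (intgM (c := I (fun y => `|b y|)) _ _ Ig).
    by apply: measurable_Rint; apply: kermeasM; [exact: kermeas_cos|apply: kermeas_snd; exact: intg_meas Ib].
  move=> x; apply: L1le_Rintegral; rewrite -[X in L1le _ _ X]mul1r.
  exact: (L1leM ler01 (measurable_trig x).1 (fun y => cos_le1 _) (intg_L1le Ib)).
- under eq_fun do rewrite mulrC.
  apply: (intgM (c := I (fun y => `|c y|)) _ _ Ig).
    by apply: measurable_Rint; apply: kermeasM; [exact: kermeas_sin|apply: kermeas_snd; exact: intg_meas Ic].
  move=> x; apply: L1le_Rintegral; rewrite -[X in L1le _ _ X]mul1r.
  exact: (L1leM ler01 (measurable_trig x).2 (fun y => sin_le1 _) (intg_L1le Ic)).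
Qed.

Lemma ct_laplace (b : R) y : 0 < b ->
  ct (fun x => laplace (b^-1 *: x)) y = 2 ^+ n * wt b y.
Proof.
move=> b0; have bV : b^-1 != 0 by rewrite invr_eq0 gt_eqF.
transitivity (I (fun x => (fun z => laplace z * cos (dotp z (b *: y))) (b^-1 *: x + 0))).
  apply: eq_Rint => x; rewrite addr0 mulrC dotpZr (dotpC _ y) dotpZr mulrA mulfV ?mul1r //.
  by rewrite gt_eqF.
rewrite (Rint_affine 0 bV (intg_laplace_cos (b *: y))).
rewrite Rint_laplace_cos gtr0_norm ?invr_gt0 // exprVn invrK !expr_prod_ord /wt -!big_split /=.
by apply: eq_bigr => i _; rewrite mxE; ring.
Qed.

Lemma laplaceE x : laplace x = expR (- \sum_i `|x ord0 i|).
Proof. by rewrite -sumrN (big_morph _ (@expRD R) (@expR0 R)). Qed.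

Lemma laplace_le1 x : `|laplace x| <= 1.
Proof.
rewrite ger0_norm ?laplace_ge0 // laplaceE expR_le1 // oppr_le0; exact: sumr_ge0.
Qed.

Lemma cvg_laplace x : laplace (k.+1%:R^-1 *: x) @[k --> \oo] --> (1 : R).
Proof.
have -> : (fun k => laplace (k.+1%:R^-1 *: x)) =
    (fun k => expR (- (k.+1%:R^-1 * \sum_i `|x ord0 i|))).
  apply/funext => k; rewrite laplaceE mulr_sumr; congr (expR (- _)).
  by apply: eq_bigr => i _; rewrite mxE normrM gtr0_norm // invr_gt0.
rewrite -[X in _ --> X](@expR0 R); apply: continuous_cvg; first exact: continuous_expR.
rewrite -[X in _ --> X]oppr0; apply: cvgN.
rewrite -[X in _ --> X](mul0r (\sum_i `|x ord0 i|)).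
by apply: cvgMl; exact: cvg_harmonic.
Qed.

(** The inverse Fourier transform of an even real function, whose sine part vanishes. *)
Definition ift psi x : R := (2 * pi) ^- n * ct psi x.

Lemma schR_ct psi : testR psi -> schR (ct psi).
Proof. by move=> tp; rewrite ctE; [apply: schR_tr => //; exact: testR0|exact: testR_intg]. Qed.

Lemma schR_ift psi : testR psi -> schR (ift psi).
Proof. by move=> tp; apply: schRZ; exact: schR_ct. Qed.

Lemma intg_wt1 : intg mu (@wt R n 1).
Proof.
have := L1le_intg (@L1le_wt R n 1 0 ltr01); congr intg.
by apply/funext => x; rewrite subr0.
Qed.

(** Inversion at the origin. The factor laplace(x/(k+1)) is inserted in the integral and transposed
    onto [psi], where it becomes a concentrating weight [wt]; the two limits in k are compared. *)
Lemma Rint_ift psi : testR psi -> I (ift psi) = psi 0.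
Proof.
move=> tp; have Ip := testR_intg tp; have Ii := schR_intg (schR_ift tp).
have mL k : measurable_fun setT (fun x : pt => laplace (k.+1%:R^-1 *: x)).
  by apply: (measurableT_comp (@measurable_laplace R n)); exact: measurable_rowZ.
have H1 : I (fun x => laplace (k.+1%:R^-1 *: x) * ift psi x) @[k --> \oo] --> I (ift psi).
  apply: (@Rint_dct _ _ (fun x => `|ift psi x|)).
  - by move=> k; apply: measurable_funM => //; exact: intg_meas Ii.
  - exact: intg_abs.
  - by move=> k x; rewrite normrM ler_piMl // laplace_le1.
  - by move=> x; rewrite -[X in _ --> X]mul1r; apply: cvgMl; exact: cvg_laplace.
have pi0 : (pi : R) != 0 by rewrite gt_eqF // pi_gt0.
have H2 k : I (fun x => laplace (k.+1%:R^-1 *: x) * ift psi x) =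
    pi ^- n * I (fun y => psi (k.+1%:R^-1 *: y) * wt 1 y).
  have k0 : 0 < k.+1%:R :> R by [].
  have IL : intg mu (fun x : pt => laplace (k.+1%:R^-1 *: x)).
    have := intg_affine 0 (c := k.+1%:R^-1) _ (L1le_intg (@L1le_laplace R n)).
    by rewrite invr_eq0 gt_eqF //; under eq_fun do rewrite addr0; exact.
  rewrite /ift ctE //.
  under eq_Rint do rewrite mulrCA.
  rewrite RintZl; last first.
    apply: (intgM (c := 1)) => //; first by move=> x; exact: laplace_le1.
    by rewrite -ctE //; exact: schR_intg (schR_ct tp).
  rewrite parseval_tr //; last exact: L1le_intg (L1le0 _).
  rewrite [X in _ + X](_ : _ = 0) ?addr0; last first.
    by rewrite (@eq_Rint _ _ _ _ _ (fun=> 0)) ?/Rintegral ?integral0 // => y; rewrite mulr0.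
  under eq_Rint do rewrite ct_laplace // -mulrA.
  have Iw : intg mu (fun y => psi (k.+1%:R^-1 *: y) * wt 1 y).
    have [B HB] := testR_bounded tp; apply: (intgM (c := B)) => //.
      by apply: (measurableT_comp (smoothR_measurable tp.1)); exact: measurable_rowZ.
    exact: intg_wt1.
  have wE y : wt k.+1%:R y = k.+1%:R ^+ n * wt 1 (k.+1%:R *: y) :> R.
    by rewrite /wt expr_prod_ord -big_split; apply: eq_bigr => i _ /=; rewrite mxE mul1r mul1r.
  have -> : (fun y => 2 ^+ n * (wt k.+1%:R y * psi y)) = fun y => 2 ^+ n *
      dil k.+1%:R (fun y => psi (k.+1%:R^-1 *: y) * wt 1 y) y.
    apply/funext => y; rewrite /dil wE scalerA mulVf ?gt_eqF // scale1r.
    by congr (_ * _); rewrite -mulrA; congr (_ * _); rewrite mulrC.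
  rewrite RintZl; last by apply: L1le_intg; apply: L1le_dil => //; exact: intg_L1le Iw.
  rewrite Rint_dil // mulrA; congr (_ * _).
  by rewrite exprMn invfM mulrAC mulVf ?mul1r // expf_neq0 // pnatr_eq0.
have H3 : I (fun x => laplace (k.+1%:R^-1 *: x) * ift psi x) @[k --> \oo] --> psi 0.
  under eq_fun do rewrite H2.
  have -> : psi 0 = pi ^- n * I (fun y => psi 0 * wt 1 y).
    have Iw := intg_wt1.
    have E : I (@wt R n 1) = pi ^+ n; last first.
      by rewrite RintZl // E mulrCA mulVf ?mulr1 // expf_neq0.
    apply: EFin_inj; rewrite EFin_Rint // -(@integral_wt R n 1 0 ltr01).
    by apply: eq_integral => x _; rewrite subr0.
  apply: cvgMr; have [B HB] := testR_bounded tp.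
  apply: (@Rint_dct _ _ (fun y => B * wt 1 y)).
  - move=> k; apply: measurable_funM; last exact: measurable_wt.
    by apply: (measurableT_comp (smoothR_measurable tp.1)); exact: measurable_rowZ.
  - by apply: intgZ; exact: intg_wt1.
  - by move=> k x; rewrite normrM (ger0_norm (wt_ge0 _ ler01)) ler_wpM2r // wt_ge0.
  - move=> x; apply: cvgMl; apply: continuous_cvg; first exact: smoothR_continuous tp.1 0.
    rewrite -[X in _ --> X](scale0r x); apply: cvgZr_tmp; exact: cvg_harmonic.
by rewrite -(cvg_lim (@Rhausdorff R) H1) (cvg_lim (@Rhausdorff R) H3).
Qed.

Definition evenf f := forall x, f (- x) = f x.

Lemma st_even f x : evenf f -> intg mu f -> st f x = 0.
Proof.
move=> ef If; have m := intg_meas (intg_sin x If).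
have := Rint_reflect 0 m; rewrite -/(st f x) => H; suff: st f x = - st f x by lra.
rewrite -{1}H -[RHS]mulN1r -RintZl; last exact: intg_sin.
by apply: eq_Rint => y; rewrite sub0r dotpNr sinN ef mulN1r mulNr.
Qed.

(** Inversion at [y] is inversion at the origin for the sum of the two translates psi(. + y) and
    psi(. - y): its cosine transform is 2 cos(y.x) times that of [psi], the sine terms cancelling,
    and its value at 0 is 2 psi(y) by evenness. *)
Lemma ct_ift psi y : testR psi -> evenf psi -> ct (ift psi) y = psi y.
Proof.
move=> tp ep; have Ip := testR_intg tp.
have ta z : testR (fun x => psi (x + z)).
  by have := testR_affine z (oner_neq0 R) tp; under eq_fun do rewrite scale1r.
pose th x := psi (x + y) + psi (x - y).
have tth : testR th by exact: testRD.
have : I (ift th) = 2 * psi y.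
  by rewrite Rint_ift // /th add0r sub0r ep; ring.
have shift x z : ct (fun w => psi (w + z)) x = I (fun w => cos (dotp x (w - z)) * psi w).
  rewrite /ct -(Rint_shift z (f := fun w => cos (dotp x (w - z)) * psi w)).
    by apply: eq_Rint => w; rewrite addrK.
  apply: measurable_funM; last exact: intg_meas Ip.
  by apply: (measurableT_comp (measurable_trig x).1); exact: measurable_rowB.
have Isx x z : intg mu (fun w => cos (dotp x (w - z)) * psi w).
  apply: (intgM (c := 1)) => // [|w]; last exact: cos_le1.
  by apply: (measurableT_comp (measurable_trig x).1); exact: measurable_rowB.
have -> : I (ift th) = I (fun x => 2 * (cos (dotp y x) * ift psi x)).
  apply: eq_Rint => x; rewrite /ift.
  have -> : ct th x = 2 * (cos (dotp y x) * ct psi x).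
    transitivity (ct (fun w => psi (w + y)) x + ct (fun w => psi (w - y)) x).
      rewrite /ct -RintD; [|exact: intg_cos (testR_intg (ta y))|exact: intg_cos (testR_intg (ta (- y)))].
      by apply: eq_Rint => w; rewrite -mulrDr.
    rewrite !shift -RintD // /ct mulrA -RintZl; last exact: intg_cos.
    apply: eq_Rint => w; rewrite !dotpDr !dotpNr opprK !cosD cosN sinN (dotpC y); ring.
  by ring.
rewrite RintZl; last by apply: intg_cos; exact: schR_intg (schR_ift tp).
by move=> E; apply: (mulfI (x := 2)).
Qed.

Lemma ift_even psi : evenf (ift psi).
Proof.
move=> x; rewrite /ift /ct; congr (_ * _); apply: eq_Rint => y.
by rewrite dotpNl cosN.
Qed.

(** The addition formula and Parseval; evenness kills the sine transform of the second factor and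
    turns its cosine transform into [psi2]. *)
Lemma cv_ift psi1 psi2 : testR psi1 -> testR psi2 -> evenf psi2 ->
  cv (ift psi1) (ift psi2) = ift (fun y => psi1 y * psi2 y).
Proof.
move=> t1 t2 e2; apply/funext => x.
have Ii2 := schR_intg (schR_ift t2).
have tt (h : pt -> R) : smoothR h -> testR (fun y => h y * psi1 y) by move=> sh; exact: testRM.
have sc : smoothR (fun y => cos (dotp x y)).
  by have := smoothR_trigf x 1 0; congr smoothR; apply/funext => y; rewrite /trigf mul1r mul0r addr0.
have ss : smoothR (fun y => sin (dotp x y)).
  by have := smoothR_trigf x 0 1; congr smoothR; apply/funext => y; rewrite /trigf mul1r mul0r add0r.
have Ic := testR_intg (tt _ sc); have Is := testR_intg (tt _ ss).
transitivity ((2 * pi) ^- n * I (fun y => ift psi2 y *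
    tr (fun w => cos (dotp x w) * psi1 w) (fun w => sin (dotp x w) * psi1 w) y)).
  rewrite -RintZl; last first.
    have [B HB] := schR_bounded (schR_ift t2).
    apply: (intgM (c := B)) => //; first exact: schR_measurable (schR_ift t2).
    by apply: schR_intg; apply: schR_tr; exact: tt.
  apply: eq_Rint => y; rewrite {1}/ift.
  have -> : ct psi1 (x - y) = tr (fun w => cos (dotp x w) * psi1 w) (fun w => sin (dotp x w) * psi1 w) y.
    rewrite tr_ct // /ct /st -RintD; [|exact: intg_cos|exact: intg_sin].
    apply: eq_Rint => w; rewrite (dotpC (x - y)) dotpDr dotpNr cosD cosN sinN !(dotpC w); ring.
  by ring.
rewrite parseval_tr //; congr (_ * _).
rewrite [X in _ + X](_ : _ = 0) ?addr0; last first.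
  rewrite (@eq_Rint _ _ _ _ _ (fun=> 0)) ?/Rintegral ?integral0 // => y.
  by rewrite st_even ?mul0r //; exact: ift_even.
by apply: eq_Rint => y; rewrite ct_ift //; ring.
Qed.

Lemma ift_dil psi (a : R) : 0 < a -> testR psi ->
  ift (fun y => psi (a^-1 *: y)) = dil a (ift psi).
Proof.
move=> a0 tp; apply/funext => x; have aV : a^-1 != 0 by rewrite invr_eq0 gt_eqF.
rewrite /dil /ift mulrCA; congr (_ * _).
transitivity (I (fun y => (fun z => cos (dotp (a *: x) z) * psi z) (a^-1 *: y + 0))).
  apply: eq_Rint => y; rewrite addr0 dotpZr (dotpC (a *: x)) dotpZr mulrA mulVf ?gt_eqF // mul1r.
  by rewrite dotpC.
rewrite (Rint_affine 0 aV (intg_cos (a *: x) (testR_intg tp))).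
by rewrite gtr0_norm ?invr_gt0 // exprVn invrK.
Qed.

End Inversion.

(** * Sequences indexed by the integers *)

Section IntSums.
Context {R : realType}.
Implicit Types (t b : int -> R) (k j : int).

(** As [Negz i] is -(i+1), the partial sum runs over -n <= k < n. *)
Definition zsum t (n : nat) : R := \sum_(i < n) (t (Posz i) + t (Negz i)).
Definition zlim t : R := lim (zsum t n @[n --> \oo]).

Lemma zsumD t t' n : zsum (fun k => t k + t' k) n = zsum t n + zsum t' n.
Proof. by rewrite /zsum -big_split; apply: eq_bigr => i _ /=; rewrite addrACA. Qed.

Lemma zsumZ (c : R) t n : zsum (fun k => c * t k) n = c * zsum t n.
Proof. by rewrite /zsum mulr_sumr; apply: eq_bigr => i _; rewrite mulrDr. Qed.

Lemma eq_zsum t t' n : t =1 t' -> zsum t n = zsum t' n.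
Proof. by move=> E; apply: eq_bigr => i _; rewrite !E. Qed.

Lemma le_zsum t t' n : (forall k, t k <= t' k) -> zsum t n <= zsum t' n.
Proof. by move=> H; apply: ler_sum => i _; rewrite lerD. Qed.

Lemma zsum_ge0 t n : (forall k, 0 <= t k) -> 0 <= zsum t n.
Proof. by move=> H; apply: sumr_ge0 => i _; rewrite addr_ge0. Qed.

Lemma norm_zsum t n : `|zsum t n| <= zsum (fun k => `|t k|) n.
Proof.
apply: le_trans (ler_norm_sum _ _ _) _; apply: ler_sum => i _; exact: ler_normD.
Qed.

Lemma zsumS t n : zsum t n.+1 = zsum t n + (t (Posz n) + t (Negz n)).
Proof. by rewrite /zsum big_ord_recr. Qed.

Lemma zsum_swap (c : int -> int -> R) n n' :
  zsum (fun j => zsum (c j) n) n' = zsum (fun k => zsum (c^~ k) n') n.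
Proof.
rewrite /zsum; under eq_bigr do rewrite -big_split /=.
rewrite exchange_big /=; apply: eq_bigr => i _; rewrite -big_split /=.
by apply: eq_bigr => i' _; rewrite addrACA.
Qed.

Lemma zlim_cvg t (B : R) : (forall n, zsum (fun k => `|t k|) n <= B) ->
  zsum t n @[n --> \oo] --> zlim t.
Proof.
move=> H; pose w i := t (Posz i) + t (Negz i).
have E : zsum t = series w.
  by apply/funext => n; rewrite /zsum /series /= big_mkord.
suff : cvgn (series w) by rewrite /zlim E.
apply: normed_cvg; apply: (@series_le_cvg _ _ (fun i => `|t (Posz i)| + `|t (Negz i)|)) => //.
- by move=> i /=.
- by move=> i; exact: ler_normD.
apply: nondecreasing_is_cvgn.
  apply/nondecreasing_seqP => i; rewrite /series /= big_nat_recr //= lerDl.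
  by rewrite addr_ge0.
exists B => _ [m _ <-]; rewrite /series /= big_mkord; exact: H.
Qed.

Lemma zlim_unique t l : zsum t n @[n --> \oo] --> l -> zlim t = l.
Proof. by move=> H; apply: cvg_lim. Qed.

Lemma zlim_le t (B : R) : (forall n, zsum (fun k => `|t k|) n <= B) -> `|zlim t| <= B.
Proof.
move=> H; have /cvg_norm C := zlim_cvg H.
rewrite -(cvg_lim _ C) //; apply: limr_le; first by apply/cvg_ex; exists `|zlim t|.
by apply: nearW => n; apply: le_trans (norm_zsum t n) (H n).
Qed.

Lemma zsum_le_zlim t (B : R) : (forall k, 0 <= t k) -> (forall n, zsum t n <= B) ->
  forall n, zsum t n <= zlim t.
Proof.
move=> t0 H n.
have H' m : zsum (fun k => `|t k|) m <= B.
  by rewrite (@eq_zsum _ t) // => k; rewrite ger0_norm.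
have C := zlim_cvg H'; rewrite -(cvg_lim _ C) //.
apply: limr_ge; first by apply/cvg_ex; exists (zlim t).
exists n => // m /= nm; rewrite /zsum -!(big_mkord xpredT (fun i => t (Posz i) + t (Negz i))).
rewrite [leRHS](@big_cat_nat _ _ _ n) //= lerDl; apply: sumr_ge0 => i _; exact: addr_ge0.
Qed.

Lemma zlimD t t' (B B' : R) : (forall n, zsum (fun k => `|t k|) n <= B) ->
  (forall n, zsum (fun k => `|t' k|) n <= B') ->
  zlim (fun k => t k + t' k) = zlim t + zlim t'.
Proof.
move=> H H'; apply: zlim_unique; under eq_fun do rewrite zsumD.
by apply: cvgD; [exact: zlim_cvg H|exact: zlim_cvg H'].
Qed.

Lemma zlimZ (c : R) t (B : R) : (forall n, zsum (fun k => `|t k|) n <= B) ->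
  zlim (fun k => c * t k) = c * zlim t.
Proof.
move=> H; apply: zlim_unique; under eq_fun do rewrite zsumZ.
by apply: cvgMr; exact: zlim_cvg H.
Qed.

Lemma zsum0 n : zsum (fun=> 0) n = 0.
Proof. by apply: big1 => i _; rewrite addr0. Qed.

Lemma zlim0 : zlim (fun=> 0) = 0.
Proof.
by apply: zlim_unique; under eq_fun do rewrite zsum0; exact: cvg_cst.
Qed.

(* [2 ^ (- x |k|)] *)
Definition geo (x : R) k : R := expR (- (x * `|k%:~R| * ln 2)).

Lemma geo_gt0 x k : 0 < geo x k. Proof. exact: expR_gt0. Qed.

Lemma ln2_gt0 : 0 < ln 2 :> R. Proof. by rewrite ln_gt0 // ltr1n. Qed.

Lemma geoE x k : geo x k = expR (- (x * ln 2)) ^+ `|k|%N.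
Proof.
rewrite /geo -expRM_natl; congr expR; rewrite -intr_norm -abszE.
by rewrite natr_absz; ring.
Qed.

Lemma sum_expr_dist (r : R) (c : int) n : 0 < r < 1 ->
  \sum_(i < n) r ^+ `|c - Posz i|%N <= 2 / (1 - r).
Proof.
move=> /andP[r0 r1]; have d0 : 0 < 1 - r by rewrite subr_gt0.
have G m : \sum_(i < m) r ^+ i <= 1 / (1 - r).
  have -> : \sum_(i < m) r ^+ i = (1 - r ^+ m) / (1 - r).
    elim: m => [|m IH]; first by rewrite big_ord0 expr0 subrr mul0r.
    by rewrite big_ord_recr /= IH exprS; field; rewrite gt_eqF.
  by rewrite ler_wpM2r ?invr_ge0 ?(ltW d0) // gerBl exprn_ge0 // ltW.
have r1' e : r ^+ e <= 1 by rewrite exprn_ile1 // ltW.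
(* The term r^e in the numerator is what lets the induction pass from [e] to [e + 1]: moving the
   centre one step to the right adds r^(e+1) to the sum and r^e to the bound. *)
have H (e m : nat) : \sum_(i < m) r ^+ `|Posz e - Posz i|%N <= (2 - r ^+ e) / (1 - r).
  elim: e m => [|e IH] m.
    rewrite expr0 (_ : 2 - 1 = 1); last by ring.
    by under eq_bigr do rewrite sub0r abszN; exact: G.
  case: m => [|m].
    rewrite big_ord0 divr_ge0 ?(ltW d0) // subr_ge0.
    by apply: le_trans (r1' _) _; rewrite ler1n.
  have -> : \sum_(i < m.+1) r ^+ `|Posz e.+1 - Posz i|%N =
      r ^+ e.+1 + \sum_(i < m) r ^+ `|Posz e - Posz i|%N.
    rewrite (big_ord_recl m (fun i : 'I_m.+1 => r ^+ `|Posz e.+1 - Posz i|%N)) /=.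
    rewrite addn0; congr (_ + _).
    apply: eq_bigr => i _; congr (_ ^+ `|_|%N).
    by rewrite /fintype.bump /= add1n !intS; ring.
  apply: (@le_trans _ _ (r ^+ e.+1 + (2 - r ^+ e) / (1 - r))); first by rewrite lerD2l.
  rewrite -subr_ge0 (_ : _ - _ = r ^+ e * (1 - r)); first by rewrite mulr_ge0 ?exprn_ge0 ?ltW.
  by rewrite exprS; field; rewrite gt_eqF.
case: c => e.
  apply: le_trans (H e n) _; rewrite ler_wpM2r ?invr_ge0 ?(ltW d0) //.
  by rewrite gerBl exprn_ge0 // ltW.
apply: (@le_trans _ _ (\sum_(i < n) r ^+ i)).
  apply: ler_sum => i _; rewrite NegzE -opprD abszN -PoszD absz_nat exprD.
  by rewrite ler_piMl // exprn_ge0 // ltW.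
by apply: le_trans (G n) _; rewrite ler_wpM2r ?invr_ge0 ?(ltW d0) // ler1n.
Qed.

Definition geoC (x : R) : R := 4 / (1 - expR (- (x * ln 2))).

Lemma geoC_gt0 (x : R) : 0 < x -> 0 < geoC x.
Proof.
move=> x0; rewrite divr_gt0 // subr_gt0 -[ltRHS](@expR0 R) ltr_expR oppr_lt0.
by rewrite mulr_gt0 // ln2_gt0.
Qed.

Lemma zsum_geo x j n : 0 < x -> zsum (fun k => geo x (j - k)) n <= geoC x.
Proof.
move=> x0; set r := expR (- (x * ln 2)).
have r01 : 0 < r < 1.
  by rewrite expR_gt0 -[ltRHS](@expR0 R) ltr_expR oppr_lt0 mulr_gt0 // ln2_gt0.
rewrite /zsum big_split /= (_ : geoC x = 2 / (1 - r) + 2 / (1 - r)); last first.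
  by rewrite -mulrDl -natrD.
apply: lerD.
  by under eq_bigr do rewrite geoE -/r; exact: sum_expr_dist.
under eq_bigr do rewrite geoE -/r.
(* The distance from j to [Negz i] is |j + 1 + i|, which is the distance from -j - 1 to i. *)
apply: le_trans (sum_expr_dist (- j - 1) n r01); apply: ler_sum => i _.
rewrite le_eqVlt; apply/orP; left; apply/eqP; congr (_ ^+ _).
by rewrite -abszN NegzE intS; congr (`|_|%N); ring.
Qed.

Lemma zsum_geo0 x n : 0 < x -> zsum (geo x) n <= geoC x.
Proof.
move=> /(zsum_geo 0 n); rewrite (@eq_zsum _ (geo x)) // => k.
by rewrite sub0r /geo rmorphN normrN.
Qed.

Lemma geoN x k : geo x (- k) = geo x k.
Proof. by rewrite /geo rmorphN normrN. Qed.

Lemma zsum_geo_col x k n : 0 < x -> zsum (fun j => geo x (j - k)) n <= geoC x.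
Proof.
move=> x0; rewrite (@eq_zsum _ (fun j => geo x (k - j))); first exact: zsum_geo.
by move=> j; rewrite -geoN opprB.
Qed.

Lemma zsum_geoM x t (B : R) n : 0 < x -> (forall k, `|t k| <= B * geo x k) ->
  zsum (fun k => `|t k|) n <= B * geoC x.
Proof.
move=> x0 H; have B0 : 0 <= B.
  by rewrite -(pmulr_lge0 _ (geo_gt0 x 0)); apply: le_trans (H 0).
apply: le_trans (le_zsum _ H) _; rewrite zsumZ ler_wpM2l //; exact: zsum_geo0.
Qed.

(** Convolution on the integers with the summable weight [geo x], hence bounded on every l^q. *)
Definition gconv x b j : R := zlim (fun k => geo x (j - k) * b k).

Lemma gconv_bound x b (B : R) j n : 0 < x -> (forall k, 0 <= b k <= B) ->
  zsum (fun k => `|geo x (j - k) * b k|) n <= geoC x * B.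
Proof.
move=> x0 bB; apply: (@le_trans _ _ (zsum (fun k => B * geo x (j - k)) n)).
  apply: le_zsum => k; have /andP[b0 bk] := bB k.
  by rewrite ger0_norm ?mulr_ge0 ?(ltW (geo_gt0 _ _)) // mulrC ler_wpM2r ?(ltW (geo_gt0 _ _)).
have B0 : 0 <= B by have /andP[] := bB 0; exact: le_trans.
by rewrite zsumZ mulrC ler_wpM2r //; exact: zsum_geo.
Qed.

Lemma gconv_ge0 x b (B : R) j : 0 < x -> (forall k, 0 <= b k <= B) -> 0 <= gconv x b j.
Proof.
move=> x0 bB.
have H0 k : 0 <= geo x (j - k) * b k by rewrite mulr_ge0 ?(ltW (geo_gt0 _ _)) //; case/andP: (bB k).
apply: le_trans (@zsum_le_zlim _ (geoC x * B) H0 _ 0%N); first by rewrite /zsum big_ord0.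
move=> n; apply: le_trans _ (gconv_bound j n x0 bB); apply: le_zsum => k; exact: ler_norm.
Qed.

Lemma gconv_le x b (B : R) j : 0 < x -> (forall k, 0 <= b k <= B) -> gconv x b j <= geoC x * B.
Proof.
move=> x0 bB; apply: le_trans (ler_norm _) _; apply: zlim_le => n.
exact: gconv_bound.
Qed.

(** The convex function y^r lies above its tangent at [z]; obtained here from Young's inequality. *)
Lemma tangent_powR (r y z : R) : 1 <= r -> 0 <= y -> 0 <= z ->
  r * (y * z `^ (r - 1)) <= y `^ r + (r - 1) * z `^ r.
Proof.
move=> r1 y0 z0; have r0 : 0 < r by exact: lt_le_trans r1.
have [->|rn] := eqVneq r 1.
  by rewrite subrr powRr0 mul0r addr0 !mul1r mulr1 powRr1.
have r1' : 0 < r - 1 by rewrite subr_gt0 lt_def rn.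
have q0 : 0 < r / (r - 1) by rewrite divr_gt0.
have pq : r^-1 + (r / (r - 1))^-1 = 1 by field; rewrite !gt_eqF.
have := conjugate_powR y0 (powR_ge0 z (r - 1)) r0 q0 pq.
rewrite -powRrM mulrCA divff ?gt_eqF // mulr1 invf_div => H.
move: H; rewrite -(ler_pM2l r0) => /le_trans; apply.
rewrite le_eqVlt; apply/orP; left; apply/eqP; field.
by rewrite !gt_eqF.
Qed.

Lemma jensen_zsum (c b : int -> R) (r A : R) n : 1 <= r -> 0 < A ->
  (forall k, 0 <= c k) -> (forall k, 0 <= b k) -> zsum c n <= A ->
  zsum (fun k => c k * b k) n `^ r <= A `^ (r - 1) * zsum (fun k => c k * b k `^ r) n.
Proof.
move=> r1 A0 c0 b0 cA; have r0 : 0 < r by exact: lt_le_trans r1.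
set a := zsum _ n; have a0 : 0 <= a by apply: zsum_ge0 => k; rewrite mulr_ge0.
(* The tangent is taken at the mean a/A; summing the tangent inequalities against the weights gives
   A z^r below the right-hand sum. *)
pose z := a / A; have z0 : 0 <= z by rewrite divr_ge0 // ltW.
have H : r * (a * z `^ (r - 1)) <= zsum (fun k => c k * b k `^ r) n + (r - 1) * z `^ r * A.
  apply: (@le_trans _ _ (zsum (fun k => c k * b k `^ r) n + (r - 1) * z `^ r * zsum c n)); last first.
    by rewrite lerD2l ler_wpM2l // mulr_ge0 ?powR_ge0 // subr_ge0.
  rewrite mulrCA mulrC -(zsumZ (r * z `^ (r - 1))) -(zsumZ ((r - 1) * z `^ r)) -zsumD.
  apply: le_zsum => k.
  rewrite (_ : r * z `^ (r - 1) * _ = c k * (r * (b k * z `^ (r - 1)))); last by ring.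
  by rewrite [leRHS](_ : _ = c k * (b k `^ r + (r - 1) * z `^ r)) ?ler_wpM2l ?tangent_powR //; ring.
have zr : z `^ r = z * z `^ (r - 1).
  have e : 1 + (r - 1) = r by ring.
  transitivity (z `^ (1 + (r - 1))); first by rewrite e.
  by rewrite (@powRD R z 1 (r - 1)) ?e ?(gt_eqF r0) // powRr1.
have aE : a = A * z by rewrite /z mulrC divfK // gt_eqF.
have H2 : A * z `^ r <= zsum (fun k => c k * b k `^ r) n.
  move: H; rewrite aE zr; lra.
rewrite {1}aE powRM ?(ltW A0) //; apply: le_trans _ (ler_wpM2l (powR_ge0 A (r - 1)) H2).
by rewrite mulrA -{3}(powRr1 (ltW A0)) -powRD ?subrK // (gt_eqF A0) implybT.
Qed.

(** Schur's test on the integers, first for finite sections of the matrix [geo x (j - k)] and then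
    in the limit. *)
Lemma gconv_lr (x : R) b (B r S : R) n : 0 < x -> 1 <= r -> (forall k, 0 <= b k <= B) ->
  (forall m, zsum (fun k => b k `^ r) m <= S) ->
  zsum (fun j => gconv x b j `^ r) n <= geoC x `^ r * S.
Proof.
move=> x0 r1 bB bS; have r0 : 0 < r by exact: lt_le_trans r1.
have b0 k : 0 <= b k by case/andP: (bB k).
have C0 := geoC_gt0 x0.
have cv j : zsum (fun k => geo x (j - k) * b k) m @[m --> \oo] --> gconv x b j.
  exact: (zlim_cvg (fun m => gconv_bound j m x0 bB)).
have L : zsum (fun j => zsum (fun k => geo x (j - k) * b k) m `^ r) n @[m --> \oo] -->
    zsum (fun j => gconv x b j `^ r) n.
  have H j : zsum (fun k => geo x (j - k) * b k) m `^ r @[m --> \oo] --> gconv x b j `^ r.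
    apply: cvg_powR => //; last exact: gconv_ge0 bB.
    by move=> m; apply: zsum_ge0 => k; rewrite mulr_ge0 ?(ltW (geo_gt0 _ _)).
  elim: n => [|n IH]; first by rewrite /zsum; under eq_fun do rewrite big_ord0; rewrite big_ord0; exact: cvg_cst.
  by rewrite zsumS; under eq_fun do rewrite zsumS; apply: cvgD => //; exact: cvgD.
rewrite -(cvg_lim _ L) //; apply: limr_le; first by apply/cvg_ex; eexists; exact: L.
apply: nearW => m.
apply: (@le_trans _ _ (zsum (fun j => geoC x `^ (r - 1) * zsum (fun k => geo x (j - k) * b k `^ r) m) n)).
  apply: le_zsum => j; apply: jensen_zsum => //; last exact: zsum_geo.
  by move=> k; exact: ltW (geo_gt0 _ _).
rewrite zsumZ zsum_swap.
have -> : geoC x `^ r = geoC x `^ (r - 1) * geoC x.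
  by rewrite -{3}(powRr1 (ltW C0)) -powRD ?subrK // (gt_eqF C0) implybT.
rewrite -mulrA ler_wpM2l ?powR_ge0 //.
apply: (@le_trans _ _ (zsum (fun k => geoC x * b k `^ r) m)).
  apply: le_zsum => k; rewrite (@eq_zsum _ (fun j => b k `^ r * geo x (j - k))); last first.
    by move=> j; rewrite mulrC.
  rewrite zsumZ mulrC ler_wpM2r ?powR_ge0 //; exact: zsum_geo_col.
by rewrite zsumZ ler_wpM2l // ltW.
Qed.

End IntSums.

(** * Powers of two and the exponents of the frequency sums *)

Section Weights.
Context {R : realType}.
Local Notation l2 := (ln (2 : R)).
Implicit Types (k j : int) (s al ka b : R).

Definition p2 k : R := 2 ^ k.
Definition ps s k : R := 2 `^ (k%:~R * s).

Lemma psE s k : ps s k = expR (k%:~R * s * l2).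
Proof. by rewrite /ps /powR pnatr_eq0. Qed.

Lemma p2E k : p2 k = expR (k%:~R * l2).
Proof.
by have := psE 1 k; rewrite /ps !mulr1 powR_intmul.
Qed.

Lemma p2_gt0 k : 0 < p2 k. Proof. by rewrite p2E expR_gt0. Qed.

Lemma ps_gt0 s k : 0 < ps s k. Proof. by rewrite psE expR_gt0. Qed.

Lemma psN s k : ps (- s) k = (ps s k)^-1.
Proof. by rewrite !psE -expRN; congr expR; ring. Qed.

Lemma expR_powR (x y : R) : expR x `^ y = expR (y * x).
Proof. by rewrite /powR gt_eqF ?expR_gt0 // expRK. Qed.

Lemma min_expR (x y : R) : Num.min (expR x) (expR y) = expR (Num.min x y).
Proof. by case: (leP x y) => h; [rewrite min_l ?ler_expR|rewrite min_r ?ler_expR ?ltW]. Qed.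

Lemma min1_expR (x y : R) : Num.min 1 (expR x / expR y) = expR (Num.min 0 (x - y)).
Proof. by rewrite -expRN -expRD -min_expR expR0. Qed.

Lemma min1_gt0 (x : R) : 0 < x -> 0 < Num.min 1 x.
Proof. by move=> x0; have [//|_] := leP 1 x. Qed.

Lemma abs_triB (x y : R) : `|x| <= `|y| + `|x - y|.
Proof. by have := ler_normD y (x - y); rewrite addrC subrK addrC. Qed.

(** This is b^(n al - s) times max(b, 1/b)^ka. The first factor is the natural size of the pairing
    with a bump of width 1/b; the second pays for recentring the decay, which takes place around 2^k
    = b, at k = 0. *)
Definition cw (n : nat) al s ka b : R := expR ((n%:R * al - s) * ln b + ka * `|ln b|).

(** In logarithms both sides are piecewise linear in x = ln 2^k. Below ln b the left-hand side
    increases with slope n al - s, and above it decreases with slope s + 1 - al; both are at least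
    [ka], which is how the two ends of the interval for s enter. *)
Lemma core_weight n al s ka b k : 0 <= al <= 1 -> 0 <= ka -> ka <= s + 1 - al ->
  ka <= al - s -> 0 < b ->
  ps (- s) k * ((Num.min (p2 k) b ^+ n.+1) `^ al * (Num.min 1 (b / p2 k)) `^ (1 - al)) <=
  cw n.+1 al s ka b * geo ka k.
Proof.
move=> /andP[a0 a1] k0 k1 k2 b0; rewrite -(lnK b0) /cw expRK /geo psE p2E.
set x := k%:~R * l2; set B := ln b.
rewrite min1_expR min_expR -expRM_natl !expR_powR -!expRD ler_expR.
have -> : k%:~R * - s * l2 = - (s * x) by rewrite /x; ring.
have -> : ka * `|k%:~R| * l2 = ka * `|x|.
  by rewrite /x normrM (ger0_norm (ltW ln2_gt0)) mulrA.
have T := abs_triB x B.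
have n1 : 1 <= n.+1%:R :> R by rewrite ler1n.
have na : al <= n.+1%:R * al by rewrite ler_peMl.
have T' : ka * `|x| <= ka * `|B| + ka * `|x - B| by rewrite -mulrDr ler_wpM2l.
have [xB|Bx] := leP x B.
  rewrite min_l ?subr_ge0 // mulr0 addr0.
  have E : `|x - B| = B - x by rewrite ler0_norm ?opprB // subr_le0.
  have : ka * (B - x) <= (n.+1%:R * al - s) * (B - x).
    by rewrite ler_wpM2r ?subr_ge0 // (le_trans k2) // lerD2r.
  rewrite E in T'; lra.
rewrite min_r ?subr_le0 ?(ltW Bx) //.
have E : `|x - B| = x - B by rewrite gtr0_norm // subr_gt0.
have : ka * (x - B) <= (s + 1 - al) * (x - B) by rewrite ler_wpM2r // subr_ge0 ltW.
rewrite E in T'; lra.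
Qed.

(** The two minima are the row and the column bounds of Schur's test, with the exponents of that
    test. For k > j the decay has rate s + 1 - al, for k < j it has rate al - s. *)
Lemma schur_weight al s ka j k : ka <= s + 1 - al -> ka <= al - s ->
  ps (- s) k * ((Num.min 1 (p2 j / p2 k)) `^ (1 - al) * (Num.min 1 (p2 k / p2 j)) `^ al) <=
  ps (- s) j * geo ka (j - k).
Proof.
move=> k1 k2; rewrite !psE !p2E /geo !min1_expR !expR_powR -!expRD ler_expR rmorphB /=.
set x := j%:~R * l2; set y := k%:~R * l2.
have -> : ka * `|j%:~R - k%:~R| * l2 = ka * `|x - y|.
  by rewrite /x /y -mulrBl normrM (ger0_norm (ltW ln2_gt0)) mulrA.
have -> : k%:~R * - s * l2 = - (s * y) by rewrite /y; ring.
have -> : j%:~R * - s * l2 = - (s * x) by rewrite /x; ring.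
have [xy|yx] := leP x y.
  rewrite (min_r (x := 0)) ?subr_le0 // min_l ?subr_ge0 //.
  rewrite ler0_norm ?subr_le0 //.
  have : ka * (y - x) <= (s + 1 - al) * (y - x) by rewrite ler_wpM2r // subr_ge0.
  lra.
rewrite (min_l (x := 0)) ?subr_ge0 ?(ltW yx) // min_r ?subr_le0 ?(ltW yx) //.
rewrite gtr0_norm ?subr_gt0 //.
have : ka * (x - y) <= (al - s) * (x - y) by rewrite ler_wpM2r // subr_ge0 ltW.
lra.
Qed.

End Weights.

Section LebesgueLp.
Context {R : realType} (n : nat).
Local Notation mu := (leb R n.+1).
Local Notation I f := (Rintegral mu setT f).
Implicit Types (f g : 'rV[R]_n.+1 -> R) (p : \bar R).

Lemma leb_gt0 : (0 < mu setT)%E.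
Proof.
apply: (@lt_le_trans _ _ (lebn n.+1 [set x : 'rV[R]_n.+1 | forall i, x ord0 i \in `[0%R, 1%R]])).
  by rewrite (@lebn_box R n.+1 (fun=> 0) (fun=> 1)) ?lte_fin ?prodr_gt0 // => i _; rewrite subr0.
apply: le_measure => //; rewrite inE.
- rewrite (_ : mkset _ = \bigcap_(i in [set: 'I_n.+1]) (row_coord i @^-1` `[0, 1]%classic)).
    apply: fin_bigcap_measurable => // i _; rewrite -[X in measurable X]setTI.
    by apply: measurable_row_coord => //; exact: measurable_itv.
  by apply/seteqP; split=> x /= H i; [move=> _|]; exact: H.
- exact: measurableT.
Qed.

Lemma alp_ge0_le1 p : (1 <= p)%E -> 0 <= alp p <= 1.
Proof.
case: p => [r| |] //; last by rewrite alp_oo lexx ler01.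
rewrite lee_fin => r1; have r0 : 0 < r by exact: lt_le_trans r1.
by rewrite alp_fin ?gt_eqF // invr_ge0 ltW //= invf_le1.
Qed.

Lemma powR_split (x al : R) : 0 <= x -> x `^ al * x `^ (1 - al) = x.
Proof.
move=> x0; rewrite -(@powRD R x al (1 - al)) addrC subrK ?powRr1 //.
by rewrite oner_eq0.
Qed.

Lemma L1le0_eq f : L1le mu f 0 -> \forall x \ae mu, f x = 0.
Proof.
move=> [mf f0]; have H : (\int[mu]_x `|(f x)%:E| = 0)%E.
  by apply/eqP; rewrite eq_le f0 /=; apply: integral_ge0.
have := (ae_eq_integral_abs mu measurableT (proj2 (measurable_EFinP _ _) mf)).1 H.
by apply: filterS => x /(_ Logic.I) [].
Qed.

(** For A = 0 the function [g] vanishes almost everywhere, which has to be seen directly since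
    A^(1-al) may be the convention 0^0 = 1. *)
Lemma L1le_holder_ge0 p f g (N S A : R) : (1 <= p)%E -> LpB mu p f N ->
  (forall x, `|g x| <= S) -> L1le mu g A ->
  L1le mu (fun x => f x * g x) (N * S `^ alp p * A `^ (1 - alp p)).
Proof.
move=> p1 Hf gS Hg; have A0 := L1le_ge0 Hg.
have [A1|A1] := ltP 0 A; first exact: (L1le_holder leb_gt0).
have N0 := LpB_ge0 Hf.
have AE : A = 0 by apply/eqP; rewrite eq_le A0 A1.
rewrite AE in Hg *; have g0 := L1le0_eq Hg.
split; first by apply: measurable_funM; [exact: Hf.1|exact: Hg.1].
rewrite (@ae_eq_integral _ _ _ mu setT (cst 0%E)) //=.
- by rewrite integral0 lee_fin mulr_ge0 ?powR_ge0 // mulr_ge0 ?powR_ge0.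
- by apply: measurable_abse; apply: measurable_funM; [exact: Hf.1|exact: Hg.1].
- by apply: filterS g0 => x -> _; rewrite mulr0 normr0.
Qed.

End LebesgueLp.

(** * The Littlewood-Paley pairing *)

Section Core.
Context {R : realType} (n : nat).
Local Notation pt := 'rV[R]_n.+1.
Local Notation mu := (leb R n.+1).
Local Notation I f := (Rintegral mu setT f).
Variables (p : \bar R) (s ka : R) (H0 : pt -> R).
Local Notation al := (alp p).
Hypotheses (p1 : (1 <= p)%E) (ka0 : 0 < ka).
Hypotheses (ka1 : ka <= s + 1 - al) (ka2 : ka < al - s).
Hypotheses (sH0 : schR H0) (IH0 : I H0 = 0) (eH0 : evenf H0).
Implicit Types (f : int -> pt -> R) (F G m th A : pt -> R) (b M B : R) (k j : int).

Let ka2' : ka <= al - s. Proof. exact: ltW. Qed.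

Definition hk k := dil (p2 k) H0.

Let C0 := projT1 (cid (schR_ker sH0)).
Let kH0 : ker 1 C0 H0. Proof. exact: projT2 (cid (schR_ker sH0)). Qed.
Let C0_ge0 : 0 <= C0. Proof. exact: ker_ge0 ltr01 kH0. Qed.
Definition coreC : R := C0 * pi ^+ n.+1.

Lemma coreC_ge0 : 0 <= coreC. Proof. by rewrite mulr_ge0 ?exprn_ge0 ?pi_ge0. Qed.

Let khk k : ker (p2 k) C0 (hk k). Proof. exact: ker_dil (p2_gt0 k) kH0. Qed.

Let Ihk k : I (hk k) = 0.
Proof. by rewrite Rint_dil ?p2_gt0 //; exact: schR_intg. Qed.

Let ehk k : evenf (hk k). Proof. by move=> x; rewrite /hk /dil scalerN eH0. Qed.

Let shk k : schR (hk k). Proof. exact: schR_dil (p2_gt0 k) sH0. Qed.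

Lemma hk_sup b M F k x : 0 < b -> BV b M F ->
  `|cv (hk k) F x| <= coreC * M * Num.min (p2 k) b ^+ n.+1.
Proof. by move=> b0; exact: BV_cv_sup (p2_gt0 k) b0 (khk k). Qed.

Lemma hk_L1 b M F k : 0 < b -> BV b M F ->
  L1le mu (cv (hk k) F) (coreC * M * Num.min 1 (b / p2 k)).
Proof. by move=> b0; exact: BV_cv_L1 (p2_gt0 k) b0 (khk k) (Ihk k). Qed.

Definition qterm f F k : R := I (fun z => f k z * cv (hk k) F z).

(* The action on [F], not necessarily smooth, of the distribution whose
   Littlewood-Paley pieces are the [f k]. *)
Definition Q f F : R := zlim (qterm f F).

(** Keeping the sequence of the 2^(ks) |f_k|_p instead of its l^q norm makes the estimates
    independent of q. *)
Definition lpseq f (bb : int -> R) :=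
  forall k, 0 <= bb k /\ LpB mu p (f k) (ps (- s) k * bb k).

(** Hoelder's inequality, the norm of H_k * F in the dual exponent being interpolated between the
    sup and the L^1 bounds; [core_weight] adds up the powers of 2^k. *)
Lemma qterm_L1 f bb b M F k : lpseq f bb -> 0 < b -> BV b M F ->
  L1le mu (fun z => f k z * cv (hk k) F z) (coreC * M * cw n.+1 al s ka b * (bb k * geo ka k)).
Proof.
move=> fb b0 HF; have [bk fk] := fb k; have M0 := BV_ge0 HF.
have := L1le_holder_ge0 p1 fk (fun x => hk_sup k x b0 HF) (hk_L1 k b0 HF).
apply: L1leW; have cM0 : 0 <= coreC * M by rewrite mulr_ge0 // coreC_ge0.
have p0 := p2_gt0 (R := R) k.
have m0 : 0 <= Num.min (p2 k) b by rewrite le_min !ltW.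
have m1 : 0 <= Num.min 1 (b / p2 k) by rewrite le_min ler01 divr_ge0 // ltW.
have := core_weight n k (alp_ge0_le1 p1) (ltW ka0) ka1 ka2' b0.
move: (coreC * M) cM0 => cM cM0.
rewrite !powRM ?exprn_ge0 //.
move/(ler_wpM2l (mulr_ge0 cM0 bk)) => H; rewrite -subr_ge0 -(subr_ge0 (_ * _ * (_ * _))) in H *.
rewrite [X in 0 <= X](_ : _ = cM * bb k * (cw n.+1 al s ka b * geo ka k) -
  (cM `^ al * cM `^ (1 - al)) * bb k * (ps (- s) k * ((Num.min (p2 k) b ^+ n.+1) `^ al *
  Num.min 1 (b / p2 k) `^ (1 - al)))); last by ring.
by rewrite powR_split.
Qed.

Lemma qterm_bound f bb B b M F k : lpseq f bb -> (forall k, bb k <= B) -> 0 < b -> BV b M F ->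
  `|qterm f F k| <= B * (coreC * M * cw n.+1 al s ka b) * geo ka k.
Proof.
move=> fb bB b0 HF; apply: le_trans (L1le_Rintegral (qterm_L1 k fb b0 HF)) _.
rewrite mulrCA [leRHS](_ : _ = B * (coreC * M * cw n.+1 al s ka b * geo ka k)); last by ring.
rewrite ler_wpM2r //.
exact: (mulr_ge0 (mulr_ge0 (mulr_ge0 coreC_ge0 (BV_ge0 HF)) (expR_ge0 _)) (expR_ge0 _)).
Qed.

Definition Qconst B b M : R := B * (coreC * M * cw n.+1 al s ka b) * geoC ka.

Lemma qsum_bound f bb B b M F N : lpseq f bb -> (forall k, bb k <= B) -> 0 < b -> BV b M F ->
  zsum (fun k => `|qterm f F k|) N <= Qconst B b M.
Proof. by move=> fb bB b0 HF; apply: zsum_geoM => // k; exact: qterm_bound fb bB b0 HF. Qed.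

Lemma Q_bound f bb B b M F : lpseq f bb -> (forall k, bb k <= B) -> 0 < b -> BV b M F ->
  `|Q f F| <= Qconst B b M.
Proof. by move=> fb bB b0 HF; apply: zlim_le => N; exact: qsum_bound fb bB b0 HF. Qed.

Lemma Q_cvg f bb B b M F : lpseq f bb -> (forall k, bb k <= B) -> 0 < b -> BV b M F ->
  zsum (qterm f F) N @[N --> \oo] --> Q f F.
Proof. by move=> fb bB b0 HF; apply: (@zlim_cvg _ _ (Qconst B b M)) => N; exact: qsum_bound fb bB b0 HF. Qed.

Lemma intg_cvBV A b M F x : schR A -> BV b M F -> intg mu (fun y => A (x - y) * F y).
Proof. by move=> sA HF; apply: intg_cv_schR => //; case: HF => _ _ /L1le_intg. Qed.

Lemma QD f bb B b M M' F G : lpseq f bb -> (forall k, bb k <= B) -> 0 < b ->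
  BV b M F -> BV b M' G -> Q f (fun x => F x + G x) = Q f F + Q f G.
Proof.
move=> fb bB b0 HF HG.
rewrite -(zlimD (fun N => qsum_bound N fb bB b0 HF) (fun N => qsum_bound N fb bB b0 HG)).
congr zlim; apply/funext => k; rewrite /qterm -RintD.
- apply: eq_Rint => z; rewrite -mulrDr; congr (_ * _); rewrite /cv -RintD.
  + by apply: eq_Rint => y; rewrite mulrDr.
  + exact: intg_cvBV HF.
  + exact: intg_cvBV HG.
- exact: L1le_intg (qterm_L1 k fb b0 HF).
- exact: L1le_intg (qterm_L1 k fb b0 HG).
Qed.

Lemma QZ f bb B b M (c : R) F : lpseq f bb -> (forall k, bb k <= B) -> 0 < b ->
  BV b M F -> Q f (fun x => c * F x) = c * Q f F.
Proof.
move=> fb bB b0 HF.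
rewrite -(zlimZ c (fun N => qsum_bound N fb bB b0 HF)).
congr zlim; apply/funext => k; rewrite /qterm -RintZl; last exact: L1le_intg (qterm_L1 k fb b0 HF).
apply: eq_Rint => z; rewrite mulrCA; congr (_ * _); rewrite /cv -RintZl; last exact: intg_cvBV HF.
by apply: eq_Rint => y; rewrite mulrCA.
Qed.

(** By Fubini, m (A * th) is a superposition of the rough bumps m A(. - x) with weights th(x). *)
Lemma cv_mul_cv H m A th z : schR H -> measurable_fun setT m -> (forall x, `|m x| <= 1) ->
  schR A -> schR th ->
  cv H (fun y => m y * cv A th y) z = I (fun x => cv H (fun y => m y * A (y - x)) z * th x).
Proof.
move=> sH mm m1 sA st.
have mA := schR_measurable sA; have mH := schR_measurable sH; have mth := schR_measurable st.
have [BA HA] := schR_bounded sA; have Ith := schR_intg st.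
have Iz : intg mu (fun y => H (z - y)) by have := L1le_intg (L1le_reflect z (intg_L1le (schR_intg sH))).
pose K y x := H (z - y) * (m y * (A (y - x) * th x)).
have mHz : measurable_fun setT (fun y : pt => H (z - y)) by exact: intg_meas Iz.
have mK : kermeas K.
  apply: kermeasM; first exact: kermeas_fst.
  apply: kermeasM; first exact: kermeas_fst.
  by apply: kermeasM; [exact: kermeas_sub|exact: kermeas_snd].
have I1 y : intg mu (K y).
  by apply: intgZ; apply: intgZ; exact: intg_cv_schR.
have mHm (x : pt) : measurable_fun setT (fun y : pt => m y * A (y - x)).
  apply: measurable_funM => //; apply: (measurableT_comp mA); exact: measurable_rowB.
have BHm (x y : pt) : `|m y * A (y - x)| <= BA.
  by rewrite normrM (le_trans _ (HA (y - x))) // ler_piMl.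
have I2' (x : pt) : intg mu (fun y => H (z - y) * (m y * A (y - x))).
  have := intgM (mHm x) (BHm x) Iz; under eq_fun do rewrite mulrC; exact.
have KE x y : K y x = H (z - y) * (m y * A (y - x)) * th x by rewrite /K; ring.
have I2 x : intg mu (K ^~ x).
  by under eq_fun do rewrite KE; exact: intgZr.
transitivity (I (fun y => I (K y))).
  apply: eq_Rint => y; rewrite /K RintZl; last by apply: intgZ; exact: intg_cv_schR.
  by rewrite RintZl //; exact: intg_cv_schR.
rewrite swap_Rint //.
  apply: eq_Rint => x; rewrite -RintZr //; by apply: eq_Rint => y; rewrite KE.
have BA0 : 0 <= BA by exact: le_trans (HA 0).
have L := L1leZ (BA * I (fun x => `|th x|)) (L1le_abs (intg_L1le Iz)).
apply: le_lt_trans (fubini_lty mK _ L) _; last exact: ltry.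
move=> y; have := L1leZ (H (z - y)) (L1leM BA0 _ (fun x => BHm x y) (intg_L1le Ith)).
have mAy : measurable_fun setT (fun x : pt => m y * A (y - x)).
  by apply: measurable_funM => //; apply: (measurableT_comp mA); exact: measurable_rowB.
move=> /(_ mAy) /(L1le_eq (g := K y)) HL.
have [_] : L1le mu (K y) (`|H (z - y)| * (BA * I (fun x => `|th x|))).
  by apply: HL => x; rewrite KE; ring.
by rewrite mulrC.
Qed.

(** The integral kernel that carries the piece f_k to its contribution to A * (m v), for an even
    kernel [A]. *)
Let Kc m A k (x z : pt) : R := cv (hk k) (fun y => m y * A (y - x)) z.

Let kermeas_Kc m A k : measurable_fun setT m -> schR A -> kermeas (Kc m A k).
Proof.
move=> mm sA; have mA := schR_measurable sA; have mh := schR_measurable (shk k).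
pose K' (q : pt * pt) (y : pt) := hk k (q.2 - y) * (m y * A (y - q.1)).
have mK : kermeas K'.
  apply: kermeasM.
    apply: (measurableT_comp mh); apply: measurable_rowB; last exact: measurable_snd.
    by apply: measurableT_comp; [exact: measurable_snd|exact: measurable_fst].
  apply: kermeasM; first exact: kermeas_snd.
  apply: (measurableT_comp mA); apply: measurable_rowB; first exact: measurable_snd.
  by apply: measurableT_comp; [exact: measurable_fst|exact: measurable_fst].
exact: (measurable_Rint mu mK).
Qed.

Lemma qterm_rep f bb B b M m A th k : lpseq f bb -> (forall k, bb k <= B) -> 0 < b ->
  measurable_fun setT m -> (forall x, `|m x| <= 1) -> schR A -> schR th ->
  (forall x, BV b M (fun y : pt => m y * A (y - x))) ->
  [/\ measurable_fun setT (fun x : pt => qterm f (fun y : pt => m y * A (y - x)) k),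
    intg mu (fun x : pt => qterm f (fun y : pt => m y * A (y - x)) k * th x) &
    qterm f (fun y : pt => m y * cv A th y) k =
    I (fun x : pt => qterm f (fun y : pt => m y * A (y - x)) k * th x)].
Proof.
move=> fb bB b0 mm m1 sA st HF.
have Ith := schR_intg st; have mth := schR_measurable st.
have mf := (fb k).2.1; have mK := kermeas_Kc k mm sA.
pose J (x z : pt) := f k z * Kc m A k x z * th x.
have mJ : kermeas J.
  apply: kermeasM; last exact: kermeas_fst.
  by apply: kermeasM; first exact: kermeas_snd.
pose D : R := coreC * M * cw n.+1 al s ka b * (bb k * geo ka k).
have HL x : L1le mu (fun z => f k z * Kc m A k x z) D by exact: qterm_L1.
have I1 x : intg mu (J x) by apply: intgZr; exact: L1le_intg (HL x).
have HK z : intg mu (fun x => Kc m A k x z * th x).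
  apply: (intgM (c := coreC * M * Num.min (p2 k) b ^+ n.+1)) => //; first exact: (kermeas2 z mK).
  by move=> x; exact: hk_sup.
have I2 z : intg mu (J ^~ z).
  by have := intgZ (f k z) (HK z); congr intg; apply/funext => x; rewrite /J mulrA.
have mq : measurable_fun setT (fun x : pt => qterm f (fun y : pt => m y * A (y - x)) k).
  apply: measurable_Rint; apply: kermeasM => //; exact: kermeas_snd.
split=> //.
  apply: (intgM (c := D)) => // x; exact: L1le_Rintegral (HL x).
transitivity (I (fun z => I (J ^~ z))).
  apply: eq_Rint => z; rewrite cv_mul_cv // -(RintZl _ (HK z)).
  by apply: eq_Rint => x; rewrite /J mulrA.
rewrite -swap_Rint //.
  by apply: eq_Rint => x; rewrite RintZr //; exact: L1le_intg (HL x).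
have L := L1leZ D (L1le_abs (intg_L1le Ith)).
apply: le_lt_trans (fubini_lty mJ _ L) _; last exact: ltry.
move=> x; have := L1leZ (th x) (HL x); rewrite mulrC => -[_].
by under eq_integral => z _ do rewrite mulrC.
Qed.

(** The function x |-> Q(m A(. - x)) represents th |-> Q(m (A * th)). Each frequency is treated by
    Fubini, the series by dominated convergence: the bumps have the same BV bound for all x, so
    [qsum_bound] is uniform in x. *)
Lemma Q_rep f bb B b M m A th : lpseq f bb -> (forall k, bb k <= B) -> 0 < b ->
  measurable_fun setT m -> (forall x, `|m x| <= 1) -> schR A -> schR th ->
  (forall x, BV b M (fun y : pt => m y * A (y - x))) ->
  [/\ measurable_fun setT (fun x : pt => Q f (fun y : pt => m y * A (y - x))),
    intg mu (fun x : pt => Q f (fun y : pt => m y * A (y - x)) * th x) &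
    Q f (fun y : pt => m y * cv A th y) = I (fun x : pt => Q f (fun y : pt => m y * A (y - x)) * th x)].
Proof.
move=> fb bB b0 mm m1 sA st HF.
have Hk k := qterm_rep k fb bB b0 mm m1 sA st HF.
have Ith := schR_intg st.
pose F N (x : pt) := zsum (qterm f (fun y : pt => m y * A (y - x))) N.
have mF N : measurable_fun setT (F N).
  have sumE : F N = \sum_(i < N) (fun x : pt => qterm f (fun y : pt => m y * A (y - x)) (Posz i) +
      qterm f (fun y : pt => m y * A (y - x)) (Negz i)).
    by apply/funext => x; rewrite fct_sumE.
  rewrite sumE; apply: (big_ind (fun h : pt -> R => measurable_fun setT h)) => [|h h' ch ch'|i _].
  - exact: measurable_cst.
  - exact: measurable_funD.
  - by apply: measurable_funD; [have [] := Hk (Posz i)|have [] := Hk (Negz i)].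
have cF x : F N x @[N --> \oo] --> Q f (fun y : pt => m y * A (y - x)) by exact: Q_cvg fb bB b0 (HF x).
have mQ : measurable_fun setT (fun x : pt => Q f (fun y : pt => m y * A (y - x))).
  by apply: (measurable_fun_cvg mF) => x _; exact: cF.
have bQ x : `|Q f (fun y : pt => m y * A (y - x))| <= Qconst B b M by exact: Q_bound fb bB b0 (HF x).
have bF N x : `|F N x| <= Qconst B b M.
  by apply: le_trans (norm_zsum _ _) _; exact: qsum_bound fb bB b0 (HF x).
split=> //; first exact: (intgM mQ bQ Ith).
apply: zlim_unique.
have E N : zsum (qterm f (fun y : pt => m y * cv A th y)) N = I (fun x => F N x * th x).
  elim: N => [|N IH].
    rewrite /zsum big_ord0 /F /Rintegral (eq_integral (cst 0%E)) ?integral0 // => x _.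
    by rewrite /zsum big_ord0 mul0r.
  rewrite zsumS IH; have [_ i1 ->] := Hk (Posz N); have [_ i2 ->] := Hk (Negz N).
  have iF := intgM (mF N) (bF N) Ith.
  rewrite -(RintD i1 i2) -(RintD iF (intgD i1 i2)).
  by apply: eq_Rint => x; rewrite /F zsumS !mulrDl.
under eq_fun do rewrite E.
apply: (@Rint_dct _ _ _ _ (fun x => Qconst B b M * `|th x|)).
- by move=> N; apply: measurable_funM => //; exact: schR_measurable.
- by apply: intgZ; exact: intg_abs.
- by move=> N x; rewrite normrM ler_wpM2r.
- by move=> x; apply: cvgMl; exact: cF.
Qed.

Lemma BV_mul_shift m : multiplier m -> forall A, schR A -> exists2 M, 0 <= M &
  forall a x, 0 < a -> BV a M (fun y : pt => m y * dil a A (y - x)).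
Proof.
move=> /BV_multiplier[C C1 H] A sA; have [S HS] := schR_bump sA.
exists (C * S); first by rewrite mulr_ge0 // (bump_ge0 ltr01 HS).
by move=> a x a0; apply: (H x) => //; exact: bump_dil.
Qed.

(** The off-diagonal estimate: each frequency k contributes through Schur's test for [Kc], and the
    contributions add up to the convolution [gconv]. *)
Lemma Q_Lp m A0 : multiplier m -> schR A0 -> I A0 = 0 -> evenf A0 -> exists2 C, 0 < C &
  forall f bb B j, lpseq f bb -> (forall k, bb k <= B) ->
  LpB mu p (fun x : pt => Q f (fun y : pt => m y * dil (p2 j) A0 (y - x)))
    (C * (ps (- s) j * gconv ka bb j)).
Proof.
move=> Hm sA0 IA0 eA0; have [g [L [mg _ mm m1 _]]] := Hm.
have [M1 M10 HM1] := BV_mul_shift Hm sA0; have [M2 M20 HM2] := BV_mul_shift Hm sH0.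
have [CA kA] := schR_ker sA0; have CA0 := ker_ge0 ltr01 kA.
pose C := 1 + coreC * M1 + CA * pi ^+ n.+1 * M2.
have c1 : 0 <= coreC * M1 by rewrite mulr_ge0 // coreC_ge0.
have c2 : 0 <= CA * pi ^+ n.+1 * M2 by rewrite !mulr_ge0 ?exprn_ge0 ?pi_ge0.
have C_gt0 : 0 < C by rewrite /C -addrA ltr_pwDl // addr_ge0.
exists C => // f bb B j fb bB; set A := dil (p2 j) A0.
have sA : schR A by exact: schR_dil (p2_gt0 j) sA0.
have pj := p2_gt0 (R := R) j.
have HA (x : pt) : BV (p2 j) M1 (fun y : pt => m y * A (y - x)) by exact: HM1.
have HL k : LpB mu p (fun x : pt => qterm f (fun y : pt => m y * A (y - x)) k)
    (C * (ps (- s) j * (geo ka (j - k) * bb k))).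
  have [bk fk] := fb k; have pk := p2_gt0 (R := R) k.
  have mj := min1_gt0 (divr_gt0 pj pk).
  have mk := min1_gt0 (divr_gt0 pk pj).
  have K1 x : L1le mu (Kc m A k x) (C * Num.min 1 (p2 j / p2 k)).
    apply: L1leW (hk_L1 k pj (HA x)).
    by rewrite ler_wpM2r ?(ltW mj) // /C -addrA addrCA lerDl addr_ge0.
  (* As a function of x, the kernel is a convolution of [A] with the bump m H_k(z - .), because both
     kernels are even; the cancellation of [A] now plays the part that the cancellation of H_k plays
     in the rows. *)
  have K2 z : L1le mu (Kc m A k ^~ z) (C * Num.min 1 (p2 k / p2 j)).
    have := BV_cv_L1 pj pk (ker_dil pj kA) _ (HM2 (p2 k) z pk).
    rewrite Rint_dil // => [|]; last exact: schR_intg.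
    move=> /(_ IA0) H; apply: (L1leW (A := CA * pi ^+ n.+1 * M2 * Num.min 1 (p2 k / p2 j))).
      by rewrite ler_wpM2r ?(ltW mk) // /C lerDr addr_ge0.
    apply: L1le_eq H => x; apply: eq_Rint => y; rewrite mulrCA [RHS]mulrCA.
    have -> : dil (p2 k) H0 (y - z) = hk k (z - y) by rewrite -(ehk k) opprB.
    have -> : dil (p2 j) A0 (x - y) = A (y - x) by rewrite /A /dil -opprB scalerN eA0.
    by rewrite [A _ * _]mulrC.
  have := LpB_schur (@leb_gt0 R n) (@leb_gt0 R n) p1 (kermeas_Kc k mm sA) (mulr_gt0 C_gt0 mj) K1 K2 fk.
  have W := schur_weight j k ka1 ka2'.
  move=> H; have -> : (fun x : pt => qterm f (fun y : pt => m y * A (y - x)) k) =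
      fun x => I (fun z => Kc m A k x z * f k z).
    by apply/funext => x; apply: eq_Rint => z; rewrite mulrC.
  apply: LpBW H; rewrite !powRM ?(ltW mj) ?(ltW mk) ?(ltW C_gt0) //.
  move: W => /(ler_wpM2l (mulr_ge0 (ltW C_gt0) bk)) W.
  rewrite -subr_ge0 -(subr_ge0 (_ * _ * (_ * _))) in W *.
  rewrite [X in 0 <= X](_ : _ = C * bb k * (ps (- s) j * geo ka (j - k)) -
    (C `^ al * C `^ (1 - al)) * bb k * (ps (- s) k * (Num.min 1 (p2 j / p2 k) `^ (1 - al) *
    Num.min 1 (p2 k / p2 j) `^ al))); last by ring.
  by rewrite powR_split // ltW.
have bB' k : 0 <= bb k <= B by rewrite bB andbT; case: (fb k).
apply: (@LpB_lim _ _ _ mu (@leb_gt0 R n) _ (fun N (x : pt) => zsum (qterm f (fun y : pt => m y * A (y - x))) N)) => //.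
  move=> N; apply: (@LpBW _ _ _ _ _ _ (C * (ps (- s) j * zsum (fun k => geo ka (j - k) * bb k) N))).
    rewrite ler_wpM2l ?(ltW C_gt0) // ler_wpM2l ?(ltW (ps_gt0 _ _)) //.
    apply: (@zsum_le_zlim _ _ (geoC ka * B)) => [k|N'].
      by rewrite mulr_ge0 ?(ltW (geo_gt0 _ _)) //; case/andP: (bB' k).
    apply: le_trans _ (gconv_bound j N' ka0 bB'); apply: le_zsum => k; exact: ler_norm.
  rewrite -zsumZ -zsumZ /zsum.
  apply: (@LpB_sum _ _ _ mu p _ _ (fun (i : 'I_N) (x : pt) =>
    qterm f (fun y : pt => m y * A (y - x)) (Posz i) +
    qterm f (fun y : pt => m y * A (y - x)) (Negz i))) => // i.
  exact: LpBD.
by move=> x; exact: Q_cvg fb bB pj (HA x).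
Qed.

(** For a < 1 the two terms of [cw] combine into the power a^(n al - s - ka), in dimension n; the
    strict inequality [ka2] makes the exponent positive. *)
Lemma cw_small (e : R) : 0 < e -> exists2 a0, 0 < a0 & forall a, 0 < a -> a <= a0 ->
  cw n.+1 al s ka a <= e.
Proof.
move=> e0; pose g := n.+1%:R * al - s - ka.
have g0 : 0 < g.
  rewrite subr_gt0 (lt_le_trans ka2) // lerD2r ler_peMl ?ler1n //.
  by have /andP[] := alp_ge0_le1 p1.
exists (expR (- `|ln e| / g)); first exact: expR_gt0.
move=> a a0 aa; rewrite -[leRHS](lnK e0) /cw ler_expR.
have la : ln a <= - `|ln e| / g by rewrite -(expRK (- `|ln e| / g)) ler_ln ?posrE ?expR_gt0.
have la0 : ln a <= 0 by apply: le_trans la _; rewrite mulNr oppr_le0 divr_ge0 // ltW.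
rewrite (ler0_norm la0) (_ : _ + _ = ln a * g); last by rewrite /g; ring.
apply: (@le_trans _ _ (- `|ln e|)); last by rewrite lerNl -normrN ler_norm.
by rewrite -ler_pdivlMr.
Qed.

End Core.

Lemma lipschitz_continuous {R : realType} {n : nat} (F : 'rV[R]_n -> R) (K : R) : 0 <= K ->
  (forall x v, `|F (x + v) - F x| <= K * `|v|) -> continuous F.
Proof.
move=> K0 H x; apply/(@cvgrPdist_lt R R 'rV[R]_n (nbhs x) _ F (F x)) => e e0.
have d0 : 0 < e / (K + 1) by rewrite divr_gt0 // ltr_pwDr.
have h : nbhs x [set y : 'rV[R]_n | `|x - y| < e / (K + 1)].
  by apply/(@nbhs_ballP R 'rV[R]_n x); exists (e / (K + 1)) => //= y; rewrite -ball_normE.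
apply: filterS h => y /= xy; rewrite distrC -{1}(subrKC x y).
apply: le_lt_trans (H x (y - x)) _.
apply: (@le_lt_trans _ _ ((K + 1) * `|y - x|)); first by rewrite ler_wpM2r // lerDl.
by rewrite mulrC -ltr_pdivlMr ?ltr_pwDr // distrC.
Qed.

(** * Functions vanishing at infinity *)

Section Vanishing.
Context {R : realType} (n : nat).
Local Notation pt := 'rV[R]_n.+1.
Local Notation mu := (leb R n.+1).
Local Notation I f := (Rintegral mu setT f).
Implicit Types (F G A m th : pt -> R).

(** Continuity is kept apart because m G has jumps along the graph; convolution with a Schwartz
    kernel restores it, see [C0_cv]. *)
Definition vanishR G := [/\ measurable_fun setT G, exists B, forall x, `|G x| <= B &
  forall e : R, 0 < e -> exists M, forall x, M < `|x| -> `|G x| <= e].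

Definition C0R F := continuous F /\ vanishR F.

Lemma vanishRM m G : measurable_fun setT m -> (forall x, `|m x| <= 1) ->
  vanishR G -> vanishR (fun x => m x * G x).
Proof.
move=> mm m1 [mG [B HB] HG]; split; first exact: measurable_funM.
  by exists B => x; rewrite normrM (le_trans _ (HB x)) // ler_piMl.
move=> e /HG[M HM]; exists M => x /HM; rewrite normrM; apply: le_trans.
by rewrite ler_piMl.
Qed.

Lemma vanishRD F G : vanishR F -> vanishR G -> vanishR (fun x => F x + G x).
Proof.
move=> [mF [B HB] HF] [mG [C HC] HG]; split; first exact: measurable_funD.
  by exists (B + C) => x; apply: le_trans (ler_normD _ _) _; exact: lerD.
move=> e e0; have e2 : 0 < e / 2 by rewrite divr_gt0.
have [M HM] := HF _ e2; have [N HN] := HG _ e2.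
exists (Num.max M N) => x; rewrite gt_max => /andP[/HM h1 /HN h2].
by apply: le_trans (ler_normD _ _) _; rewrite [leRHS](splitr e) lerD.
Qed.

Lemma C0RD F G : C0R F -> C0R G -> C0R (fun x => F x + G x).
Proof.
move=> [cF vF] [cG vG]; split; last exact: vanishRD.
by move=> x; apply: (@continuousD _ _ _ F G x); [exact: cF|exact: cG].
Qed.

Lemma schR_vanish G : schR G -> vanishR G.
Proof.
move=> sG; split; [exact: schR_measurable|exact: schR_bounded|].
have [B HB] := sG.2 1%N [::]; move=> e e0; exists (Num.max 0 (B / e)) => x.
rewrite gt_max => /andP[x0]; rewrite ltr_pdivrMr // mulrC => H.
have := HB x; rewrite expr1 /= => /le_lt_trans/(_ H).
by rewrite [e * _]mulrC ltr_pM2l // => /ltW.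
Qed.

Lemma multiplier1 : multiplier (fun=> 1 : R) (n := n).
Proof.
exists (fun=> 0), 0; split=> // [x|x v]; first by rewrite normr1.
by rewrite subrr normr0.
Qed.

Lemma schR_BV A : schR A -> exists2 M, 0 <= M & BV 1 M A.
Proof.
move=> sA; have [C C0 H] := BV_multiplier multiplier1; have [S HS] := schR_bump sA.
exists (C * S); first by rewrite mulr_ge0 // (bump_ge0 ltr01 HS).
by have := H _ _ _ _ ltr01 HS; under eq_fun do rewrite mul1r.
Qed.

Lemma C0_cv A G : schR A -> vanishR G -> C0R (cv A G).
Proof.
move=> sA [mG [B HB] HG]; have mA := schR_measurable sA; have IA := intg_L1le (schR_intg sA).
have B0 : 0 <= B by exact: le_trans (HB 0).
have [M M0 [_ _ _ HM]] := schR_BV sA.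
have intA x := L1le_intg (intg_cv x IA mG HB).
split.
  apply: (@lipschitz_continuous R n.+1 _ (B * M)); first exact: mulr_ge0.
  move=> x v; rewrite /cv -RintB //.
  have := L1leM B0 mG HB (L1le_reflect x (HM v)); rewrite mul1r mulrA => H.
  apply: L1le_Rintegral; apply: L1le_eq H => y.
  by rewrite -mulrBl mulrC; congr ((A _ - _) * _); rewrite addrAC.
split; first exact: measurable_cv.
  by exists (B * I (fun y => `|A y|)) => x; exact: cv_sup.
have IA1 := intg_L1le (schR_moments sA 1).
set a0 := I _ in IA; set a1 := I _ in IA1.
have a00 : 0 <= a0 by exact: L1le_ge0 IA.
have a10 : 0 <= a1 by exact: L1le_ge0 IA1.
(* Where |y| > M1 the function is at most e', which contributes e/2; elsewhere |x - y| exceeds T,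
   and the first moment of the kernel contributes e/2. *)
move=> e e0; pose e' := e / 2 / (a0 + 1); pose T := (B * a1 + 1) / (e / 2).
have e'0 : 0 < e' by rewrite !divr_gt0 // ltr_pwDr.
have T0 : 0 < T by rewrite !divr_gt0 // ltr_pwDr // mulr_ge0.
have [M1 HM1] := HG _ e'0; exists (M1 + T) => x xM.
have H := L1leD (L1leZ e' (L1le_abs (L1le_reflect x IA))) (L1leZ (B / T) (L1le_abs (L1le_reflect x IA1))).
have BT0 : 0 <= B / T by rewrite divr_ge0 // ltW.
rewrite (ger0_norm (ltW e'0)) (ger0_norm BT0) in H.
apply: (@le_trans _ _ (e' * a0 + B / T * a1)).
  apply: L1le_Rintegral; apply: le_L1le H.
    by apply: measurable_funM => //; apply: (measurableT_comp mA); exact: measurable_rowB.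
  move=> y; rewrite !normrM expr1 normr_id.
  have Bt : 0 <= B / T * (`|x - y| * `|A (x - y)|) by exact: (mulr_ge0 BT0 (mulr_ge0 (normr_ge0 _) (normr_ge0 _))).
  have [yM|yM] := ltP M1 `|y|.
    by apply: ler_wpDr => //; rewrite mulrC ler_wpM2r // HM1.
  apply: ler_wpDl; first by rewrite mulr_ge0 // ltW.
  rewrite [B / T * _]mulrA mulrC ler_wpM2r // (le_trans (HB y)) //.
  rewrite -[leLHS]mulr1 -mulrA ler_wpM2l // mulrC ler_pdivlMr // mul1r.
  rewrite -(lerD2l `|y|) addrC; apply: le_trans (ltW (le_lt_trans _ xM)) _.
    by rewrite addrC lerD2r.
  by have := ler_normD (x - y) y; rewrite subrK addrC.
rewrite [leRHS](splitr e); apply: lerD.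
  by rewrite /e' mulrAC ler_pdivrMr ?ltr_pwDr // ler_wpM2l ?divr_ge0 ?(ltW e0) // lerDl.
rewrite /T invf_div mulrA mulrAC ler_pdivrMr ?ltr_pwDr ?mulr_ge0 //.
by rewrite mulrAC mulrC ler_wpM2l ?divr_ge0 ?(ltW e0) // lerDl.
Qed.

End Vanishing.

(** * Transposed convolution *)

Section Adjoint.
Context {R : realType} (n : nat).
Local Notation pt := 'rV[R]_n.
Local Notation mu := (leb R n).
Local Notation I f := (Rintegral mu setT f).
Implicit Types (f A B G th : pt -> R) (D : R).

(** Fubini with [f] rough, such as an L^p function: the bound [D], uniform in x, is the only
    integrability asked of it. *)
Lemma dual_cv f A G D : measurable_fun setT f -> schR A -> intg mu G ->
  (forall x : pt, L1le mu (fun y : pt => f y * A (y - x)) D) ->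
  [/\ measurable_fun setT (fun x : pt => I (fun y : pt => f y * A (y - x))),
    forall x : pt, `|I (fun y : pt => f y * A (y - x))| <= D,
    intg mu (fun x : pt => I (fun y : pt => f y * A (y - x)) * G x) &
    I (fun y => f y * cv A G y) = I (fun x : pt => I (fun y : pt => f y * A (y - x)) * G x)].
Proof.
move=> mf sA IG HL; have mA := schR_measurable sA.
pose J (x y : pt) := f y * A (y - x) * G x.
have mK : kermeas (fun x y : pt => f y * A (y - x)).
  apply: kermeasM; first exact: kermeas_snd.
  apply: (measurableT_comp mA); apply: measurable_rowB; [exact: measurable_snd|exact: measurable_fst].
have mJ : kermeas J by apply: kermeasM => //; apply: kermeas_fst; exact: intg_meas IG.
have mF := measurable_Rint mu mK.
have bF (x : pt) : `|I (fun y : pt => f y * A (y - x))| <= D by exact: L1le_Rintegral (HL x).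
have I1 x : intg mu (J x) by apply: intgZr; exact: L1le_intg (HL x).
have IA (y : pt) : intg mu (fun x : pt => A (y - x) * G x) by exact: intg_cv_schR.
have I2 y : intg mu (J ^~ y).
  by have := intgZ (f y) (IA y); congr intg; apply/funext => x; rewrite /J mulrA.
split=> //; first exact: (intgM mF bF IG).
transitivity (I (fun y => I (J ^~ y))).
  apply: eq_Rint => y; rewrite -(RintZl _ (IA y)).
  by apply: eq_Rint => x; rewrite /J mulrA.
rewrite -(swap_Rint mJ I1 I2).
  by apply: eq_Rint => x; rewrite RintZr //; exact: L1le_intg (HL x).
have L := L1leZ D (L1le_abs (intg_L1le IG)).
apply: le_lt_trans (fubini_lty mJ _ L) _; last exact: ltry.
move=> x; have := L1leZ (G x) (HL x); rewrite mulrC => -[_].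
by under eq_integral => z _ do rewrite mulrC.
Qed.

Lemma cv_assoc A B G : schR A -> schR B -> intg mu G -> cv A (cv B G) = cv (cv A B) G.
Proof.
move=> sA sB IG; apply/funext => x.
have mA := schR_measurable sA; have mB := schR_measurable sB.
have [S HS] := schR_bounded sB.
have IAx := L1le_reflect x (intg_L1le (schR_intg sA)).
have HL (z : pt) : L1le mu (fun y : pt => A (x - y) * B (y - z)) (S * I (fun y => `|A y|)).
  have S0 : 0 <= S by exact: le_trans (HS 0).
  have mBz : measurable_fun setT (fun y : pt => B (y - z)).
    by apply: (measurableT_comp mB); exact: measurable_rowB.
  by apply: L1le_eq (L1leM S0 mBz (fun y => HS _) IAx) => y; rewrite mulrC.
have mAx : measurable_fun setT (fun y : pt => A (x - y)) by exact: IAx.1.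
have [_ _ _ E] := dual_cv mAx sB IG HL.
rewrite /cv E; apply: eq_Rint => z; congr (_ * _).
have mAB : measurable_fun setT (fun y : pt => A (x - z - y) * B y).
  by apply: measurable_funM => //; apply: (measurableT_comp mA); exact: measurable_rowB.
rewrite -(Rint_shift (- z) mAB); apply: eq_Rint => y.
by congr (A _ * _); rewrite opprB addrA subrK.
Qed.

Lemma cv_dil (a : R) A B : 0 < a -> schR A -> schR B ->
  cv (dil a A) (dil a B) = dil a (cv A B).
Proof.
move=> a0 sA sB; apply/funext => x; rewrite /dil /cv.
have IAB := intg_cv_schR (a *: x) sA (schR_intg sB).
transitivity (I (fun y => a ^+ n * a ^+ n * (fun z => A (a *: x - z) * B z) (a *: y + 0))).
  by apply: eq_Rint => y; rewrite addr0 scalerBr; ring.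
have an : a != 0 by rewrite gt_eqF.
rewrite (RintZl _ (intg_affine 0 an IAB)) (Rint_affine 0 an IAB) gtr0_norm // mulrA.
congr (_ * _).
by rewrite -mulrA mulfV ?mulr1 // expf_neq0.
Qed.

End Adjoint.

Lemma p2S (R : realType) (k : int) : p2 (k + 1) = 2 * p2 k :> R.
Proof. by rewrite !p2E rmorphD /= mulrDl expRD mul1r lnK ?posrE // mulrC. Qed.

(** * Littlewood-Paley kernels and their reproducing formula *)

Section Kernels.
Context {R : realType} (n : nat).
Local Notation pt := 'rV[R]_n.+1.
Local Notation mu := (leb R n.+1).
Local Notation I f := (Rintegral mu setT f).
Variable phi : pt -> R.
Hypotheses (tphi : testR phi) (ephi : evenf phi) (phi0 : phi 0 = 1).
Hypothesis phi_lp : forall x, (phi (4^-1 *: x) - phi (2 *: x)) * (phi (2^-1 *: x) - phi x) =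
  phi (2^-1 *: x) - phi x.

Definition lpPhi := ift phi.
(** [lp0] is the convolution kernel of [Delta 0]. [LP0], the fattened kernel, is that of psi_(-1) +
    psi_0 + psi_1 = phi(x/4) - phi(2x), which reproduces psi_0 by [phi_lp]. *)
Definition lp0 x : R := dil 2 lpPhi x - lpPhi x.
Definition LP0 x : R := dil 4 lpPhi x - dil 2^-1 lpPhi x.

Lemma schR_lpPhi : schR lpPhi. Proof. exact: schR_ift. Qed.

Lemma schR_lp0 : schR lp0.
Proof. by apply: schRB; [exact: schR_dil schR_lpPhi|exact: schR_lpPhi]. Qed.

Lemma schR_LP0 : schR LP0.
Proof. by apply: schRB; apply: schR_dil => //; exact: schR_lpPhi. Qed.

Lemma Rint_lpPhi : I lpPhi = 1. Proof. by rewrite Rint_ift // phi0. Qed.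

Let Iphi a : 0 < a -> intg mu (dil a lpPhi).
Proof. by move=> a0; apply: schR_intg; exact: schR_dil schR_lpPhi. Qed.

Let Rphi a : 0 < a -> I (dil a lpPhi) = 1.
Proof. by move=> a0; rewrite Rint_dil ?Rint_lpPhi //; exact: schR_intg schR_lpPhi. Qed.

Lemma Rint_lp0 : I lp0 = 0.
Proof.
rewrite RintB; [|exact: Iphi|exact: schR_intg schR_lpPhi].
by rewrite Rphi // Rint_lpPhi subrr.
Qed.

Lemma Rint_LP0 : I LP0 = 0.
Proof. by rewrite RintB; [rewrite !Rphi ?subrr|exact: Iphi|exact: Iphi]. Qed.

Lemma dil_even (a : R) (f : pt -> R) : evenf f -> evenf (dil a f).
Proof. by move=> ef x; rewrite /dil scalerN ef. Qed.

Lemma lpPhi_even : evenf lpPhi. Proof. exact: ift_even. Qed.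

Lemma lp0_even : evenf lp0.
Proof. by move=> x; rewrite /lp0 lpPhi_even (dil_even _ lpPhi_even). Qed.

Lemma LP0_even : evenf LP0.
Proof. by move=> x; rewrite /LP0 !(dil_even _ lpPhi_even). Qed.

Lemma iftB (f g : pt -> R) : testR f -> testR g ->
  ift (fun x => f x - g x) = fun x => ift f x - ift g x.
Proof.
move=> tf tg; apply/funext => x; rewrite /ift -mulrBr; congr (_ * _); rewrite /ct -RintB.
- by apply: eq_Rint => y; rewrite mulrBr.
- by apply: intg_cos; exact: testR_intg.
- by apply: intg_cos; exact: testR_intg.
Qed.

Lemma testR_scale (f : pt -> R) (a : R) : a != 0 -> testR f -> testR (fun x => f (a *: x)).
Proof. by move=> a0 /(testR_affine 0 a0); under eq_fun do rewrite addr0. Qed.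

Lemma testRB (f g : pt -> R) : testR f -> testR g -> testR (fun x => f x - g x).
Proof. by move=> tf tg; apply: testRD => //; exact: testRN. Qed.

Let psi0 x := phi (2^-1 *: x) - phi x.
Let chi0 x := phi (4^-1 *: x) - phi (2 *: x).

Let tphi_scale (a : R) : 0 < a -> testR (fun x => phi (a *: x)).
Proof. by move=> a0; apply: testR_scale => //; rewrite gt_eqF. Qed.

Lemma testR_psi0 : testR psi0.
Proof. by apply: testRB => //; apply: tphi_scale; rewrite invr_gt0. Qed.

Lemma lp0E : lp0 = ift psi0.
Proof.
rewrite /psi0 iftB //; last by apply: tphi_scale; rewrite invr_gt0.
by rewrite ift_dil.
Qed.

Lemma LP0E : LP0 = ift chi0.
Proof.
rewrite /chi0 iftB; [|by apply: tphi_scale; rewrite invr_gt0|exact: tphi_scale].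
rewrite ift_dil //; apply/funext => x; rewrite /LP0; congr (_ - _).
by have /= <- := congr1 (fun h => h x) (@ift_dil R n.+1 phi (2^-1) _ tphi); rewrite ?invr_gt0 // invrK.
Qed.

Lemma cv_LP0_lp0 : cv LP0 lp0 = lp0.
Proof.
have tc : testR chi0.
  by apply: testRB; [apply: tphi_scale; rewrite invr_gt0|exact: tphi_scale].
rewrite LP0E lp0E cv_ift //; last first.
  by move=> x; rewrite /psi0 scalerN !ephi.
- exact: testR_psi0.
- by congr ift; apply/funext => x; exact: phi_lp.
Qed.

Lemma cv_hk k : cv (hk LP0 k) (hk lp0 k) = hk lp0 k.
Proof.
rewrite /hk cv_dil ?p2_gt0 ?cv_LP0_lp0 //; [exact: schR_LP0|exact: schR_lp0].
Qed.

Lemma schR_hk (h : pt -> R) k : schR h -> schR (hk h k).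
Proof. by move=> sh; exact: schR_dil (p2_gt0 k) sh. Qed.

Lemma cv_hk_hk k (th : pt -> R) : schR th ->
  cv (hk lp0 k) (cv (hk LP0 k) th) = cv (hk lp0 k) th.
Proof.
move=> st; rewrite cv_assoc; [|exact: schR_hk schR_lp0|exact: schR_hk schR_LP0|exact: schR_intg].
congr cv; rewrite -[RHS]cv_hk; apply/funext => x; apply: cvC; apply: schR_measurable.
  exact: schR_hk schR_lp0.
exact: schR_hk schR_LP0.
Qed.

Lemma lp0_hkE k : hk lp0 k = fun x => dil (p2 (k + 1)) lpPhi x - dil (p2 k) lpPhi x.
Proof.
apply/funext => x; rewrite /hk /lp0 {1}/dil mulrBr /dil mulrA -exprMn scalerA.
by rewrite [p2 k * 2]mulrC -p2S.
Qed.

(** The pieces -N <= k < N telescope, each being the difference of two consecutive low-pass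
    filters. *)
Lemma zsum_hk (th : pt -> R) N x : schR th ->
  zsum (fun k => cv (hk lp0 k) th x) N =
  cv (dil (p2 (Posz N)) lpPhi) th x - cv (dil (p2 (- Posz N)) lpPhi) th x.
Proof.
move=> st; have Ic k : intg mu (fun y : pt => dil (p2 k) lpPhi (x - y) * th y).
  by apply: intg_cv_schR; [exact: schR_dil (p2_gt0 k) schR_lpPhi|exact: schR_intg].
have E k : cv (hk lp0 k) th x = cv (dil (p2 (k + 1)) lpPhi) th x - cv (dil (p2 k) lpPhi) th x.
  rewrite /cv -RintB //; apply: eq_Rint => y; by rewrite lp0_hkE mulrBl.
have add (a b c d : R) : a - b + (c - a + (b - d)) = c - d by ring.
elim: N => [|N IH]; first by rewrite /zsum big_ord0 oppr0 subrr.
rewrite zsumS IH !E NegzE (_ : Posz N + 1 = Posz N.+1); last by rewrite -PoszD addn1.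
rewrite (_ : - Posz N.+1 + 1 = - Posz N); last by rewrite intS opprD addrAC addNr add0r.
exact: add.
Qed.

End Kernels.

(** * Exponents for functions small in L^1 *)

Section SmallWeight.
Context {R : realType}.
Local Notation l2 := (ln (2 : R)).

Lemma min_expR0 (x : R) : Num.min (expR x) 1 = expR (Num.min x 0).
Proof. by rewrite -min_expR expR0. Qed.

Lemma min_expR0' (x : R) : Num.min 1 (expR x) = expR (Num.min 0 x).
Proof. by rewrite -min_expR expR0. Qed.

Lemma half_lt (k x : R) : 0 < k -> 2 * k <= x -> k < x.
Proof. lra. Qed.

Lemma min_gt0 (x y : R) : 0 < x -> 0 < y -> 0 < Num.min x y.
Proof. by have [] := leP x y. Qed.

Lemma small_weight n (al s ka e : R) k : 0 <= al <= 1 -> 0 < ka -> 2 * ka <= s + 1 - al ->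
  2 * ka <= al - s -> 0 < e <= 1 ->
  (Num.min (e * p2 k ^+ n.+1) (Num.min (p2 k) 1 ^+ n.+1)) `^ (1 - al) *
  (Num.min e (Num.min 1 (1 / p2 k))) `^ al <=
  ps (- s) k * (e `^ (ka / n.+2%:R) * geo ka k).
Proof.
move=> /andP[a0 a1] k0 k1 k2 /andP[e0 e1].
have E0 : ln e <= 0 by rewrite ln_le0.
rewrite -(lnK e0) /geo psE p2E; set x := k%:~R * l2; set E := ln e in E0 *.
have -> : 1 / expR x = expR (- x) by rewrite div1r expRN.
rewrite (min_expR0 x) (min_expR0' (- x)) -!expRM_natl -expRD !min_expR !expR_powR -!expRD ler_expR.
have -> : k%:~R * - s * l2 = - (s * x) by rewrite /x; ring.
have -> : ka * `|k%:~R| * l2 = ka * `|x|.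
  by rewrite /x normrM (ger0_norm (ltW ln2_gt0)) mulrA.
pose t : R := ka / n.+2%:R; pose d : R := n.+1%:R.
have d1 : 1 <= d by rewrite ler1n.
have dE : n.+2%:R = d + 1 :> R by rewrite -[LHS]natr1.
have tE : t * (d + 1) = ka by rewrite /t -dE divfK // pnatr_eq0.
have t0 : 0 <= t by rewrite divr_ge0 // ltW.
have t1 : t <= 1.
  rewrite /t ler_pdivrMr // mul1r; apply: (@le_trans _ _ 1); last by rewrite ler1n.
  lra.
rewrite -/t -/d; set m1 := Num.min (E + _) _; set m2 := Num.min E _.
have I (y z : R) : Num.min y z <= t * y + (1 - t) * z.
  have [yz|zy] := leP y z.
    by rewrite -subr_ge0 (_ : _ - _ = (1 - t) * (z - y)) ?mulr_ge0 ?subr_ge0 //; ring.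
  by rewrite -subr_ge0 (_ : _ - _ = t * (y - z)) ?mulr_ge0 ?subr_ge0 ?ltW //; ring.
have b0 : 0 <= 1 - al by rewrite subr_ge0.
have H1 := ler_wpM2l b0 (I (E + d * x) (d * Num.min x 0)).
have H2 := ler_wpM2l a0 (I E (Num.min 0 (- x))).
apply: le_trans (lerD H1 H2) _.
have [x0|x0] := leP x 0.
  have -> : Num.min 0 (- x) = 0 by rewrite min_l // oppr_ge0.
  rewrite ler0_norm //.
  have : 0 <= ((1 - al) * (d - 1) + (s + 1 - al - ka)) * - x.
    by rewrite mulr_ge0 ?oppr_ge0 // addr_ge0 ?mulr_ge0 ?subr_ge0 //; lra.
  lra.
have -> : Num.min 0 (- x) = - x by rewrite min_r // oppr_le0 ltW.
rewrite gtr0_norm //.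
have : 0 <= (al - s - ka - t * ((1 - al) * d + al)) * x.
  rewrite mulr_ge0 ?(ltW x0) // subr_ge0; apply: (@le_trans _ _ ka); last by lra.
  rewrite -tE ler_wpM2l //.
  have : 0 <= al * d by rewrite mulr_ge0 // (le_trans _ d1).
  lra.
lra.
Qed.

Lemma le_scaled_min (c c1 c2 x y z : R) : 0 <= x -> 0 <= y -> c1 <= c -> c2 <= c ->
  z <= c1 * x -> z <= c2 * y -> z <= c * Num.min x y.
Proof.
move=> x0 y0 h1 h2 zx zy; have [_|_] := leP x y.
  by rewrite (le_trans zx) // ler_wpM2r.
by rewrite (le_trans zy) // ler_wpM2r.
Qed.

End SmallWeight.

(** * Multiplication by the indicator of a Lipschitz domain *)

Section Besov.
Context {R : realType} (n : nat).
Local Notation pt := 'rV[R]_n.+1.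
Local Notation mu := (leb R n.+1).
Local Notation I f := (Rintegral mu setT f).
Implicit Types (f : int -> pt -> R) (F G m th A : pt -> R) (b bb : int -> R) (M B : R) (k j : int).

Definition tempR (v : (pt -> R) -> R) :=
  (forall (a : R) th eta, schR th -> schR eta ->
     v (fun x => a * th x + eta x) = a * v th + v eta) /\
  exists N K, 0 <= K /\ forall B th, sbound N B th -> `|v th| <= K * B.

Definition repR F (v : (pt -> R) -> R) := measurable_fun setT F /\
  forall th, schR th -> intg mu (fun x => F x * th x) /\ v th = I (fun x => F x * th x).

(** The condition defining S'_h, read on kernels: [a] is 1/lam, and [A] ranges over Schwartz
    functions instead of inverse transforms of test functions. *)
Definition smallR (v : (pt -> R) -> R) := forall A, schR A -> forall e : R, 0 < e ->
  exists2 a0, 0 < a0 & forall a, 0 < a -> a <= a0 ->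
    exists2 F, repR F (fun th => v (cv (dil a A) th)) & forall x, `|F x| <= e.

Lemma tempR_add v w : tempR v -> tempR w -> tempR (fun th => v th + w th).
Proof.
move=> [lv [N [K [K0 HK]]]] [lw [N' [K' [K0' HK']]]]; split.
  by move=> a th eta st se; rewrite lv // lw //; ring.
exists (maxn N N'), (K + K'); split; first exact: addr_ge0.
move=> B th [st Hth]; rewrite mulrDl; apply: le_trans (ler_normD _ _) _; apply: lerD.
  by apply: HK; split=> // k l x kN lN; apply: Hth; rewrite leq_max ?kN ?lN.
by apply: HK'; split=> // k l x kN lN; apply: Hth; rewrite leq_max ?kN ?lN orbT.
Qed.

Lemma repR_add F G v w : repR F v -> repR G w -> repR (fun x => F x + G x) (fun th => v th + w th).
Proof.
move=> [mF HF] [mG HG]; split; first exact: measurable_funD.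
move=> th st; have [IF ->] := HF th st; have [IG ->] := HG th st.
split; first by have := intgD IF IG; congr intg; apply/funext => x; rewrite mulrDl.
by rewrite -RintD //; apply: eq_Rint => x; rewrite mulrDl.
Qed.

Lemma smallR_add v w : smallR v -> smallR w -> smallR (fun th => v th + w th).
Proof.
move=> sv sw A sA e e0; have e2 : 0 < e / 2 by rewrite divr_gt0.
have [a1 a10 H1] := sv A sA _ e2; have [a2 a20 H2] := sw A sA _ e2.
exists (Num.min a1 a2); first exact: min_gt0.
move=> a a0; rewrite le_min => /andP[/(H1 _ a0)[F rF HF] /(H2 _ a0)[G rG HG]].
exists (fun x => F x + G x); first exact: repR_add.
by move=> x; apply: le_trans (ler_normD _ _) _; rewrite [leRHS](splitr e) lerD.
Qed.

Variables (p : \bar R) (s ka : R) (h0 H0 : pt -> R).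
Local Notation al := (alp p).
Hypotheses (p1 : (1 <= p)%E) (ka0 : 0 < ka).
Hypotheses (ka1 : 2 * ka <= s + 1 - al) (ka2 : 2 * ka <= al - s).
Hypotheses (sh0 : schR h0) (Ih0 : I h0 = 0) (eh0 : evenf h0).
Hypotheses (sH0 : schR H0) (IH0 : I H0 = 0) (eH0 : evenf H0).

Let ka1' : ka <= s + 1 - al. Proof. exact: ltW (half_lt ka0 ka1). Qed.
Let ka2' : ka < al - s. Proof. exact: half_lt ka0 ka2. Qed.
Let al01 := alp_ge0_le1 p1.

(* Membership of a real functional, with [c0] selecting the C^0_0 variant; the
   sequence [b] bounds the terms of the Besov norm. *)
Definition besR (c0 : bool) (v : (pt -> R) -> R) b := [/\ tempR v,
  forall j, exists F, [/\ repR F (fun th => v (cv (hk h0 j) th)),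
    LpB mu p F (ps (- s) j * b j) & c0 -> C0R F] & smallR v].

Lemma besR_add c0 v w b b' : besR c0 v b -> besR c0 w b' ->
  besR c0 (fun th => v th + w th) (fun j => b j + b' j).
Proof.
move=> [tv rv sv] [tw rw sw]; split; [exact: tempR_add| |exact: smallR_add].
move=> j; have [F [rF LF CF]] := rv j; have [G [rG LG CG]] := rw j.
exists (fun x => F x + G x); split; first exact: repR_add.
  by rewrite mulrDr; exact: LpBD.
by move=> c; apply: C0RD; [exact: CF|exact: CG].
Qed.

Let qC := coreC sH0.
Let qC0 : 0 <= qC. Proof. exact: coreC_ge0. Qed.

Lemma multiplier_meas m : multiplier m -> measurable_fun setT m /\ forall x, `|m x| <= 1.
Proof. by move=> [g [L [_ _ mm m1 _]]]. Qed.

Lemma BV_mul_sbound m : multiplier m -> exists N C, 0 <= C /\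
  forall B th, sbound N B th -> BV 1 (C * B) (fun x => m x * th x).
Proof.
move=> /BV_multiplier[C C0 H]; have [N [C' [C'0 HN]]] := @sbound_bump R n.
exists N, (C * C'); split; first exact: mulr_ge0.
by move=> B th /HN Hb; rewrite -mulrA; exact: H Hb.
Qed.

Lemma schR_mul_BV m th : multiplier m -> schR th ->
  exists2 M, 0 <= M & BV 1 M (fun x => m x * th x).
Proof.
move=> /BV_mul_sbound[N [C [C0 H]]] st; have [B HB] := schR_sbound N st.
by exists (C * B); [rewrite mulr_ge0 // (sbound_ge0 HB)|exact: H].
Qed.

Lemma tempR_Q f bb B m : multiplier m -> lpseq p s f bb -> (forall k, bb k <= B) ->
  tempR (fun th => Q H0 f (fun x => m x * th x)).
Proof.
move=> Hm fb bB; split.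
  move=> a th eta st se; have [M M0 HM] := schR_mul_BV Hm st; have [M' M'0 HM'] := schR_mul_BV Hm se.
  have HaM : BV 1 (`|a| * M) (fun x => a * (m x * th x)).
    case: HM => mM sM LM VM; split.
    - exact: measurable_funM.
    - by move=> x; rewrite normrM -mulrA ler_wpM2l.
    - exact: L1leZ.
    - move=> v; rewrite -mulrA; apply: L1le_eq (L1leZ a (VM v)) => x; exact: mulrBr.
  rewrite -(QZ (ka := ka) p1 ka0 ka1' ka2' sH0 IH0 a fb bB ltr01 HM).
  rewrite -(QD (ka := ka) p1 ka0 ka1' ka2' sH0 IH0 fb bB ltr01 HaM HM').
  by congr Q; apply/funext => x; ring.
have [N [C [C0 H]]] := BV_mul_sbound Hm.
have B0 : 0 <= B by apply: le_trans (bB 0); case: (fb 0).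
exists N, (Qconst p s ka sH0 B 1 1 * C); split.
  exact: (mulr_ge0 (mulr_ge0 (mulr_ge0 B0 (mulr_ge0 (mulr_ge0 qC0 ler01) (expR_ge0 _))) (ltW (geoC_gt0 ka0))) C0).
move=> B' th /H HF.
apply: le_trans (Q_bound (ka := ka) p1 ka0 ka1' ka2' sH0 IH0 fb bB ltr01 HF) _.
by rewrite /Qconst le_eqVlt; apply/orP; left; apply/eqP; ring.
Qed.

(** The representing function takes at x the value of [Q] at a bump of width 1/a, hence is bounded
    by a multiple of [cw] at a, which tends to 0 with a. *)
Lemma smallR_Q f bb B m : multiplier m -> lpseq p s f bb -> (forall k, bb k <= B) ->
  smallR (fun th => Q H0 f (fun x => m x * th x)).
Proof.
move=> Hm fb bB A sA e e0; have [mm m1] := multiplier_meas Hm.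
have [M M0 HM] := BV_mul_shift Hm sA.
have B0 : 0 <= B by apply: le_trans (bB 0); case: (fb 0).
pose K := B * (qC * M) * geoC ka.
have K0 : 0 <= K by exact: (mulr_ge0 (mulr_ge0 B0 (mulr_ge0 qC0 M0)) (ltW (geoC_gt0 ka0))).
have e0' : 0 < e / (K + 1) by rewrite divr_gt0 // ltr_pwDr.
have [a0 a00 Ha] := cw_small n p1 ka2' e0'.
exists a0 => // a a_gt0 aa.
have HF (x : pt) : BV a M (fun y : pt => m y * dil a A (y - x)) by exact: HM.
exists (fun x : pt => Q H0 f (fun y : pt => m y * dil a A (y - x))).
  have R1 th (st : schR th) := Q_rep p1 ka0 ka1' ka2' sH0 IH0 fb bB a_gt0 mm m1 (schR_dil a_gt0 sA) st HF.
  split; first by case: (R1 _ (schR0 _)).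
  by move=> th st; case: (R1 th st).
move=> x; apply: le_trans (Q_bound (ka := ka) p1 ka0 ka1' ka2' sH0 IH0 fb bB a_gt0 (HF x)) _.
rewrite /Qconst (_ : _ * _ = K * cw n.+1 al s ka a); last by rewrite /K /qC; ring.
apply: le_trans (ler_wpM2l K0 (Ha a a_gt0 aa)) _.
by rewrite mulrCA ler_piMr ?(ltW e0) // ler_pdivrMr ?ltr_pwDr // mul1r lerDl.
Qed.

Lemma C0R_ulim (FN : nat -> pt -> R) F : (forall N, C0R (FN N)) ->
  (forall e, 0 < e -> exists N, forall x, `|F x - FN N x| <= e) -> C0R F.
Proof.
move=> CN HF; have cF : continuous F.
  move=> x; apply/(@cvgrPdist_lt R R pt (nbhs x) _ F (F x)) => e e0.
  have e4 : 0 < e / 4 by rewrite divr_gt0.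
  have [N HN] := HF _ e4.
  have /(@cvgrPdist_lt R R pt (nbhs x) _ (FN N) (FN N x))/(_ _ e4) := (CN N).1 x.
  apply: filterS => y Hy; rewrite (_ : F x - F y = (F x - FN N x) + (FN N x - FN N y) - (F y - FN N y)); last by ring.
  apply: le_lt_trans (ler_normB _ _) _; apply: le_lt_trans (lerD (ler_normD _ _) (HN y)) _.
  have := HN x; lra.
split=> //; split.
- exact: continuous_measurable_row.
- have [N HN] := HF 1 ltr01; have [_ [B HB] _] := (CN N).2; exists (1 + B) => x.
  by rewrite -(subrK (FN N x) (F x)); apply: le_trans (ler_normD _ _) _; exact: lerD.
- move=> e e0; have e2 : 0 < e / 2 by rewrite divr_gt0.
  have [N HN] := HF _ e2; have [_ _ /(_ _ e2)[M HM]] := (CN N).2; exists M => x /HM xM.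
  rewrite -(subrK (FN N x) (F x)); apply: le_trans (ler_normD _ _) _.
  by rewrite [leRHS](splitr e) lerD.
Qed.

Lemma zlim_tail (t : int -> R) (x D : R) N : 0 < x -> (forall k, `|t k| <= D * geo x k) ->
  `|zlim t - zsum t N| <= D * (zlim (geo x) - zsum (geo x) N).
Proof.
move=> x0 H.
have ge0 (m : nat) : zsum (fun k => `|geo x k|) m <= geoC x.
  by rewrite (@eq_zsum _ _ (geo x)) => [|k]; [exact: zsum_geo0|rewrite gtr0_norm // geo_gt0].
have C1 := zlim_cvg (fun m : nat => zsum_geoM m x0 H); have C2 := zlim_cvg ge0.
have C3 : `|zsum t m - zsum t N| @[m --> \oo] --> `|zlim t - zsum t N|.
  by apply: cvg_norm; apply: cvgB => //; exact: cvg_cst.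
have C4 : D * (zsum (geo x) m - zsum (geo x) N) @[m --> \oo] --> D * (zlim (geo x) - zsum (geo x) N).
  by apply: cvgMr; apply: cvgB => //; exact: cvg_cst.
rewrite -(cvg_lim _ C3) // -(cvg_lim _ C4) //; apply: ler_lim.
- by apply/cvg_ex; eexists; exact: C3.
- by apply/cvg_ex; eexists; exact: C4.
exists N => // m /= Nm.
have sub (u : int -> R) : zsum u m - zsum u N = \sum_(N <= i < m) (u (Posz i) + u (Negz i)).
  rewrite /zsum -!(big_mkord xpredT (fun i => u (Posz i) + u (Negz i))).
  by rewrite (@big_cat_nat _ _ _ N 0 m) //= addrAC subrr add0r.
rewrite !sub mulr_sumr; apply: le_trans (ler_norm_sum _ _ _) _; apply: ler_sum => i _.
by rewrite mulrDr; apply: le_trans (ler_normD _ _) _; exact: lerD.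
Qed.

(** Each term is h_j * (m (H_k * f_k)): the inner convolution vanishes at infinity, the product may
    jump, the outer convolution is continuous again. The series converges uniformly, its terms being
    dominated by a geometric sequence independent of x. *)
Lemma C0R_Q f bb B m j : multiplier m -> lpseq p s f bb -> (forall k, bb k <= B) ->
  (forall k, C0R (f k)) -> C0R (fun x : pt => Q H0 f (fun y : pt => m y * hk h0 j (y - x))).
Proof.
move=> Hm fb bB Cf; have [mm m1] := multiplier_meas Hm.
have [M M0 HM] := BV_mul_shift Hm sh0; have pj := p2_gt0 (R := R) j.
have HF (x : pt) : BV (p2 j) M (fun y : pt => m y * hk h0 j (y - x)) by exact: HM.
have shj : schR (hk h0 j) by exact: schR_hk.
have Ct k : C0R (fun x : pt => qterm H0 f (fun y : pt => m y * hk h0 j (y - x)) k).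
  have [_ [mf [S HS] _]] := Cf k; have sHk : schR (hk H0 k) by exact: schR_hk.
  have eHk : evenf (hk H0 k) by exact: dil_even.
  have ehj : evenf (hk h0 j) by exact: dil_even.
  have := C0_cv shj (vanishRM mm m1 (C0_cv sHk (Cf k).2).2).
  congr C0R; apply/funext => x; rewrite /qterm.
  have IG : intg mu (fun y : pt => m y * hk h0 j (y - x)) by case: (HF x) => _ _ /L1le_intg.
  have HL (y : pt) : L1le mu (fun z : pt => f k z * hk H0 k (z - y)) (S * I (fun z => `|hk H0 k z|)).
    have S0 : 0 <= S by exact: le_trans (HS 0).
    exact: (L1leM S0 mf HS (L1le_shiftN y (intg_L1le (schR_intg sHk)))).
  have [_ _ _ ->] := dual_cv mf sHk IG HL.
  apply: eq_Rint => y; rewrite mulrA [RHS]mulrC; congr (_ * _).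
    by rewrite mulrC -ehj opprB.
  apply: eq_Rint => z.
  by rewrite mulrC; congr (_ * _); rewrite -eHk opprB.
apply: (@C0R_ulim (fun N (x : pt) => zsum (qterm H0 f (fun y : pt => m y * hk h0 j (y - x))) N)).
  elim=> [|N IH].
    rewrite (_ : (fun x : pt => _) = fun=> 0); last by apply/funext => x; rewrite /zsum big_ord0.
    split; first exact: cst_continuous.
    split; [exact: measurable_cst|by exists 0 => x; rewrite normr0|].
    by move=> e e0; exists 0 => x _; rewrite normr0 ltW.
  rewrite (_ : (fun x : pt => _) = fun x : pt => zsum (qterm H0 f (fun y : pt => m y * hk h0 j (y - x))) N +
    (qterm H0 f (fun y : pt => m y * hk h0 j (y - x)) (Posz N) +
     qterm H0 f (fun y : pt => m y * hk h0 j (y - x)) (Negz N))); last first.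
    by apply/funext => x; rewrite zsumS.
  by apply: C0RD => //; exact: C0RD.
move=> e e0; pose D := B * (qC * M * cw n.+1 al s ka (p2 j)).
have B0 : 0 <= B by apply: le_trans (bB 0); case: (fb 0).
have D0 : 0 <= D by exact: (mulr_ge0 B0 (mulr_ge0 (mulr_ge0 qC0 M0) (expR_ge0 _))).
have ge0 (N : nat) : zsum (fun k => `|geo ka k|) N <= geoC ka.
  by rewrite (@eq_zsum _ _ (geo ka)) => [|k]; [exact: zsum_geo0|rewrite gtr0_norm // geo_gt0].
have /(@cvgrPdist_lt R R _ _ _ _ _) C2 := zlim_cvg ge0.
have e0' : 0 < e / (D + 1) by rewrite divr_gt0 // ltr_pwDr.
have [N _ /(_ N (leqnn N)) HN] := C2 _ e0'; exists N => x.
have Hq k : `|qterm H0 f (fun y : pt => m y * hk h0 j (y - x)) k| <= D * geo ka k.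
  exact: (qterm_bound p1 ka0 ka1' ka2' sH0 IH0 k fb bB pj (HF x)).
apply: le_trans (zlim_tail N ka0 Hq) _.
apply: (@le_trans _ _ (D * (e / (D + 1)))).
  by rewrite ler_wpM2l // (le_trans (ler_norm _)) // ltW.
by rewrite mulrCA ler_piMr ?(ltW e0) // ler_pdivrMr ?ltr_pwDr // mul1r lerDl.
Qed.

Lemma besR_Q m : multiplier m -> exists2 C, 0 < C & forall (c0 : bool) f bb B,
  lpseq p s f bb -> (forall k, bb k <= B) -> (c0 -> forall k, C0R (f k)) ->
  besR c0 (fun th => Q H0 f (fun x => m x * th x)) (fun j => C * gconv ka bb j).
Proof.
move=> Hm; have [mm m1] := multiplier_meas Hm.
have [C C0 HC] := Q_Lp p1 ka0 ka1' ka2' sH0 IH0 eH0 Hm sh0 Ih0 eh0.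
have [M M0 HM] := BV_mul_shift Hm sh0.
exists C => // c0 f bb B fb bB Cf; split.
- exact: tempR_Q fb bB.
- move=> j; have pj := p2_gt0 (R := R) j.
  have HF (x : pt) : BV (p2 j) M (fun y : pt => m y * hk h0 j (y - x)) by exact: HM.
  exists (fun x : pt => Q H0 f (fun y : pt => m y * hk h0 j (y - x))); split.
  + have R1 th (st : schR th) := Q_rep p1 ka0 ka1' ka2' sH0 IH0 fb bB pj mm m1 (schR_hk j sh0) st HF.
    split; first by case: (R1 _ (schR0 _)).
    by move=> th st; case: (R1 th st).
  + by rewrite mulrCA; exact: HC fb bB.
  + by move=> /Cf; exact: C0R_Q fb bB.
- exact: smallR_Q fb bB.
Qed.

Local Notation tau := (ka / n.+2%:R).

(** Two bounds compete: the convolution may be estimated through the small L^1 norm of [G] or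
    through its BV norm, and the smaller one is kept for the sup and for the L^1 norm. *)
Lemma small_kernel A : schR A -> I A = 0 -> exists2 C, 0 <= C &
  forall k M (e : R) G, 0 < e -> BV 1 M G -> L1le mu G (e * M) ->
  (forall x, `|cv (hk A k) G x| <= C * M * Num.min (e * p2 k ^+ n.+1) (Num.min (p2 k) 1 ^+ n.+1)) /\
  L1le mu (cv (hk A k) G) (C * M * Num.min e (Num.min 1 (1 / p2 k))).
Proof.
move=> sA IA; have [CA kA] := schR_ker sA; have CA0 := ker_ge0 ltr01 kA.
pose c := CA * pi ^+ n.+1; have c0 : 0 <= c by rewrite mulr_ge0 ?exprn_ge0 ?pi_ge0.
exists (CA + c); first exact: addr_ge0.
move=> k M e G e0 HG LG; have M0 := BV_ge0 HG; have pk := p2_gt0 (R := R) k.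
have kk : ker (p2 k) CA (hk A k) by exact: ker_dil.
have Ik : I (hk A k) = 0 by rewrite Rint_dil //; exact: schR_intg.
have m0 := ltW (min_gt0 pk ltr01).
have m0' := ltW (min_gt0 ltr01 (divr_gt0 ltr01 pk)).
have le1 : CA * M <= (CA + c) * M by rewrite ler_wpM2r // lerDl.
have le2 : c * M <= (CA + c) * M by rewrite ler_wpM2r // lerDr.
split.
  move=> x; apply: (le_scaled_min _ _ le1 le2).
  - by rewrite mulr_ge0 ?exprn_ge0 // ltW.
  - by rewrite exprn_ge0.
  - rewrite (_ : CA * M * _ = CA * p2 k ^+ n.+1 * (e * M)); last by ring.
    by apply: cv_supr LG; [case: kk|move=> y; exact: ker_sup].
  - exact: BV_cv_sup pk ltr01 kk HG.
have H1 := L1le_cv (ker_L1 pk kk) LG; have H2 := BV_cv_L1 pk ltr01 kk Ik HG.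
have [_|_] := leP e (Num.min 1 (1 / p2 k)).
  by apply: L1leW H1; rewrite mulrCA mulrC ler_wpM2r // ltW.
by apply: L1leW H2; rewrite ler_wpM2r.
Qed.

(** [Q] is continuous along sequences that are bounded in BV and convergent in L^1; this is what
    allows an indicator times a Schwartz function to be replaced by test functions. *)
Lemma Q_small : exists2 C, 0 <= C & forall f bb B M (e : R) F,
  lpseq p s f bb -> (forall k, bb k <= B) -> 0 < e <= 1 -> BV 1 M F -> L1le mu F (e * M) ->
  `|Q H0 f F| <= C * B * M * e `^ tau.
Proof.
have [C C0 HC] := small_kernel sH0 IH0.
exists (C * geoC ka); first by rewrite mulr_ge0 // ltW // geoC_gt0.
move=> f bb B M e F fb bB e01 HF LF; have /andP[e0 e1] := e01; have M0 := BV_ge0 HF.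
have Hk k : `|qterm H0 f F k| <= (C * B * M * e `^ tau) * geo ka k.
  have [bk fk] := fb k; have [Hs HL] := HC k M e F e0 HF LF.
  have m1 : 0 <= Num.min (e * p2 k ^+ n.+1) (Num.min (p2 k) 1 ^+ n.+1).
    by apply/ltW/min_gt0; rewrite ?mulr_gt0 ?exprn_gt0 ?min_gt0 ?p2_gt0.
  have m2 : 0 <= Num.min e (Num.min 1 (1 / p2 k)).
    by apply/ltW/min_gt0 => //; apply: min_gt0; rewrite ?divr_gt0 ?p2_gt0.
  have CM : 0 <= C * M by exact: mulr_ge0.
  apply: le_trans (L1le_Rintegral (L1le_holder_ge0 p1 fk Hs HL)) _.
  (* The pairing sees [F] in the dual space, so the exponents are those for 1 - 1/p and -s. *)
  have W := @small_weight R n (1 - al) (- s) ka e k _ ka0 _ _ e01.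
  have {W} : (Num.min (e * p2 k ^+ n.+1) (Num.min (p2 k) 1 ^+ n.+1)) `^ al *
      (Num.min e (Num.min 1 (1 / p2 k))) `^ (1 - al) <= ps s k * (e `^ tau * geo ka k).
    rewrite subKr opprK in W; apply: W.
    - by case/andP: al01 => a0 a1; rewrite subr_ge0 a1 /= gerBl.
    - by rewrite (_ : - s + 1 - (1 - al) = al - s) //; ring.
    - by rewrite (_ : 1 - al + s = s + 1 - al) //; ring.
  rewrite [X in _ -> _ <= X](_ : _ = B * (C * M * (e `^ tau * geo ka k))); last by ring.
  move: (C * M) CM => cM CM; rewrite !powRM //.
  move: (Num.min _ _) m1 => x m1; move: (Num.min e _) m2 => y m2.
  have pp : ps (- s) k * ps s k = 1 by rewrite psN mulVf // gt_eqF // ps_gt0.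
  have b0 : 0 <= ps (- s) k * bb k * cM by rewrite !mulr_ge0 // ltW // ps_gt0.
  move=> /(ler_wpM2l b0) W.
  rewrite (_ : _ * _ * _ = ps (- s) k * bb k * (cM `^ al * cM `^ (1 - al)) * (x `^ al * y `^ (1 - al))); last by ring.
  rewrite powR_split //; apply: le_trans W _.
  rewrite (_ : _ * _ * _ * _ = (ps (- s) k * ps s k) * (bb k * (cM * (e `^ tau * geo ka k)))); last by ring.
  rewrite pp mul1r.
  by rewrite ler_wpM2r // !mulr_ge0 ?powR_ge0 // ltW // geo_gt0.
apply: zlim_le => N; apply: le_trans (zsum_geoM N ka0 Hk) _.
by rewrite le_eqVlt; apply/orP; left; apply/eqP; ring.
Qed.

Lemma tempR_intg G M : L1le mu G M -> tempR (fun th => I (fun x => G x * th x)).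
Proof.
move=> LG; have M0 := L1le_ge0 LG.
have IG th : schR th -> intg mu (fun x => G x * th x).
  move=> st; have [B HB] := schR_bounded st.
  by have := intgM (schR_measurable st) HB (L1le_intg LG); under eq_fun do rewrite mulrC.
split.
  move=> a th eta st se; rewrite -RintZl; last exact: IG.
  rewrite -RintD; [|exact: intgZ (IG _ st)|exact: IG].
  by apply: eq_Rint => x; ring.
exists 0%N, M; split=> // B th [st Hth].
have B0 : 0 <= B.
  by apply: le_trans (Hth 0%N [::] 0 (leqnn _) (leqnn _)); rewrite expr0 mul1r.
rewrite mulrC; apply: L1le_Rintegral.
have Hb x : `|th x| <= B by have := Hth 0%N [::] x (leqnn _) (leqnn _); rewrite expr0 mul1r.
by apply: L1le_eq (L1leM B0 (smoothR_measurable st) Hb LG) => x; rewrite mulrC.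
Qed.

Lemma repR_cv_intg G M A (S : R) : L1le mu G M -> schR A -> (forall x, `|A x| <= S) ->
  repR (fun x : pt => I (fun y : pt => G y * A (y - x))) (fun th => I (fun x => G x * cv A th x)) /\
  forall x : pt, `|I (fun y : pt => G y * A (y - x))| <= S * M.
Proof.
move=> LG sA HS; have S0 : 0 <= S by exact: le_trans (HS 0).
have HL (x : pt) : L1le mu (fun y : pt => G y * A (y - x)) (S * M).
  have mAx : measurable_fun setT (fun y : pt => A (y - x)).
    by apply: (measurableT_comp (schR_measurable sA)); exact: measurable_rowB.
  by apply: L1le_eq (L1leM S0 mAx (fun y => HS _) LG) => y; rewrite mulrC.
have H th (st : schR th) := dual_cv LG.1 sA (schR_intg st) HL.
split; last by case: (H _ (schR0 _)).
split; first by case: (H _ (schR0 _)).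
by move=> th st; case: (H th st).
Qed.

Lemma smallR_intg G M : L1le mu G M -> smallR (fun th => I (fun x => G x * th x)).
Proof.
move=> LG A sA e e0; have M0 := L1le_ge0 LG; have [S HS] := schR_bounded sA.
have S0 : 0 <= S by exact: le_trans (HS 0).
pose K := S * M; have K0 : 0 <= K by exact: mulr_ge0.
have K1 : 0 < e / (K + 1) by rewrite divr_gt0 // ltr_pwDr.
exists (Num.min 1 (e / (K + 1))); first exact: min_gt0.
move=> a a0; rewrite le_min => /andP[a1 aK].
have HaS x : `|dil a A x| <= a * S.
  rewrite /dil normrM ger0_norm ?exprn_ge0 ?(ltW a0) //.
  apply: ler_pM; rewrite ?exprn_ge0 ?(ltW a0) // exprS ler_piMr ?(ltW a0) //.
  by rewrite exprn_ile1 // ltW.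
have [Hr Hb] := repR_cv_intg LG (schR_dil a0 sA) HaS.
exists (fun x : pt => I (fun y : pt => G y * dil a A (y - x))) => //.
move=> x; apply: le_trans (Hb x) _; rewrite -mulrA.
apply: (@le_trans _ _ (e / (K + 1) * K)); first by rewrite ler_wpM2r.
by rewrite mulrAC ler_pdivrMr ?ltr_pwDr // ler_wpM2l ?(ltW e0) // lerDl.
Qed.

(** With e = 1 this places test functions in the space; with e small it gives the convergence of the
    mollifications in the Besov norm. *)
Lemma besR_L1 : exists2 C, 0 <= C & forall (c0 : bool) G M (e : R),
  0 < e <= 1 -> BV 1 M G -> L1le mu G (e * M) -> vanishR G ->
  besR c0 (fun th => I (fun x => G x * th x)) (fun j => C * M * e `^ tau * geo ka j).
Proof.
have [C C0 HC] := small_kernel sh0 Ih0; exists C => // c0 G M e e01 HG LG vG.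
have /andP[e0 e1] := e01; have M0 := BV_ge0 HG.
split; [exact: tempR_intg LG| |exact: smallR_intg LG].
move=> j; have shj : schR (hk h0 j) by exact: schR_hk.
have ehj : evenf (hk h0 j) by exact: dil_even.
have [S HS] := schR_bounded shj; have [Hr _] := repR_cv_intg LG shj HS.
exists (cv (hk h0 j) G); split; last 1 first.
- by move=> _; exact: C0_cv.
- have -> // : cv (hk h0 j) G = fun x : pt => I (fun y : pt => G y * hk h0 j (y - x)).
  apply/funext => x; apply: eq_Rint => y; rewrite mulrC -ehj opprB //.
have [Hs HL] := HC j M e G e0 HG LG.
have := LpB_interp (@leb_gt0 R n) p1 Hs HL; apply: LpBW.
have m1 : 0 <= Num.min (e * p2 j ^+ n.+1) (Num.min (p2 j) 1 ^+ n.+1).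
  by apply/ltW/min_gt0; rewrite ?mulr_gt0 ?exprn_gt0 ?min_gt0 ?p2_gt0.
have m2 : 0 <= Num.min e (Num.min 1 (1 / p2 j)).
  by apply/ltW/min_gt0 => //; apply: min_gt0; rewrite ?divr_gt0 ?p2_gt0.
have CM : 0 <= C * M by exact: mulr_ge0.
have W := @small_weight R n al s ka e j al01 ka0 ka1 ka2 e01.
move: (C * M) CM => cM CM; rewrite !powRM //.
move: W; move: (Num.min _ _) m1 => x m1; move: (Num.min e _) m2 => y m2.
move=> /(ler_wpM2l CM) W.
rewrite (_ : _ * _ * _ = (cM `^ al * cM `^ (1 - al)) * (x `^ (1 - al) * y `^ al)); last by ring.
rewrite powR_split //; apply: le_trans W _.
by rewrite le_eqVlt; apply/orP; left; apply/eqP; ring.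
Qed.

End Besov.

(** * Littlewood-Paley decomposition of a functional *)

Section Decomposition.
Context {R : realType} (n : nat).
Local Notation pt := 'rV[R]_n.+1.
Local Notation mu := (leb R n.+1).
Local Notation I f := (Rintegral mu setT f).
Implicit Types (f : int -> pt -> R) (F G m th A : pt -> R) (v : (pt -> R) -> R) (k : int).
Variable phi : pt -> R.
Hypotheses (tphi : testR phi) (ephi : evenf phi) (phi0 : phi 0 = 1).
Hypothesis phi_lp : forall x, (phi (4^-1 *: x) - phi (2 *: x)) * (phi (2^-1 *: x) - phi x) =
  phi (2^-1 *: x) - phi x.
Local Notation Phi := (lpPhi phi).
Local Notation h k := (hk (lp0 phi) k).
Local Notation H k := (hk (LP0 phi) k).

Let sPhi : schR Phi := schR_lpPhi tphi.
Let sh k : schR (h k). Proof. exact: schR_hk (schR_lp0 tphi). Qed.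
Let sH k : schR (H k). Proof. exact: schR_hk (schR_LP0 tphi). Qed.

Lemma schR_cvs A th : schR A -> schR th -> schR (cv A th).
Proof. by move=> sA st; exact: schR_cv sA (schR_moments st). Qed.

Lemma tempRB v th eta : tempR v -> schR th -> schR eta ->
  v (fun x => th x - eta x) = v th - v eta.
Proof.
move=> [lv _] st se; rewrite addrC -[- v eta]mulN1r -lv //; congr v.
by apply/funext => x; rewrite mulN1r addrC.
Qed.

Lemma tempRD v th eta : tempR v -> schR th -> schR eta ->
  v (fun x => th x + eta x) = v th + v eta.
Proof.
by move=> [lv _] st se; have := lv 1 th eta st se; under eq_fun do rewrite mul1r; rewrite mul1r.
Qed.

Lemma tempR0 v : tempR v -> v (fun=> 0) = 0.
Proof.
move=> tv; have := tempRB tv (schR0 n.+1) (schR0 n.+1).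
by under eq_fun do rewrite subrr; rewrite subrr.
Qed.

Lemma tempR_approx v th : tempR v -> schR th ->
  v (cv (dil (p2 (Posz N)) Phi) th) @[N --> \oo] --> v th.
Proof.
move=> tv st; have [_ [N0 [K [K0 HK]]]] := tv.
have [C HC] := approx_identity N0 st sPhi (Rint_lpPhi tphi phi0).
have C0 : 0 <= C by have := sbound_ge0 (HC 1 (lexx 1)); rewrite divr1.
have sa N : schR (cv (dil (p2 (Posz N)) Phi) th) by apply: schR_cvs => //; exact: schR_dil (p2_gt0 _) sPhi.
have B N : `|v (cv (dil (p2 (Posz N)) Phi) th) - v th| <= K * C * (N.+1%:R)^-1.
  rewrite -tempRB // -mulrA; have a1 : 1 <= p2 (Posz N) :> R by rewrite /p2 exprn_ege1 // ler1n.
  apply: le_trans (HK (C / p2 (Posz N)) _ _) _.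
    have := HC _ a1; congr sbound; apply/funext => x; congr (_ - _); apply: cvC.
      exact: schR_measurable.
    by apply: schR_measurable; exact: schR_dil (p2_gt0 _) sPhi.
  rewrite ler_wpM2l // ler_wpM2l // lef_pV2 ?posrE ?p2_gt0 //.
  rewrite (_ : p2 (Posz N) = (2 ^ N)%:R); last by rewrite natrX.
  by rewrite ler_nat ltn_expl.
apply/cvgrPdist_le => e e0.
have /cvgrPdist_le/(_ _ e0) : K * C * (N.+1%:R)^-1 @[N --> \oo] --> (0 : R).
  by rewrite -(mulr0 (K * C)); apply: cvgMr; exact: cvg_harmonic.
apply: filterS => N; rewrite sub0r normrN distrC => HN.
by apply: le_trans (B N) _; exact: le_trans (ler_norm _) HN.
Qed.

(** What S'_h gives for Theta = phi, with a bound almost everywhere. This is the form consumed by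
    the decomposition, while [smallR] is the form produced for the extension. *)
Definition smallPhi v := forall e : R, 0 < e -> exists2 a0, 0 < a0 & forall a, 0 < a -> a <= a0 ->
  exists2 F, repR F (fun th => v (cv (dil a Phi) th)) & LpB mu +oo%E F e.

Lemma smallPhi_approx v th : smallPhi v -> schR th ->
  v (cv (dil (p2 (- Posz N)) Phi) th) @[N --> \oo] --> (0 : R).
Proof.
move=> sv st; have Lt := intg_L1le (schR_intg st); set T := I _ in Lt.
have T0 : 0 <= T by exact: L1le_ge0 Lt.
apply/cvgrPdist_le => e e0.
have e0' : 0 < e / (T + 1) by rewrite divr_gt0 // ltr_pwDr.
have [a0 a00 Ha] := sv _ e0'.
have /cvgrPdist_le/(_ _ a00) := @cvg_harmonic R.
apply: filterS => N; rewrite sub0r normrN ger0_norm ?invr_ge0 // => HN.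
have [|F rF LF] := Ha (p2 (- Posz N)) (p2_gt0 _).
  apply: le_trans HN; have -> : p2 (- Posz N) = ((2 ^ N)%:R)^-1 :> R by rewrite natrX /p2 -invr_expz.
  by rewrite lef_pV2 ?posrE ?ltr0n ?expn_gt0 // ler_nat ltn_expl.
have [_ /(_ th st)[_ ->]] := rF; rewrite sub0r normrN.
have LL := L1le_holder_oo (leb_gt0 n) LF Lt.
apply: (@le_trans _ _ (e / (T + 1) * T)); first exact: L1le_Rintegral LL.
by rewrite mulrAC ler_pdivrMr ?ltr_pwDr // ler_wpM2l ?(ltW e0) // lerDl.
Qed.

(** The telescoped partial sum is a high-frequency filter, which tends to [v th], minus a
    low-frequency one, which tends to 0 by [smallPhi]; without the latter a polynomial could be
    lost. *)
Lemma decompose v f th : tempR v -> smallPhi v ->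
  (forall k, repR (f k) (fun th => v (cv (h k) th))) -> schR th -> v th = Q (LP0 phi) f th.
Proof.
move=> tv sv rf st; apply/esym/zlim_unique.
have qE k : qterm (LP0 phi) f th k = v (cv (h k) th).
  rewrite /qterm; have [_ /(_ _ (schR_cvs (sH k) st))[_ <-]] := rf k.
  by rewrite cv_hk_hk.
have E N : zsum (qterm (LP0 phi) f th) N =
    v (cv (dil (p2 (Posz N)) Phi) th) - v (cv (dil (p2 (- Posz N)) Phi) th).
  have sd k : schR (cv (dil (p2 k) Phi) th) by apply: schR_cvs => //; exact: schR_dil (p2_gt0 _) sPhi.
  rewrite -tempRB //.
  have -> : (fun x => cv (dil (p2 (Posz N)) Phi) th x - cv (dil (p2 (- Posz N)) Phi) th x) =
      fun x => zsum (fun k => cv (h k) th x) N.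
    by apply/funext => x; rewrite zsum_hk.
  have [] // : schR (fun x => zsum (fun k => cv (h k) th x) N) /\
    zsum (qterm (LP0 phi) f th) N = v (fun x => zsum (fun k => cv (h k) th x) N).
  elim: N => [|N [IH1 IH2]].
    rewrite (_ : (fun x => _) = fun=> 0); last by apply/funext => x; rewrite /zsum big_ord0.
    by split; [exact: schR0|rewrite tempR0 // /zsum big_ord0].
  have -> : (fun x => zsum (fun k => cv (h k) th x) N.+1) =
      fun x => zsum (fun k => cv (h k) th x) N + (cv (h (Posz N)) th x + cv (h (Negz N)) th x).
    by apply/funext => x; rewrite zsumS.
  have s2 : schR (fun x => cv (h (Posz N)) th x + cv (h (Negz N)) th x).
    by apply: schRD; exact: schR_cvs.
  split; first exact: schRD.
  by rewrite zsumS IH2 !qE tempRD // tempRD //; exact: schR_cvs.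
rewrite -[X in _ --> X]subr0 (_ : (fun N => zsum _ N) = fun N => v (cv (dil (p2 (Posz N)) Phi) th) - v (cv (dil (p2 (- Posz N)) Phi) th)); last by apply/funext.
by apply: cvgB; [exact: tempR_approx|exact: smallPhi_approx].
Qed.

(* The pieces [v * h_k], computed from [v] itself: they do not depend on the choice
   of an L^p or of a C^0_0 representative. *)
Definition canon v k (x : pt) : R := v (cv (h k) (fun y => H k (x - y))).

Lemma canon_rep p : (1 <= p)%E -> exists2 C, 0 < C & forall v F N k,
  repR F (fun th => v (cv (h k) th)) -> LpB mu p F N ->
  [/\ repR (canon v k) (fun th => v (cv (h k) th)), LpB mu p (canon v k) (C * N) &
    C0R F -> C0R (canon v k)].
Proof.
move=> p1; pose C := 1 + I (fun x => `|LP0 phi x|).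
have L0 := intg_L1le (schR_intg (schR_LP0 tphi)).
have C0 : 0 < C by rewrite ltr_pwDl // (L1le_ge0 L0).
exists C => // v F N k [mF rF] LF.
have LH : L1le mu (H k) C.
  by apply: L1leW (L1le_dil (p2_gt0 k) L0); rewrite lerDr.
have eH : evenf (H k) by apply: dil_even; exact: LP0_even.
have mH := schR_measurable (sH k).
have sHx x : schR (fun y => H k (x - y)).
  have := schR_affine x (c := -1) _ (sH k); rewrite oppr_eq0 oner_eq0 => /(_ isT).
  by congr schR; apply/funext => y; rewrite scaleN1r addrC.
have cE x : canon v k x = cv (H k) F x.
  rewrite /canon; have [_ ->] := rF _ (sHx x); apply: eq_Rint => y.
  exact: mulrC.
have mcv : measurable_fun setT (cv (H k) F) by exact: measurable_cv.
have cF : canon v k = cv (H k) F by apply/funext.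
split.
- split; first by rewrite cF.
  move=> th st.
  have [B HB] := schR_bounded (sH k).
  have LD (x : pt) : L1le mu (fun y : pt => F y * H k (y - x)) (N * B `^ alp p * C `^ (1 - alp p)).
    exact: (@L1le_holder_ge0 R n p F (fun y : pt => H k (y - x)) N B C p1 LF (fun y => HB (y - x)) (L1le_shiftN x LH)).
  have [_ _ i1 i2] := dual_cv mF (sH k) (schR_intg st) LD.
  have E : canon v k = fun x : pt => I (fun y : pt => F y * H k (y - x)).
    rewrite cF; apply/funext => x; apply: eq_Rint => y.
    by rewrite mulrC -(eH (y - x)) opprB.
  rewrite E; split=> //; rewrite -i2.
  by have [_ <-] := rF _ (schR_cvs (sH k) st); rewrite cv_hk_hk.
- rewrite cF mulrC; have -> : C = C `^ (1 - alp p) * C `^ alp p by rewrite mulrC powR_split // ltW.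
  exact: (@LpB_schur _ _ _ _ R mu mu (leb_gt0 n) (leb_gt0 n) p (fun x z : pt => H k (x - z)) F C C N
    p1 (kermeas_sub mH) C0 (fun x => L1le_reflect x LH) (fun z => L1le_shiftN z LH) LF).
- by move=> [_ vF]; rewrite cF; exact: C0_cv.
Qed.

End Decomposition.

(** * Mollification and truncation *)

Section Mollify.
Context {R : realType} (n : nat).
Local Notation pt := 'rV[R]_n.+1.
Local Notation mu := (leb R n.+1).
Local Notation I f := (Rintegral mu setT f).
Implicit Types (F G m th rho : pt -> R).

(** A Lipschitz cutoff at distance 1/e: [bump] only asks for first differences, and the
    mollification that follows makes the product smooth. *)
Definition tent (e : R) (x : pt) : R := Num.max 0 (1 - e * `|x|).

Lemma tent_ge0 e x : 0 <= tent e x.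
Proof. by rewrite /tent le_max lexx. Qed.

Lemma tent_le1 e x : 0 <= e -> tent e x <= 1.
Proof. by move=> e0; rewrite /tent ge_max ler01 gerBl mulr_ge0. Qed.

Lemma tent_support e x : 0 < e -> e^-1 < `|x| -> tent e x = 0.
Proof.
move=> e0 xe; apply/max_idPl; rewrite subr_le0.
by rewrite -ler_pdivrMl // mulr1 ltW.
Qed.

Lemma tent1 e x : 0 <= e -> `|tent e x - 1| <= e * `|x|.
Proof.
move=> e0; rewrite distrC ger0_norm ?subr_ge0 ?tent_le1 //.
by rewrite lerBlDl -lerBlDr /tent le_max lexx orbT.
Qed.

Lemma tent_lip e x v : 0 <= e <= 1 -> `|tent e (x + v) - tent e x| <= `|v|.
Proof.
move=> /andP[e0 e1].
have L y z : tent e (y + z) <= tent e y + `|z|.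
  rewrite {1}/tent ge_max addr_ge0 ?tent_ge0 //=.
  have : 1 - e * `|y| <= tent e y by rewrite /tent le_max lexx orbT.
  have : `|y| <= `|y + z| + `|z| by rewrite -{1}(addrK z y) -[leRHS]/(_ + _); exact: ler_normB.
  move=> h1 h2.
  suff : e * `|y| <= e * `|y + z| + `|z| by lra.
  apply: le_trans (ler_wpM2l e0 h1) _; rewrite mulrDr lerD2l.
  by rewrite ler_piMl.
have h1 := L x v; have := L (x + v) (- v); rewrite addrK normrN => h2.
by rewrite ler_norml; lra.
Qed.

Lemma measurable_tent e : measurable_fun setT (tent e).
Proof.
apply: measurable_maxr => //.
apply: measurable_funB => //; apply: measurable_funM => //.
exact: (@measurable_normX R _ 1).
Qed.

Lemma bump_tent S th e : 0 <= e <= 1 -> bump 0 1 S th ->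
  bump 0 1 (2 * S) (fun x => th x * tent e x).
Proof.
move=> /andP[e0 e1] bt; have S0 := bump_ge0 ltr01 bt; have [mt tW tv] := bt.
have W0 (x : pt) : 0 <= Wt 1 (x - 0) by exact: Wt_ge0.
split.
- by apply: measurable_funM => //; exact: measurable_tent.
- move=> y; rewrite normrM (ger0_norm (tent_ge0 _ _)).
  apply: (@le_trans _ _ (S * Wt 1 (y - 0) * 1)).
    by apply: ler_pM => //; [exact: tent_ge0|exact: tent_le1].
  by rewrite mulr1 -mulrA ler_peMl ?ler1n // mulr_ge0.
- move=> y v v1.
  have -> : th (y + v) * tent e (y + v) - th y * tent e y =
    (th (y + v) - th y) * tent e (y + v) + th y * (tent e (y + v) - tent e y) by ring.
  apply: le_trans (ler_normD _ _) _; rewrite !normrM (ger0_norm (tent_ge0 _ _)).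
  have h1 : `|th (y + v) - th y| * tent e (y + v) <= S * (1 * `|v|) * Wt 1 (y - 0).
    rewrite -[leRHS]mulr1; apply: ler_pM => //; [exact: tent_ge0|exact: tv|exact: tent_le1].
  have h2 : `|th y| * `|tent e (y + v) - tent e y| <= S * Wt 1 (y - 0) * `|v|.
    by apply: ler_pM => //; apply: tent_lip; rewrite e0.
  by apply: le_trans (lerD h1 h2) _; rewrite le_eqVlt; apply/orP; left; apply/eqP; ring.
Qed.

Lemma L1le_cv_sub rho F A M (e r : R) : 0 < e -> 0 <= r -> L1le mu rho A ->
  (forall x, r < `|x| -> rho x = 0) -> I rho = 1 -> BV 1 M F ->
  L1le mu (fun x => cv (dil e^-1 rho) F x - F x) (e * (r * A * M)).
Proof.
move=> e0 r0 Lr rs Ir bF; have M0 := BV_ge0 bF; have [mF sF LF dF] := bF.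
have ei0 : 0 < e^-1 by rewrite invr_gt0.
have Ld : L1le mu (dil e^-1 rho) A by exact: L1le_dil.
have [md _] := Ld.
have E x : cv (dil e^-1 rho) F x - F x = I (fun y : pt => dil e^-1 rho y * (F (x - y) - F x)).
  rewrite (cvE x md mF) [RHS](eq_Rint mu (g := fun y : pt => dil e^-1 rho y * F (x - y) - dil e^-1 rho y * F x)); last first.
    by move=> y; rewrite mulrBr.
  have i1 := L1le_intg Ld.
  rewrite RintB; last 2 first.
  - under eq_fun do rewrite mulrC.
    apply: (intgM (c := M * 1 ^+ n.+1)) => //.
    by apply: measurableT_comp => //; apply: measurable_rowB.
  - exact: intgZr.
  by rewrite RintZr // Rint_dil // ?Ir ?mul1r //; exact: L1le_intg Lr.
apply: (L1le_eq (f := fun x : pt => I (fun y : pt => dil e^-1 rho y * (F (x - y) - F x)))).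
  by move=> x; rewrite E.
apply: (L1le_Rint_ker (m2 := mu) (g := fun y => `|dil e^-1 rho y| * (M * (r * e)))).
- apply: kermeasM; first exact: kermeas_snd.
  by apply: kermeasB; [exact: kermeas_sub|exact: kermeas_fst].
- move=> y; have := L1leZ (dil e^-1 rho y) (dF (- y)).
  apply: L1leW; rewrite mul1r normrN.
  have [H|H] := leP `|y| (r * e); first by rewrite ler_wpM2l // ler_wpM2l.
  rewrite /dil rs ?mulr0 ?normr0 ?mul0r //.
  by rewrite normrZ gtr0_norm // mulrC ltr_pdivlMr.
- have := L1leZ (M * (r * e)) (L1le_abs Ld).
  move/(L1le_eq (g := fun y => `|dil e^-1 rho y| * (M * (r * e)))) => /(_ (fun y => mulrC _ _)).
  apply: L1leW; rewrite ger0_norm ?mulr_ge0 // ?(ltW e0) //.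
  by rewrite le_eqVlt; apply/orP; left; apply/eqP; ring.
Qed.

(** [w] is m th cut off at distance 1/e, translated by e v0 and mollified at scale e. Each operation
    moves the function by O(e) in L^1 and keeps it bounded in BV; the translation is what will carry
    the support off the graph. *)
Lemma mollify m th rho r (v0 : pt) : multiplier m -> schR th -> testR rho -> 0 <= r ->
  (forall x, r < `|x| -> rho x = 0) -> I rho = 1 ->
  exists2 M, 0 <= M & forall e, 0 < e <= 1 -> exists w, [/\ testR w,
    BV 1 M (fun x => w x - m x * th x), L1le mu (fun x => w x - m x * th x) (e * M) &
    forall x : pt, w x != 0 -> exists2 y : pt, `|x - y| <= r * e & m (y - e *: v0) != 0].
Proof.
move=> Mm st tr r0 rs Ir.
have [mm m1] := multiplier_meas Mm.
have [S bS] := schR_bump st; have S0 := bump_ge0 ltr01 bS.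
have [C C0 HC] := BV_multiplier Mm.
have Lr := intg_L1le (testR_intg tr); set A := I _ in Lr.
have A0 := L1le_ge0 Lr.
have bm := HC _ _ _ _ ltr01 bS.
have Lx := intg_L1le (schR_moments st 1%N); set X := I _ in Lx.
have X0 := L1le_ge0 Lx.
pose M1 := C * (2 * S); have M10 : 0 <= M1 by rewrite !mulr_ge0.
(* The three terms are the errors, divided by e, of the mollification, the translation and the
   cutoff. *)
pose T := r * A * M1 + (M1 * `|v0| + X).
have T0 : 0 <= T by rewrite !addr_ge0 // !mulr_ge0.
exists (A * M1 + C * S + T); first by rewrite !addr_ge0 // !mulr_ge0.
move=> e /andP[e0 e1].
have ei0 : 0 < e^-1 by rewrite invr_gt0.
pose F0 x := m x * (th x * tent e x).
have bF0 : BV 1 M1 F0 by apply: HC => //; apply: bump_tent => //; rewrite (ltW e0).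
pose F (x : pt) := F0 (x - e *: v0).
have bF : BV 1 M1 F by exact: BV_comp_shift.
have sF x : e^-1 + `|e *: v0| < `|x| -> F x = 0.
  move=> xe; rewrite /F /F0 tent_support ?mulr0 //.
  rewrite -(ltrD2r `|e *: v0|); apply: lt_le_trans xe _.
  by rewrite -{1}(subrK (e *: v0) x); exact: ler_normD.
have iF : intg mu F by have [_ _ L _] := bF; exact: L1le_intg L.
pose w := cv (dil e^-1 rho) F.
have sd : schR (dil e^-1 rho) by apply: schR_dil => //; exact: testR_schR.
have sw : schR w by exact: schR_cv sd (moments_bounded_support iF sF).
have dr x : r * e < `|x| -> dil e^-1 rho x = 0.
  move=> H; rewrite /dil rs ?mulr0 //.
  by rewrite normrZ gtr0_norm // mulrC ltr_pdivlMr.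
have LT : L1le mu (fun x => w x - m x * th x) (e * T).
  have h1 := L1le_cv_sub e0 r0 Lr rs Ir bF.
  have h2 : L1le mu (fun x => F x - F0 x) (e * (M1 * `|v0|)).
    have [_ _ _ /(_ (- (e *: v0)))] := bF0; apply: L1leW.
    by rewrite mul1r normrN normrZ gtr0_norm // mulrCA.
  have h3 : L1le mu (fun x => F0 x - m x * th x) (e * X).
    have LX : L1le mu (fun x : pt => e * `| (`|x| ^+ 1 * th x)|) (e * X).
      by have := L1leZ e (L1le_abs Lx); rewrite gtr0_norm.
    apply: (le_L1le _ _ LX).
    - apply: measurable_funB; first by have [] := bF0.
      by apply: measurable_funM => //; exact: schR_measurable.
    - move=> x; rewrite /F0 expr1 -mulrBr normrM -[leRHS]mul1r; apply: ler_pM => //.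
      rewrite -{2}(mulr1 (th x)) -mulrBr !normrM normr_id.
      rewrite (_ : e * (`|x| * `|th x|) = `|th x| * (e * `|x|)); last by ring.
      by rewrite ler_wpM2l // tent1 // ltW.
  have := L1leD h1 (L1leD h2 h3).
  rewrite -!mulrDr; apply: L1le_eq => x; rewrite -/(w x); ring.
exists w; split.
- by split; [exact: schR_smooth|exists (r * e + (e^-1 + `|e *: v0|)); exact: cv_support].
- apply: (BVW ler01 (M := A * M1 + C * S)); first by rewrite lerDl.
  have := BVD (BV_cv (L1le_dil ei0 Lr) bF) (BVN bm).
  by [].
- apply: L1leW LT; rewrite ler_wpM2l ?(ltW e0) // lerDr addr_ge0 // mulr_ge0 //.
- move=> x wx; apply: contrapT => H; move/eqP: wx; apply.
  rewrite /w /cv (@eq_Rint _ _ _ _ _ (fun=> 0)) ?/Rintegral ?integral0 //.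
  move=> y; have [xy|xy] := leP `|x - y| (r * e); last by rewrite dr ?mul0r.
  have [my|my] := eqVneq (m (y - e *: v0)) 0; last by case: H; exists y.
  by rewrite /F /F0 my mul0r mulr0.
Qed.

End Mollify.

(** * Sequence norms and tails *)

Section SequenceNorm.
Context {R : realType}.
Implicit Types (q : \bar R) (b : int -> R) (k : int).

(* [b] has l^q norm at most [e]; [q = -oo] is irrelevant. *)
Definition qle q b (e : R) : Prop :=
  if q is r%:E then forall N, zsum (fun k => b k `^ r) N <= e `^ r else forall k, b k <= e.

(** The stage at which [k] enters the partial sums: [zidx k < K] means -K <= k < K. *)
Definition zidx k : nat := match k with Posz i => i | Negz i => i end.

Definition cut (K : nat) (d : R) b k : R := if (zidx k < K)%N then d else b k.

(** The common form, used for density, of q < +oo and of the vanishing condition at q = +oo. *)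
Definition tailq q b := forall e : R, 0 < e -> exists K, qle q (cut K 0 b) e.

Definition van b := forall e : R, 0 < e -> exists K, forall k, (K <= zidx k)%N -> b k <= e.

Lemma le_zsum_term b k : (forall k, 0 <= b k) -> b k <= zsum b (zidx k).+1.
Proof.
move=> b0; rewrite zsumS; apply: (@le_trans _ _ (b (Posz (zidx k)) + b (Negz (zidx k)))).
  by case: k => i /=; rewrite ?lerDl ?lerDr.
by rewrite lerDr zsum_ge0.
Qed.

Lemma qle_bound q b e k : (1 <= q)%E -> (forall k, 0 <= b k) -> 0 <= e -> qle q b e -> b k <= e.
Proof.
case: q => [r||] //= r1 b0 e0.
move/(_ (zidx k).+1); move: r1; rewrite lee_fin => r1.
have r0 : 0 < r by lra.
move/(le_trans (le_zsum_term (b := fun k => b k `^ r) k (fun k => powR_ge0 _ _))).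
move=> H; rewrite leNgt; apply/negP => /(gt0_ltr_powR r0); rewrite !nnegrE => /(_ e0 (b0 k)).
by rewrite ltNge H.
Qed.

Lemma le_qle q b b' e e' : (1 <= q)%E -> (forall k, 0 <= b k <= b' k) -> 0 <= e <= e' ->
  qle q b' e -> qle q b e'.
Proof.
case: q => [r||] //= r1 b0 /andP[e0 e1] H; last first.
  by move=> k; have /andP[_ h] := b0 k; exact: le_trans h (le_trans (H k) e1).
have r0 : 0 <= r by move: r1; rewrite lee_fin; lra.
move=> N; apply: (@le_trans _ _ (e `^ r)); last by apply: ge0_ler_powR; rewrite ?nnegrE // (le_trans e0).
apply: le_trans (H N); apply: le_zsum => k; have /andP[h h'] := b0 k.
by apply: ge0_ler_powR; rewrite ?nnegrE // (le_trans h).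
Qed.

Lemma qleZ q b e (c : R) : (1 <= q)%E -> (forall k, 0 <= b k) -> 0 <= e -> 0 <= c ->
  qle q b e -> qle q (fun k => c * b k) (c * e).
Proof.
case: q => [r||] //= r1 b0 e0 c0 H; last by move=> k; rewrite ler_wpM2l.
move=> N; rewrite powRM //.
rewrite (eq_zsum (t' := fun k => c `^ r * b k `^ r)); last by move=> k; rewrite powRM.
by rewrite zsumZ ler_wpM2l // powR_ge0.
Qed.

Lemma powRD_le (r x y : R) : 0 <= r -> 0 <= x -> 0 <= y ->
  (x + y) `^ r <= 2 `^ r * (x `^ r + y `^ r).
Proof.
move=> r0 x0 y0.
apply: (@le_trans _ _ (2 `^ r * Num.max x y `^ r)).
  rewrite -powRM // ?le_max ?x0 //; apply: ge0_ler_powR; rewrite ?nnegrE ?addr_ge0 ?mulr_ge0 ?le_max ?x0 //.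
  by rewrite mulr_natl mulr2n lerD // le_max lexx ?orbT.
rewrite ler_wpM2l ?powR_ge0 //.
by case: (leP x y) => _; rewrite ?lerDl ?lerDr powR_ge0.
Qed.

(** A crude triangle inequality: (x + y)^r <= 2^r (x^r + y^r), and 2 * 2^r <= 4^r as r >= 1. *)
Lemma qleD q b b' e : (1 <= q)%E -> (forall k, 0 <= b k) -> (forall k, 0 <= b' k) -> 0 <= e ->
  qle q b e -> qle q b' e -> qle q (fun k => b k + b' k) (4 * e).
Proof.
case: q => [r||] //= r1 b0 b0' e0 H H'; last by move=> k; have := H k; have := H' k; lra.
move: r1; rewrite lee_fin => r1; have r0 : 0 <= r by lra.
move=> N; apply: (@le_trans _ _ (2 `^ r * (zsum (fun k => b k `^ r) N + zsum (fun k => b' k `^ r) N))).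
  rewrite -zsumD -zsumZ; apply: le_zsum => k; exact: powRD_le.
apply: (@le_trans _ _ (2 `^ r * (2 * e `^ r))).
  by rewrite ler_wpM2l ?powR_ge0 // mulr_natl mulr2n lerD.
rewrite mulrA powRM // ler_wpM2r ?powR_ge0 //.
rewrite (_ : 4 = 2 * 2 :> R); last by ring.
rewrite powRM // ler_wpM2l ?powR_ge0 //.
by rewrite -{1}(powRr1 (a := 2 : R)) //; apply: ler_powR => //; rewrite ler1n.
Qed.

Lemma qle_gconv q x b e : (1 <= q)%E -> 0 < x -> (forall k, 0 <= b k) -> 0 <= e ->
  qle q b e -> qle q (gconv x b) (geoC x * e).
Proof.
move=> q1 x0 b0 e0 H; have hb k : 0 <= b k <= e by rewrite b0 (qle_bound _ q1).
case: q q1 H => [r||] //= r1 H; last by move=> j; exact: gconv_le.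
move=> N; rewrite powRM ?(ltW (geoC_gt0 x0)) //.
by apply: (gconv_lr (B := e)).
Qed.

Lemma geo_le1 (x : R) k : 0 <= x -> geo x k <= 1.
Proof.
move=> x0; rewrite /geo -[leRHS](@expR0 R) ler_expR oppr_le0 !mulr_ge0 //.
exact: ltW ln2_gt0.
Qed.

(** The terms are at most 1, so their r-th powers are smaller still; the summand 1 makes the bound
    at most its own r-th power. *)
Lemma qle_geo q x : (1 <= q)%E -> 0 < x -> qle q (geo x) (1 + geoC x).
Proof.
move=> q1 x0; have g0 := ltW (geoC_gt0 x0).
have h k : geo x k <= 1 by apply: geo_le1; exact: ltW.
case: q q1 => [r||] //= r1; last by move=> k; apply: le_trans (h k) _; rewrite lerDl.
move: r1; rewrite lee_fin => r1 N; have r0 : 0 < r by lra.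
apply: (@le_trans _ _ (zsum (geo x) N)).
  apply: le_zsum => k; rewrite -[leRHS]powRr1 ?(ltW (geo_gt0 _ _)) //.
  by apply: ger_powR; rewrite ?geo_gt0 ?h.
apply: le_trans (zsum_geo0 N x0) _.
apply: (@le_trans _ _ (1 + geoC x)); first by rewrite lerDr.
by rewrite -{1}(powRr1 (a := 1 + geoC x)) ?addr_ge0 //; apply: ler_powR => //; rewrite lerDl.
Qed.

Lemma zsum_cut b K N : zsum (cut K 0 b) N + zsum b K = zsum b (maxn N K).
Proof.
elim: N => [|N IH]; first by rewrite max0n /zsum big_ord0 add0r.
rewrite zsumS {2 3}/cut /=; have [NK|KN] := ltnP N K.
  by rewrite !addr0 IH (maxn_idPr (ltnW NK)) (maxn_idPr NK).
by rewrite addrAC IH (maxn_idPl KN) (maxn_idPl (leqW KN)) zsumS.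
Qed.

Lemma tailq_fin r b e : 1 <= r -> (forall k, 0 <= b k) -> qle r%:E b e -> tailq r%:E b.
Proof.
move=> r1 b0 H d d0; have r0 : 0 < r by lra.
pose t k := b k `^ r; have t0 k : 0 <= t k by exact: powR_ge0.
have bt N : zsum (fun k => `|t k|) N <= e `^ r.
  by rewrite (eq_zsum (t' := t)) ?H // => k; rewrite ger0_norm.
have ct := zlim_cvg bt.
have dr : 0 < d `^ r by exact: powR_gt0.
have /cvgrPdist_le/(_ _ dr) [K _ HK] := ct.
exists K => N.
have -> : zsum (fun k => cut K 0 b k `^ r) N = zsum (cut K 0 t) N.
  by apply: eq_zsum => k; rewrite /cut; case: ifP => // _; rewrite powR0 // gt_eqF.
have := zsum_cut t K N => /(canRL (addrK _)) ->.
apply: (@le_trans _ _ (zlim t - zsum t K)).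
  by rewrite lerB // (zsum_le_zlim t0 (B := e `^ r)).
by apply: le_trans (ler_norm _) _; exact: (HK K (leqnn _)).
Qed.

Lemma tailq_oo b : (forall k, 0 <= b k) -> van b -> tailq +oo%E b.
Proof.
move=> b0 vb e e0; have [K HK] := vb _ e0; exists K => k.
by rewrite /cut; case: ltnP => [_|/HK //]; exact: ltW.
Qed.

Lemma qle_cut q K d : (1 <= q)%E -> 0 <= d -> qle q (cut K d (fun=> 0)) ((K.*2.+1)%:R * d).
Proof.
(* At most 2K terms are nonzero; the added 1 keeps the factor at least 1, hence below its r-th
   power, when K = 0. *)
move=> q1 d0; have D1 : 1 <= (K.*2.+1)%:R :> R by rewrite ler1n.
case: q q1 => [r||] //= r1; last first.
  by move=> k; rewrite /cut; case: ifP => _; rewrite ?mulr_ge0 // ler_peMl.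
move: r1; rewrite lee_fin => r1 N; have r0 : 0 < r by lra.
have h0 : 0 <= d `^ r by exact: powR_ge0.
apply: (@le_trans _ _ ((K.*2)%:R * d `^ r)).
  have -> : zsum (fun k => cut K d (fun=> 0) k `^ r) N = zsum (cut K (d `^ r) (fun=> 0)) N.
    by apply: eq_zsum => k; rewrite /cut; case: ifP => // _; rewrite powR0 // gt_eqF.
  apply: (@le_trans _ _ ((minn N K).*2%:R * d `^ r)); last first.
    by rewrite ler_wpM2r // ler_nat leq_double geq_minr.
  elim: N => [|N IH]; first by rewrite /zsum big_ord0 min0n mul0r.
  rewrite zsumS /cut /=; have [NK|KN] := ltnP N K.
    rewrite (minn_idPl NK); move: IH; rewrite (minn_idPl (ltnW NK)) => IH.
    rewrite doubleS -addn2 natrD mulrDl lerD //.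
    by rewrite mulr_natl mulr2n.
  rewrite !addr0 (minn_idPr _) ?leqW //; move: IH; rewrite (minn_idPr KN) => IH.
  exact: IH.
rewrite powRM // ler_wpM2r //.
apply: (@le_trans _ _ ((K.*2.+1)%:R : R)); first by rewrite ler_nat.
by rewrite -{1}(powRr1 (a := (K.*2.+1)%:R : R)) //; apply: ler_powR.
Qed.

Lemma vanD b b' : van b -> van b' -> van (fun k => b k + b' k).
Proof.
move=> H H' e e0; have e2 : 0 < e / 2 by lra.
have [K HK] := H _ e2; have [K' HK'] := H' _ e2.
exists (maxn K K') => k; rewrite geq_max => /andP[/HK h /HK' h']; lra.
Qed.

Lemma vanZ b c : 0 <= c -> van b -> van (fun k => c * b k).
Proof.
move=> c0 H e e0; have e2 : 0 < e / (c + 1) by rewrite divr_gt0 // ltr_wpDl.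
have [K HK] := H _ e2; exists K => k /HK h.
apply: (@le_trans _ _ (c * (e / (c + 1)))); first by rewrite ler_wpM2l.
by rewrite mulrCA ler_piMr ?(ltW e0) // ler_pdivrMr ?ltr_wpDl // mul1r lerDl.
Qed.

Lemma le_van b b' : (forall k, b k <= b' k) -> van b' -> van b.
Proof. by move=> h H e /H[K HK]; exists K => k /HK; exact: le_trans. Qed.

Lemma van_geo x : 0 < x -> van (geo x).
Proof.
move=> x0; pose r := expR (- (x * ln 2)) : R.
have r1 : `|r| < 1.
  by rewrite ger0_norm ?expR_ge0 // -[ltRHS](@expR0 R) ltr_expR oppr_lt0 mulr_gt0 // ln2_gt0.
move=> e e0; have /cvgrPdist_le/(_ _ e0) [K _ HK] := cvg_expr r1.
exists K => k kK; rewrite geoE -/r.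
have kk : (K <= `|k|)%N by case: k kK => i //= iK; rewrite leqW.
by have := HK _ kk; rewrite sub0r normrN ger0_norm // exprn_ge0 // expR_ge0.
Qed.

(** Half of the decay is turned into decay in j by the triangle inequality; what is left stays
    summable in k. *)
Lemma geo_half (x : R) j k : 0 <= x -> geo x (j - k) * geo x k <= geo (x / 2) j * geo (x / 2) k.
Proof.
move=> x0; rewrite /geo -!expRD ler_expR.
have l0 := @ln2_gt0 R.
have t : `|j%:~R| <= `|(j - k)%:~R| + `|k%:~R| :> R.
  by rewrite -{1}(subrK k j) rmorphD; exact: ler_normD.
have n0 : 0 <= `|(j - k)%:~R| :> R by [].
set a := `|j%:~R| in t *; set b := `|(j - k)%:~R| in t n0 *; set c := `|k%:~R| in t *.
have : x * ln 2 * (a + c) <= x * ln 2 * (2 * (b + c)).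
  by rewrite ler_wpM2l ?mulr_ge0 ?(ltW l0) //; lra.
lra.
Qed.

Lemma van_gconv x b B : 0 < x -> (forall k, 0 <= b k <= B) -> van b -> van (gconv x b).
Proof.
move=> x0 hb vb e e0; have g0 := geoC_gt0 x0.
have x2 : 0 < x / 2 by lra.
have B0 : 0 <= B by have /andP[h] := hb 0; exact: le_trans.
have d0 : 0 < e / 2 / geoC x by rewrite divr_gt0 //; lra.
have [K HK] := vb _ d0.
(* Up to a small constant the sequence is bounded by a multiple of [geo x]: the finitely many large
   terms are absorbed in D. *)
have [D D0 HD] : exists2 D, 0 <= D & forall k, b k <= e / 2 / geoC x + D * geo x k.
  exists (B * expR (x * K.+1%:R * ln 2)); first by rewrite mulr_ge0 ?expR_ge0.
  move=> k; have [kK|/HK kK] := ltnP (zidx k) K; last first.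
    by apply: le_trans kK _; rewrite lerDl !mulr_ge0 ?expR_ge0.
  apply: (@le_trans _ _ B); first by have /andP[] := hb k.
  apply: le_trans (_ : B * expR (x * K.+1%:R * ln 2) * geo x k <= _); last by rewrite lerDr ltW.
  rewrite -mulrA ler_peMr // /geo -expRD -[leLHS](@expR0 R) ler_expR -mulNr -mulrDl.
  rewrite mulr_ge0 ?(ltW ln2_gt0) // -mulrN -mulrDr mulr_ge0 ?(ltW x0) //.
  rewrite subr_ge0 -intr_norm -abszE -pmulrn ler_nat.
  by case: k kK => i //= /ltnW // h; exact: leqW.
have [J HJ] := vanZ (mulr_ge0 D0 (ltW (geoC_gt0 x2))) (van_geo x2) (e := e / 2) (ltac:(lra)).
exists J => j /HJ hj.
have h : gconv x b j <= e / 2 + D * geoC (x / 2) * geo (x / 2) j; last by lra.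
apply: (le_trans (ler_norm _)); apply: zlim_le => N.
apply: (@le_trans _ _ (zsum (fun k => e / 2 / geoC x * geo x (j - k) + D * geo (x / 2) j * geo (x / 2) k) N)).
  apply: le_zsum => k; have /andP[b0 _] := hb k.
  rewrite ger0_norm; last by rewrite mulr_ge0 ?(ltW (geo_gt0 _ _)).
  apply: le_trans (ler_wpM2l (ltW (geo_gt0 _ _)) (HD k)) _.
  rewrite mulrDr mulrC lerD2l mulrCA -[leRHS]mulrA ler_wpM2l //.
  by apply: geo_half; exact: ltW.
rewrite zsumD !zsumZ; apply: lerD.
  apply: (@le_trans _ _ (e / 2 / geoC x * geoC x)); last by rewrite divfK // gt_eqF.
  by rewrite ler_wpM2l ?(ltW d0) // zsum_geo.
by rewrite [leRHS]mulrAC ler_wpM2l ?zsum_geo0 // mulr_ge0 ?(ltW (geo_gt0 _ _)).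
Qed.

End SequenceNorm.

(** * Truncation of the pieces in space and frequency *)

Section Truncation.
Context {R : realType} (n : nat).
Local Notation pt := 'rV[R]_n.+1.
Local Notation mu := (leb R n.+1).
Local Notation I f := (Rintegral mu setT f).
Implicit Types (F G m th chi : pt -> R) (p : \bar R).

Lemma LpB_trunc p F N (u : nat -> pt -> R) (c : R) : (1 <= p)%E -> (p < +oo)%E ->
  LpB mu p F N -> (forall k, measurable_fun setT (u k)) -> (forall k x, `|u k x| <= c) ->
  (forall x, u k x @[k --> \oo] --> (0 : R)) ->
  forall e, 0 < e -> exists k, LpB mu p (fun x => u k x * F x) e.
Proof.
case: p => [r||] // r1 _ LF mu_ uc u0 e e0; have [mF _] := LF; have N0 := LpB_ge0 LF.
move: r1; rewrite lee_fin => r1; have r0 : 0 < r by lra.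
have mUF k : measurable_fun setT (fun x => u k x * F x) by exact: measurable_funM.
have c0 : 0 <= c by apply: le_trans (uc 0%N 0).
have iF : intg mu (fun x => `|F x| `^ r).
  apply: (L1le_intg (A := N `^ r)); split; first exact: measurable_powR_abs.
  have /(LpB_finP mu r1 mF N0) := LF.
  by under [X in (_ -> X <= _)%E]eq_integral do rewrite ger0_norm ?powR_ge0 //.
have iG : intg mu (fun x => c `^ r * `|F x| `^ r) by exact: intgZ.
have lim : I (fun x => `|u k x * F x| `^ r) @[k --> \oo] --> I (fun=> 0 : R).
  apply: (@Rint_dct _ _ (fun k x => `|u k x * F x| `^ r) (fun=> 0) _ _ iG).
  - by move=> k; exact: measurable_powR_abs.
  - move=> k x; rewrite ger0_norm ?powR_ge0 // -powRM // normrM.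
    by apply: ge0_ler_powR; rewrite ?nnegrE ?mulr_ge0 ?(ltW r0) // ler_wpM2r.
  - move=> x; have rn : r != 0 by rewrite gt_eqF.
    rewrite -(powR0 rn) -[in X in _ --> X](normr0 R).
    apply: cvg_powR => //.
    by apply: cvg_norm; rewrite -(mul0r (F x)); apply: cvgMl; exact: u0.
rewrite /Rintegral integral0 /= in lim.
have er : 0 < e `^ r by exact: powR_gt0.
have /cvgrPdist_le/(_ _ er) [k _ /(_ k (leqnn _))] := lim.
rewrite sub0r normrN ger0_norm; last by apply: Rint_ge0 => x; exact: powR_ge0.
move=> Hk; exists k.
apply/(LpB_finP mu r1 (mUF k) (ltW e0)).
have iU : intg mu (fun x => `|u k x * F x| `^ r).
  apply: intg_le iG; first exact: measurable_powR_abs.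
  move=> x; rewrite ger0_norm ?powR_ge0 // -powRM // normrM.
  by apply: ge0_ler_powR; rewrite ?nnegrE ?mulr_ge0 ?(ltW r0) // ler_wpM2r.
by rewrite -EFin_Rint.
Qed.

Variable phi : pt -> R.
Hypotheses (tphi : testR phi).
Variable r1 : R.
Hypotheses (r10 : 0 < r1) (phi1 : forall x, `|x| < r1 -> phi x = 1).

Lemma C0R_cutoff F B chi : (forall x, `|chi x| <= B) -> continuous chi -> C0R F ->
  C0R (fun x => chi x * F x).
Proof.
move=> cB cc [cF [mF [D HD] vF]].
have B0 : 0 <= B by apply: le_trans (cB 0).
split; first by move=> x; apply: (@continuousM _ _ chi F x); [exact: cc|exact: cF].
split; first by apply: measurable_funM => //; exact: continuous_measurable_row.
- by exists (B * D) => x; rewrite normrM ler_pM.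
- move=> e e0; have e1 : 0 < e / (B + 1) by rewrite divr_gt0 // ltr_wpDl.
  have [M HM] := vF _ e1; exists M => x /HM h; rewrite normrM.
  apply: (@le_trans _ _ (B * (e / (B + 1)))); first by rewrite ler_pM.
  by rewrite mulrCA ler_piMr ?(ltW e0) // ler_pdivrMr ?ltr_wpDl // mul1r lerDl.
Qed.

Lemma truncation p F N : (1 <= p)%E -> LpB mu p F N -> (p < +oo)%E \/ p = +oo%E /\ C0R F ->
  forall e, 0 < e -> exists chi, [/\ testR chi,
    LpB mu p (fun x => F x - chi x * F x) e &
    C0R F -> C0R (fun x => F x - chi x * F x)].
Proof.
move=> p1 LF pF e e0; have [mF _] := LF.
have [B HB] := testR_bounded tphi.
pose u k (x : pt) := 1 - phi (k.+1%:R^-1 *: x).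
have k0 k : (k.+1%:R : R)^-1 != 0 by rewrite invr_eq0 pnatr_eq0.
have tk k : testR (fun x => phi (k.+1%:R^-1 *: x)) by exact: testR_scale.
have cu k : continuous (u k).
  exact: smoothR_continuous (smoothRD (smoothR_cst 1) (smoothRN (testR_smooth (tk k)))).
have uB k x : `|u k x| <= 1 + B.
  by apply: le_trans (ler_normB _ _) _; rewrite normr1 lerD2l.
have E k : (fun x => F x - phi (k.+1%:R^-1 *: x) * F x) = fun x => u k x * F x.
  by apply/funext => x; rewrite mulrBl mul1r.
suff [k Hk] : exists k, LpB mu p (fun x => u k x * F x) e.
  exists (fun x => phi (k.+1%:R^-1 *: x)); rewrite E; split=> //.
  by apply: (C0R_cutoff (B := 1 + B)).
have small (M : R) : exists K, forall k x, (K <= k)%N -> `|x| <= M -> u k x = 0.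
  have [K _ Hk] := near_infty_natSinv_lt (PosNum (divr_gt0 r10 (ltr_pwDl ltr01 (normr_ge0 M)))).
  exists K => k x kK xM; rewrite /u phi1 ?subrr //.
  have := Hk k kK => /= h.
  rewrite normrZ ger0_norm ?invr_ge0 //.
  apply: (@le_lt_trans _ _ (k.+1%:R^-1 * (1 + `|M|))).
    by rewrite ler_wpM2l ?invr_ge0 // (le_trans xM) // (le_trans (ler_norm M)) // lerDr.
  by rewrite -ltr_pdivlMr // ltr_pwDl.
case: pF => [poo|[-> [cF [_ _ vF]]]].
  apply: (LpB_trunc (c := 1 + B) p1 poo LF) => //.
    by move=> k; exact: continuous_measurable_row.
  move=> x; apply/cvgrPdist_le => d d0.
  have [K HK] := small `|x|; exists K => // k /= kK.
  by rewrite HK // sub0r normrN normr0 ltW.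
have e1 : 0 < e / (1 + B + 1) by rewrite divr_gt0 // ltr_wpDl // (le_trans _ (uB 0%N 0)).
have [M HM] := vF _ e1; have [k Hk] := small M.
have mk : measurable_fun setT (fun x => u k x * F x).
  by apply: measurable_funM => //; exact: continuous_measurable_row.
exists k; apply/(LpB_ooP (leb_gt0 n) _ mk).
apply: aeW => x /=; have [/(Hk k x (leqnn _)) ->|/HM h] := leP `|x| M; first by rewrite mul0r normr0 ltW.
rewrite normrM; apply: (@le_trans _ _ ((1 + B) * (e / (1 + B + 1)))); first by rewrite ler_pM.
have B0 : 0 <= 1 + B by rewrite (le_trans _ (uB 0%N 0)).
by rewrite mulrCA ler_piMr ?(ltW e0) // ler_pdivrMr ?ltr_wpDl // mul1r lerDl.
Qed.

End Truncation.

Section Density.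
Context {R : realType} (n : nat).
Local Notation pt := 'rV[R]_n.+1.
Local Notation mu := (leb R n.+1).
Local Notation I f := (Rintegral mu setT f).
Implicit Types (f g : int -> pt -> R) (F G m th : pt -> R) (b bb : int -> R).

Lemma BV_intg (b M : R) F : BV b M F -> intg mu F.
Proof. by move=> [_ _ L _]; exact: L1le_intg L. Qed.

(** With finitely many nonzero pieces the series is a finite sum, and H_k, being even, can be
    transposed onto g_k. *)
Lemma Q_finite (H0 : pt -> R) g K : schR H0 -> evenf H0 ->
  (forall k, moments (g k)) -> (forall k, (K <= zidx k)%N -> g k = fun=> 0) ->
  let G x := zsum (fun k => cv (hk H0 k) (g k) x) K in
  schR G /\ forall F, intg mu F -> Q H0 g F = I (fun x => G x * F x).
Proof.
move=> sH eH mg g0 G.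
have sh k : schR (hk H0 k) by exact: schR_hk.
have sc k : schR (cv (hk H0 k) (g k)) by exact: schR_cv.
have sz (t : int -> pt -> R) N : (forall k, schR (t k)) -> schR (fun x => zsum (t^~ x) N).
  move=> st; elim: N => [|N IH].
    by rewrite (_ : (fun x => _) = fun=> 0); [exact: schR0|apply/funext => x; rewrite /zsum big_ord0].
  rewrite (_ : (fun x => _) = fun x => zsum (t^~ x) N + (t (Posz N) x + t (Negz N) x)).
    by apply: schRD => //; exact: schRD.
  by apply/funext => x; rewrite zsumS.
split; first exact: sz.
move=> F iF.
have qE k : qterm H0 g F k = I (fun x => cv (hk H0 k) (g k) x * F x).
  rewrite /qterm.
  have [B HB] := schR_bounded (sh k).
  have ig := moments_intg (mg k).
  have LD (x : pt) : L1le mu (fun y : pt => g k y * hk H0 k (y - x)) (B * I (fun x => `|g k x|)).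
    under eq_fun do rewrite mulrC.
    apply: L1leM (intg_L1le ig) => //.
    - by apply: le_trans (HB 0).
    - by apply: measurableT_comp (measurable_rowB _ _) => //; exact: schR_measurable.
  have [_ _ _ ->] := dual_cv (intg_meas ig) (sh k) iF LD.
  have ek : evenf (hk H0 k) by exact: dil_even.
  apply: eq_Rint => x; congr (_ * _); apply: eq_Rint => y.
  by rewrite mulrC -(ek (x - y)) opprB.
have iq k : intg mu (fun x => cv (hk H0 k) (g k) x * F x).
  have [B HB] := schR_bounded (sc k).
  by apply: (intgM (c := B)) => //; exact: schR_measurable.
have zE N : zsum (fun k => I (fun x => cv (hk H0 k) (g k) x * F x)) N =
    I (fun x => zsum (fun k => cv (hk H0 k) (g k) x) N * F x) /\
    intg mu (fun x => zsum (fun k => cv (hk H0 k) (g k) x) N * F x).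
  have si := sz _ N sc.
  have [B HB] := schR_bounded si.
  split; last by apply: (intgM (c := B)) => //; exact: schR_measurable.
  have -> : (fun x => zsum (fun k => cv (hk H0 k) (g k) x) N * F x) =
    fun x => \sum_(i < N) (cv (hk H0 (Posz i)) (g (Posz i)) x * F x + cv (hk H0 (Negz i)) (g (Negz i)) x * F x).
    by apply/funext => x; rewrite /zsum mulr_suml; apply: eq_bigr => i _; rewrite mulrDl.
  by rewrite Rint_sum => [|i]; [apply: eq_bigr => i _; rewrite RintD|exact: intgD].
rewrite -(zE K).1 /Q; apply: zlim_unique.
have -> : qterm H0 g F = fun k => I (fun x => cv (hk H0 k) (g k) x * F x) by exact/funext.
apply: cvg_near_cst; exists K => // N /= KN.
elim: N KN => [|N IH]; first by rewrite leqn0 => /eqP ->.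
rewrite leq_eqVlt => /orP[/eqP -> //|]; rewrite ltnS => KN.
rewrite zsumS IH // !(g0 _) //.
have h k : I (fun x => cv (hk H0 k) (fun=> 0) x * F x) = 0.
  rewrite (@eq_Rint _ _ _ _ _ (fun=> 0)) ?/Rintegral ?integral0 // => x.
  rewrite /cv (@eq_Rint _ _ _ _ _ (fun=> 0)) ?/Rintegral ?integral0 ?mul0r // => y.
  by rewrite mulr0.
by rewrite !h !addr0.
Qed.

Variable phi : pt -> R.
Hypotheses (tphi : testR phi).
Variable r1 : R.
Hypotheses (r10 : 0 < r1) (phi1 : forall x, `|x| < r1 -> phi x = 1).

Lemma truncate_seq (p q : \bar R) (s : R) (H0 : pt -> R) f bb : (1 <= p)%E -> (1 <= q)%E ->
  schR H0 -> evenf H0 -> lpseq p s f bb -> tailq q bb ->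
  (forall k, (p < +oo)%E \/ p = +oo%E /\ C0R (f k)) ->
  forall e, 0 < e -> exists g b' G, [/\ lpseq p s (fun k x => f k x - g k x) b', qle q b' e,
    (van bb -> van b'), (forall k, C0R (f k) -> C0R (fun x => f k x - g k x)) /\ lpseq p s g (fun k => bb k + b' k) &
    schR G /\ forall F, intg mu F -> Q H0 g F = I (fun x => G x * F x)].
Proof.
move=> p1 q1 sH eH lf tb pf e e0.
have e8 : 0 < e / 8 by lra.
have e4 : 0 < e / 4 by lra.
have [K HK] := tb _ e4.
(* The 2K truncated pieces have errors of l^q norm at most e/4 by [qle_cut], and so does the tail;
   [qleD] turns the two into e. *)
pose d := e / 4 / (K.*2.+1)%:R.
have d0 : 0 < d by rewrite divr_gt0.
have T k : exists chi, [/\ testR chi, LpB mu p (fun x => f k x - chi x * f k x) (ps (- s) k * d) &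
    C0R (f k) -> C0R (fun x => f k x - chi x * f k x)].
  have [_ L] := lf k; apply: (truncation tphi r10 phi1 p1 L (pf k)).
  by rewrite mulr_gt0 // ps_gt0.
have [chi Hchi] := choice T.
pose g k x := if (zidx k < K)%N then chi k x * f k x else 0.
pose b' := cut K d bb.
have b0 k : 0 <= bb k by have [] := lf k.
have Lb k : LpB mu p (fun x => f k x - g k x) (ps (- s) k * b' k).
  rewrite /g /b' /cut; have [_ L _] := Hchi k; have [_ L'] := lf k; case: (zidx k < K)%N => //.
  by under eq_fun do rewrite subr0.
have b'0 k : 0 <= b' k by rewrite /b' /cut; case: ifP => // _; exact: ltW.
exists g, b'.
have mg k : moments (g k).
  rewrite /g; case: (zidx k < K)%N; last first.
    by apply: schR_moments; exact: schR0.
  have [tc _ _] := Hchi k; have [_ L] := lf k.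
  have [_ [M HM]] := tc.
  have [B HB] := testR_bounded tc.
  apply: (moments_bounded_support (M := M)); last by move=> x /HM ->; rewrite mul0r.
  under eq_fun do rewrite mulrC.
  exact: L1le_intg (L1le_holder_ge0 p1 L HB (intg_L1le (testR_intg tc))).
exists (fun x => zsum (fun k => cv (hk H0 k) (g k) x) K); split.
- by move=> k.
- have -> : b' = fun k => cut K d (fun=> 0) k + cut K 0 bb k.
    by apply/funext => k; rewrite /b' /cut; case: ifP; rewrite ?addr0 ?add0r.
  rewrite (_ : e = 4 * (e / 4)); last by field.
  have h1 k : 0 <= cut K d (fun=> 0) k by rewrite /cut; case: ifP => // _; exact: ltW.
  have h2 k : 0 <= cut K 0 bb k by rewrite /cut; case: ifP.
  apply: (qleD q1 h1 h2 (ltW e4) _ HK).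
  have := qle_cut K q1 (ltW d0).
  by rewrite (_ : _ * d = e / 4) // /d mulrCA mulfV ?mulr1 // pnatr_eq0.
- move=> vb c /vb[K' HK']; exists (maxn K K') => k; rewrite geq_max => /andP[kK kK'].
  by rewrite /b' /cut ltnNge kK /=; exact: HK'.
- split=> k.
    have [_ _ C] := Hchi k; rewrite /g; case: (zidx k < K)%N => // cf.
    by under eq_fun do rewrite subr0.
  split; first by rewrite addr_ge0.
  rewrite mulrDr; have [_ L] := lf k; have := LpBB p1 L (Lb k).
  by congr LpB; apply/funext => x; rewrite opprB addrCA subrr addr0.
- apply: Q_finite => // k kK; apply/funext => x; rewrite /g ltnNge kK.
  by [].
Qed.

End Density.

(** * Special Lipschitz domains *)

Section Graph.
Context {R : realType} (n : nat).
Local Notation pt := 'rV[R]_n.+1.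
Implicit Types (x v : pt).
Variables (g : 'rV[R]_n -> R) (L : R).
Hypotheses (L0 : 0 <= L) (gL : forall x y : 'rV[R]_n, `|g x - g y| <= L * `|x - y|).

Definition height x : R := x ord0 ord_max - g (col' ord_max x).

Definition above x : R := (0 < height x)%R%:R.
Definition below x : R := 1 - above x.

Lemma measurable_g : measurable_fun setT g.
Proof.
apply: continuous_measurable_row; apply: (@lipschitz_continuous R n g L L0) => x v.
by apply: le_trans (gL _ _) _; rewrite addrAC subrr add0r.
Qed.

Lemma height_lip x v : `|height (x + v) - height x| <= (1 + L) * `|v|.
Proof.
have -> : height (x + v) - height x =
    v ord0 ord_max + (g (col' ord_max x) - g (col' ord_max (x + v))).
  by rewrite /height !mxE; ring.
apply: le_trans (ler_normD _ _) _; rewrite mulrDl mul1r; apply: lerD; first exact: normr_coord.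
apply: le_trans (gL _ _) _; rewrite ler_wpM2l //.
apply: row_normP => // i; rewrite !mxE opprD addrA subrr add0r normrN.
exact: normr_coord.
Qed.

Lemma measurable_height : measurable_fun setT height.
Proof.
apply: measurable_funB; first exact: measurable_coord.
by apply: measurableT_comp; [exact: measurable_g|exact: measurable_col'].
Qed.

Lemma above01 x : above x = 0 \/ above x = 1.
Proof. by rewrite /above; case: ltP; [right|left]. Qed.

(** The height is Lipschitz with constant 1 + L, so its sign can change along [v] only from within
    the strip. *)
Lemma above_jump x v : `|above (x + v) - above x| <= strip g ((1 + L) * `|v|) x.
Proof.
rewrite /strip -/(height x); have := height_lip x v; rewrite ler_norml => /andP[h1 h2].
have [N|] := boolP (`|height x| <= (1 + L) * `|v|); first by rewrite /above; do 2!case: ltP => _; rewrite ?subrr ?normr0 ?sub0r ?subr0 ?normrN ?normr1 ?ler01.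
rewrite -ltNge => N; suff -> : above (x + v) = above x by rewrite subrr normr0.
rewrite /above; congr (_%:R); congr nat_of_bool; apply/idP/idP => h; move: N; rewrite lter_normr => /orP[]; lra.
Qed.

Lemma multiplier_above : multiplier above.
Proof.
exists g, (1 + L); split => //; [exact: measurable_g|by rewrite addr_ge0| | |exact: above_jump].
- rewrite (_ : above = fun x => 1 - (height x <= 0)%R%:R); last first.
    by apply/funext => x; rewrite /above leNgt; case: ltP; rewrite /= ?subr0 ?subrr.
  by apply: measurable_funB => //; apply: measurable_leR; exact: measurable_height.
- by move=> x; case: (above01 x) => ->; rewrite ?normr0 ?normr1.
Qed.

Lemma multiplier_below : multiplier below.
Proof.
have [h [L' [mh L'0 ma a1 aj]]] := multiplier_above.
exists h, L'; split => //.
- exact: measurable_funB.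
- by move=> x; rewrite /below; case: (above01 x) => ->; rewrite ?subr0 ?subrr ?normr0 ?normr1.
- by move=> x v; rewrite /below (_ : _ - _ = - (above (x + v) - above x)) ?normrN //; ring.
Qed.

(** The uniform margin [d] passes to the closure of the set where [th] is nonzero, which a strict
    inequality would not. *)
Definition inside (th : pt -> R) := exists2 d : R, 0 < d & forall x, th x != 0 -> d <= height x.
Definition outside (th : pt -> R) := exists2 d : R, 0 < d & forall x, th x != 0 -> height x <= - d.

Definition vert (c : R) : pt := c *: delta_mx 0 ord_max.

Lemma height_vert x (c : R) : height (x + vert c) = height x + c.
Proof.
rewrite /height !mxE eqxx mulr1.
have -> : col' ord_max (x + vert c) = col' ord_max x.
  apply/rowP => i; rewrite !mxE (negbTE (_ : lift ord_max i != ord_max)) ?andbF ?mulr0 ?addr0 //.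
  by rewrite eq_sym neq_lift.
by rewrite addrAC.
Qed.

Variable rho : pt -> R.
Hypothesis trho : testR rho.
Variable r : R.
Hypotheses (r0 : 0 <= r) (rhos : forall x, r < `|x| -> rho x = 0).
Hypothesis Irho : Rintegral (leb R n.+1) setT rho = 1.

(** A mollifier of radius r e may lower the height by (1 + L) r e. Raising by e times this constant
    compensates for it and leaves the margin e. *)
Let c0 : R := (1 + L) * r + 1.

Lemma mollify_above th : schR th -> exists2 M, 0 <= M & forall e, 0 < e <= 1 -> exists w,
  [/\ testR w, BV 1 M (fun x => w x - above x * th x),
      L1le (leb R n.+1) (fun x => w x - above x * th x) (e * M) & inside w].
Proof.
move=> st; have [M M0 HM] := mollify (vert c0) multiplier_above st trho r0 rhos Irho.
exists M => // e e1; have [w [tw bw lw sw]] := HM e e1; exists w; split=> //.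
have /andP[e0 _] := e1; exists e => // x /sw[y xy].
rewrite /above; case: ltP => [|_ /eqP //] hy _.
have := height_lip y (x - y); rewrite subrKC ler_norml => /andP[h _].
have := height_vert (y - e *: vert c0) (e * c0).
rewrite /vert -scalerA subrK => h'.
have : (1 + L) * `|x - y| <= (1 + L) * (r * e) by rewrite ler_wpM2l // addr_ge0.
move: h' hy h; rewrite /vert /c0; lra.
Qed.

Lemma mollify_below th : schR th -> exists2 M, 0 <= M & forall e, 0 < e <= 1 -> exists w,
  [/\ testR w, BV 1 M (fun x => w x - below x * th x),
      L1le (leb R n.+1) (fun x => w x - below x * th x) (e * M) & outside w].
Proof.
move=> st; have [M M0 HM] := mollify (vert (- c0)) multiplier_below st trho r0 rhos Irho.
exists M => // e e1; have [w [tw bw lw sw]] := HM e e1; exists w; split=> //.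
have /andP[e0 _] := e1; exists e => // x /sw[y xy].
rewrite /below /above; case: ltP => [_|hy _]; first by rewrite subrr eqxx.
have := height_lip y (x - y); rewrite subrKC ler_norml => /andP[_ h].
have := height_vert (y - e *: vert (- c0)) (e * - c0).
rewrite /vert -scalerA subrK => h'.
have : (1 + L) * `|x - y| <= (1 + L) * (r * e) by rewrite ler_wpM2l // addr_ge0.
move: h' hy h; rewrite /vert /c0; lra.
Qed.

End Graph.

(** * Extension, uniqueness and density for real functionals *)

Section RealCore.
Context {R : realType} (n : nat).
Local Notation pt := 'rV[R]_n.+1.
Local Notation mu := (leb R n.+1).
Local Notation I f := (Rintegral mu setT f).
Implicit Types (f : int -> pt -> R) (F G m th w : pt -> R) (b bb : int -> R) (v : (pt -> R) -> R).

Lemma small_powR (A tau e : R) : 0 <= A -> 0 < tau -> 0 < e ->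
  exists2 d, 0 < d <= 1 & A * d `^ tau <= e.
Proof.
move=> A0 t0 e0; pose x := e / (A + 1).
have x0 : 0 < x by rewrite divr_gt0 // ltr_wpDl.
have y0 : 0 < x `^ tau^-1 by exact: powR_gt0.
exists (Num.min 1 (x `^ tau^-1)).
  by rewrite min_gt0 // ge_min lexx.
apply: (@le_trans _ _ (A * x)).
  rewrite ler_wpM2l //.
  have tn : tau != 0 by rewrite gt_eqF.
  rewrite [leRHS](_ : x = (x `^ tau^-1) `^ tau); last by rewrite -powRrM mulVf // powRr1 // ltW.
  by apply: ge0_ler_powR; rewrite ?nnegrE ?(ltW t0) ?(ltW y0) // ?le_min ?ler01 ?(ltW y0) // ge_min lexx orbT.
by rewrite /x mulrCA ler_piMr ?(ltW e0) // ler_pdivrMr ?ltr_wpDl // mul1r lerDl.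
Qed.

Variable phi : pt -> R.
Hypotheses (tphi : testR phi) (ephi : evenf phi) (phi0 : phi 0 = 1).
Hypothesis phi_ge0 : forall x, 0 <= phi x.
Hypothesis phi_lp : forall x, (phi (4^-1 *: x) - phi (2 *: x)) * (phi (2^-1 *: x) - phi x) =
  phi (2^-1 *: x) - phi x.
Variable r1 : R.
Hypotheses (r10 : 0 < r1) (phi1 : forall x, `|x| < r1 -> phi x = 1).
Local Notation h := (lp0 phi).
Local Notation H := (LP0 phi).

(** If the integral were 0, the nonnegative [phi] would be 0 in L^1, hence so would its inverse
    transform vanish identically; but the integral of the latter is phi(0) = 1. *)
Lemma Rint_phi_gt0 : 0 < I phi.
Proof.
rewrite lt_neqAle Rint_ge0 // andbT eq_sym; apply/eqP => I0.
have L : L1le mu phi 0.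
  rewrite -I0; have := intg_L1le (testR_intg tphi); congr L1le; apply: eq_Rint => x.
  by rewrite ger0_norm.
have Z x : ift phi x = 0.
  have [mc _] := measurable_trig x.
  have := L1le_Rintegral (L1leM ler01 mc (fun y => cos_le1 _) L).
  by rewrite mulr0 normr_le0 /ift => /eqP h0; rewrite /ct h0 mulr0.
have := Rint_ift tphi; rewrite phi0 (@eq_Rint _ _ _ _ _ (fun=> 0)) // /Rintegral integral0 /= => /eqP.
by rewrite eq_sym oner_eq0.
Qed.

Lemma exists_mollifier : exists rho r, [/\ testR rho, 0 <= r,
  forall x : pt, r < `|x| -> rho x = 0 & I rho = 1].
Proof.
have [_ [M HM]] := tphi.
exists (fun x => (I phi)^-1 * phi x), (Num.max 0 M); split.
- exact: testRZ.
- by rewrite le_max lexx.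
- by move=> x; rewrite gt_max => /andP[_ /HM ->]; rewrite mulr0.
- by rewrite RintZl ?mulVf ?gt_eqF // ?Rint_phi_gt0 //; exact: testR_intg.
Qed.

Variables (p : \bar R) (s ka : R).
Local Notation al := (alp p).
Hypotheses (p1 : (1 <= p)%E) (ka0 : 0 < ka).
Hypotheses (ka1 : 2 * ka <= s + 1 - al) (ka2 : 2 * ka <= al - s).
Variables (g : 'rV[R]_n -> R) (L : R).
Hypotheses (L0 : 0 <= L) (gL : forall x y : 'rV[R]_n, `|g x - g y| <= L * `|x - y|).
Local Notation above := (above g).
Local Notation below := (below g).

Let ka1' : ka <= s + 1 - al. Proof. exact: ltW (half_lt ka0 ka1). Qed.
Let ka2' : ka < al - s. Proof. exact: half_lt ka0 ka2. Qed.
Let sh := schR_lp0 tphi.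
Let sH := schR_LP0 tphi.
Let eh : evenf h := @lp0_even _ _ _.
Let eH : evenf H := @LP0_even _ _ _.
Let Ih : I h = 0 := Rint_lp0 tphi phi0.
Let IH : I H = 0 := Rint_LP0 tphi phi0.

(** What is known beforehand of the real or imaginary part of an element. The slack [e] is there
    because an L^p norm of a distribution is an infimum over representatives, and the representative
    in C^0_0 may be another one. *)
Definition dataR (c0 : bool) v b := [/\ tempR v, smallPhi phi v,
  forall k, 0 <= b k /\ forall e, 0 < e -> exists2 F, repR F (fun th => v (cv (hk h k) th)) &
    LpB mu p F (ps (- s) k * b k + e) &
  c0 -> forall k, exists2 F, repR F (fun th => v (cv (hk h k) th)) & C0R F].

Definition canonR v (f : int -> pt -> R) (c0 : bool) (bb : int -> R) :=
  [/\ lpseq p s f bb, c0 -> forall k, C0R (f k) & forall th, schR th -> v th = Q H f th].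

(** As [canon] does not depend on the representative, the slack can be let go to 0 and the bound
    becomes exact. *)
Lemma canon_data : exists2 C, 0 < C & forall c0 v b, dataR c0 v b ->
  canonR v (canon phi v) c0 (fun k => C * b k).
Proof.
have [C C0 HC] := canon_rep tphi ephi phi_lp p1.
(* The C^0_0 representative is not known to be the one with the L^p bound; being bounded, it is
   treated with exponent +oo. *)
have [C' C'0 HC'] := canon_rep tphi ephi phi_lp (leey 1 : (1 <= +oo :> \bar R)%E).
exists C => // c0 v b [tv sv bv cv0].
split.
- move=> k; have [b0 Hb] := bv k; split; first by rewrite mulr_ge0 // ltW.
  have mc : measurable_fun setT (canon phi v k).
    by have [F rF LF] := Hb 1 ltr01; have [[]] := HC v F _ k rF LF.
  split=> //; apply/lee_addgt0Pr => e e0.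
  have [F rF LF] := Hb _ (divr_gt0 e0 C0).
  have [_ [_ H] _] := HC v F _ k rF LF.
  by apply: le_trans H _; rewrite -EFinD lee_fin mulrDr mulrCA [C * (e / C)]mulrC divfK // gt_eqF.
- move=> c k; have [F rF cF] := cv0 c k.
  have [_ [mF [B HB] _]] := cF.
  have LF : LpB mu +oo%E F B by apply/(LpB_ooP (leb_gt0 n) _ mF); exact: aeW.
  by have [_ _ /(_ cF)] := HC' v F B k rF LF.
- move=> th st; apply: decompose => // k.
  by have [_ /(_ 1 ltr01)[F rF LF]] := bv k; have [] := HC v F _ k rF LF.
Qed.

(** The product of [v] with the indicator of the domain. *)
Definition ext v th := Q H (canon phi v) (fun x => above x * th x).

Lemma gconvZ b (B C : R) j : 0 <= C -> (forall k, 0 <= b k <= B) ->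
  gconv ka (fun k => C * b k) j = C * gconv ka b j.
Proof.
move=> C0 hb; rewrite /gconv -(zlimZ C (fun N : nat => gconv_bound j N ka0 hb)).
by congr zlim; apply/funext => k; rewrite mulrCA.
Qed.

Lemma ext_bes : exists2 C, 0 < C & forall c0 v b (B : R), dataR c0 v b -> (forall k, b k <= B) ->
  besR p s h c0 (ext v) (fun j => C * gconv ka b j).
Proof.
have [C C0 HC] := canon_data.
have [C' C'0 HC'] := besR_Q p1 ka0 ka1 ka2 sh Ih eh sH IH eH (multiplier_above L0 gL).
exists (C' * C); first exact: mulr_gt0.
move=> c0 v b B dv bB; have [lf cf vE] := HC _ _ _ dv.
have hb k : 0 <= b k <= B by rewrite bB andbT; have [_ _ /(_ k)[]] := dv.
have := HC' c0 _ _ (C * B) lf (fun k => ler_wpM2l (ltW C0) (bB k)) cf.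
by congr besR; apply/funext => j; rewrite (gconvZ _ (ltW C0) hb) mulrA.
Qed.

Lemma ext_agree c0 v b th : dataR c0 v b -> schR th -> (forall x, above x * th x = th x) ->
  ext v th = v th.
Proof.
have [C C0 HC] := canon_data.
move=> dv st E; have [_ _ vE] := HC _ _ _ dv.
rewrite (vE th st) /ext (_ : (fun x => above x * th x) = th) //.
by apply/funext => x; exact: E.
Qed.

Lemma ext_zero v th : (forall x, above x * th x = 0) -> ext v th = 0.
Proof.
move=> E; rewrite /ext (_ : (fun x => _) = fun=> 0); last by apply/funext => x; exact: E.
rewrite /Q (_ : qterm _ _ _ = fun=> 0) ?zlim0 //; apply/funext => k.
rewrite /qterm (@eq_Rint _ _ _ _ _ (fun=> 0)) ?/Rintegral ?integral0 // => z.
rewrite /cv (@eq_Rint _ _ _ _ _ (fun=> 0)) ?/Rintegral ?integral0 ?mulr0 // => y.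
by rewrite mulr0.
Qed.

Lemma Q_sub f f' bb bb' b' (B b M : R) F : lpseq p s f bb -> lpseq p s f' bb' ->
  lpseq p s (fun k x => f k x - f' k x) b' -> (forall k, bb k <= B) -> (forall k, bb' k <= B) ->
  (forall k, b' k <= B) -> 0 < b -> BV b M F ->
  Q H (fun k x => f k x - f' k x) F = Q H f F - Q H f' F.
Proof.
move=> l1 l2 l3 b1 b2 b3 b0 bF; apply: zlim_unique.
have E N : zsum (qterm H (fun k x => f k x - f' k x) F) N = zsum (qterm H f F) N - zsum (qterm H f' F) N.
  rewrite -[- _]mulN1r -zsumZ -zsumD; apply: eq_zsum => k; rewrite mulN1r.
  rewrite /qterm -RintB; last 2 first.
  - exact: L1le_intg (qterm_L1 p1 ka0 ka1' ka2' sH IH k l1 b0 bF).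
  - exact: L1le_intg (qterm_L1 p1 ka0 ka1' ka2' sH IH k l2 b0 bF).
  by apply: eq_Rint => x; rewrite mulrBl.
rewrite (_ : zsum _ = fun N => zsum (qterm H f F) N - zsum (qterm H f' F) N); last by apply/funext.
by apply: cvgB; [exact: (Q_cvg p1 ka0 ka1' ka2' sH IH l1 b1 b0 bF)|exact: (Q_cvg p1 ka0 ka1' ka2' sH IH l2 b2 b0 bF)].
Qed.

(** The approximations converge in the sense of [Q_small], so that their vanishing passes to the
    limit. *)
Lemma Q_mollify_zero f bb (B : R) m th : lpseq p s f bb -> (forall k, bb k <= B) ->
  multiplier m -> schR th ->
  (exists2 M, 0 <= M & forall e, 0 < e <= 1 -> exists w, [/\ testR w,
    BV 1 M (fun x => w x - m x * th x), L1le mu (fun x => w x - m x * th x) (e * M) & Q H f w = 0]) ->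
  Q H f (fun x => m x * th x) = 0.
Proof.
move=> lf fB Mm st [M M0 HM].
have [C C0 HC] := Q_small p1 ka0 ka1 ka2 sH IH.
have B0 : 0 <= B by have [b0 _] := lf 0; exact: le_trans (fB 0).
have [M' M'0 bm] := schR_mul_BV Mm st.
apply/eqP; rewrite -normr_le0; apply/ler_addgt0Pr => e e0; rewrite add0r.
have t0 : 0 < ka / n.+2%:R by rewrite divr_gt0.
have [d d1 Hd] := small_powR (mulr_ge0 (mulr_ge0 C0 B0) M0) t0 e0.
have [w [tw bw lw w0]] := HM d d1.
have := HC f bb B M d _ lf fB d1 bw lw.
have E : Q H f w = Q H f (fun x => m x * th x) + Q H f (fun x => w x - m x * th x).
  rewrite -(QD p1 ka0 ka1' ka2' sH IH lf fB ltr01 bm bw).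
  by congr Q; apply/funext => x; rewrite addrC subrK.
move: E; rewrite w0 => /eqP; rewrite eq_sym addr_eq0 => /eqP ->; rewrite normrN => h1.
exact: le_trans h1 Hd.
Qed.

(** [Q] can cut a Schwartz function along the graph, which [v] alone cannot. Each half is a limit of
    test functions supported strictly on its side, where [v] vanishes: no such distribution lives on
    the graph. *)
Lemma dataR_unique c0 v b (B : R) : dataR c0 v b -> (forall k, b k <= B) ->
  (forall th, testR th -> inside g th -> v th = 0) ->
  (forall th, testR th -> outside g th -> v th = 0) ->
  forall th, schR th -> v th = 0.
Proof.
move=> dv bB vin vout th st.
have [C C0 HC] := canon_data; have [lf _ vE] := HC _ _ _ dv.
have fB k : C * b k <= C * B by rewrite ler_wpM2l // ltW.
have [rho [r [trho r0 rs Ir]]] := exists_mollifier.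
have ma := multiplier_above L0 gL; have mb := multiplier_below L0 gL.
have [M1 _ b1] := schR_mul_BV ma st; have [M2 _ b2] := schR_mul_BV mb st.
rewrite vE //.
have -> : th = fun x => above x * th x + below x * th x.
  by apply/funext => x; rewrite /below; ring.
rewrite (QD p1 ka0 ka1' ka2' sH IH lf fB ltr01 b1 b2) !(Q_mollify_zero lf fB) ?addr0 //.
- have [M M0 HM] := mollify_below L0 gL trho r0 rs Ir st; exists M => // e /HM[w [tw bw lw ow]].
  by exists w; split=> //; rewrite -vE ?vout //; exact: testR_schR.
- have [M M0 HM] := mollify_above L0 gL trho r0 rs Ir st; exists M => // e /HM[w [tw bw lw ow]].
  by exists w; split=> //; rewrite -vE ?vin //; exact: testR_schR.
Qed.

Lemma dataR_dense (q : \bar R) c0 v b (B e : R) : (1 <= q)%E -> dataR c0 v b -> (forall k, b k <= B) ->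
  tailq q b -> (p < +oo)%E \/ p = +oo%E /\ c0 -> 0 < e ->
  exists w z b', [/\ testR w, inside g w, besR p s h c0 z b', 
    (forall th, schR th -> (forall x, above x * th x = th x) -> z th = v th - I (fun x => w x * th x)) &
    [/\ forall k, 0 <= b' k, qle q b' e & van b -> van b']].
Proof.
move=> q1 dv bB tb pc e0.
have [C C0 HC] := canon_data; have [lf cf vE] := HC _ _ _ dv.
have b0 k : 0 <= b k by have [_ _ /(_ k)[]] := dv.
set f := canon phi v in lf cf vE.
have ma := multiplier_above L0 gL.
have [C' C'0 HC'] := besR_Q p1 ka0 ka1 ka2 sh Ih eh sH IH eH ma.
have [C2 C20 HC2] := besR_L1 p1 ka0 ka1 ka2 sh Ih eh.
have tCb : tailq q (fun k => C * b k).
  move=> d d0; have [K HK] := tb _ (divr_gt0 d0 C0); exists K.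
  have := qleZ q1 _ _ (ltW C0) HK.
  rewrite (_ : C * (d / C) = d); last by rewrite mulrC divfK // gt_eqF.
  have -> : cut K 0 (fun k => C * b k) = fun k => C * cut K 0 b k.
    by apply/funext => k; rewrite /cut; case: ifP; rewrite ?mulr0.
  by apply=> [k|]; [rewrite /cut; case: ifP|rewrite ltW // divr_gt0].
have pf k : (p < +oo)%E \/ p = +oo%E /\ C0R (f k).
  by case: pc => [|[-> c]]; [left|right; split=> //; exact: cf].
have gC0 := geoC_gt0 ka0.
have e40 : 0 < e / 4 by lra.
(* The bound of the extension multiplies the truncation error by C' geoC(ka), leaving e/4; the
   mollification error takes another e/4, and [qleD] makes e of both. *)
pose d := e / 4 / (C' * geoC ka).
have d0 : 0 < d by rewrite divr_gt0 // mulr_gt0.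
have [gg [b1 [G [l1 q1' vb1 [c1 lg] [sG QG]]]]] := truncate_seq tphi r10 phi1 p1 q1 sH eH lf tCb pf d0.
have b10 k : 0 <= b1 k by have [] := l1 k.
have b1d k : b1 k <= d by exact: qle_bound q1 b10 (ltW d0) q1'.
have [rho [r [trho r0 rs Ir]]] := exists_mollifier.
have [M M0 HM] := mollify_above L0 gL trho r0 rs Ir sG.
have t0 : 0 < ka / n.+2%:R by rewrite divr_gt0.
have e4 : 0 < e / 4 / (1 + geoC ka) by rewrite divr_gt0 // addr_gt0.
have [u u1 Hu] := small_powR (mulr_ge0 C20 M0) t0 e4.
have [w [tw bw lw iw]] := HM u u1.
have bw' : BV 1 M (fun x => above x * G x - w x).
  by have := BVN bw; congr BV; apply/funext => x; rewrite opprB.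
have lw' : L1le mu (fun x => above x * G x - w x) (u * M).
  by have := L1leN lw; congr L1le; apply/funext => x; rewrite opprB.
have [mm m1] := multiplier_meas ma.
have vG : vanishR (fun x => above x * G x - w x).
  apply: vanishRD; first by apply: vanishRM => //; exact: schR_vanish.
  by apply: schR_vanish; apply: testR_schR; exact: testRN.
(* An extension of v - w: the truncation error times the indicator, plus the mollification error
   above G - w, which is an integrable function. *)
pose zz th := Q H (fun k x => f k x - gg k x) (fun x => above x * th x) +
  I (fun x => (above x * G x - w x) * th x).
pose b' j := C' * gconv ka b1 j + C2 * M * u `^ (ka / n.+2%:R) * geo ka j.
have hb1 k : 0 <= b1 k <= d by rewrite b10 b1d.
have g1 j : 0 <= C' * gconv ka b1 j by rewrite mulr_ge0 ?(ltW C'0) // (gconv_ge0 j ka0 hb1).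
have cu : 0 <= C2 * M * u `^ (ka / n.+2%:R) by rewrite !mulr_ge0 ?powR_ge0.
have g2 j : 0 <= C2 * M * u `^ (ka / n.+2%:R) * geo ka j by rewrite mulr_ge0 // ltW // geo_gt0.
exists w, zz, b'; split=> //.
- apply: besR_add => //; first by apply: (HC' c0 _ _ d l1 b1d) => c k; apply: c1; exact: cf.
  exact: HC2.
- move=> th st E; rewrite /zz.
  have [Mt _ bth] := schR_mul_BV ma st.
  have Em : (fun x => above x * th x) = th by apply/funext => x; exact: E.
  have CB k : C * b k <= C * B by rewrite ler_wpM2l // ltW.
  have CB0 : 0 <= C * B by rewrite mulr_ge0 ?(ltW C0) // (le_trans (b0 0)).
  have -> : Q H (fun k x => f k x - gg k x) (fun x => above x * th x) = v th - I (fun x => G x * th x).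
    rewrite (Q_sub (B := C * B + d) lf lg l1 _ _ _ ltr01 bth).
    - rewrite QG ?(BV_intg bth) // Em (vE th st); congr (_ - _).
      by apply: eq_Rint => x; rewrite E.
    - by move=> k; apply: le_trans (CB k) _; rewrite lerDl ltW.
    - by move=> k; rewrite lerD.
    - by move=> k; apply: le_trans (b1d k) _; rewrite lerDr.
  have E1 x : (above x * G x - w x) * th x = G x * th x - w x * th x.
    by rewrite mulrBl -[in LHS]mulrA mulrCA E.
  rewrite (eq_Rint mu E1) RintB; first by rewrite addrA subrK.
  + by have [D HD] := schR_bounded sG; apply: (intgM (c := D)) (schR_intg st) => //; exact: schR_measurable.
  + by have [D HD] := testR_bounded tw; apply: (intgM (c := D)) (schR_intg st) => //; exact: schR_measurable (testR_schR tw).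
- split.
  + by move=> k; rewrite addr_ge0.
  + rewrite (_ : e = 4 * (e / 4)); last by field.
    apply: qleD => //; first by lra.
      have := qleZ q1 _ _ (ltW C'0) (qle_gconv q1 ka0 b10 (ltW d0) q1').
      rewrite (_ : C' * (geoC ka * d) = e / 4); last by rewrite mulrA mulrC divfK // mulf_neq0 ?gt_eqF.
      by apply=> [k|]; [exact: (gconv_ge0 k ka0 hb1)|rewrite mulr_ge0 ?(ltW d0) ?(ltW gC0)].
    have G1 : 0 <= 1 + geoC ka by rewrite addr_ge0 // ltW.
    apply: (le_qle (e := C2 * M * u `^ (ka / n.+2%:R) * (1 + geoC ka)) q1 (b' := fun j => C2 * M * u `^ (ka / n.+2%:R) * geo ka j)).
    * by move=> k; rewrite g2 lexx.
    * rewrite mulr_ge0 //=; apply: le_trans (ler_wpM2r G1 Hu) _.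
      by rewrite divfK // gt_eqF // ltr_pwDl // ltW.
    * apply: qleZ => //; [by move=> k; rewrite ltW // geo_gt0|exact: qle_geo].
  + move=> vb; apply: vanD.
      apply: vanZ; first exact: ltW.
      apply: (van_gconv ka0 hb1); apply: vb1; apply: vanZ => //; exact: ltW.
    by apply: vanZ => //; exact: van_geo.
Qed.

End RealCore.

(** * From real functionals to complex distributions *)

Section Complex.
Context {R : realType} (n : nat).
Local Notation pt := 'rV[R]_n.
Local Notation C := R[i].
Local Notation mu := (leb R n).
Local Notation I f := (Rintegral mu setT f).
Implicit Types (x y : pt) (a b F : pt -> R) (f theta Theta : pt -> C) (u : dist R n) (v : (pt -> R) -> R).

Lemma dotp_ge0 x : 0 <= dotp x x.
Proof. by apply: sumr_ge0 => i _; rewrite -expr2 sqr_ge0. Qed.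

Lemma norm_le_enorm x : `|x| <= enorm x.
Proof.
apply: row_normP => [|i]; first exact: sqrtr_ge0.
rewrite -sqrtr_sqr ler_sqrt ?dotp_ge0 // /dotp (bigD1 i) //= expr2 lerDl.
by apply: sumr_ge0 => j _; rewrite -expr2 sqr_ge0.
Qed.

Lemma enorm_le x : enorm x <= n.+1%:R * `|x|.
Proof.
have h0 : 0 <= n.+1%:R * `|x| by rewrite mulr_ge0.
rewrite -[leRHS](ger0_norm h0) -sqrtr_sqr ler_sqrt ?sqr_ge0 // /dotp.
apply: (@le_trans _ _ (\sum_(i < n) `|x| ^+ 2)).
  apply: ler_sum => i _; rewrite -expr2 -real_normK ?num_real //.
  by rewrite lerXn2r ?nnegrE // normr_coord.
rewrite sumr_const card_ord -[leLHS]mulr_natl exprMn ler_wpM2r ?exprn_ge0 //.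
by rewrite -natrX ler_nat (leq_trans (leqnSn n)) // -{1}(expn1 n.+1) leq_pexp2l.
Qed.

Lemma enorm0 : enorm (0 : pt) = 0.
Proof. by apply/le_anti; rewrite sqrtr_ge0 andbT (le_trans (enorm_le 0)) // normr0 mulr0. Qed.

Lemma enormN x : enorm (- x) = enorm x.
Proof. by rewrite /enorm; congr Num.sqrt; apply: eq_bigr => i _; rewrite mxE mulrNN. Qed.

Lemma enormZ (c : R) x : 0 <= c -> enorm (c *: x) = c * enorm x.
Proof.
move=> c0; rewrite /enorm (_ : dotp _ _ = c ^+ 2 * dotp x x).
  by rewrite sqrtrM ?sqr_ge0 // sqrtr_sqr ger0_norm.
by rewrite /dotp mulr_sumr; apply: eq_bigr => i _; rewrite mxE; ring.
Qed.

Lemma enorm_ge0 x : 0 <= enorm x. Proof. exact: sqrtr_ge0. Qed.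

Section Cutoff.
Variable phi : pt -> R.
Hypothesis hphi : cutoff phi.

Lemma cutoff_zero x : 4 / 3 <= enorm x -> phi x = 0.
Proof.
move=> H; have [_ _ _ sp _] := hphi; apply/eqP; apply: contraPT H => px.
by apply/negP; rewrite -ltNge; apply: sp; exact: subset_closure.
Qed.

Lemma cutoff_test : testR phi.
Proof.
have [sp _ _ _ _] := hphi; split=> //; exists (4 / 3) => x H; apply: cutoff_zero.
exact: le_trans (ltW H) (norm_le_enorm x).
Qed.

Lemma cutoff_even : evenf phi.
Proof. by have [_ e _ _ _] := hphi => x; apply: e; exact: enormN. Qed.

Lemma cutoff0 : phi 0 = 1.
Proof. by have [_ _ _ _ H] := hphi; rewrite H // enorm0; lra. Qed.

(** The difference psi_0 lives where 3/4 <= |x| < 8/3. There |x|/4 < 3/4 gives phi(x/4) = 1, and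
    2|x| >= 4/3 gives phi(2x) = 0. *)
Lemma cutoff_lp x : (phi (4^-1 *: x) - phi (2 *: x)) * (phi (2^-1 *: x) - phi x) =
  phi (2^-1 *: x) - phi x.
Proof.
have [_ _ _ _ H] := hphi; have e0 := enorm_ge0 x.
have [h1|h1] := ltP (enorm x) (3 / 4).
  rewrite (H _ h1) (H (2^-1 *: x)) ?subrr ?mulr0 // enormZ //; lra.
have z2 : phi (2 *: x) = 0 by rewrite cutoff_zero // enormZ //; lra.
have [h2|h2] := ltP (enorm x) (8 / 3).
  by rewrite (H (4^-1 *: x)) ?z2 ?subr0 ?mul1r // enormZ //; lra.
rewrite (cutoff_zero (x := x)) ?(cutoff_zero (x := 2^-1 *: x)) ?subrr ?mulr0 // ?enormZ //; lra.
Qed.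

Lemma cutoff1 x : `|x| < 3 / 4 / n.+1%:R -> phi x = 1.
Proof.
move=> h; have [_ _ _ _ H] := hphi; apply: H; apply: le_lt_trans (enorm_le x) _.
by rewrite mulrC -ltr_pdivlMr.
Qed.

End Cutoff.

Definition cplx a b : pt -> C := fun x => Complex (a x) (b x).

Lemma cplxE f : f = cplx (reF f) (imF f).
Proof. by apply/funext => x; rewrite /cplx /reF /imF; case: (f x). Qed.

Lemma cmod_le (z : C) : cmod z <= `|complex.Re z| + `|complex.Im z|.
Proof.
case: z => x y; rewrite /cmod /= -[leRHS]ger0_norm ?addr_ge0 // -sqrtr_sqr ler_sqrt ?sqr_ge0 //.
rewrite sqrrD !real_normK ?num_real // addrAC lerDl mulrn_wge0 // mulr_ge0 //.
Qed.

Lemma Re_le_cmod (z : C) : `|complex.Re z| <= cmod z.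
Proof.
by case: z => x y; rewrite /cmod /= -sqrtr_sqr ler_sqrt ?addr_ge0 ?sqr_ge0 // lerDl sqr_ge0.
Qed.

Lemma Im_le_cmod (z : C) : `|complex.Im z| <= cmod z.
Proof.
by case: z => x y; rewrite /cmod /= -sqrtr_sqr ler_sqrt ?addr_ge0 ?sqr_ge0 // lerDr sqr_ge0.
Qed.

Lemma cmod_ge0 (z : C) : 0 <= cmod z.
Proof. by case: z => x y; exact: sqrtr_ge0. Qed.

Lemma schwartz_norm_le N a b (A B : R) : sbound N A a -> sbound N B b ->
  (schwartz_norm N (cplx a b) <= (n.+1%:R ^+ N * (A + B))%:E)%E.
Proof.
move=> [_ HA] [_ HB]; apply: ge_ereal_sup => _ [k [l [x [kN lN ->]]]].
rewrite lee_fin; apply: (@le_trans _ _ ((n.+1%:R * `|x|) ^+ k * (`|pderivs l a x| + `|pderivs l b x|))).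
  apply: ler_pM; [exact: exprn_ge0 (enorm_ge0 x)|exact: cmod_ge0| |exact: cmod_le].
  by rewrite lerXn2r ?nnegrE ?enorm_ge0 ?mulr_ge0 // enorm_le.
rewrite exprMn -mulrA mulrDr.
apply: ler_pM; rewrite ?exprn_ge0 ?addr_ge0 ?mulr_ge0 ?exprn_ge0 //.
  by apply: ler_weXn2l => //; rewrite ler1n.
by apply: lerD; [exact: HA|exact: HB].
Qed.

Lemma schwartz_norm_sbound N f (B : R) : smooth f -> (schwartz_norm N f <= B%:E)%E ->
  sbound N B (reF f) /\ sbound N B (imF f).
Proof.
move=> [s1 s2] H.
have E k l x : (k <= N)%N -> (size l <= N)%N -> enorm x ^+ k * cmod (cpderivs l f x) <= B.
  move=> kN lN; rewrite -lee_fin; apply: le_trans H; apply: ereal_sup_ubound.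
  by exists k, l, x.
by split; split=> // k l x kN lN; apply: le_trans (E k l x kN lN);
  apply: ler_pM => //; rewrite ?exprn_ge0 ?lerXn2r ?nnegrE ?enorm_ge0 ?norm_le_enorm //;
  [exact: (Re_le_cmod (cpderivs l f x))|exact: (Im_le_cmod (cpderivs l f x))].
Qed.

Lemma schwartz_norm_ge0 N f : (0 <= schwartz_norm N f)%E.
Proof.
apply: (@le_trans _ _ (enorm (0 : pt) ^+ 0 * cmod (cpderivs [::] f 0))%:E).
  by rewrite lee_fin expr0 mul1r cmod_ge0.
by apply: ereal_sup_ubound; exists 0%N, [::], 0.
Qed.

Lemma schwartzP f : schwartz f <-> schR (reF f) /\ schR (imF f).
Proof.
split=> [[sf Hf]|[s1 s2]].
  have [s1 s2] := sf.
  have K N : exists B, sbound N B (reF f) /\ sbound N B (imF f).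
    have h0 := schwartz_norm_ge0 N f; have h1 := Hf N.
    exists (fine (schwartz_norm N f)); apply: schwartz_norm_sbound => //.
    by rewrite fineK // ge0_fin_numE.
  by split; split=> // k l; have [B [[_ H1] [_ H2]]] := K (maxn k (size l)); exists B => x;
    [apply: H1|apply: H2]; rewrite ?leq_maxl ?leq_maxr.
split; first by split; exact: schR_smooth.
move=> N; have [A HA] := schR_sbound N s1; have [B HB] := schR_sbound N s2.
by rewrite [f]cplxE; apply: le_lt_trans (schwartz_norm_le HA HB) _; rewrite ltry.
Qed.

Lemma schwartz_cplx a b : schR a -> schR b -> schwartz (cplx a b).
Proof. by move=> sa sb; apply/schwartzP. Qed.

Lemma schwartz_real a : schR a -> schwartz (cplx a (fun=> 0)).
Proof. by move=> sa; apply: schwartz_cplx => //; exact: schR0. Qed.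

Definition Rpart u a : R := complex.Re (u (cplx a (fun=> 0))).
Definition Ipart u a : R := complex.Im (u (cplx a (fun=> 0))).

(** The value of v1 + i v2 on a + i b by complex linearity. *)
Definition cxval v1 v2 theta : C :=
  Complex (v1 (reF theta) - v2 (imF theta)) (v2 (reF theta) + v1 (imF theta)).

(** Zero off the Schwartz functions, as [tempered] prescribes, so that a tempered distribution
    equals the one rebuilt from its parts. *)
Definition cxdist v1 v2 : dist R n := fun theta =>
  if `[< schwartz theta >] then cxval v1 v2 theta else 0.

Lemma cxdistE v1 v2 theta : schwartz theta -> cxdist v1 v2 theta = cxval v1 v2 theta.
Proof. by move=> st; rewrite /cxdist asboolT. Qed.

End Complex.

Section ComplexTempered.
Context {R : realType} (n : nat).
Local Notation pt := 'rV[R]_n.+1.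
Local Notation C := R[i].
Local Notation mu := (leb R n.+1).
Local Notation I f := (Rintegral mu setT f).
Implicit Types (x y : pt) (a b F : pt -> R) (f theta Theta : pt -> C) (u : dist R n.+1) (v : (pt -> R) -> R).

Lemma tempered_cxdist v1 v2 : tempR v1 -> tempR v2 -> tempered (cxdist v1 v2).
Proof.
move=> [l1 [N1 [K1 [K10 b1]]]] [l2 [N2 [K2 [K20 b2]]]].
have sboundW N N' B a : (N <= N')%N -> sbound N' B a -> sbound N B a.
  by move=> NN [sa H]; split=> // k l x kN lN; apply: H; exact: leq_trans NN.
split.
- move=> c th eta st se.
  have [s1 s2] := (schwartzP _).1 st; have [e1 e2] := (schwartzP _).1 se.
  have Er : reF (fun x => c * th x + eta x) =
      fun x => complex.Re c * reF th x + (- complex.Im c * imF th x + reF eta x).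
    apply/funext => x; rewrite /reF /imF; case: (c) (th x) (eta x) => [? ?] [? ?] [? ?] /=; ring.
  have Ei : imF (fun x => c * th x + eta x) =
      fun x => complex.Im c * reF th x + (complex.Re c * imF th x + imF eta x).
    apply/funext => x; rewrite /reF /imF; case: (c) (th x) (eta x) => [? ?] [? ?] [? ?] /=; ring.
  have sZD (d : R) a b : schR a -> schR b -> schR (fun x => d * a x + b x).
    by move=> sa sb; apply: schRD => //; exact: schRZ.
  rewrite !cxdistE //; last by apply/schwartzP; rewrite Er Ei; split; do 2!apply: (sZD) => //.
  rewrite /cxval Er Ei !(l1, l2) //; try exact: sZD.
  clear Er Ei; case: c => c1 c2 /=; apply/eqP; rewrite eq_complex /=; apply/andP; split; apply/eqP; ring.
- exists (maxn N1 N2), (2 * (K1 + K2)) => th st; rewrite cxdistE //.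
  have [sm fin] := st; have h0 := schwartz_norm_ge0 (maxn N1 N2) th.
  set S := schwartz_norm _ _ in h0 *.
  have Sf : S \is a fin_num by rewrite ge0_fin_numE // fin.
  have hS : (S <= (fine S)%:E)%E by rewrite fineK.
  have [h1 h2] := schwartz_norm_sbound (N := maxn N1 N2) sm hS.
  rewrite -[S]fineK // -EFinM lee_fin.
  apply: le_trans (cmod_le _) _; rewrite /cxval /=.
  have := b1 _ _ (sboundW _ _ _ _ (leq_maxl N1 N2) h1).
  have := b1 _ _ (sboundW _ _ _ _ (leq_maxl N1 N2) h2).
  have := b2 _ _ (sboundW _ _ _ _ (leq_maxr N1 N2) h1).
  have := b2 _ _ (sboundW _ _ _ _ (leq_maxr N1 N2) h2).
  have := ler_normB (v1 (reF th)) (v2 (imF th)).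
  have := ler_normD (v2 (reF th)) (v1 (imF th)).
  lra.
- by move=> th nst; rewrite /cxdist asboolF.
Qed.

Lemma tempered_cxE u : tempered u -> [/\ tempR (Rpart u), tempR (Ipart u) & u = cxdist (Rpart u) (Ipart u)].
Proof.
move=> [lu [N [K bu]] u0].
have E (d : R) a b : (fun x => real_complex R d * cplx a (fun=> 0) x + cplx b (fun=> 0) x) =
    cplx (fun x => d * a x + b x) (fun=> 0).
  by apply/funext => x; apply/eqP; rewrite eq_complex /=; apply/andP; split; apply/eqP; ring.
have lin (d : R) a b : schR a -> schR b ->
    u (cplx (fun x => d * a x + b x) (fun=> 0)) =
    real_complex R d * u (cplx a (fun=> 0)) + u (cplx b (fun=> 0)).
  by move=> sa sb; rewrite -E lu //; exact: schwartz_real.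
have bd B a : sbound N B a -> cmod (u (cplx a (fun=> 0))) <= Num.max 0 K * n.+2%:R ^+ N * B.
  move=> sa; have B0 := sbound_ge0 sa.
  have m0 : 0 <= Num.max 0 K by rewrite le_max lexx.
  (* Finitely many seminorms do not make [a] a Schwartz function; off the Schwartz functions [u] is
     0 by convention. *)
  have [st|nst] := pselect (schwartz (cplx a (fun=> 0))); last first.
    by rewrite u0 // /cmod /= expr0n /= addr0 sqrtr0 !mulr_ge0 // exprn_ge0.
  have [_ s0] := (schwartzP _).1 st.
  have sb0 : sbound N 0 ((fun=> 0) : pt -> R).
    by split=> [|k l x _ _]; [exact: schR_smooth s0|rewrite (_ : pderivs l _ = fun=> 0) ?normr0 ?mulr0 //; elim: l {x} => //= i l ->; exact: pderivs_cst].
  rewrite -lee_fin; apply: le_trans (bu _ st) _.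
  have H := schwartz_norm_le sa sb0; rewrite addr0 in H.
  have h0 := schwartz_norm_ge0 N (cplx a (fun=> 0)).
  set S := schwartz_norm _ _ in H h0 *.
  have KK : (K%:E <= (Num.max 0 K)%R%:E)%E by rewrite lee_fin le_max lexx orbT.
  apply: le_trans (lee_wpmul2r h0 KK) _.
  by rewrite -mulrA [leRHS]EFinM; apply: lee_wpmul2l.
split.
- split.
    move=> d a b sa sb; rewrite /Rpart lin //.
    by case: (u _) (u _) => [? ?] [? ?] /=; rewrite mul0r subr0.
  exists N, (Num.max 0 K * n.+2%:R ^+ N); split; first by rewrite mulr_ge0 ?exprn_ge0 // le_max lexx.
  by move=> B a /bd; apply: le_trans; exact: Re_le_cmod.
- split.
    move=> d a b sa sb; rewrite /Ipart lin //.
    by case: (u _) (u _) => [? ?] [? ?] /=; rewrite mul0r addr0.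
  exists N, (Num.max 0 K * n.+2%:R ^+ N); split; first by rewrite mulr_ge0 ?exprn_ge0 // le_max lexx.
  by move=> B a /bd; apply: le_trans; exact: Im_le_cmod.
apply/funext => th; have [st|nst] := pselect (schwartz th); last by rewrite u0 // /cxdist asboolF.
have [s1 s2] := (schwartzP _).1 st.
rewrite cxdistE // [in LHS](cplxE th).
have -> : cplx (reF th) (imF th) = fun x => Complex 0 1 * cplx (imF th) (fun=> 0) x + cplx (reF th) (fun=> 0) x.
  by apply/funext => x; apply/eqP; rewrite eq_complex /=; apply/andP; split; apply/eqP; ring.
rewrite lu; [|exact: schwartz_real|exact: schwartz_real].
rewrite /cxval /Rpart /Ipart; case: (u _) (u _) => [? ?] [? ?] /=.
by apply/eqP; rewrite eq_complex /=; apply/andP; split; apply/eqP; ring.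
Qed.

End ComplexTempered.

(** * Fourier multipliers as convolutions *)

Section FourierMultiplier.
Context {R : realType} (n : nat).
Local Notation pt := 'rV[R]_n.+1.
Local Notation C := R[i].
Local Notation mu := (leb R n.+1).
Local Notation I f := (Rintegral mu setT f).
Implicit Types (x y : pt) (a b g F psi : pt -> R) (f theta Theta : pt -> C) (u : dist R n.+1) (v : (pt -> R) -> R).

Lemma Rint_lin4 (h p q r t : pt -> R) (c d1 d2 d3 d4 : R) : measurable_fun setT h ->
  (forall x, `|h x| <= 1) -> intg mu p -> intg mu q -> intg mu r -> intg mu t ->
  intg mu (fun y => c * ((d1 * p y + d2 * q y) + (d3 * r y + d4 * t y))) /\
  I (fun y => h y * (c * ((d1 * p y + d2 * q y) + (d3 * r y + d4 * t y)))) =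
  c * ((d1 * I (fun y => h y * p y) + d2 * I (fun y => h y * q y)) +
       (d3 * I (fun y => h y * r y) + d4 * I (fun y => h y * t y))).
Proof.
move=> mh h1 ip iq ir it.
have D a b : intg mu a -> intg mu b -> intg mu (fun y => a y + b y) by exact: intgD.
have Z (d : R) a : intg mu a -> intg mu (fun y => d * a y) by exact: intgZ.
have M a : intg mu a -> intg mu (fun y => h y * a y) by exact: intgM.
split; first by apply: (Z); apply: (D); apply: (D); exact: Z.
rewrite (eq_Rint mu (g := fun y => c * ((d1 * (h y * p y) + d2 * (h y * q y)) + (d3 * (h y * r y) + d4 * (h y * t y))))).
  rewrite RintZl; last by apply: (D); apply: (D); apply: (Z); exact: M.
  rewrite RintD; [|by apply: (D); apply: (Z); exact: M|by apply: (D); apply: (Z); exact: M].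
  rewrite RintD; [|by apply: (Z); exact: M|by apply: (Z); exact: M].
  rewrite (RintD (f := fun y => d3 * (h y * r y))); [|by apply: (Z); exact: M|by apply: (Z); exact: M].
  by rewrite !RintZl //; exact: M.
by move=> y; ring.
Qed.

Lemma ct_lin4 (p q r t : pt -> R) (c d1 d2 d3 d4 : R) x : intg mu p -> intg mu q -> intg mu r -> intg mu t ->
  ct (fun y => c * ((d1 * p y + d2 * q y) + (d3 * r y + d4 * t y))) x =
  c * ((d1 * ct p x + d2 * ct q x) + (d3 * ct r x + d4 * ct t x)).
Proof.
by move=> ip iq ir it; exact: (Rint_lin4 _ _ _ _ _ (measurable_trig x).1 (fun _ => cos_le1 _) ip iq ir it).2.
Qed.

Lemma st_lin4 (p q r t : pt -> R) (c d1 d2 d3 d4 : R) x : intg mu p -> intg mu q -> intg mu r -> intg mu t ->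
  st (fun y => c * ((d1 * p y + d2 * q y) + (d3 * r y + d4 * t y))) x =
  c * ((d1 * st p x + d2 * st q x) + (d3 * st r x + d4 * st t x)).
Proof.
by move=> ip iq ir it; exact: (Rint_lin4 _ _ _ _ _ (measurable_trig x).2 (fun _ => sin_le1 _) ip iq ir it).2.
Qed.

Lemma bounded_transform (h : pt -> pt -> R) b : kermeas h -> (forall x y, `|h x y| <= 1) ->
  intg mu b -> measurable_fun setT (fun x => I (fun y => h x y * b y)) /\
  forall x, `|I (fun y => h x y * b y)| <= I (fun y => `|b y|).
Proof.
move=> mh h1 ib; split.
  apply: measurable_Rint; apply: kermeasM => //; apply: kermeas_snd; exact: intg_meas ib.
move=> x; rewrite -[leRHS]mul1r; apply: L1le_Rintegral.
by apply: L1leM (intg_L1le ib) => //; exact: kermeas1.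
Qed.

Lemma intgM_ct a b : intg mu a -> intg mu b -> intg mu (fun x => a x * ct b x).
Proof.
move=> ia ib; have [m c] := bounded_transform (@kermeas_cos R _) (fun _ _ => cos_le1 _) ib.
by under eq_fun do rewrite mulrC; exact: intgM m c ia.
Qed.

Lemma intgM_st a b : intg mu a -> intg mu b -> intg mu (fun x => a x * st b x).
Proof.
move=> ia ib; have [m c] := bounded_transform (@kermeas_sin R _) (fun _ _ => sin_le1 _) ib.
by under eq_fun do rewrite mulrC; exact: intgM m c ia.
Qed.

Lemma measurable_cosR : measurable_fun setT (@cos R).
Proof. by apply: continuous_measurable_fun; exact: continuous_cos. Qed.

Lemma measurable_sinR : measurable_fun setT (@sin R).
Proof. by apply: continuous_measurable_fun; exact: continuous_sin. Qed.

(** Fubini and the addition formula for cos(y.(x - z)). *)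
Lemma ct_cv a b x : intg mu a -> intg mu b ->
  ct (fun y => a y * ct b y) x + st (fun y => a y * st b y) x = cv (ct a) b x.
Proof.
move=> ia ib; have mb := intg_meas ib.
have [ma _] := bounded_transform (@kermeas_cos R _) (fun _ _ => cos_le1 _) ia.
rewrite (cvE x ma mb) -(parseval measurable_cosR cos_le1 ia) /ct /st; last first.
  by have := intg_affine x (c := -1) _ ib; rewrite oppr_eq0 oner_eq0 => /(_ isT); congr intg;
    apply/funext => y; rewrite scaleN1r addrC.
rewrite -RintD; [|exact: intg_cos (intgM_ct ia ib)|exact: intg_sin (intgM_st ia ib)].
apply: eq_Rint => y; rewrite mulrCA [X in _ + X]mulrCA -mulrDr; congr (_ * _).
rewrite -(Rint_reflect x (f := fun z => cos (dotp y z) * b (x - z))); last first.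
  apply: measurable_funM; first by have [] := measurable_trig y.
  by apply: measurableT_comp => //; exact: measurable_rowB.
rewrite -RintZl; last exact: intg_cos.
rewrite -RintZl; last exact: intg_sin.
rewrite -RintD; [|by apply: intgZ; exact: intg_cos|by apply: intgZ; exact: intg_sin].
apply: eq_Rint => z; rewrite subKr dotpDr dotpNr cosB (dotpC x y); ring.
Qed.

Lemma st_cv a b x : intg mu a -> intg mu b ->
  st (fun y => a y * ct b y) x - ct (fun y => a y * st b y) x = cv (st a) b x.
Proof.
move=> ia ib; have mb := intg_meas ib.
have [ma _] := bounded_transform (@kermeas_sin R _) (fun _ _ => sin_le1 _) ia.
rewrite (cvE x ma mb) -(parseval measurable_sinR sin_le1 ia) /ct /st; last first.
  by have := intg_affine x (c := -1) _ ib; rewrite oppr_eq0 oner_eq0 => /(_ isT); congr intg;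
    apply/funext => y; rewrite scaleN1r addrC.
rewrite -RintB; [|exact: intg_sin (intgM_ct ia ib)|exact: intg_cos (intgM_st ia ib)].
apply: eq_Rint => y; rewrite mulrCA [X in _ - X]mulrCA -mulrBr; congr (_ * _).
rewrite -(Rint_reflect x (f := fun z => sin (dotp y z) * b (x - z))); last first.
  apply: measurable_funM; first by have [] := measurable_trig y.
  by apply: measurableT_comp => //; exact: measurable_rowB.
rewrite -RintZl; last exact: intg_cos.
rewrite -RintZl; last exact: intg_sin.
rewrite -RintB; [|by apply: intgZ; exact: intg_cos|by apply: intgZ; exact: intg_sin].
apply: eq_Rint => z; rewrite subKr dotpDr dotpNr sinB (dotpC x y); ring.
Qed.

Lemma fourierE f : intg mu (reF f) -> intg mu (imF f) ->
  fourier f = cplx (fun x => ct (reF f) x + st (imF f) x) (fun x => ct (imF f) x - st (reF f) x).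
Proof.
move=> i1 i2; apply/funext => x; rewrite /fourier /cintegral /cplx /ct /st.
congr Complex.
  rewrite -RintD; [|exact: intg_cos|exact: intg_sin].
  apply: eq_Rint => y; rewrite /reF /imF /= (dotpC y); case: (f y) => s t /=.
  by rewrite cosN sinN mulNr opprK.
rewrite -RintB; [|exact: intg_cos|exact: intg_sin].
apply: eq_Rint => y; rewrite /reF /imF /= (dotpC y); case: (f y) => s t /=.
by rewrite cosN sinN mulNr.
Qed.

Lemma ifourierE f : intg mu (reF f) -> intg mu (imF f) ->
  ifourier f = cplx (fun x => (2 * pi) ^- n.+1 * (ct (reF f) x - st (imF f) x))
    (fun x => (2 * pi) ^- n.+1 * (ct (imF f) x + st (reF f) x)).
Proof.
move=> i1 i2; apply/funext => x; rewrite /ifourier /cintegral /cplx /ct /st.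
rewrite -RintB; [|exact: intg_cos|exact: intg_sin].
rewrite -RintD; [|exact: intg_cos|exact: intg_sin].
have -> : reF (fun xi => expi (dotp x xi) * f xi) =
    fun y => cos (dotp x y) * reF f y - sin (dotp x y) * imF f y.
  by apply/funext => y; rewrite /reF /imF /=; case: (f y).
have -> : imF (fun xi => expi (dotp x xi) * f xi) =
    fun y => cos (dotp x y) * imF f y + sin (dotp x y) * reF f y.
  by apply/funext => y; rewrite /reF /imF /=; case: (f y).
apply/eqP; rewrite eq_complex /=; apply/andP; split; apply/eqP.
  by rewrite mul0r subr0.
by rewrite mul0r addr0.
Qed.

(** Real and imaginary parts of (2 pi)^-n times the Fourier transform of [Theta], n being the
    dimension. This is the reflection of the inverse transform, because a multiplier acts on the
    test function by transposition. *)
Definition kerR Theta x : R := (2 * pi) ^- n.+1 * (ct (reF Theta) x + st (imF Theta) x).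
Definition kerI Theta x : R := (2 * pi) ^- n.+1 * (ct (imF Theta) x - st (reF Theta) x).

Lemma cv_ct_st a b g (c d : R) x : intg mu a -> intg mu b -> intg mu g ->
  cv (fun z => c * (ct a z + d * st b z)) g x = c * (cv (ct a) g x + d * cv (st b) g x).
Proof.
move=> ia ib ig; rewrite /cv.
have [m1 c1] := bounded_transform (@kermeas_cos R _) (fun _ _ => cos_le1 _) ia.
have [m2 c2] := bounded_transform (@kermeas_sin R _) (fun _ _ => sin_le1 _) ib.
have msub : measurable_fun setT (fun y : pt => x - y) by exact: measurable_rowB.
have j1 : intg mu (fun y => ct a (x - y) * g y).
  by apply: intgM ig; [exact: measurableT_comp m1 msub|move=> y; exact: c1].
have j2 : intg mu (fun y => st b (x - y) * g y).
  by apply: intgM ig; [exact: measurableT_comp m2 msub|move=> y; exact: c2].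
rewrite -(RintZl d) // -RintD //; last exact: intgZ.
rewrite -RintZl; last by apply: intgD => //; exact: intgZ.
by apply: eq_Rint => y; ring.
Qed.

(** This turns the definition of [fourier_mult] into the convolution of the test function with a
    fixed kernel. *)
Lemma fourier_ifourier Theta theta :
  intg mu (reF Theta) -> intg mu (imF Theta) -> intg mu (reF theta) -> intg mu (imF theta) ->
  fourier (fun x => Theta x * ifourier theta x) =
  cplx (fun x => cv (kerR Theta) (reF theta) x - cv (kerI Theta) (imF theta) x)
       (fun x => cv (kerR Theta) (imF theta) x + cv (kerI Theta) (reF theta) x).
Proof.
move=> iT1 iT2 i1 i2.
pose c : R := (2 * pi) ^- n.+1.
have kR : kerR Theta = fun z => c * (ct (reF Theta) z + 1 * st (imF Theta) z).
  by apply/funext => z; rewrite mul1r.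
have kI : kerI Theta = fun z => c * (ct (imF Theta) z + (- 1) * st (reF Theta) z).
  by apply/funext => z; rewrite mulN1r.
set T1 := reF Theta in iT1 kR kI *; set T2 := imF Theta in iT2 kR kI *.
set t1 := reF theta in i1 *; set t2 := imF theta in i2 *.
have Er : reF (fun x => Theta x * ifourier theta x) =
  fun x => c * ((1 * (T1 x * ct t1 x) + - 1 * (T1 x * st t2 x)) + (- 1 * (T2 x * ct t2 x) + - 1 * (T2 x * st t1 x))).
  rewrite ifourierE //; apply/funext => x; rewrite /reF /cplx -/c /T1 /T2 /reF /imF.
  by case: (Theta x) => p q /=; rewrite -/t1 -/t2; ring.
have Ei : imF (fun x => Theta x * ifourier theta x) =
  fun x => c * ((1 * (T1 x * ct t2 x) + 1 * (T1 x * st t1 x)) + (1 * (T2 x * ct t1 x) + - 1 * (T2 x * st t2 x))).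
  rewrite ifourierE //; apply/funext => x; rewrite /reF /cplx -/c /T1 /T2 /reF /imF.
  by case: (Theta x) => p q /=; rewrite -/t1 -/t2; ring.
have P11 := intgM_ct iT1 i1; have P12 := intgM_ct iT1 i2; have P21 := intgM_ct iT2 i1; have P22 := intgM_ct iT2 i2.
have S11 := intgM_st iT1 i1; have S12 := intgM_st iT1 i2; have S21 := intgM_st iT2 i1; have S22 := intgM_st iT2 i2.
have [mc _] := measurable_trig (0 : pt).
have jr := (Rint_lin4 c 1 (- 1) (- 1) (- 1) mc (fun _ => cos_le1 _) P11 S12 P22 S21).1.
have ji := (Rint_lin4 c 1 1 1 (- 1) mc (fun _ => cos_le1 _) P12 S11 P21 S22).1.
rewrite fourierE ?Er ?Ei //; apply/funext => x; rewrite /cplx kR kI.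
rewrite !cv_ct_st // -!ct_cv // -!st_cv //.
rewrite !ct_lin4 // !st_lin4 //.
move: (ct _ x) (ct _ x) (ct _ x) (ct _ x) (ct _ x) (ct _ x) (ct _ x) (ct _ x).
move: (st _ x) (st _ x) (st _ x) (st _ x) (st _ x) (st _ x) (st _ x) (st _ x).
by move=> ? ? ? ? ? ? ? ? ? ? ? ? ? ? ? ?; congr Complex; ring.
Qed.

Lemma schR_kerR Theta : testR (reF Theta) -> testR (imF Theta) -> schR (kerR Theta).
Proof.
move=> t1 t2; apply: schRZ; have := schR_tr t1 t2; congr schR; apply/funext => x.
by rewrite tr_ct //; exact: testR_intg.
Qed.

Lemma schR_kerI Theta : testR (reF Theta) -> testR (imF Theta) -> schR (kerI Theta).
Proof.
move=> t1 t2; apply: schRZ; have := schRB (schR_tr t2 (testR0 _)) (schR_tr (testR0 _) t1).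
congr schR; apply/funext => x.
rewrite !tr_ct; try exact: testR_intg; try exact: testR_intg (testR0 _).
have z0 (h : pt -> pt -> R) : I (fun y => h x y * 0) = 0.
  by rewrite (@eq_Rint _ _ _ _ _ (fun=> 0)) ?/Rintegral ?integral0 // => y; rewrite mulr0.
have -> : st (fun=> 0) x = 0 by exact: (z0 (fun x y => sin (dotp x y))).
have -> : ct (fun=> 0) x = 0 by exact: (z0 (fun x y => cos (dotp x y))).
by rewrite addr0 add0r.
Qed.

Lemma transform_scale psi (h : R -> R) (l : R) x : 0 < l -> intg mu (fun z => h (dotp (l^-1 *: x) z) * psi z) ->
  I (fun y => h (dotp x y) * psi (l *: y)) = dil l^-1 (fun x => I (fun y => h (dotp x y) * psi y)) x.
Proof.
move=> l0 ip; have lV : l != 0 by rewrite gt_eqF.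
rewrite /dil.
transitivity (I (fun y => (fun z => h (dotp (l^-1 *: x) z) * psi z) (l *: y + 0))).
  apply: eq_Rint => y; rewrite addr0 dotpZr (dotpC (l^-1 *: x)) dotpZr mulrA mulfV // mul1r.
  by rewrite dotpC.
by rewrite (Rint_affine 0 lV ip) gtr0_norm // exprVn.
Qed.

Lemma kerR_scale Theta (l : R) : 0 < l -> testR (reF Theta) -> testR (imF Theta) ->
  kerR (fun x => Theta (l *: x)) = dil l^-1 (kerR Theta) /\
  kerI (fun x => Theta (l *: x)) = dil l^-1 (kerI Theta).
Proof.
move=> l0 t1 t2; have i1 := testR_intg t1; have i2 := testR_intg t2.
split; apply/funext => x; rewrite /kerR /kerI /dil mulrCA; congr (_ * _); rewrite mulrDr.
  by congr (_ + _); [apply: (transform_scale (h := @cos R)) => //; exact: intg_cos|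
    apply: (transform_scale (h := @sin R)) => //; exact: intg_sin].
by rewrite mulrN; congr (_ - _); [apply: (transform_scale (h := @cos R)) => //; exact: intg_cos|
  apply: (transform_scale (h := @sin R)) => //; exact: intg_sin].
Qed.

Lemma fourier_multE u Theta theta : tempered u -> testR (reF Theta) -> testR (imF Theta) ->
  schwartz theta -> fourier_mult Theta u theta =
  cxval (fun th => Rpart u (cv (kerR Theta) th) - Ipart u (cv (kerI Theta) th))
        (fun th => Ipart u (cv (kerR Theta) th) + Rpart u (cv (kerI Theta) th)) theta.
Proof.
move=> tu T1 T2 /schwartzP[s1 s2]; have [t1 t2 uE] := tempered_cxE tu.
rewrite /fourier_mult /dist_ifourier /dist_mult /dist_fourier.
rewrite fourier_ifourier; try exact: testR_intg; try exact: schR_intg.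
have sR := schR_kerR T1 T2; have sI := schR_kerI T1 T2.
have c1 := schR_cvs sR s1; have c2 := schR_cvs sI s2; have c3 := schR_cvs sR s2; have c4 := schR_cvs sI s1.
rewrite {1}uE cxdistE; last by apply: schwartz_cplx; [exact: schRB|exact: schRD].
rewrite /cxval /reF /imF /cplx /= -/(reF theta) -/(imF theta).
rewrite !tempRB // !tempRD //; congr Complex; ring.
Qed.

End FourierMultiplier.

Lemma cvge0_intro {R : realType} (T : Type) (F : set_system T) (FF : Filter F) (f : T -> \bar R) :
  (forall x, 0 <= f x)%E -> (forall e : R, 0 < e -> \forall x \near F, (f x <= e%:E)%E) ->
  f @ F --> (0 : \bar R)%E.
Proof.
move=> f0 H; apply/fine_cvgP; split.
  apply: filterS (H 1 ltr01) => x fx.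
  by rewrite ge0_fin_numE // (le_lt_trans fx) // ltry.
apply/cvgrPdist_le => e e0; apply: filterS (H _ e0) => x fx /=.
have ffin : f x \is a fin_num by rewrite ge0_fin_numE // (le_lt_trans fx) // ltry.
by rewrite sub0r normrN ger0_norm ?fine_ge0 // -lee_fin fineK.
Qed.

Lemma cvge0_elim {R : realType} (T : Type) (F : set_system T) (FF : Filter F) (f : T -> \bar R) :
  f @ F --> (0 : \bar R)%E -> forall e : R, 0 < e -> \forall x \near F, (f x < e%:E)%E.
Proof.
move=> /fine_cvgP[ff /cvgrPdist_lt H] e e0; apply: filterS2 ff (H _ e0) => x fx /=.
rewrite sub0r normrN => h; rewrite -(fineK fx) lte_fin.
exact: le_lt_trans (ler_norm _) h.
Qed.

(** * Functions representing distributions *)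

Section Representation.
Context {R : realType} (n : nat).
Local Notation pt := 'rV[R]_n.+1.
Local Notation C := R[i].
Local Notation mu := (leb R n.+1).
Local Notation I f := (Rintegral mu setT f).
Implicit Types (x y : pt) (a b g F psi : pt -> R) (f theta Theta U : pt -> C) (u : dist R n.+1) (v : (pt -> R) -> R).

Lemma represents_cplx u v1 v2 F1 F2 : (forall theta, schwartz theta -> u theta = cxval v1 v2 theta) ->
  repR F1 v1 -> repR F2 v2 -> represents (cplx F1 F2) u.
Proof.
move=> uE [m1 r1] [m2 r2]; split; first by [].
move=> th st; rewrite uE //; have [s1 s2] := (schwartzP _).1 st.
have [i11 e11] := r1 _ s1; have [i12 e12] := r1 _ s2.
have [i21 e21] := r2 _ s1; have [i22 e22] := r2 _ s2.
have Er : reF (fun x => cplx F1 F2 x * th x) = fun x => F1 x * reF th x - F2 x * imF th x.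
  by apply/funext => x; rewrite /reF /imF /=; case: (th x).
have Ei : imF (fun x => cplx F1 F2 x * th x) = fun x => F2 x * reF th x + F1 x * imF th x.
  by apply/funext => x; rewrite /reF /imF /=; case: (th x) => p q /=; rewrite addrC.
rewrite /cintegrable /dist_of /cintegral Er Ei; split.
  by split; [exact: intgB|exact: intgD].
by rewrite /cxval e11 e12 e21 e22; congr Complex; [rewrite -RintB|rewrite -RintD].
Qed.

Lemma represents_parts u v1 v2 U :
  (forall a, schR a -> u (cplx a (fun=> 0)) = Complex (v1 a) (v2 a)) ->
  represents U u -> repR (reF U) v1 /\ repR (imF U) v2.
Proof.
move=> uE [[m1 m2] rU].
have H a : schR a -> [/\ intg mu (fun x => reF U x * a x), intg mu (fun x => imF U x * a x),
    v1 a = I (fun x => reF U x * a x) & v2 a = I (fun x => imF U x * a x)].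
  move=> sa; have [[i1 i2] e] := rU _ (schwartz_real sa).
  have Er : reF (fun x => U x * cplx a (fun=> 0) x) = fun x => reF U x * a x.
    by apply/funext => x; rewrite /reF /=; case: (U x) => p q /=; rewrite mulr0 subr0.
  have Ei : imF (fun x => U x * cplx a (fun=> 0) x) = fun x => imF U x * a x.
    by apply/funext => x; rewrite /imF /=; case: (U x) => p q /=; rewrite mulr0 add0r.
  rewrite Er in i1; rewrite Ei in i2.
  move: e; rewrite uE // /dist_of /cintegral Er Ei => -[e1 e2].
  by split.
by split; split=> // a /H[].
Qed.

Lemma LpB_abs (p : \bar R) F (N : R) : (1 <= p)%E -> LpB mu p F N -> LpB mu p (fun x => `|F x|) N.
Proof.
move=> p1 LF; have [mF _] := LF; apply: (le_LpB (leb_gt0 n) p1 _ _ LF); first exact: measurableT_comp.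
by move=> x; rewrite normr_id.
Qed.

Lemma measurable_cmod U : cmeasurable U -> measurable_fun setT (fun x => cmod (U x)).
Proof.
move=> [m1 m2].
rewrite (_ : (fun x => _) = fun x => Num.sqrt (reF U x ^+ 2 + imF U x ^+ 2)); last first.
  by apply/funext => x; rewrite /cmod /reF /imF; case: (U x).
apply: measurableT_comp; first exact: continuous_measurable_fun (@sqrt_continuous R).
by apply: measurable_funD; exact: measurable_funX.
Qed.

Lemma Lp_normE (p : \bar R) U : Lp_norm p U = Lnorm mu p (EFin \o (fun x => cmod (U x))).
Proof. by rewrite /Lp_norm !unlock. Qed.

Lemma dist_Lp_le (p : \bar R) u F1 F2 (N1 N2 : R) : (1 <= p)%E -> represents (cplx F1 F2) u ->
  LpB mu p F1 N1 -> LpB mu p F2 N2 -> (dist_Lp_norm p u <= (N1 + N2)%:E)%E.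
Proof.
move=> p1 rU L1 L2; apply: (@le_trans _ _ (Lp_norm p (cplx F1 F2))).
  by apply: ereal_inf_lbound; exists (cplx F1 F2).
rewrite Lp_normE; have [mU _] := rU.
suff [] : LpB mu p (fun x => cmod (cplx F1 F2 x)) (N1 + N2) by [].
apply: (le_LpB (g := fun x => `|F1 x| + `|F2 x|) (leb_gt0 n) p1).
- exact: measurable_cmod.
- move=> x; rewrite ger0_norm ?cmod_ge0 // ger0_norm ?addr_ge0 //.
  exact: (cmod_le (cplx F1 F2 x)).
- by apply: LpBD => //; exact: LpB_abs.
Qed.

Lemma dist_Lp_lt (p : \bar R) u (N : R) : (1 <= p)%E -> (dist_Lp_norm p u < N%:E)%E ->
  exists U, [/\ represents U u, LpB mu p (reF U) N & LpB mu p (imF U) N].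
Proof.
move=> p1 /ereal_inf_lt[_ [U /= rU <-] HU]; exists U; split=> //;
  have [mU _] := rU; have mc := measurable_cmod mU; have [m1 m2] := mU.
  have L : LpB mu p (fun x => cmod (U x)) N by split=> //; rewrite -Lp_normE ltW.
  by apply: (le_LpB (leb_gt0 n) p1 m1 _ L) => x; rewrite [leRHS]ger0_norm ?cmod_ge0 // Re_le_cmod.
have L : LpB mu p (fun x => cmod (U x)) N by split=> //; rewrite -Lp_normE ltW.
by apply: (le_LpB (leb_gt0 n) p1 m2 _ L) => x; rewrite [leRHS]ger0_norm ?cmod_ge0 // Im_le_cmod.
Qed.

Lemma dist_Lp_ge0 (p : \bar R) u : (0 <= dist_Lp_norm p u)%E.
Proof. by apply: le_ereal_inf_tmp => _ [U _ <-]; exact: Lnorm_ge0. Qed.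

Lemma test_testR E theta : test E theta -> testR (reF theta) /\ testR (imF theta).
Proof.
move=> [[s1 s2] ct _]; have [M [Mr HM]] := compact_bounded ct.
have H x : M + 1 < `|x| -> theta x = 0.
  move=> xM; apply/eqP; apply: contraT => tx.
  have := HM (M + 1) (ltac:(by rewrite ltrDl)) x (@subset_closure _ [set x | theta x != 0] x tx).
  by move=> /=; rewrite leNgt xM.
by split; split=> //; exists (M + 1) => x /H; rewrite /reF /imF => ->.
Qed.

Lemma compact_closure (A : set pt) (M : R) : (forall x, A x -> `|x| <= M) -> compact (closure A).
Proof.
move=> HA; apply: bounded_closed_compact; last exact: closed_closure.
exists M; split; first exact: num_real.
move=> B MB x cx.
have cl : closed ((fun y : pt => `|y|) @^-1` [set r : R | r <= B]).
  by apply: closed_comp => [y _|]; [exact: norm_continuous|exact: closed_le].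
rewrite -/(((fun y : pt => `|y|) @^-1` [set r : R | r <= B]) x) ((closure_id _).1 cl).
by apply: closureS cx => y /HA /=; move/le_trans; apply; exact: ltW.
Qed.

Lemma testR_test E a b : testR a -> testR b ->
  closure [set x | cplx a b x != 0] `<=` E -> test E (cplx a b).
Proof.
move=> [sa [M HM]] [sb [N HN]] sE; split=> //.
apply: (compact_closure (M := Num.max M N)) => y /=; apply: contraTT; rewrite -ltNge gt_max => /andP[My Ny].
by rewrite /cplx (HM _ My) (HN _ Ny) negbK.
Qed.

End Representation.

Section Frequency.
Context {R : realType} (n : nat).
Local Notation pt := 'rV[R]_n.+1.
Local Notation C := R[i].
Local Notation mu := (leb R n.+1).
Local Notation I f := (Rintegral mu setT f).
Implicit Types (x y : pt) (a b g F psi : pt -> R) (f theta Theta U : pt -> C) (u : dist R n.+1) (v : (pt -> R) -> R).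

Lemma Rint_zero : I (fun=> 0 : R) = 0.
Proof. by rewrite /Rintegral integral0. Qed.

Lemma ct0 : ct ((fun=> 0) : pt -> R) = (fun=> 0).
Proof. by apply/funext => x; rewrite -[RHS]Rint_zero; apply: eq_Rint => y; rewrite mulr0. Qed.

Lemma st0 : st ((fun=> 0) : pt -> R) = (fun=> 0).
Proof. by apply/funext => x; rewrite -[RHS]Rint_zero; apply: eq_Rint => y; rewrite mulr0. Qed.

Lemma ker_even psi : testR psi -> evenf psi ->
  kerR (cplx psi (fun=> 0)) = ift psi /\ kerI (cplx psi (fun=> 0)) = fun=> 0.
Proof.
move=> tp ep; split; apply/funext => x; rewrite /kerR /kerI.
  by rewrite [st _](st0) addr0.
by rewrite [ct _](ct0) [st _ _](st_even x ep (testR_intg tp)) subrr mulr0.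
Qed.

Lemma cv0l (th : pt -> R) : cv (fun=> 0) th = (fun=> 0).
Proof. by apply/funext => x; rewrite -[RHS]Rint_zero; apply: eq_Rint => y; rewrite mul0r. Qed.

Lemma fourier_mult_even u psi theta : tempered u -> testR psi -> evenf psi -> schwartz theta ->
  fourier_mult (cplx psi (fun=> 0)) u theta =
  cxval (fun th => Rpart u (cv (ift psi) th)) (fun th => Ipart u (cv (ift psi) th)) theta.
Proof.
move=> tu tp ep st; rewrite fourier_multE //; last exact: testR0.
have [t1 t2 _] := tempered_cxE tu; have [-> ->] := ker_even tp ep.
by rewrite /cxval !cv0l !(tempR0 t1) !(tempR0 t2) !subr0 !addr0.
Qed.

Lemma cxval_real v1 v2 a : v1 (fun=> 0) = 0 -> v2 (fun=> 0) = 0 ->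
  cxval v1 v2 (cplx a (fun=> 0)) = Complex (v1 a) (v2 a).
Proof. by move=> h1 h2; rewrite /cxval h1 h2 subr0 addr0. Qed.

Lemma cv0r (A : pt -> R) : cv A (fun=> 0) = (fun=> 0).
Proof. by apply/funext => x; rewrite -[RHS]Rint_zero; apply: eq_Rint => y; rewrite mulr0. Qed.

Lemma Rpart_cxdist v1 v2 a : tempR v1 -> tempR v2 -> schR a ->
  Rpart (cxdist v1 v2) a = v1 a /\ Ipart (cxdist v1 v2) a = v2 a.
Proof.
move=> t1 t2 sa; rewrite /Rpart /Ipart cxdistE; last exact: schwartz_real.
by rewrite cxval_real ?tempR0.
Qed.

Section LittlewoodPaley.
Variable phi : pt -> R.
Hypothesis hphi : cutoff phi.

Lemma psij_test j : testR (psij phi j) /\ evenf (psij phi j).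
Proof.
have tp := cutoff_test hphi; have ep := cutoff_even hphi.
have j0 : (2 : R) ^ (- j) != 0 by rewrite expfz_neq0.
split; last by move=> x; rewrite /psij /phij !scalerN !ep.
apply: testRB.
  have := testR_scale (a := 2^-1) _ (testR_scale j0 tp); apply.
  by rewrite invr_eq0.
exact: testR_scale.
Qed.

Lemma ift_psij j : ift (psij phi j) = hk (lp0 phi) j.
Proof.
have tp := cutoff_test hphi.
rewrite (lp0E tp) /hk -(ift_dil (p2_gt0 j)); last first.
  by apply: testRB => //; apply: testR_scale => //; rewrite invr_eq0.
congr ift; apply/funext => x; rewrite /psij /phij /p2 invr_expz.
by rewrite !scalerA mulrC.
Qed.

Lemma DeltaE u j theta : tempered u -> schwartz theta -> Delta phi j u theta =
  cxval (fun th => Rpart u (cv (hk (lp0 phi) j) th)) (fun th => Ipart u (cv (hk (lp0 phi) j) th)) theta.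
Proof.
move=> tu st; rewrite /Delta -ift_psij; have [t e] := psij_test j.
exact: fourier_mult_even.
Qed.

Lemma Delta_real u j a : tempered u -> schR a -> Delta phi j u (cplx a (fun=> 0)) =
  Complex (Rpart u (cv (hk (lp0 phi) j) a)) (Ipart u (cv (hk (lp0 phi) j) a)).
Proof.
move=> tu sa; rewrite DeltaE //; last exact: schwartz_real.
have [t1 t2 _] := tempered_cxE tu.
by rewrite cxval_real // cv0r tempR0.
Qed.

Lemma Sh_smallPhi u : Sh u -> smallPhi phi (Rpart u) /\ smallPhi phi (Ipart u).
Proof.
move=> [tu Hu]; have tp := cutoff_test hphi; have ep := cutoff_even hphi.
have [t1 t2 _] := tempered_cxE tu.
have /Hu/cvge0_elim H : test setT (cplx phi (fun=> 0)) by apply: testR_test => //; exact: testR0.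
suff K (e : R) : 0 < e -> exists2 a0 : R, 0 < a0 & forall a : R, 0 < a -> a <= a0 ->
    exists U, [/\ repR (reF U) (fun th => Rpart u (cv (dil a (lpPhi phi)) th)),
      repR (imF U) (fun th => Ipart u (cv (dil a (lpPhi phi)) th)), LpB mu +oo%E (reF U) e & LpB mu +oo%E (imF U) e].
  by split=> e /K[a0 a00 Ha]; exists a0 => // a h1 /(Ha a h1)[U [r1 r2 l1 l2]]; [exists (reF U)|exists (imF U)].
move=> e0; have [M [Mr HM]] := H _ e0.
have M1 : 0 < `|M| + 1 by rewrite ltr_wpDl.
exists (`|M| + 1)^-1; first by rewrite invr_gt0.
move=> a a0 aM; have l0 : 0 < a^-1 by rewrite invr_gt0.
have lM : M < a^-1.
  apply: (@lt_le_trans _ _ (`|M| + 1)); first by rewrite (le_lt_trans (ler_norm M)) // ltrDl.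
  by rewrite -[leLHS]invrK lef_pV2 ?posrE ?invr_gt0.
have [U [rU L1 L2]] := dist_Lp_lt (leey 1) (HM _ lM).
exists U; have aE : a^-1 != 0 by rewrite gt_eqF.
have := @represents_parts R n _ (fun th => Rpart u (cv (dil a (lpPhi phi)) th))
  (fun th => Ipart u (cv (dil a (lpPhi phi)) th)) U _ rU; case=> [b sb|r1 r2] //.
have -> : (fun xi => cplx phi (fun=> 0) (a^-1 *: xi)) = cplx (fun xi => phi (a^-1 *: xi)) (fun=> 0) by [].
rewrite fourier_mult_even //; last exact: schwartz_real.
- by rewrite ift_dil // cxval_real // cv0r tempR0.
- exact: testR_scale.
- by move=> x; rewrite scalerN ep.
Qed.

End LittlewoodPaley.

(** A general [Theta] is neither real nor even, so its kernel has two parts and mixes [v1] with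
    [v2]: four functions arise, each bounded by e/4. *)
Lemma smallR_Sh v1 v2 : tempR v1 -> tempR v2 -> smallR v1 -> smallR v2 -> Sh (cxdist v1 v2).
Proof.
move=> t1 t2 s1 s2; have tu := tempered_cxdist t1 t2; split=> // Theta tT.
have [T1 T2] := test_testR tT.
have sR := schR_kerR T1 T2; have sI := schR_kerI T1 T2.
apply: cvge0_intro => [l|e e0]; first exact: dist_Lp_ge0.
have e4 : 0 < e / 4 by lra.
have [a1 a10 H1] := s1 _ sR _ e4; have [a2 a20 H2] := s1 _ sI _ e4.
have [a3 a30 H3] := s2 _ sR _ e4; have [a4 a40 H4] := s2 _ sI _ e4.
pose a0 := Num.min (Num.min a1 a2) (Num.min a3 a4).
have a00 : 0 < a0 by rewrite !min_gt0.
exists a0^-1; split; first exact: num_real.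
move=> l lM; have l0 : 0 < l by apply: lt_trans lM; rewrite invr_gt0.
have li : 0 < l^-1 by rewrite invr_gt0.
have la : l^-1 <= a0 by rewrite -[leRHS]invrK lef_pV2 ?posrE ?invr_gt0 // ltW.
move: la; rewrite !le_min => /andP[/andP[l1 l2] /andP[l3 l4]].
have [F1 r1 b1] := H1 _ li l1; have [F2 r2 b2] := H2 _ li l2.
have [F3 r3 b3] := H3 _ li l3; have [F4 r4 b4] := H4 _ li l4.
have [kR kI] := kerR_scale l0 T1 T2.
have repB F G v w : repR F v -> repR G w -> repR (fun x => F x - G x) (fun th => v th - w th).
  move=> [mF rF] [mG rG]; split; first exact: measurable_funB.
  move=> th st; have [i1 ->] := rF _ st; have [i2 ->] := rG _ st.
  under eq_fun do rewrite mulrBl; split; first exact: intgB.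
  by rewrite -RintB //; apply: eq_Rint => x; rewrite mulrBl.
have LB F v : repR F v -> (forall x, `|F x| <= e / 4) -> LpB mu +oo%E F (e / 4).
  by move=> [mF _] bF; apply/(LpB_ooP (leb_gt0 n) _ mF); exact: aeW.
pose w1 th := v1 (cv (dil l^-1 (kerR Theta)) th) - v2 (cv (dil l^-1 (kerI Theta)) th).
pose w2 th := v2 (cv (dil l^-1 (kerR Theta)) th) + v1 (cv (dil l^-1 (kerI Theta)) th).
have q1 : repR (fun x => F1 x - F4 x) w1 by exact: repB.
have q2 : repR (fun x => F3 x + F2 x) w2 by exact: repR_add.
have rU : represents (cplx (fun x => F1 x - F4 x) (fun x => F3 x + F2 x))
    (fourier_mult (fun xi => Theta (l *: xi)) (cxdist v1 v2)).
  apply: (represents_cplx (v1 := w1) (v2 := w2)) => // th st.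
  have ln : l != 0 by rewrite gt_eqF.
  have S1 : testR (reF (fun xi => Theta (l *: xi))) := testR_scale ln T1.
  have S2 : testR (imF (fun xi => Theta (l *: xi))) := testR_scale ln T2.
  rewrite fourier_multE // kR kI /cxval.
  have [h1 h2] := (schwartzP _).1 st.
  have E A b : schR A -> schR b -> (Rpart (cxdist v1 v2) (cv A b) = v1 (cv A b)) *
      (Ipart (cxdist v1 v2) (cv A b) = v2 (cv A b)).
    by move=> sA sb; have [] := Rpart_cxdist t1 t2 (schR_cvs sA sb).
  have dR := schR_dil li sR; have dI := schR_dil li sI.
  by rewrite !(E _ _ dR h1) !(E _ _ dI h1) !(E _ _ dR h2) !(E _ _ dI h2).
have m1 := r1.1; have m2 := r2.1; have m3 := r3.1; have m4 := r4.1.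
have L1 : LpB mu +oo%E (fun x => F1 x - F4 x) (e / 4 + e / 4).
  by apply: LpBB; [exact: leey|exact: LB r1 b1|exact: LB r4 b4].
have L2 : LpB mu +oo%E (fun x => F3 x + F2 x) (e / 4 + e / 4).
  by apply: LpBD; [exact: leey|exact: LB r3 b3|exact: LB r2 b2].
apply: le_trans (dist_Lp_le (leey 1) rU L1 L2) _.
by rewrite lee_fin; lra.
Qed.

End Frequency.

(** * The l^q norms through symmetric partial sums *)

Section LqNorm.
Context {R : realType}.
Implicit Types (q : \bar R) (a : int -> \bar R) (b : int -> R) (k : int).

Definition zlist (K : nat) : seq int := [seq Posz i | i <- iota 0 K] ++ [seq Negz i | i <- iota 0 K].

Lemma mem_zlist K k : (k \in zlist K) = (zidx k < K)%N.
Proof.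
rewrite mem_cat; case: k => i /=.
  rewrite mem_map ?mem_iota ?add0n; last by move=> x y [].
  by rewrite orb_idr // => /mapP[j _].
rewrite orbC mem_map ?mem_iota ?add0n; last by move=> x y [].
by rewrite orb_idr // => /mapP[j _].
Qed.

Lemma uniq_zlist K : uniq (zlist K).
Proof.
rewrite cat_uniq !map_inj_uniq ?iota_uniq; try by move=> x y [].
by rewrite andbT /=; apply/hasPn => k /mapP[i _ ->]; apply/negP => /mapP[j _].
Qed.

Lemma sum_zlist b K : (\sum_(k <- zlist K) (b k)%:E = (zsum b K)%:E)%E.
Proof.
rewrite sumEFin big_cat !big_map -{1 2}[K]subn0 -/(index_iota 0 K) /= !big_mkord -big_split /=.
by [].
Qed.

(** Every finite set of integers lies in some window -K <= k < K, so for nonnegative terms the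
    windows compute the supremum over finite sets. *)
Lemma esum_zsum b (S : R) : (forall k, 0 <= b k) ->
  (\esum_(k in [set: int]) (b k)%:E <= S%:E)%E <-> forall N, zsum b N <= S.
Proof.
move=> b0; have fz K : (\sum_(k \in [set` zlist K]) (b k)%:E = \sum_(k <- zlist K) (b k)%:E)%E.
  by rewrite -fsbig_seq // uniq_zlist.

split=> [H N|H].
  rewrite -lee_fin -sum_zlist -fz; apply: le_trans H; apply: ereal_sup_ubound.
  by exists [set` zlist N] => //; split=> //; exact: finite_seq.
apply: ge_ereal_sup => _ [A [/finite_seqP[s ->] _] <-].
pose K := (\max_(k <- s) zidx k).+1.
apply: (@le_trans _ _ (\sum_(k \in [set` zlist K]) (b k)%:E)%E).
  apply: lee_fsum_nneg_subset.
  - exact: finite_seq.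
  - exact: finite_seq.
  - by move=> k; rewrite !inE /= => ks; rewrite mem_zlist ltnS leq_bigmax_seq.
  - by move=> k _; rewrite lee_fin.
by rewrite fz sum_zlist lee_fin.
Qed.

Lemma lq_norm_le q a b e : (1 <= q)%E -> (forall k, 0 <= a k <= (b k)%:E)%E -> (forall k, 0 <= b k) ->
  0 <= e -> qle q b e -> (lq_norm q a <= e%:E)%E.
Proof.
case: q => [r||] //= r1 ab b0 e0 H; last first.
  apply: ge_ereal_sup => _ [k _ <-]; have /andP[_ h] := ab k.
  by apply: le_trans h _; rewrite lee_fin.
have r0 : 0 < r by move: r1; rewrite lee_fin; lra.
have -> : e%:E = ((e `^ r) `^ r^-1)%:E by rewrite -powRrM mulfV ?powRr1 // gt_eqF.
rewrite -poweR_EFin; apply: le_poweR; first by rewrite invr_ge0 ltW.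
  by apply: esum_ge0 => k _; exact: poweR_ge0.
apply: (@le_trans _ _ (\esum_(k in [set: int]) (b k `^ r)%:E)%E).
  apply: le_esum => k _; rewrite -poweR_EFin; have /andP[h1 h2] := ab k.
  by apply: le_poweR => //; exact: ltW.
by apply/esum_zsum => // k; exact: powR_ge0.
Qed.

Lemma qle_lq_norm q b e : (1 <= q)%E -> (forall k, 0 <= b k) -> 0 <= e ->
  (lq_norm q (fun k => (b k)%:E) <= e%:E)%E -> qle q b e.
Proof.
case: q => [r||] //= r1 b0 e0 H; last first.
  by move=> k; rewrite -lee_fin; apply: le_trans H; apply: ereal_sup_ubound; exists k.
have r0 : 0 < r by move: r1; rewrite lee_fin; lra.
apply/esum_zsum; first by move=> k; exact: powR_ge0.
have ri : 0 < r^-1 by rewrite invr_gt0.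
apply: (poweR_le ri).
- by apply: esum_ge0 => k _; rewrite lee_fin powR_ge0.
- exact: powR_ge0.
- rewrite -powRrM mulfV ?gt_eqF // powRr1 //.
Qed.

Lemma lq_norm_ge0 q a : (forall k, 0 <= a k)%E -> (0 <= lq_norm q a)%E.
Proof.
case: q => [r||] a0 /=; first exact: poweR_ge0.
  by apply: le_trans (a0 0) _; apply: ereal_sup_ubound; exists 0.
by apply: le_trans (a0 0) _; apply: ereal_sup_ubound; exists 0.
Qed.

Lemma lq_norm_fin q a k : (1 <= q)%E -> (forall k, 0 <= a k)%E -> (lq_norm q a < +oo)%E -> (a k < +oo)%E.
Proof.
case: q => [r||] //= r1 a0; last first.
  by apply: le_lt_trans; apply: ereal_sup_ubound; exists k.
have r0 : 0 < r by move: r1; rewrite lee_fin; lra.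
have rn : r != 0 by rewrite gt_eqF.
have rin : r^-1 != 0 by rewrite invr_eq0.
rewrite !ltey; apply: contra => /eqP ak.
have : (a k `^ r <= \esum_(j in [set: int]) (a j `^ r))%E.
  apply: esum_ge; exists [set k] => //.
  by rewrite fsbig_set1.
by rewrite ak poweRyr // leye_eq => /eqP ->; rewrite poweRyr.
Qed.

End LqNorm.

Lemma van_cvg {R : realType} (b : int -> R) : (forall k, 0 <= b k) ->
  van b <-> (b k%:Z)%:E @[k --> \oo] --> 0%E /\ (b (- k%:Z))%:E @[k --> \oo] --> 0%E.
Proof.
move=> b0; split=> [vb|[h1 h2] e e0].
  split; apply: cvge0_intro => [k|e /vb[K HK]]; rewrite ?lee_fin //.
    by exists K => // k /= kK; rewrite lee_fin HK.
  (* The shift by one: -(k+1) is [Negz k], of index k. *)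
  exists K.+1 => // -[|k] //= kK; rewrite lee_fin; apply: HK.
  exact: kK.
have [K1 _ H1] := cvge0_elim _ h1 e0; have [K2 _ H2] := cvge0_elim _ h2 e0.
exists (maxn K1 K2) => -[i|i] /=; rewrite geq_max => /andP[k1 k2].
  by have := H1 i k1; rewrite /= lte_fin => /ltW.
by have := H2 i.+1 (leqW k2); rewrite /= lte_fin => /ltW.
Qed.

(** * Besov spaces in terms of real functionals *)

Section Membership.
Context {R : realType} (n : nat).
Local Notation pt := 'rV[R]_n.+1.
Local Notation mu := (leb R n.+1).
Implicit Types (x y : pt) (u : dist R n.+1) (v : (pt -> R) -> R) (b : int -> R).
Variable phi : pt -> R.
Hypothesis hphi : cutoff phi.
Local Notation h := (lp0 phi).

Lemma C0_vanishing_parts (f : pt -> R[i]) : C0_vanishing f -> C0R (reF f) /\ C0R (imF f).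
Proof.
move=> [c1 c2 Hf].
have V F : continuous F -> (forall x, `|F x| <= cmod (f x)) -> C0R F.
  move=> cF HF; split=> //; split; first exact: continuous_measurable_row.
    have [M HM] := Hf 1 ltr01; have [B HB] := continuous_bounded_ball M cF.
    exists (Num.max B 1) => x; have [/HB h1|xM] := leP `|x| M; first by rewrite le_max h1.
    rewrite le_max; apply/orP; right; apply: le_trans (HF x) _; apply: ltW; apply: HM.
    exact: lt_le_trans xM (norm_le_enorm x).
  move=> e /Hf[M HM]; exists M => x xM; apply: le_trans (HF x) _; apply: ltW; apply: HM.
  exact: lt_le_trans xM (norm_le_enorm x).
by split; apply: V => // x; [exact: Re_le_cmod|exact: Im_le_cmod].
Qed.

Lemma C0R_vanishing (F1 F2 : pt -> R) : C0R F1 -> C0R F2 -> C0_vanishing (cplx F1 F2).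
Proof.
move=> [c1 [_ _ v1]] [c2 [_ _ v2]]; split=> // e e0.
have e3 : 0 < e / 3 by lra.
have [M1 H1] := v1 _ e3; have [M2 H2] := v2 _ e3.
exists (n.+2%:R * Num.max M1 M2) => x xM.
have : Num.max M1 M2 < `|x|.
  by rewrite -(ltr_pM2l (ltr0Sn R n.+1)); apply: lt_le_trans xM (enorm_le x).
rewrite gt_max => /andP[/H1 h1 /H2 h2].
apply: le_lt_trans (cmod_le (cplx F1 F2 x)) _; rewrite /cplx /=; lra.
Qed.

Variables (p q : \bar R) (s : R).
Hypotheses (p1 : (1 <= p)%E) (q1 : (1 <= q)%E).

(** All the spaces at once: [vf] adds the vanishing of the terms at both ends, [c0] the C^0_0
    condition. *)
Definition inX (vf c0 : bool) : set (dist R n.+1) := [set u | [/\ Sh u,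
  (besov_norm phi s p q u < +oo)%E,
  vf -> besov_term phi s p u k%:Z @[k --> \oo] --> 0%E /\
        besov_term phi s p u (- k%:Z) @[k --> \oo] --> 0%E &
  c0 -> forall j, exists2 f, C0_vanishing f & represents f (Delta phi j u)]].

Definition bterm u k : R := fine (besov_term phi s p u k).

Lemma besov_term_ge0 u k : (0 <= besov_term phi s p u k)%E.
Proof. by rewrite mule_ge0 ?dist_Lp_ge0 // lee_fin powR_ge0. Qed.

Lemma bterm_ge0 u k : 0 <= bterm u k.
Proof. by rewrite fine_ge0 // besov_term_ge0. Qed.

Lemma btermE u k : (besov_norm phi s p q u < +oo)%E -> besov_term phi s p u k = (bterm u k)%:E.
Proof.
move=> H; rewrite fineK // ge0_fin_numE ?besov_term_ge0 //.
exact: lq_norm_fin q1 (besov_term_ge0 u) H.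
Qed.

Lemma inX_data vf c0 u : inX vf c0 u ->
  [/\ dataR phi p s c0 (Rpart u) (bterm u), dataR phi p s c0 (Ipart u) (bterm u),
   qle q (bterm u) (fine (besov_norm phi s p q u)), vf -> van (bterm u) &
   forall k, bterm u k <= fine (besov_norm phi s p q u)].
Proof.
move=> [Su nu vu cu]; have [tu _] := Su; have [t1 t2 _] := tempered_cxE tu.
have [s1 s2] := Sh_smallPhi hphi Su.
have b0 := bterm_ge0 u; have bE := (fun k => btermE k nu).
have n0 : (0 <= besov_norm phi s p q u)%E by apply: lq_norm_ge0; exact: besov_term_ge0.
have nE : besov_norm phi s p q u = (fine (besov_norm phi s p q u))%:E by rewrite fineK // ge0_fin_numE.
have Q : qle q (bterm u) (fine (besov_norm phi s p q u)).
  apply: qle_lq_norm => //; first exact: fine_ge0.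
  rewrite -nE /besov_norm (_ : (fun k => _) = besov_term phi s p u) //.
  by apply/funext => k; rewrite bE.
have dE k : dist_Lp_norm p (Delta phi k u) = (ps (- s) k * bterm u k)%:E.
  have := bE k; rewrite /besov_term -/(ps s k) => E.
  by rewrite psN EFinM -E muleA -EFinM mulVf ?mul1e // gt_eqF // ps_gt0.
have rep k e : 0 < e -> exists U, [/\ repR (reF U) (fun th => Rpart u (cv (hk h k) th)),
    repR (imF U) (fun th => Ipart u (cv (hk h k) th)),
    LpB mu p (reF U) (ps (- s) k * bterm u k + e) & LpB mu p (imF U) (ps (- s) k * bterm u k + e)].
  move=> e0; have : (dist_Lp_norm p (Delta phi k u) < (ps (- s) k * bterm u k + e)%:E)%E.
    by rewrite dE lte_fin ltrDl.
  move=> /(dist_Lp_lt p1)[U [rU l1 l2]].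
  by have [r1 r2] := @represents_parts R n _ (fun th => Rpart u (cv (hk h k) th))
    (fun th => Ipart u (cv (hk h k) th)) U (fun a sa => Delta_real hphi k tu sa) rU; exists U.
have c0rep : c0 -> forall k, exists U, [/\ repR (reF U) (fun th => Rpart u (cv (hk h k) th)),
    repR (imF U) (fun th => Ipart u (cv (hk h k) th)), C0R (reF U) & C0R (imF U)].
  move=> c k; have [U cU rU] := cu c k; have [k1 k2] := C0_vanishing_parts cU.
  by have [r1 r2] := @represents_parts R n _ (fun th => Rpart u (cv (hk h k) th))
    (fun th => Ipart u (cv (hk h k) th)) U (fun a sa => Delta_real hphi k tu sa) rU; exists U.
split=> //.
- split=> // [k|/c0rep H k]; last by have [U [? ? ? ?]] := H k; exists (reF U).
  by split=> // e /(rep k)[U [? ? ? ?]]; exists (reF U).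
- split=> // [k|/c0rep H k]; last by have [U [? ? ? ?]] := H k; exists (imF U).
  by split=> // e /(rep k)[U [? ? ? ?]]; exists (imF U).
- move=> /vu[h1 h2]; apply/(van_cvg b0); split.
    by under eq_fun do rewrite -bE.
  by under eq_fun do rewrite -bE.
- by move=> k; apply: qle_bound q1 b0 (fine_ge0 n0) Q.
Qed.

(** The terms of the complex distribution are bounded by the sums of those of its parts, whence the
    factor 4 of [qleD]. *)
Lemma besR_inX (vf c0 : bool) v1 v2 b1 b2 e : besR p s h c0 v1 b1 -> besR p s h c0 v2 b2 ->
  (forall k, 0 <= b1 k) -> (forall k, 0 <= b2 k) -> 0 <= e -> qle q b1 e -> qle q b2 e ->
  (vf -> van b1 /\ van b2) ->
  inX vf c0 (cxdist v1 v2) /\ (besov_norm phi s p q (cxdist v1 v2) <= (4 * e)%:E)%E.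
Proof.
move=> [t1 r1 m1] [t2 r2 m2] b10 b20 e0 Q1 Q2 vv.
have tu := tempered_cxdist t1 t2; have tp := cutoff_test hphi.
have sh k : schR (hk h k) by apply: schR_hk; exact: schR_lp0.
have rep k : exists F1 F2, [/\ represents (cplx F1 F2) (Delta phi k (cxdist v1 v2)),
    LpB mu p F1 (ps (- s) k * b1 k), LpB mu p F2 (ps (- s) k * b2 k) & c0 -> C0R F1 /\ C0R F2].
  have [F1 [q1' l1 c1]] := r1 k; have [F2 [q2' l2 c2]] := r2 k.
  exists F1, F2; split=> //; last by move=> c; split; [exact: c1|exact: c2].
  apply: represents_cplx q1' q2' => th st; rewrite DeltaE //.
  have [s1 s2] := (schwartzP _).1 st.
  have [E1 E2] := Rpart_cxdist t1 t2 (schR_cvs (sh k) s1).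
  have [E3 E4] := Rpart_cxdist t1 t2 (schR_cvs (sh k) s2).
  by rewrite /cxval E1 E2 E3 E4.
have le k : (besov_term phi s p (cxdist v1 v2) k <= (b1 k + b2 k)%:E)%E.
  have [F1 [F2 [rU l1 l2 _]]] := rep k.
  have := dist_Lp_le p1 rU l1 l2; rewrite -mulrDr => H.
  apply: (@le_trans _ _ ((ps s k)%:E * (ps (- s) k * (b1 k + b2 k))%:E)%E).
    by apply: lee_wpmul2l => //; rewrite lee_fin ltW // ps_gt0.
  by rewrite -EFinM psN mulrA mulfV ?mul1r // gt_eqF // ps_gt0.
have b0 k : 0 <= b1 k + b2 k by rewrite addr_ge0.
have N : (besov_norm phi s p q (cxdist v1 v2) <= (4 * e)%:E)%E.
  apply: (lq_norm_le q1 (b := fun k => b1 k + b2 k)) => //.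
  - by move=> k; rewrite besov_term_ge0 le.
  - by rewrite mulr_ge0.
  - exact: qleD.
split=> //; split=> //.
- exact: smallR_Sh.
- by apply: le_lt_trans N _; rewrite ltry.
- move=> /vv[w1 w2]; have nu : (besov_norm phi s p q (cxdist v1 v2) < +oo)%E.
    by apply: le_lt_trans N _; rewrite ltry.
  have bE := (fun k => btermE k nu).
  have vb : van (bterm (cxdist v1 v2)).
    apply: le_van (vanD w1 w2) => k; rewrite -lee_fin -bE; exact: le.
  have [h1 h2] := (van_cvg (bterm_ge0 _)).1 vb.
  by split; under eq_fun do rewrite bE.
- move=> c j; have [F1 [F2 [rU _ _ /(_ c)[k1 k2]]]] := rep j.
  by exists (cplx F1 F2) => //; exact: C0R_vanishing.
Qed.

End Membership.

(** * Vanishing is a local property *)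

Section LocalVanishing.
Context {R : realType} (n : nat).
Local Notation pt := 'rV[R]_n.+1.
Local Notation mu := (leb R n.+1).
Implicit Types (x y : pt) (th : pt -> R) (v w : (pt -> R) -> R).

Lemma repR_sub F G v w : repR F v -> repR G w ->
  repR (fun x => F x - G x) (fun th => v th - w th).
Proof.
move=> [mF rF] [mG rG]; split; first exact: measurable_funB.
move=> th st; have [i1 ->] := rF _ st; have [i2 ->] := rG _ st.
under eq_fun do rewrite mulrBl; split; first exact: intgB.
by rewrite -RintB //; apply: eq_Rint => x; rewrite mulrBl.
Qed.

Lemma tempR_sub v w : tempR v -> tempR w -> tempR (fun th => v th - w th).
Proof.
move=> [lv [N1 [K1 [K10 b1]]]] [lw [N2 [K2 [K20 b2]]]]; split.
  by move=> a th eta s1 s2; rewrite lv // lw //; ring.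
have sW N N' B th : (N <= N')%N -> sbound N' B th -> sbound N B th.
  by move=> NN [sa H]; split=> // k l x kN lN; apply: H; exact: leq_trans NN.
exists (maxn N1 N2), (K1 + K2); split; first exact: addr_ge0.
move=> B th sb; apply: le_trans (ler_normB _ _) _; rewrite mulrDl; apply: lerD.
  by apply: b1; apply: sW sb; exact: leq_maxl.
by apply: b2; apply: sW sb; exact: leq_maxr.
Qed.

Variable phi : pt -> R.
Hypothesis hphi : cutoff phi.

Lemma dataR_sub (p : \bar R) (s : R) v w b b' : (1 <= p)%E ->
  dataR phi p s false v b -> dataR phi p s false w b' ->
  dataR phi p s false (fun th => v th - w th) (fun k => b k + b' k).
Proof.
move=> p1 [t1 m1 d1 _] [t2 m2 d2 _]; split=> //.
- exact: tempR_sub.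
- move=> e e0; have e2 : 0 < e / 2 by lra.
  have [a1 a10 H1] := m1 _ e2; have [a2 a20 H2] := m2 _ e2.
  exists (Num.min a1 a2); first exact: min_gt0.
  move=> a a0; rewrite le_min => /andP[/(H1 a a0)[F rF LF] /(H2 a a0)[G rG LG]].
  exists (fun x => F x - G x); first exact: repR_sub.
  by rewrite [e]splitr; apply: LpBB => //; exact: leey.
- move=> k; have [b0 H1] := d1 k; have [b0' H2] := d2 k; split; first exact: addr_ge0.
  move=> e e0; have e2 : 0 < e / 2 by lra.
  have [F rF LF] := H1 _ e2; have [G rG LG] := H2 _ e2.
  exists (fun x => F x - G x); first exact: repR_sub.
  have := LpBB p1 LF LG; congr LpB; lra.
Qed.

(** The balls of a finite cover are peeled off one at a time: a cutoff equal to 1 on the first ball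
    splits off a piece on which [v] vanishes, and what remains is covered by the other balls. *)
Lemma local_zero v (D : set pt) : tempR v ->
  (forall x, D x -> exists2 r : R, 0 < r & forall th, testR th ->
     (forall y, th y != 0 -> `|y - x| <= r) -> v th = 0) ->
  forall th, testR th -> closure [set x | th x != 0] `<=` D -> v th = 0.
Proof.
move=> tv Hloc th tth sD.
have tp := cutoff_test hphi; have [_ [M0 HM0]] := tp.
pose M := Num.max 1 M0; have M_gt0 : 0 < M by rewrite lt_max ltr01.
have HM x : M < `|x| -> phi x = 0 by rewrite gt_max => /andP[_ /HM0].
pose r1 : R := 3 / 4 / n.+2%:R; have r10 : 0 < r1 by rewrite divr_gt0 //; lra.
have phi1 x : `|x| < r1 -> phi x = 1 by exact: cutoff1.
have rr x : exists r : R, D x -> 0 < r /\ forall th, testR th ->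
    (forall y, th y != 0 -> `|y - x| <= r) -> v th = 0.
  have [/Hloc[r r0 Hr]|nD] := pselect (D x); first by exists r.
  by exists 1 => /nD.
have [r Hr] := choice rr.
(* The cutoff y |-> phi((M / r x)(y - x)) vanishes beyond distance [r x] and equals 1 within
   distance [d x]. *)
pose d x := r x * r1 / M.
have d0 x : D x -> 0 < d x.
  by move=> /Hr[h _]; rewrite /d divr_gt0 // mulr_gt0.
have cK : compact (closure [set x | th x != 0]).
  have [_ [B HB]] := tth; apply: (compact_closure (M := B)) => x /=.
  by apply: contraTT; rewrite -ltNge => /HB ->; rewrite negbK.
have := cK; rewrite compact_cover => /(_ pt D (fun x => ball x (d x))) [].
- by move=> x Dx; apply: ball_open; exact: d0.
- move=> x /sD Dx; exists x => //; apply: ballxx.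
  exact: d0.
move=> D' D'D cov.
have {cov} : forall y, th y != 0 -> exists2 x, x \in finmap.enum_fset D' & `|y - x| < d x.
  move=> y ty; have [x xD' yx] := cov y (@subset_closure _ [set x | th x != 0] y ty).
  by exists x => //; move: yx; rewrite -ball_normE /= distrC.
have : forall x, x \in finmap.enum_fset D' -> D x by move=> x /D'D; rewrite inE.
elim: (finmap.enum_fset D') th tth {sD cK} => [|x s IH] th tth Ds cov.
  rewrite (_ : th = fun=> 0) ?tempR0 //; apply/funext => y; apply/eqP; apply: contraT.
  by move=> /cov[].
have Dx : D x by apply: Ds; rewrite mem_head.
have [r0 Hv] := Hr x Dx.
pose k := M / r x; have k0 : 0 < k by rewrite divr_gt0.
pose chi y := phi (k *: y + - (k *: x)).
have tchi : testR chi by apply: testR_affine => //; rewrite gt_eqF.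
have chiE y : chi y = phi (k *: (y - x)) by rewrite /chi scalerBr.
have kn y : `|k *: (y - x)| = k * `|y - x| by rewrite normrZ gtr0_norm.
have t1 : testR (fun y => chi y * th y) by apply: testRM => //; exact: testR_smooth.
have t2 : testR (fun y => th y - chi y * th y) by exact: testRB.
have -> : th = fun y => chi y * th y + (th y - chi y * th y).
  by apply/funext => y; rewrite addrC subrK.
rewrite tempRD //; [|exact: testR_schR|exact: testR_schR].
rewrite (Hv _ t1) ?add0r.
  apply: IH => // [y ys|y]; first by apply: Ds; rewrite inE ys orbT.
  have [->|ty] := eqVneq (th y) 0; first by rewrite mulr0 subrr eqxx.
  have [z] := cov y ty; rewrite inE => /orP[/eqP -> yx|zs yz _]; last by exists z.
  rewrite chiE phi1 ?mul1r ?subrr ?eqxx // kn /k mulrAC ltr_pdivrMr //.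
  by move: yx; rewrite /d ltr_pdivlMr // mulrC [r x * _]mulrC.
move=> y; rewrite mulf_eq0 negb_or => /andP[cy _]; rewrite leNgt; apply: contra cy => ry.
by rewrite chiE HM // kn /k mulrAC ltr_pdivlMr // ltr_pM2l.
Qed.

End LocalVanishing.

Lemma closure_closed (T : topologicalType) (A B : set T) x : closed B -> A `<=` B ->
  closure A x -> B x.
Proof. by move=> cB AB; rewrite ((closure_id _).1 cB); exact: closureS. Qed.

(** * Besov spaces on the domain *)

Section Domain.
Context {R : realType} (n : nat).
Local Notation pt := 'rV[R]_n.+1.
Local Notation mu := (leb R n.+1).
Local Notation I f := (Rintegral mu setT f).
Implicit Types (x y : pt) (th : pt -> R) (u w z : dist R n.+1).
Variable phi : pt -> R.
Hypothesis hphi : cutoff phi.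
Variables (g : 'rV[R]_n -> R) (L : R).
Hypotheses (L0 : 0 <= L) (gL : forall x y : 'rV[R]_n, `|g x - g y| <= L * `|x - y|).
Local Notation Om := ([set x : pt | g (col' ord_max x) < x ord0 ord_max]).
Variables (p q : \bar R) (s : R).
Hypotheses (p1 : (1 <= p)%E) (q1 : (1 <= q)%E).
Hypotheses (s1 : -1 + alp p < s) (s2 : s < alp p).

(** Half the distance from s to the ends of the interval, so that the margin can be spent twice. *)
Let ka : R := Num.min (s + 1 - alp p) (alp p - s) / 2.
Let ka0 : 0 < ka.
Proof. by rewrite divr_gt0 // min_gt0 // subr_gt0 //; move: s1; lra. Qed.
Let ka1 : 2 * ka <= s + 1 - alp p.
Proof. by rewrite mulrC divfK // ge_min lexx. Qed.
Let ka2 : 2 * ka <= alp p - s.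
Proof. by rewrite mulrC divfK // ge_min lexx orbT. Qed.

Let tp := cutoff_test hphi.
Let ep := cutoff_even hphi.
Let pz := cutoff0 hphi.
Let plp := cutoff_lp hphi.
Let pge0 : forall x, 0 <= phi x. Proof. by have [_ _ H _ _] := hphi. Qed.
Let r1 : R := 3 / 4 / n.+2%:R.
Let r10 : 0 < r1. Proof. by rewrite divr_gt0 //; lra. Qed.
Let pone : forall x, `|x| < r1 -> phi x = 1. Proof. by move=> x; exact: cutoff1. Qed.

Local Notation N := (besov_norm phi s p q).
Local Notation X := (inX phi p q s).
Local Notation h := (lp0 phi).

Lemma OmE x : Om x <-> 0 < height g x.
Proof. by rewrite /= /height subr_gt0. Qed.

Lemma continuous_height : continuous (height g).
Proof.
apply: (@lipschitz_continuous R n.+1 _ (1 + L)); first by rewrite addr_ge0.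
exact: height_lip.
Qed.

Lemma closure_Om x : closure Om x -> 0 <= height g x.
Proof.
have cl : closed (height g @^-1` [set r : R | 0 <= r]).
  by apply: closed_comp => [y _|]; [exact: continuous_height|exact: closed_ge].
by apply: (closure_closed cl) => y /OmE /ltW.
Qed.

Lemma inside_test th1 th2 : testR th1 -> testR th2 -> inside g th1 -> inside g th2 ->
  test Om (cplx th1 th2).
Proof.
move=> t1 t2 [d1 d10 H1] [d2 d20 H2]; apply: testR_test => // x.
pose d := Num.min d1 d2; have d0 : 0 < d by exact: min_gt0.
have cl : closed (height g @^-1` [set r : R | d <= r]).
  by apply: closed_comp => [y _|]; [exact: continuous_height|exact: closed_ge].
move=> cx; apply/OmE; apply: (lt_le_trans d0).
apply: (closure_closed cl _ cx) => y /=; rewrite /cplx eq_complex /= negb_and => /orP[/H1|/H2] h'.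
  by rewrite (le_trans _ h') // ge_min lexx.
by rewrite (le_trans _ h') // ge_min lexx orbT.
Qed.

Lemma test_above (theta : pt -> R[i]) : test Om theta ->
  (forall x, above g x * reF theta x = reF theta x) /\
  (forall x, above g x * imF theta x = imF theta x).
Proof.
move=> [_ _ st]; have H x : theta x != 0 -> above g x = 1.
  move=> tx; have /st/OmE hx := @subset_closure _ [set x | theta x != 0] x tx.
  by rewrite /above hx.
by split=> x; have [tx|/H ->] := eqVneq (theta x) 0; rewrite ?mul1r // /reF /imF tx mulr0.
Qed.

Lemma test_schwartz E (theta : pt -> R[i]) : test E theta -> schwartz theta.
Proof. by move=> /test_testR[t1 t2]; apply/schwartzP; split; exact: testR_schR. Qed.

(** The support is defined pointwise, through a neighbourhood of each point; [local_zero] makes it a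
    statement on test functions supported away from the closed domain. *)
Lemma outside_zero u th : tempered u -> dist_supp u `<=` closure Om -> testR th -> outside g th ->
  Rpart u th = 0 /\ Ipart u th = 0.
Proof.
move=> tu su tth [d d0 Hd]; have [t1 t2 _] := tempered_cxE tu.
have cl : closed (height g @^-1` [set r : R | r <= - d]).
  by apply: closed_comp => [y _|]; [exact: continuous_height|exact: closed_le].
have sD : closure [set x | th x != 0] `<=` ~` closure Om.
  move=> x cx /closure_Om hx.
  have : (height g @^-1` [set r : R | r <= - d]) x.
    by apply: (closure_closed cl _ cx) => y /Hd.
  by rewrite /=; lra.
have loc x : (~` closure Om) x -> exists2 r : R, 0 < r & forall th, testR th ->
    (forall y, th y != 0 -> `|y - x| <= r) -> u (cplx th (fun=> 0)) = 0.
  move=> nx; have /existsNP[V /not_implyP[oV /not_implyP[Vx HV]]] : ~ dist_supp u x by move=> /su.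
  have /nbhs_ballP[r /= r0 rV] : nbhs x V by exact: open_nbhs_nbhs.
  exists (r / 2); first by rewrite divr_gt0.
  move=> th' t' H; apply/eqP; apply: contraT => nz; exfalso; apply: HV; exists (cplx th' (fun=> 0)) => //.
  apply: testR_test => //; first exact: testR0.
  move=> y cy; apply: rV; rewrite -ball_normE /= distrC.
  have cb : closed ((fun y : pt => `|y - x|) @^-1` [set t : R | t <= r / 2]).
    apply: closed_comp => [z _|]; last exact: closed_le.
    apply: (@lipschitz_continuous R n.+1 (fun y => `|y - x|) 1) => // y' t.
    by apply: le_trans (ler_dist_dist _ _) _; rewrite mul1r opprB addrA subrK addrC addKr.
  have : ((fun y : pt => `|y - x|) @^-1` [set t : R | t <= r / 2]) y.
    apply: (closure_closed cb _ cy) => z /=.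
    by rewrite /cplx eq_complex /= eqxx andbT => /H.
  by move=> /= /le_lt_trans; apply; lra.
by split; [apply: (local_zero hphi t1 _ tth sD)|apply: (local_zero hphi t2 _ tth sD)] => x /loc[r r0 Hr];
  exists r => // th' t' /(Hr _ t'); rewrite /Rpart /Ipart => ->.
Qed.

Lemma extension (vf c0 : bool) : (vf -> q = +oo%E) -> exists2 C : R, 0 < C & forall w, X vf c0 w ->
  exists z, [/\ supported (X vf c0) Om z, restr_to Om z = restr_to Om w & (N z <= C%:E * N w)%E].
Proof.
move=> _; have [C C0 HC] := ext_bes tp ep pz plp p1 ka0 ka1 ka2 L0 gL.
have G0 := geoC_gt0 ka0.
exists (4 * (C * geoC ka)); first by rewrite mulr_gt0 ?ltr0n // mulr_gt0.
move=> w Xw; have [[tw _] nw _ _] := Xw.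
have [d1 d2 Qw vw bw] := inX_data hphi p1 q1 Xw.
set b := bterm phi p s w in d1 d2 Qw vw bw; set B := fine (N w) in Qw bw.
have b0 k : 0 <= b k by exact: bterm_ge0.
have N0 : (0 <= N w)%E by apply: lq_norm_ge0; exact: besov_term_ge0.
have B0 : 0 <= B by exact: fine_ge0.
have hb k : 0 <= b k <= B by rewrite b0 bw.
have e1 := HC _ _ _ _ d1 bw; have e2 := HC _ _ _ _ d2 bw.
have c0' k : 0 <= C * gconv ka b k by rewrite mulr_ge0 ?(ltW C0) // (gconv_ge0 _ ka0 hb).
have Qg : qle q (fun k => C * gconv ka b k) (C * (geoC ka * B)).
  apply: qleZ => //; [by move=> k; exact: gconv_ge0 hb|by rewrite mulr_ge0 // ltW|exact: ltW|].
  exact: qle_gconv.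
have CB : 0 <= C * (geoC ka * B).
  by apply: mulr_ge0; [exact: ltW|apply: mulr_ge0 => //; exact: ltW].
have vg : vf -> van (fun k => C * gconv ka b k) /\ van (fun k => C * gconv ka b k).
  by move=> /vw vb; split; apply: vanZ; rewrite ?(ltW C0) //; exact: van_gconv hb vb.
have [Xz Nz] := besR_inX hphi p1 q1 e1 e2 c0' c0' CB Qg Qg vg.
exists (cxdist (ext phi g (Rpart w)) (ext phi g (Ipart w))); split.
- split=> // x sx; apply: contrapT => nx.
  have oV : open (~` closure Om) by apply: closed_openC; exact: closed_closure.
  have [theta tt] := sx _ oV nx; rewrite cxdistE; last exact: test_schwartz tt.
  have [_ _ st] := tt.
  have H y : theta y != 0 -> above g y = 0.
    move=> ty; have := st y (@subset_closure _ [set x | theta x != 0] y ty).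
    rewrite /above; case: ltP => // hy; case; apply: subset_closure; exact/OmE.
  have z1 y : above g y * reF theta y = 0.
    by have [ty|/H ->] := eqVneq (theta y) 0; rewrite ?mul0r // /reF ty mulr0.
  have z2 y : above g y * imF theta y = 0.
    by have [ty|/H ->] := eqVneq (theta y) 0; rewrite ?mul0r // /imF ty mulr0.
  by rewrite /cxval !(ext_zero phi (g := g) _ z1) !(ext_zero phi (g := g) _ z2) subrr addr0 eqxx.
- apply/funext => theta; rewrite /restr_to; case: ifP => // /asboolP tt.
  have st := test_schwartz tt; have [h1 h2] := (schwartzP _).1 st.
  have [a1 a2] := test_above tt.
  have -> : w theta = cxval (Rpart w) (Ipart w) theta.
    by have [_ _ wE] := tempered_cxE tw; rewrite -(cxdistE _ _ st) -wE.
  rewrite cxdistE // /cxval.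
  rewrite (ext_agree tp ep pz plp p1 d1 h1 a1) (ext_agree tp ep pz plp p1 d1 h2 a2).
  by rewrite (ext_agree tp ep pz plp p1 d2 h1 a1) (ext_agree tp ep pz plp p1 d2 h2 a2).
- apply: le_trans Nz _; rewrite -[N w]fineK ?ge0_fin_numE // -EFinM lee_fin -/B.
  by rewrite -!mulrA.
Qed.

Lemma supported_unique (vf c0 : bool) u z : supported (X vf c0) Om u -> supported (X vf c0) Om z ->
  restr_to Om u = restr_to Om z -> u = z.
Proof.
move=> [Xu su] [Xz sz] uz; have [[tu _] _ _ _] := Xu; have [[tz _] _ _ _] := Xz.
have [u1 u2 _ _ bu] := inX_data hphi p1 q1 Xu; have [z1 z2 _ _ bz] := inX_data hphi p1 q1 Xz.
have dF v b : dataR phi p s c0 v b -> dataR phi p s false v b by move=> [? ? ? _]; split.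
have b0 k : bterm phi p s u k + bterm phi p s z k <= fine (N u) + fine (N z) by exact: lerD.
have cin th : testR th -> inside g th -> u (cplx th (fun=> 0)) = z (cplx th (fun=> 0)).
  move=> tth ith; have tt : test Om (cplx th (fun=> 0)).
    apply: inside_test => //; first exact: testR0.
    by exists 1 => // x; rewrite eqxx.
  by have := congr1 (fun f => f (cplx th (fun=> 0))) uz; rewrite /restr_to asboolT.
have E1 th : schR th -> Rpart u th = Rpart z th.
  move=> sth; apply/eqP; rewrite -subr_eq0; apply/eqP; move: th sth.
  have D := dataR_sub p1 (dF _ _ u1) (dF _ _ z1).
  have K := dataR_unique tp ep pz pge0 plp p1 ka0 ka1 ka2 L0 gL D b0.
  apply: K.
    by move=> th tth ith; rewrite /Rpart cin // subrr.
  move=> th tth oth; have [-> _] := outside_zero tu su tth oth.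
  by have [-> _] := outside_zero tz sz tth oth; rewrite subrr.
have E2 th : schR th -> Ipart u th = Ipart z th.
  move=> sth; apply/eqP; rewrite -subr_eq0; apply/eqP; move: th sth.
  have D := dataR_sub p1 (dF _ _ u2) (dF _ _ z2).
  have K := dataR_unique tp ep pz pge0 plp p1 ka0 ka1 ka2 L0 gL D b0.
  apply: K.
    by move=> th tth ith; rewrite /Ipart cin // subrr.
  move=> th tth oth; have [_ ->] := outside_zero tu su tth oth.
  by have [_ ->] := outside_zero tz sz tth oth; rewrite subrr.
have [_ _ ->] := tempered_cxE tu; have [_ _ ->] := tempered_cxE tz.
apply/funext => theta; rewrite /cxdist; case: ifP => // /asboolP /schwartzP[h1 h2].
by rewrite /cxval !E1 // !E2.
Qed.

Lemma supported_eq (vf c0 : bool) : (vf -> q = +oo%E) -> supported_eq_on_domain (X vf c0) N Om.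
Proof.
move=> vq; have [C C0 HC] := @extension vf c0 vq; split.
  split.
  - by move=> u [Xu _]; exists u.
  - by move=> u z; rewrite !inE => su sz; exact: supported_unique su sz.
  - by move=> _ [w Xw <-]; have [z [sz rz _]] := HC w Xw; exists z.
exists C^-1, 1; split=> //; first by rewrite invr_gt0.
move=> u su; rewrite mul1e; apply/andP; split; last first.
  by apply: ereal_inf_lbound; exists u => //; split=> //; case: su.
(* For any competitor [w] with the same restriction, the bounded extension of [w] is [u] itself by
   uniqueness, which gives the lower bound; the upper bound takes [u] as a competitor. *)
apply: le_ereal_inf_tmp => _ [w [Xw rw] <-].
have [z [sz rz Nz]] := HC w Xw.
have -> : u = z by apply: supported_unique su sz _; rewrite rz.
have -> : N w = (C^-1%:E * (C%:E * N w))%E by rewrite muleA -EFinM mulVf ?mul1e // gt_eqF.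
by apply: lee_wpmul2l => //; rewrite lee_fin invr_ge0 ltW.
Qed.

Lemma dist_ofE (a b : pt -> R) (theta : pt -> R[i]) : testR a -> testR b -> schwartz theta ->
  dist_of (cplx a b) theta = cxval (fun th => I (fun x => a x * th x)) (fun th => I (fun x => b x * th x)) theta.
Proof.
move=> ta tb st; have [h1 h2] := (schwartzP _).1 st.
have rep c : testR c -> repR c (fun th => I (fun x => c x * th x)).
  move=> tc; split; first exact: schR_measurable (testR_schR tc).
  by move=> th sth; have [D HD] := testR_bounded tc; split=> //; apply: (intgM (c := D)) (schR_intg sth) => //;
    exact: schR_measurable (testR_schR tc).
have [_ H] := represents_cplx (u := cxdist (fun th => I (fun x => a x * th x)) (fun th => I (fun x => b x * th x)))
  (fun eta (se : schwartz eta) => cxdistE _ _ se) (rep _ ta) (rep _ tb).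
by have [_ <-] := H _ st; rewrite cxdistE.
Qed.

Lemma test_dists_sub (vf c0 : bool) : test_dists Om `<=` on_domain (X vf c0) Om.
Proof.
move=> _ [theta tt <-]; have [t1 t2] := test_testR tt.
have [C C0 HC] := besR_L1 p1 ka0 ka1 ka2 (schR_lp0 tp) (Rint_lp0 tp pz) (@lp0_even _ _ phi).
have [M1 M10 B1] := schR_BV (testR_schR t1); have [M2 M20 B2] := schR_BV (testR_schR t2).
have H G M : testR G -> 0 <= M -> BV 1 M G -> besR p s h c0 (fun th => I (fun x => G x * th x))
    (fun j => C * M * geo ka j).
  move=> tG M0 bG; have [_ _ LG _] := bG.
  have e1 : 0 < (1 : R) <= 1 by rewrite ltr01 lexx.
  have := HC c0 G M 1 e1 bG; rewrite mul1r => /(_ LG (schR_vanish (testR_schR tG))).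
  by congr besR; apply/funext => j; rewrite powR1 mulr1.
have Q M : 0 <= M -> qle q (fun j => C * M * geo ka j) (C * M * (1 + geoC ka)).
  move=> M0; apply: qleZ => //; [by move=> k; rewrite ltW // geo_gt0| |by rewrite mulr_ge0|exact: qle_geo].
  by rewrite addr_ge0 // ltW // geoC_gt0.
have g0 M k : 0 <= M -> 0 <= C * M * geo ka k by move=> M0; rewrite !mulr_ge0 // ltW // geo_gt0.
have G0 : 0 <= 1 + geoC ka by rewrite addr_ge0 // ltW // geoC_gt0.
pose e := C * (M1 + M2) * (1 + geoC ka).
have e0 : 0 <= e by rewrite !mulr_ge0 // addr_ge0.
have QM M : 0 <= M <= M1 + M2 -> qle q (fun j => C * M * geo ka j) e.
  move=> /andP[M0 MM]; apply: le_qle (Q _ M0) => // [k|]; first by rewrite g0 // lexx.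
  by rewrite !mulr_ge0 //= ler_wpM2r // ler_wpM2l.
have Q1 : qle q (fun j => C * M1 * geo ka j) e by apply: QM; rewrite M10 lerDl.
have Q2 : qle q (fun j => C * M2 * geo ka j) e by apply: QM; rewrite M20 lerDr.
have vg : vf -> van (fun j => C * M1 * geo ka j) /\ van (fun j => C * M2 * geo ka j).
  by move=> _; split; apply: vanZ; rewrite ?mulr_ge0 //; exact: van_geo.
have [Xz _] := besR_inX hphi p1 q1 (H _ _ t1 M10 B1) (H _ _ t2 M20 B2) (fun k => g0 _ k M10)
  (fun k => g0 _ k M20) e0 Q1 Q2 vg.
eexists; first exact: Xz.
apply/funext => eta; rewrite /restr_to; case: ifP => // /asboolP te.
by rewrite [theta in RHS](cplxE theta) dist_ofE // ?cxdistE //; exact: test_schwartz te.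
Qed.

Lemma dense (vf c0 : bool) : (q < +oo)%E \/ vf /\ q = +oo%E -> (p < +oo)%E \/ p = +oo%E /\ c0 ->
  test_dense (X vf c0) N Om.
Proof.
move=> qc pc; split; first exact: test_dists_sub.
move=> _ [u Xu <-] e e0; have [[tu _] _ _ _] := Xu.
have [d1 d2 Qu vu bu] := inX_data hphi p1 q1 Xu.
have b0 := bterm_ge0 phi p s u.
have tb : tailq q (bterm phi p s u).
  case: qc => [qf|[v qoo]]; last by rewrite qoo; apply: tailq_oo => //; exact: vu.
  move: q q1 qf Qu => [r||] //; rewrite lee_fin => r1' _; exact: tailq_fin.
(* Combining the real and imaginary parts costs a factor 4, and the final inequality is strict. *)
have e5 : 0 < e / 5 by lra.
have [w1 [z1 [b1 [tw1 iw1 B1 E1 [b10 Q1 v1]]]]] :=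
  dataR_dense tp ep pz pge0 plp r10 pone p1 ka0 ka1 ka2 L0 gL q1 d1 bu tb pc e5.
have [w2 [z2 [b2 [tw2 iw2 B2 E2 [b20 Q2 v2]]]]] :=
  dataR_dense tp ep pz pge0 plp r10 pone p1 ka0 ka1 ka2 L0 gL q1 d2 bu tb pc e5.
have vv : vf -> van b1 /\ van b2 by move=> /vu vb; split; [exact: v1|exact: v2].
have [Xz Nz] := besR_inX hphi p1 q1 B1 B2 b10 b20 (ltW e5) Q1 Q2 vv.
exists (restr_to Om (dist_of (cplx w1 w2))).
  by exists (cplx w1 w2) => //; exact: inside_test.
apply: (@le_lt_trans _ _ (4 * (e / 5))%:E); last by rewrite lte_fin; lra.
apply: le_trans Nz; apply: ereal_inf_lbound; eexists; last by [].
split=> //; apply/funext => eta; rewrite /restr_to /=; case: ifP => [/asboolP te|_]; last by rewrite subrr.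
have se := test_schwartz te; have [h1 h2] := (schwartzP _).1 se; have [a1 a2] := test_above te.
rewrite dist_ofE // cxdistE //; have [_ _ {1}->] := tempered_cxE tu; rewrite cxdistE //.
rewrite /cxval !E1 // !E2 //.
by apply/eqP; rewrite eq_complex /=; apply/andP; split; apply/eqP; ring.
Qed.

End Domain.

Lemma inveE_alp {R : realType} (p : \bar R) : (1 <= p)%E -> (p^-1)%E = (alp p)%:E.
Proof.
rewrite /alp; case: p => [r| |] // r1.
have r0 : r != 0 by move: r1; rewrite lee_fin => h; rewrite gt_eqF // (lt_le_trans ltr01).
by rewrite inver (negbTE r0).
Qed.

Section Spaces.
Context {R : realType} (n : nat).
Variable phi : 'rV[R]_n.+1 -> R.
Implicit Types (p q : \bar R) (s : R).

Lemma besov_inX p q s : besov phi s p q = inX phi p q s false false.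
Proof. by apply/seteqP; split=> u [] *. Qed.

Lemma besov_van_inX p s : besov_van phi s p = inX phi p +oo%E s true false.
Proof.
apply/seteqP; split=> [u [[Su Nu] h1 h2]|u [Su Nu /(_ isT)[h1 h2] _]]; split=> //.
Qed.

Lemma besov0_inX q s : besov0 phi s q = inX phi +oo%E q s false true.
Proof.
apply/seteqP; split=> [u [[Su Nu] h]|u [Su Nu _ /(_ isT) h]]; split=> //.
Qed.

Lemma besov0_van_inX s : besov0_van phi s = inX phi +oo%E +oo%E s true true.
Proof.
rewrite /besov0_van besov_van_inX besov0_inX.
apply/seteqP; split=> [u [[Su Nu h _] [_ _ _ c]]|u [Su Nu h c]]; split=> //.
Qed.

End Spaces.

Theorem proposition3p31 (R : realType) (n : nat) (hn : (2 <= n.+1)%N)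
    (phi : 'rV[R]_n.+1 -> R) (hphi : cutoff phi)
    (Om : set 'rV[R]_n.+1) (hOm : special_lipschitz Om) :
  (forall (p q : \bar R) (s : R), (1 <= p)%E -> (1 <= q)%E ->
     (- 1 + p^-1 < s%:E)%E -> (s%:E < p^-1)%E ->
     [/\ supported_eq_on_domain (besov phi s p q) (besov_norm phi s p q) Om,
         (p < +oo)%E -> (q < +oo)%E ->
           test_dense (besov phi s p q) (besov_norm phi s p q) Om &
         (p < +oo)%E ->
           test_dense (besov_van phi s p) (besov_norm phi s p +oo%E) Om]) /\
  (forall s : R, -1 < s -> s < 0 ->
     (forall q : \bar R, (1 <= q)%E ->
        supported_eq_on_domain (besov0 phi s q) (besov_norm phi s +oo%E q) Om /\
        ((q < +oo)%E ->
           test_dense (besov0 phi s q) (besov_norm phi s +oo%E q) Om)) /\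
     supported_eq_on_domain (besov0_van phi s) (besov_norm phi s +oo%E +oo%E) Om /\
     test_dense (besov0_van phi s) (besov_norm phi s +oo%E +oo%E) Om).
Proof.
have [g [[k kg] ->]] := hOm.
have gL (x y : 'rV[R]_n) : `|g x - g y| <= `|k| * `|x - y|.
  have := kg (x, y) (conj I I) => /= h; apply: le_trans h _.
  by rewrite ler_wpM2r // ler_norm.
have k0 : 0 <= `|k| by [].
have oo1 : (1 <= +oo :> \bar R)%E by exact: leey.
split=> [p q s p1 q1|s s1 s0].
  rewrite (inveE_alp p1) -EFinN -EFinD !lte_fin => s1 s2; rewrite besov_inX besov_van_inX; split.
  - exact: (supported_eq hphi k0 gL).
  - by move=> poo qoo; apply: (dense hphi k0 gL) => //; left.
  - by move=> poo; apply: (dense hphi k0 gL) => //; [right|left].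
(* At p = +oo, where 1/p = 0, the interval for s becomes (-1, 0). *)
have s1' : -1 + alp +oo%E < s by rewrite alp_oo addr0.
have s0' : s < alp +oo%E by rewrite alp_oo.
rewrite besov0_van_inX; split=> [q q1|]; last first.
  split; first exact: (supported_eq hphi k0 gL).
  by apply: (dense hphi k0 gL) => //; right.
rewrite besov0_inX; split; first exact: (supported_eq hphi k0 gL).
by move=> qoo; apply: (dense hphi k0 gL) => //; [left|right].
Qed.
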